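(* Let $\hbar\in\mathbb R\setminus\{0\}$, $m,r,s\in\mathbb N$ and $(k,\ell)=(r+2s,r)$. Let $(\mathcal H_S,U_0,U)$ be the Schrödinger representation with parameter $\hbar$ of the Heisenberg supergroup $\mathrm H(E_0,\omega)=\mathrm H_{2m|k,\ell}$ and $\mu$ the metaplectic representation of the metaplectic supergroup $\mathrm{Mp}(E_0,\omega)$ on $\mathcal A\otimes\mathcal H_S^\infty$. Then for all $M\in\mathrm{Mp}(E_0,\omega)$ and all $g=(\mathbf x,t)\in\mathrm H(E_0,\omega)=E_0\times\mathbb R^{1|0}$, $$U(\rho(M)g)=\mu(M)\,U(g)\,\mu(M)^{-1},\qquad\text{where }\rho(M)g:=(\rho(M)\mathbf x,t).$$
   Context: **Base algebra.** $\mathcal A=\mathcal A_0\oplus\mathcal A_1$ is a fixed unital supercommutative real $\mathbb Z_2$-graded algebra with $\mathcal A/\mathcal N_{\mathcal A}\simeq\mathbb R$ ($\mathcal N_{\mathcal A}$ = nilpotent elements) and containing, for each $n\ge1$, elements $a_1,\dots,a_n\in\mathcal A_1$ with $a_1\cdots a_n\ne0$. $\mathbb R^{m|n}=(\mathcal A_0)^m\times(\mathcal A_1)^n$. Smooth functions on $\mathbb R^m$ (or on a Lie group) extend to $(\mathcal A_0)^m$ (or to the supergroup obtained by $\mathcal A_0$-scalar extension) by finite Taylor expansion at the body. **Symplectic superspace, Heisenberg supergroup.** $E_{\mathbb R}=\mathbb R^{2m}\oplus\mathbb R^{k+\ell}$ has even basis $(a_i,b_i)_{i\le m}$ and odd basis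 $(u_a,v_a)_{a\le r}$, $(w_c)_{c\le2s}$, and the form $\omega$ with non-zero values $\omega(a_i,b_i)=-\omega(b_i,a_i)=1$, $\omega(u_a,v_a)=\omega(v_a,u_a)=-1$, $\omega(w_c,w_c)=-1$. $E=\mathcal A\otimes E_{\mathbb R}$, with $\omega(aX,bY)=(-1)^{|X||b|}ab\,\omega(X,Y)$; an element $\mathbf x$ of the even part $E_0$ has coordinates $(q,p,\xi)\in\mathbb R^{m|r}\times\mathbb R^{m|r}\times\mathbb R^{0|2s}$ (coefficients on the left of the basis vectors, $q$ along $a_i,u_a$, $p$ along $b_i,v_a$, $\xi$ along $w_c$), so that $\omega(\mathbf x,\mathbf x')=\sum_i(q^ip'^i-q'^ip^i)+\sum_c\xi^c\xi'^c$. $\mathrm H(E_0,\omega)=E_0\times\mathbb R^{1|0}$ with law $(\mathbf x,t)(\mathbf x',t')=(\mathbf x+\mathbf x',t+t'+\frac12\omega(\mathbf x,\mathbf x'))$. $\mathfrak g_{\mathbb R}=E_{\mathbb R}\oplus\mathbb RZ$ with $[X,Y]=\omega(X,Y)Z$, $Z$ central. **Schrödinger representation.** $\mathcal H_S=L^2(\mathbb R^{m|r})\otimes Hol(\mathbb C^{0|s})\simeq L^2(\mathbb R^m)\otimes\bigwedge(\theta_1,\dots,\theta_r,\zeta_1,\dots,\zeta_s)$, $\mathcal H_S^\infty=\mathcal S(\mathbb R^m)\otimes\bigwedge(\theta,\zeta)$. With $q_0=(x,\theta)$ and $\zeta^c=\xi^c+i\xi^{c+s}$, $U(q,p,\xi,t)$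 acts on $\mathcal A\otimes\mathcal H_S^\infty$ by $(U(g)\varphi)(q_0,\zeta_0)=e^{i\hbar(t+(\frac12q-q_0)p+\frac12(\frac12\zeta-\zeta_0)\bar\zeta)}\varphi(q_0-q,\zeta_0-\zeta)$, and $U_0$ is the same formula on the body (real $q,p,t$, no odd variables). Infinitesimally: $U_*(Z)=i\hbar$, $U_*(a_i)=-\partial_{x_i}$, $U_*(b_i)=-i\hbar x_i$, $U_*(u_a)=-\partial_{\theta_a}$, $U_*(v_a)=i\hbar\theta_a$, $U_*(w_c)=-\partial_{\zeta_c}+\frac{i\hbar}{2}\zeta_c$, $U_*(w_{c+s})=-i\partial_{\zeta_c}+\frac{\hbar}{2}\zeta_c$ ($c\le s$). **Metaplectic supergroup.** $\mathfrak{spo}(E,\omega)_{\mathbb R}=\{A\in\mathrm{End}(E_{\mathbb R}):\omega(AX,Y)+(-1)^{|A||X|}\omega(X,AY)=0\}$, identified with the span of the elements $XY+(-1)^{|X||Y|}YX$ ($X,Y\in E_{\mathbb R}$) in $\mathfrak U(\mathfrak g_{\mathbb R})/\langle Z-1\rangle$, acting on $E_{\mathbb R}$ by supercommutator. $\mathrm{SpO}^0(E_0,\omega)$ is the identity component of the supergroup of invertible $\mathcal A$-linear transformations of $E_0$ preserving $\omega$. $\mathrm{Mp}(E_0,\omega)$ is its $\mathbb Z_2\times\mathbb Z_2$-covering whose super Harish-Chandra pair is $(\mathrm{Mp}(2m,\mathbb R)\times\mathrm{Spin}^0(k,\ell),\mathfrak{spo}(E,\omega)_{\mathbb R})$, and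 $\rho:\mathrm{Mp}(E_0,\omega)\to\mathrm{SpO}^0(E_0,\omega)$ is the covering map. Every $M\in\mathrm{Mp}(E_0,\omega)$ is uniquely $M=M_0e^{X}$ with $M_0$ in the $\mathcal A_0$-scalar extension of $\mathrm{Mp}(2m,\mathbb R)\times\mathrm{Spin}^0(k,\ell)$ and $X\in\mathcal A_1\otimes(\mathfrak{spo}(E,\omega)_{\mathbb R})_1$; $\rho(M)\mathbf x$ denotes the natural action on $E_0$. **Metaplectic representation.** $\mu_*(XY+(-1)^{|X||Y|}YX)=\frac1{i\hbar}\big(U_*(X)U_*(Y)+(-1)^{|X||Y|}U_*(Y)U_*(X)\big)$ on $\mathcal H_S^\infty$. $\mu_0$ is the tensor product of the metaplectic representation of $\mathrm{Mp}(2m,\mathbb R)$ on $L^2(\mathbb R^m)$ and the spinor representation of $\mathrm{Spin}^0(k,\ell)$ on $\bigwedge(\theta,\zeta)$, so that $d\mu_0=\mu_*$ on the even part; its smooth vectors are $\mathcal H_S^\infty$. Then $\mu(M_0e^X)=\widetilde{\mu_0}(M_0)\exp(\mu_*(X))$, where $\widetilde{\mu_0}$ is the Taylor extension of $\mu_0$ and $\mu_*$ is extended $\mathcal A$-linearly. *)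

(* Defs.v *)
From HB Require Import structures.
From mathcomp Require Import all_boot all_order all_algebra.
From mathcomp Require Import ring complex.
From mathcomp Require Import all_classical all_reals all_analysis.

Set Implicit Arguments.
Unset Strict Implicit.
Unset Printing Implicit Defensive.

Import Order.TTheory GRing.Theory Num.Theory.
Import numFieldNormedType.Exports.
Local Open Scope classical_set_scope.
Local Open Scope ring_scope.

(* [hpart p] is the projection onto A_0 (p = false) or A_1 (p = true).  As
   [body] is surjective, [body_eq0] says that A / N_A is isomorphic to R. *)
Record baseAlgebra (R : realType) := BaseAlgebra {
  carrier :> algType R ;
  hpart : bool -> {linear carrier -> carrier} ;
  body : {lrmorphism carrier -> R^o} ;
  hpart_sum : forall a, hpart false a + hpart true a = a ;
  hpart_id : forall p a, hpart p (hpart p a) = hpart p a ;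
  hpart_neg : forall p a, hpart (~~ p) (hpart p a) = 0 ;
  hpart_mul : forall p q a b,
    hpart (p (+) q) (hpart p a * hpart q b) = hpart p a * hpart q b ;
  hpart_comm : forall p q a b,
    hpart p a * hpart q b = (-1) ^+ (p && q) * (hpart q b * hpart p a) ;
  body_eq0 : forall a, body a = 0 <-> exists n, a ^+ n = 0 ;
  odd_prod_neq0 : forall n, exists a : 'I_n -> carrier,
    (forall i, hpart true (a i) = a i) /\ \prod_(i < n) a i != 0
}.

Section BaseAlgebra.
Variables (R : realType) (A : baseAlgebra R).

Definition homog (p : bool) (a : A) : Prop := hpart A p a = a.

(* The sign produced by moving [a] across an element of parity [p]. *)
Definition twist (p : bool) (a : A) : A :=
  hpart A false a + (-1) ^+ p * hpart A true a.

(* The complexification of A: the pair (a, b) stands for a + i b. *)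
Definition cA : Type := (A * A)%type.
Definition cmul (z w : A * A) : A * A :=
  (z.1 * w.1 - z.2 * w.2, z.1 * w.2 + z.2 * w.1).
Definition cscale (c : R[i]) (z : A * A) : A * A :=
  (complex.Re c *: z.1 - complex.Im c *: z.2,
   complex.Re c *: z.2 + complex.Im c *: z.1).
Definition ctwist (p : bool) (z : A * A) : A * A := (twist p z.1, twist p z.2).
Definition cbody (z : A * A) : R[i] := Complex (body A z.1) (body A z.2).

End BaseAlgebra.

(* The exponential series at [v] of an operator with [iter k T v = 0] for all
   large k; the value does not depend on the bound that is picked. *)
Definition nilexp (R : realType) (V : lmodType R) (T : V -> V) (v : V) : V :=
  \sum_(k < xget 0%N [set K | forall k, (K <= k)%N -> iter k T v = 0])
    (k`!%:R)^-1 *: iter k T v.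

(* e_I e_J = (-1)^(inversions I J) e_(I :|: J) for anticommuting generators. *)
Definition inversions (n : nat) (I J : {set 'I_n}) : nat :=
  #|[set p : 'I_n * 'I_n | [&& p.1 \in I, p.2 \in J & (p.2 < p.1)%N]]|.

Section Grassmann.
Variables (R : realType) (A : baseAlgebra R) (n : nat).

(* A (x) C (x) Lambda(e_1, ..., e_n): z stands for \sum_I z_I e_I. *)
Definition grass : Type := {set 'I_n} -> A * A.

Definition gconst (z : A * A) : grass := fun K => if K == finset.set0 then z else 0.
Definition ggen (k : 'I_n) : grass := fun K => if K == [set k]%SET then (1, 0) else 0.
Definition gmul (z w : grass) : grass := fun K =>
  \sum_(I : {set 'I_n} | I \subset K)
    ((-1) ^+ inversions I (K :\: I)) *:
      cmul (z I) (ctwist (odd #|I|) (w (K :\: I))).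
Definition gscale (c : R[i]) (z : grass) : grass := fun K => cscale c (z K).
Definition gbody (z : grass) : R[i] := cbody (z finset.set0).

Definition cexp (c : R[i]) : R[i] :=
  Complex (expR (complex.Re c) * cos (complex.Im c))
          (expR (complex.Re c) * sin (complex.Im c)).

(* Taylor extension of the complex exponential: e^(c + n) = e^c \sum n^k / k!
   with c the body. *)
Definition gexp (z : grass) : grass :=
  let c := gbody z in
  let nz := z - gconst (cscale c (1, 0)) in
  gscale (cexp c)
    (nilexp (V := ({set 'I_n} -> A * A)%type) (gmul nz) (gconst (1, 0))).

(* e_i |-> e_i - h_i *)
Definition gshift (h : 'I_n -> A * A) (w : grass) : grass :=
  \sum_(I : {set 'I_n})
    gmul (gconst (w I))
      (foldr gmul (gconst (1, 0)) [seq ggen i - gconst (h i) | i <- enum I]).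

End Grassmann.

Section Schwartz.
Variables (R : realType) (m : nat).
Implicit Types g : 'rV[R]_m -> R.

Definition iter_partial (s : seq 'I_m) g : 'rV[R]_m -> R :=
  foldr (fun i h => 'D_(delta_mx 0 i) h) g s.

Definition schwartzR g : Prop :=
  (forall s i (x : 'rV[R]_m), derivable (iter_partial s g) x (delta_mx 0 i)) /\
  (forall s (k : 'I_m -> nat), exists C, forall x : 'rV[R]_m,
     `| (\prod_i x 0 i ^+ k i) * iter_partial s g x | <= C).

Definition schwartz (f : 'rV[R]_m -> R[i]) : Prop :=
  schwartzR (fun x => complex.Re (f x)) /\ schwartzR (fun x => complex.Im (f x)).

Definition partialC (i : 'I_m) (f : 'rV[R]_m -> R[i]) : 'rV[R]_m -> R[i] :=
  fun x => Complex ('D_(delta_mx 0 i) (fun y => complex.Re (f y)) x)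
                   ('D_(delta_mx 0 i) (fun y => complex.Im (f y)) x).

End Schwartz.

Fixpoint integral_Rn (R : realType) (m : nat) : ('rV[R]_m -> R) -> R :=
  match m return ('rV[R]_m -> R) -> R with
  | 0 => fun f => f 0
  | m'.+1 => fun f =>
      Rintegral lebesgue_measure setT
        (fun x : R => integral_Rn (fun y => f (row_mx (x%:M : 'rV_1) y)))
  end.

Definition L2inner (R : realType) (m : nat) (f h : 'rV[R]_m -> R[i]) : R[i] :=
  Complex (integral_Rn (fun x => complex.Re (f x * (h x)^*)))
          (integral_Rn (fun x => complex.Im (f x * (h x)^*))).

(* The double cover Mp(2m, R), realized as the pairs (S, phi) with S symplectic
   and phi a continuous square root of tau |-> det (C tau + D) on the Siegel
   upper half space; phi is set to 0 elsewhere. *)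
Section RealMetaplectic.
Variables (R : realType) (m : nat).

Definition omega_even : 'M[R]_(m + m) := block_mx 0 1%:M (- 1%:M) 0.

Definition siegel : set 'M[R[i]^o]_m :=
  [set tau | tau^T = tau /\ forall v : 'cV[R]_m, v != 0 ->
     0 < (v^T *m map_mx (@complex.Im R) tau *m v) 0 0].

Definition cplx_mx p q (S : 'M[R]_(p, q)) : 'M[R[i]^o]_(p, q) :=
  map_mx (fun x : R => Complex x 0) S.

Definition siegel_den (S : 'M[R]_(m + m)) (tau : 'M[R[i]^o]_m) : 'M[R[i]^o]_m :=
  cplx_mx (dlsubmx S) *m tau + cplx_mx (drsubmx S).
Definition siegel_act (S : 'M[R]_(m + m)) (tau : 'M[R[i]^o]_m) : 'M[R[i]^o]_m :=
  (cplx_mx (ulsubmx S) *m tau + cplx_mx (ursubmx S)) *m invmx (siegel_den S tau).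

Definition mp_elt : Type := ('M[R]_(m + m) * ('M[R[i]^o]_m -> R[i]^o))%type.

Definition Mp2m : set mp_elt :=
  [set g : mp_elt | [/\ g.1^T *m omega_even *m g.1 = omega_even,
     {within siegel, continuous g.2},
     forall tau, siegel tau -> (g.2 tau : R[i]) ^+ 2 = \det (siegel_den g.1 tau) &
     forall tau, ~ siegel tau -> g.2 tau = 0]].

Definition mp_one : mp_elt := (1%:M, fun tau => if `[< siegel tau >] then 1 else 0).
Definition mp_mul (g h : mp_elt) : mp_elt :=
  (g.1 *m h.1, fun tau => (g.2 (siegel_act h.1 tau) : R[i]) * h.2 tau).

(* One-parameter subgroups t |-> gam t with tangent vector B at the identity. *)
Definition mp_one_parameter (gam : R -> mp_elt) (B : 'M[R]_(m + m)) : Prop :=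
  [/\ forall t, Mp2m (gam t),
      forall t u, gam (t + u) = mp_mul (gam t) (gam u),
      forall tau, siegel tau -> continuous (fun t => (gam t).2 tau) &
      forall i j, is_derive (0 : R) (1 : R) (fun t => (gam t).1 i j) (B i j)].

End RealMetaplectic.

Section Odd.
Variables (R : realType) (r s : nat).

(* Basis u_a, v_a (a < r), w_c, w_{c+s} (c < s) of the odd part. *)
Definition dim_odd : nat := (r + r) + (s + s).

Definition omega_odd : 'M[R]_dim_odd :=
  block_mx (block_mx 0 (- 1%:M) (- 1%:M) 0) 0 0 (- 1%:M).

(* Columns: the omega-orthogonal basis u_a + v_a, u_a - v_a, w_c. *)
Definition orth_basis : 'M[R]_dim_odd :=
  block_mx (block_mx 1%:M 1%:M 1%:M (- 1%:M)) 0 0 1%:M.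

(* The Clifford algebra X Y + Y X = omega(X, Y), with basis the products of
   the orthogonal basis; the square of the i-th generator is [cl_square i]. *)
Definition cl : Type := {set 'I_dim_odd} -> R.
Definition cl_square (i : 'I_dim_odd) : R :=
  (orth_basis^T *m omega_odd *m orth_basis) i i / 2.
Definition cl_one : cl := fun K => if K == finset.set0 then 1 else 0.
Definition cl_mul (a b : cl) : cl := fun K =>
  \sum_(I : {set 'I_dim_odd})
    let J := (I :\: K) :|: (K :\: I) in
    (-1) ^+ inversions I J * (\prod_(i in I :&: J) cl_square i) * a I * b J.
Definition cl_rev (a : cl) : cl := fun K => (-1) ^+ 'C(#|K|, 2) * a K.
Definition cl_vec (v : 'cV[R]_dim_odd) : cl := fun K =>
  \sum_(i | K == [set i]%SET) (invmx orth_basis *m v) i 0.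

(* Spin^0(k, l), together with the induced orthogonal transformation G. *)
Definition spin_elt : Type := (cl * 'M[R]_dim_odd)%type.
Definition Spin0 : set spin_elt :=
  [set aG : spin_elt | [/\ forall K : {set 'I_dim_odd}, odd #|K| -> aG.1 K = 0,
     cl_mul aG.1 (cl_rev aG.1) = cl_one &
     forall v, cl_mul (cl_mul aG.1 (cl_vec v)) (cl_rev aG.1) = cl_vec (aG.2 *m v)]].

End Odd.

Section Superspace.
Variables (R : realType) (m r s : nat).

Definition dim_E : nat := (m + m) + dim_odd r s.

Definition par (i : 'I_dim_E) : bool := (m + m <= i)%N.

Definition omega : 'M[R]_dim_E :=
  block_mx (omega_even R m) 0 0 (omega_odd R r s).

(* Index of q_i, p_i (along a_i, b_i), q_a, p_a (along u_a, v_a), xi^c, xi^(c+s). *)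
Definition ia (i : 'I_m) : 'I_dim_E := lshift _ (lshift m i).
Definition ib (i : 'I_m) : 'I_dim_E := lshift _ (rshift m i).
Definition iu (a : 'I_r) : 'I_dim_E := rshift _ (lshift _ (lshift r a)).
Definition iv (a : 'I_r) : 'I_dim_E := rshift _ (lshift _ (rshift r a)).
Definition iw (c : 'I_s) : 'I_dim_E := rshift _ (rshift _ (lshift s c)).
Definition iw' (c : 'I_s) : 'I_dim_E := rshift _ (rshift _ (rshift s c)).

(* The part of parity p of spo(E, omega)_R. *)
Definition spo (p : bool) : set 'M[R]_dim_E :=
  [set B : 'M[R]_dim_E | (forall i j, par i (+) par j != p -> B i j = 0) /\
     forall j k, (B^T *m omega) j k + (-1) ^+ (p && par j) * (omega *m B) j k = 0].

(* S(R^m) (x) Lambda(theta_1, ..., theta_r, zeta_1, ..., zeta_s), by components. *)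
Definition Hfun : Type := 'rV[R]_m -> {set 'I_(r + s)} -> R[i].
Definition Hsmooth : set Hfun := [set f | forall J, schwartz (fun x => f x J)].

Definition gen_sign (k : 'I_(r + s)) (J : {set 'I_(r + s)}) : nat :=
  #|[set j in J | (j < k)%N]|.
Definition gen_mul (k : 'I_(r + s)) (f : Hfun) : Hfun := fun x J =>
  if k \in J then (-1) ^+ gen_sign k J * f x (J :\ k) else 0.
Definition gen_deriv (k : 'I_(r + s)) (f : Hfun) : Hfun := fun x J =>
  if k \in J then 0 else (-1) ^+ gen_sign k J * f x (k |: J).
Definition Hpartial (i : 'I_m) (f : Hfun) : Hfun := fun x J =>
  partialC i (fun y => f y J) x.
Definition Hscale (c : R[i]) (f : Hfun) : Hfun := fun x J => c * f x J.

Definition theta (a : 'I_r) : 'I_(r + s) := lshift s a.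
Definition zeta (c : 'I_s) : 'I_(r + s) := rshift r c.

Variable hbar : R.

Definition Ustar_basis (k : 'I_dim_E) (f : Hfun) : Hfun :=
  match fintype.split k with
  | inl k => match fintype.split k with
    | inl i => - Hpartial i f
    | inr i => fun x J => - (Complex 0 (hbar * x 0 i) * f x J)
    end
  | inr k => match fintype.split k with
    | inl k => match fintype.split k with
      | inl a => - gen_deriv (theta a) f
      | inr a => Hscale (Complex 0 hbar) (gen_mul (theta a) f)
      end
    | inr k => match fintype.split k with
      | inl c => - gen_deriv (zeta c) f
                 + Hscale (Complex 0 (hbar / 2)) (gen_mul (zeta c) f)
      | inr c => Hscale (Complex 0 (-1)) (gen_deriv (zeta c) f)
                 + Hscale (Complex (hbar / 2) 0) (gen_mul (zeta c) f)
      end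
    end
  end.

Definition Ustar (v : 'cV[R]_dim_E) (f : Hfun) : Hfun :=
  \sum_i Hscale (Complex (v i 0) 0) (Ustar_basis i f).

(* mu_*(e_i e_k + (-1)^(|e_i||e_k|) e_k e_i) *)
Definition mu_quad (i k : 'I_dim_E) (f : Hfun) : Hfun :=
  Hscale (Complex 0 hbar)^-1
    (Ustar_basis i (Ustar_basis k f)
     + Hscale ((-1) ^+ (par i && par k)) (Ustar_basis k (Ustar_basis i f))).

(* B in spo is the action of
   1/4 \sum_(i, k) (B omega^T)_(i k) (e_i e_k + (-1)^(|e_i||e_k|) e_k e_i);
   see [spo_quad] and [mu_star_quad] below. *)
Definition mu_star (B : 'M[R]_dim_E) (f : Hfun) : Hfun :=
  \sum_i \sum_k Hscale (Complex ((B *m omega^T) i k / 4) 0) (mu_quad i k f).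

(* The supercommutator W |-> [X Y + (-1)^(|X||Y|) Y X, W] on E_R, for X and Y
   homogeneous of parities p and q. *)
Definition quad_act (p q : bool) (X Y : 'cV[R]_dim_E) : 'M[R]_dim_E :=
  2 *: (X *m (Y^T *m omega) + (-1) ^+ (p && q) *: (Y *m (X^T *m omega))).

End Superspace.

Lemma omega_even_tr (R : realType) m : (omega_even R m)^T = - omega_even R m.
Proof.
rewrite /omega_even tr_block_mx !trmx0 linearN /= trmx1 opp_block_mx !oppr0 opprK //.
Qed.
Lemma omega_odd_tr (R : realType) r s : (omega_odd R r s)^T = omega_odd R r s.
Proof.
rewrite /omega_odd /dim_odd. 
rewrite (tr_block_mx (block_mx 0 (- 1%:M) (- 1%:M) 0 : 'M[R]_(r + r)) 0 0).
rewrite !trmx0 !linearN /= !trmx1.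
by rewrite tr_block_mx !trmx0 linearN /= trmx1. 
Qed.
Lemma omega_even_sq (R : realType) m : omega_even R m *m omega_even R m = - 1%:M.
Proof.
by rewrite /omega_even mulmx_block !mulmx0 !mul0mx !mulmxN !mulNmx !mulmx1 !addr0 !add0r
   (scalar_mx_block m m) opp_block_mx oppr0.
Qed.
Lemma omega_odd_sq (R : realType) r s : omega_odd R r s *m omega_odd R r s = 1%:M.
Proof.
rewrite /omega_odd /dim_odd.
rewrite (mulmx_block (block_mx 0 (- 1%:M) (- 1%:M) 0 : 'M[R]_(r + r)) 0 0).
rewrite !mulmx0 !mul0mx !addr0 !add0r !mulmxN !mulNmx !mulmx1 !opprK mulmx_block.
by rewrite !mulmx0 !mul0mx !addr0 !add0r !mulmxN !mulNmx !mulmx1 !opprK -!scalar_mx_block.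
Qed.

Section SpoFacts.
Variables (R : realType) (m r s : nat).
Local Notation N := (dim_E m r s).
Local Notation Om := (omega R m r s).
Let D (p : bool) : 'M[R]_N := block_mx 1%:M 0 0 ((-1) ^+ p)%:M.

Lemma par_cases (i : 'I_N) :
  (exists2 a, i = lshift _ a & par i = false) \/
  (exists2 a, i = rshift _ a & par i = true).
Proof.
rewrite -(splitK i); case: (fintype.split i) => a /=; [left|right]; exists a => //.
- by rewrite /par /= leqNgt ltn_ord.
- by rewrite /par /= leq_addr.
Qed.

Lemma D_mul p (B : 'M[R]_N) i j : (D p *m B) i j = (-1) ^+ (p && par i) * B i j.
Proof.
rewrite -[B](submxK (m1 := m + m) (n1 := m + m)) /D mulmx_block !mul0mx !mul1mx addr0 add0r add0r addr0.
have [[a -> ->]|[a -> ->]] := par_cases i.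
- by rewrite andbF expr0 mul1r /block_mx !col_mxEu.
- rewrite andbT; rewrite /block_mx !col_mxEd !mul_scalar_mx.
  by rewrite -scale_row_mx mxE.
Qed.

Lemma D_tr p : (D p)^T = D p.
Proof. by rewrite /D tr_block_mx !trmx0 !tr_scalar_mx. Qed.

Lemma mul_D p (B : 'M[R]_N) i j : (B *m D p) i j = (-1) ^+ (p && par j) * B i j.
Proof. by rewrite -[B *m _]trmxK trmx_mul D_tr mxE D_mul mxE. Qed.

Lemma omega_tr : Om^T = - (D true *m Om).
Proof.
rewrite /omega /D tr_block_mx mulmx_block omega_even_tr omega_odd_tr.
by rewrite !trmx0 !mulmx0 !mul0mx !addr0 add0r mul1mx expr1 mul_scalar_mx scaleN1r
  (opp_block_mx (omega_even R m)) !oppr0 opprK.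
Qed.

Lemma omega_sq : Om *m Om = - D true.
Proof.
rewrite /omega /D mulmx_block omega_even_sq omega_odd_sq.
rewrite !mulmx0 !mul0mx !addr0 !add0r (opp_block_mx (1%:M : 'M[R]_(m + m))) oppr0.
by rewrite expr1 (raddfN (@scalar_mx R _)) opprK ?oppr0.
Qed.

Lemma omega_par i j : par i != par j -> Om i j = 0.
Proof.
have [[a -> ->]|[a -> ->]] := par_cases i; have [[b -> ->]|[b -> ->]] := par_cases j => //= _;
  rewrite /omega.
- by rewrite block_mxEur mxE.
- by rewrite block_mxEdl mxE.
Qed.

Lemma D_om p : D p *m Om = Om *m D p.
Proof.
apply/matrixP => i j; rewrite D_mul mul_D.
by have [->//|/omega_par ->] := eqVneq (par i) (par j); rewrite !mulr0.
Qed.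

Lemma D_sq p : D p *m D p = 1%:M.
Proof.
apply/matrixP => i j; rewrite D_mul -[D p]mulmx1 D_mul !mxE.
by rewrite mulrA -signr_addb addbb mul1r.
Qed.

Lemma omega_mul_tr : Om *m Om^T = 1%:M.
Proof. by rewrite omega_tr mulmxN mulmxA -D_om -mulmxA omega_sq mulmxN opprK D_sq. Qed.

Lemma omega_tr_mul : Om^T *m Om = 1%:M.
Proof. exact/mulmx1C/omega_mul_tr. Qed.

Lemma spo_coef p (B : 'M[R]_N) i k : spo p B ->
  (B *m Om^T) k i = (-1) ^+ (par i && par k) * (B *m Om^T) i k.
Proof.
case=> Bpar Bspo.
have C0 a b : par a (+) par b != p -> (B *m Om^T) a b = 0.
  move=> ab; rewrite mxE big1// => l _; rewrite mxE.
  have [e|/omega_par] := eqVneq (par b) (par l); last by move=> ->; rewrite mulr0.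
  by rewrite Bpar ?mul0r// -e.
have E : B^T *m Om = - (D p *m (Om *m B)).
  apply/matrixP => a b; rewrite [RHS]mxE D_mul.
  by apply/eqP; rewrite -addr_eq0; apply/eqP/Bspo.
have : (B *m Om^T)^T = D p *m (D true *m (B *m Om^T)).
  rewrite trmx_mul trmxK -[LHS]mulmx1 -omega_mul_tr -(mulmxA Om B^T) (mulmxA B^T) E.
  rewrite mulNmx mulmxN !mulmxA -D_om -(mulmxA (D p) Om) omega_sq mulmxN !mulNmx opprK.
  by [].
move/matrixP/(_ i k); rewrite mxE !D_mul => ->.
rewrite mulrA -signr_addb.
have [e|/C0 ->] := eqVneq (par i (+) par k) p; last by rewrite !mulr0.
by rewrite -e; case: (par i); case: (par k).
Qed.

Let e i : 'cV[R]_N := delta_mx i 0.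

Lemma quad_act_coef i k :
  quad_act (par i) (par k) (e i) (e k) *m Om^T =
  2 *: (delta_mx i k + (-1) ^+ (par i && par k) *: delta_mx k i).
Proof.
rewrite /quad_act -scalemxAl mulmxDl -scalemxAl -!mulmxA omega_mul_tr !mulmx1.
by rewrite !trmx_delta !mul_delta_mx.
Qed.

(* spo(E, omega)_R is the span of the e_i e_k + (-1)^(|e_i||e_k|) e_k e_i. *)
Lemma spo_quad p (B : 'M[R]_N) : spo p B ->
  B = \sum_i \sum_k ((B *m Om^T) i k / 4) *: quad_act (par i) (par k) (e i) (e k).
Proof.
move=> Bspo; set C := B *m Om^T.
have half : \sum_i \sum_k (C i k / 2) *: delta_mx i k = 2^-1 *: C.
  rewrite [in RHS](matrix_sum_delta C) scaler_sumr; apply: eq_bigr => i _.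
  by rewrite scaler_sumr; apply: eq_bigr => k _; rewrite scalerA mulrC.
rewrite -[LHS]mulmx1 -[RHS]mulmx1 -omega_tr_mul !mulmxA; congr (_ *m _).
rewrite -/C mulmx_suml.
transitivity (2^-1 *: C + 2^-1 *: C).
  by rewrite -scalerDl -[LHS]scale1r; congr (_ *: _); field.
rewrite -{1}half -half [X in _ + X]exchange_big -big_split /=; apply: eq_bigr => i _.
rewrite mulmx_suml -big_split /=; apply: eq_bigr => k _.
rewrite -scalemxAl quad_act_coef scalerA scalerDr scalerA.
rewrite (spo_coef i k Bspo) -/C.
by congr (_ *: _ + _ *: _); field.
Qed.

Lemma mu_quadC (hbar : R) i k (f : Hfun R m r s) :
  mu_quad hbar k i f = Hscale ((-1) ^+ (par i && par k)) (mu_quad hbar i k f).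
Proof.
apply/funext => x; apply/funext => J; rewrite /mu_quad /Hscale !fctE (andbC (par k)).
by case: (par i && par k); rewrite ?expr0 ?expr1; ring.
Qed.

Lemma mu_star_quad (hbar : R) i k (f : Hfun R m r s) :
  mu_star hbar (quad_act (par i) (par k) (e i) (e k)) f = mu_quad hbar i k f.
Proof.
have delta_sum (a b : 'I_N) (G : 'I_N -> 'I_N -> R[i]) :
    \sum_i \sum_k ((delta_mx a b : 'M[R]_N) i k)%:C%C * G i k = G a b.
  rewrite (bigD1 a)//= (bigD1 b)//= mxE !eqxx mul1r !big1 ?addr0// => [j /negPf ne|j /negPf ne].
    by rewrite big1// => l _; rewrite mxE ne mul0r.
  by rewrite mxE ne andbF mul0r.
apply/funext => x; apply/funext => J; rewrite /mu_star !fct_sumE.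
under eq_bigr => a _ do rewrite !fct_sumE.
have cM (a b : R) : (a * b)%:C%C = a%:C%C * b%:C%C.
  by apply/eqP; rewrite eq_complex /= !(mulr0, mul0r, subr0, addr0) !eqxx.
have cD (a b : R) : (a + b)%:C%C = a%:C%C + b%:C%C.
  by apply/eqP; rewrite eq_complex /= addr0 !eqxx.
set sg : R := (-1) ^+ (par i && par k).
have sgE : (-1) ^+ (par i && par k) = sg%:C%C :> R[i].
  by rewrite /sg; case: (par i && par k) => //=; apply/eqP; rewrite eq_complex /= oppr0 !eqxx.
transitivity ((2^-1)%:C%C * (mu_quad hbar i k f x J : R[i])
              + (2^-1 * sg)%:C%C * mu_quad hbar k i f x J).
  rewrite -(delta_sum i k (fun a b => mu_quad hbar a b f x J)).
  rewrite -(delta_sum k i (fun a b => mu_quad hbar a b f x J)).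
  rewrite !mulr_sumr -big_split /=; apply: eq_bigr => a _.
  rewrite !mulr_sumr -big_split /=; apply: eq_bigr => b _.
  rewrite quad_act_coef /Hscale complexr0 [RHS](_ : _ =
    (2^-1 * (delta_mx i k : 'M[R]_N) a b + 2^-1 * sg * (delta_mx k i : 'M[R]_N) a b)%:C%C *
    (mu_quad hbar a b f x J : R[i])); last by rewrite cD !cM; ring.
  by congr (_%:C%C * _); rewrite !mxE -/sg; field.
rewrite (mu_quadC hbar i k) /Hscale sgE mulrA -cM -mulrA -signr_addb addbb mulr1 -mulrDl -cD.
by rewrite -div1r -splitr mul1r.
Qed.
End SpoFacts.

(* The metaplectic representation of Mp(2m, R) on L^2(R^m), given through its
   restriction to the dense subspace S(R^m) of smooth vectors: a unitary
   representation with differential mu_* (the limit is taken in L^2). *)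
Record metaplectic_rep (R : realType) (m r s : nat) (hbar : R)
    (mu : mp_elt R m -> ('rV[R]_m -> R[i]) -> 'rV[R]_m -> R[i]) : Prop := {
  mp_smooth : forall g f, Mp2m g -> schwartz f -> schwartz (mu g f) ;
  mp_linear : forall g (c : R[i]) f h, Mp2m g -> schwartz f -> schwartz h ->
    mu g (fun x => c * f x + h x) = (fun x => c * mu g f x + mu g h x) ;
  mp_rep_one : forall f, schwartz f -> mu (mp_one R m) f = f ;
  mp_rep_mul : forall g h f, Mp2m g -> Mp2m h -> schwartz f ->
    mu (mp_mul g h) f = mu g (mu h f) ;
  mp_unitary : forall g f h, Mp2m g -> schwartz f -> schwartz h ->
    L2inner (mu g f) (mu g h) = L2inner f h ;
  mp_differential : forall gam B (f : Hfun R m r s) J,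
    mp_one_parameter gam B -> Hsmooth f ->
    let quot t : 'rV[R]_m -> R[i] := fun x =>
      Complex t^-1 0 * (mu (gam t) (fun y => f y J) x - f x J)
      - mu_star hbar (block_mx B 0 0 0) f x J in
    (fun t => complex.Re (L2inner (quot t) (quot t))) @ 0^' --> (0 : R)
}.

Section Spinor.
Variables (R : realType) (m r s : nat) (hbar : R).

(* On the even Clifford algebra: X_1 ... X_2p |-> (i hbar)^-p U_*(X_1) ... U_*(X_2p). *)
Definition spinor (a : cl R r s) (f : Hfun R m r s) : Hfun R m r s :=
  \sum_(I : {set 'I_(dim_odd r s)})
    Hscale (Complex (a I) 0 * (Complex 0 hbar) ^- (#|I|./2))
      (foldr (fun i => Ustar hbar (col_mx 0 (col i (orth_basis R r s)))) f (enum I)).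

Variable mu : mp_elt R m -> ('rV[R]_m -> R[i]) -> 'rV[R]_m -> R[i].

Definition mu0 (g : mp_elt R m) (a : spin_elt R r s) (f : Hfun R m r s) :
    Hfun R m r s :=
  fun x J => mu g (fun y => spinor a.1 f y J) x.

End Spinor.

Section Super.
Variables (R : realType) (A : baseAlgebra R) (m r s : nat).

Local Notation N := (dim_E m r s).

(* [x i] is the coefficient of x on the left of the i-th basis vector. *)
Definition E0 : set ('I_N -> A) := [set x | forall i, homog (par i) (x i)].

(* The action of A (x) End(E_R) on even vectors; [X i j] is the coefficient on
   the left of the elementary matrix. *)
Definition super_act (X : 'M[A]_N) (x : 'I_N -> A) : 'I_N -> A :=
  fun i => \sum_j (-1) ^+ ((par i (+) par j) && par j) * (X i j * x j).

Definition tensor_spo (L : set A) (p : bool) : set 'M[A]_N :=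
  [set X | exists n (a : 'I_n -> A) (B : 'I_n -> 'M[R]_N),
     (forall k, L (a k) /\ spo p (B k)) /\
     X = \sum_k (\matrix_(i, j) (B k i j *: a k))].

(* M = M_0 e^X with X = [mp_odd].  The point M_0 of the A_0-scalar extension of
   Mp(2m, R) x Spin^0(k, l) is g e^Y, where g = ([mp_sp], [mp_spin]) is its body
   and Y = [mp_nil] its coordinate, with zero body, in the exponential chart
   centred at g. *)
Record Mp : Type := {
  mp_sp : mp_elt R m ;
  mp_spin : spin_elt R r s ;
  mp_nil : 'M[A]_N ;
  mp_odd : 'M[A]_N ;
  mp_spP : Mp2m mp_sp ;
  mp_spinP : Spin0 mp_spin ;
  mp_nilP : tensor_spo [set a | homog false a /\ body A a = 0] false mp_nil ;
  mp_oddP : tensor_spo [set a | homog true a] true mp_odd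
}.

Definition body_act (M : Mp) (x : 'I_N -> A) : 'I_N -> A :=
  fun i => \sum_j (block_mx (mp_sp M).1 0 0 (mp_spin M).2 : 'M[R]_N) i j *: x j.

Definition rho (M : Mp) (x : 'I_N -> A) : 'I_N -> A :=
  body_act M (nilexp (super_act (mp_nil M)) (nilexp (super_act (mp_odd M)) x)).

(* A (x) S(R^m) (x) Lambda(theta, zeta), as A (x) C (x) Lambda-valued functions
   of finite rank. *)
Definition AHfun : Type := 'rV[R]_m -> {set 'I_(r + s)} -> A * A.

Definition tens (a : A) (f : Hfun R m r s) : AHfun := fun x J =>
  (complex.Re (f x J) *: a, complex.Im (f x J) *: a).

Definition tens_sum (l : seq (A * Hfun R m r s)) : AHfun :=
  \sum_(af <- l) tens af.1 af.2.
Definition decomposes (phi : AHfun) : set (seq (A * Hfun R m r s)) :=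
  [set l | all (fun af => `[< Hsmooth af.2 >]) l /\ phi = tens_sum l].
Definition AH : set AHfun := [set phi | exists l, decomposes phi l].

(* (a (x) T)(b (x) f) = (-1)^(|T||b|) a b (x) T f, with p the parity of T; it
   does not depend on the decomposition when T is linear. *)
Definition tens_op (a : A) (p : bool) (T : Hfun R m r s -> Hfun R m r s)
    (phi : AHfun) : AHfun :=
  if pselect (AH phi) is left h then
    tens_sum [seq (a * twist p bf.1, T bf.2) | bf <- projT1 (cid h)]
  else 0.

Variable hbar : R.

Definition mu_starA (X : 'M[A]_N) (phi : AHfun) : AHfun :=
  \sum_i \sum_k
    tens_op (4^-1 *: (X *m map_mx (fun c : R => c%:A) (omega R m r s)^T) i k)
      (par i (+) par k) (mu_quad hbar i k) phi.

(* mu(g e^Y e^X) = mu_0(g) exp(mu_*(Y)) exp(mu_*(X)).  Since d mu_0 = mu_*, the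
   Taylor expansion of mu_0 at the body g, in the chart Y |-> g e^Y, is
   mu_0(g) \sum_n mu_*(Y)^n / n!. *)
Definition metaplectic
    (mu : mp_elt R m -> ('rV[R]_m -> R[i]) -> 'rV[R]_m -> R[i])
    (M : Mp) (phi : AHfun) : AHfun :=
  tens_op 1 false (mu0 hbar mu (mp_sp M) (mp_spin M))
    (nilexp (V := ('rV[R]_m -> {set 'I_(r + s)} -> A * A)%type)
      (mu_starA (mp_nil M))
      (nilexp (V := ('rV[R]_m -> {set 'I_(r + s)} -> A * A)%type)
        (mu_starA (mp_odd M)) phi)).

(* mu(M)^-1, as an operator on A (x) H_S^oo. *)
Definition metaplectic_inv
    (mu : mp_elt R m -> ('rV[R]_m -> R[i]) -> 'rV[R]_m -> R[i])
    (M : Mp) : AHfun -> AHfun :=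
  'pinv_(fun=> 0) AH (metaplectic mu M).

Section Schrodinger.
Variables (x : 'I_N -> A) (t : A).

Definition qev (i : 'I_m) : A := x (ia r s i).
Definition pev (i : 'I_m) : A := x (ib r s i).
Definition qodd (a : 'I_r) : A := x (iu m s a).
Definition podd (a : 'I_r) : A := x (iv m s a).
Definition zetac (c : 'I_s) : A * A := (x (iw m r c), x (iw' m r c)).
Definition zetabar (c : 'I_s) : A * A := (x (iw m r c), - x (iw' m r c)).

Definition qbody : 'rV[R]_m := \row_i body A (qev i).

(* i hbar (t + (q / 2 - q0) p + 1/2 (zeta / 2 - zeta0) zetabar) at q0 = (y, theta) *)
Definition sch_phase (y : 'rV[R]_m) : grass A (r + s) :=
  gscale (Complex 0 hbar)
    (gconst (t, 0)
     + \sum_i gconst ((2^-1 *: qev i - (y 0 i)%:A) * pev i, 0)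
     + \sum_a gmul (gconst (2^-1 *: qodd a, 0) - ggen A (theta s a))
                   (gconst (podd a, 0))
     + 2^-1 *: \sum_c gmul (gconst (2^-1 *: zetac c) - ggen A (zeta r c))
                           (gconst (zetabar c))).

(* - \sum_i (q_i - body q_i) d/dx_i, whose exponential is the Taylor expansion *)
Definition sch_taylor (phi : AHfun) : AHfun :=
  \sum_i tens_op (- (qev i - (body A (qev i))%:A)) false (@Hpartial R m r s i) phi.

Definition odd_shift (k : 'I_(r + s)) : A * A :=
  match fintype.split k with inl a => (qodd a, 0) | inr c => zetac c end.

Definition schrodinger (phi : AHfun) : AHfun := fun y =>
  gmul (gexp (sch_phase y))
    (gshift odd_shift
      (nilexp (V := ('rV[R]_m -> {set 'I_(r + s)} -> A * A)%type)
        sch_taylor phi (y - qbody))).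

End Schrodinger.
End Super.

(* Main.v *)
(* Let b be the body of x and n = x - b its nilpotent part.  Writing
   u(y) = U_*(y) and W(b) for the real Weyl operator of b, the operator U(x, t) is
     e^(i hbar body(t)) W(b) exp(u(n) + i hbar (t - body(t) - omega(b, n) / 2)),
   where the last exponential is a finite sum.  The claim splits along
   M = g e^Y e^X.

   For the nilpotent factors, [mu_*(Y), u(x)] = u(Y x) and the derivative of W(b)
   reduce the claim to an identity of Baker-Campbell-Hausdorff type between
   nilpotent exponentials, proved by comparing two polynomial solutions of one
   linear differential equation.

   For the body g, the spinor factor is conjugation in the Clifford algebra.  On
   L^2, let S_t be a unipotent one-parameter subgroup of the metaplectic group
   on which S_t is affine in t.  As mu_t = mu(S_t) is unitary with differential
   mu_*, the function t |-> <mu_t U(X) f, U(S_t X) mu_t h> is constant, so that mu_t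
   intertwines U(X) and U(S_t X).  The upper and lower unipotent
   matrices generate Sp(2m, R); the cocycle part of their lifts is followed on the
   Siegel upper half-space, where a continuous square root of a given
   automorphy factor is determined up to sign. *)
From Pilot Require Import Defs.
From HB Require Import structures.
From mathcomp Require Import all_boot all_order all_algebra perm.
From mathcomp Require Import ring lra zify complex.
From mathcomp Require Import all_classical all_reals all_analysis measurable_realfun.

Set Implicit Arguments.
Unset Strict Implicit.
Unset Printing Implicit Defensive.

Import Order.TTheory GRing.Theory Num.Theory.
Import numFieldNormedType.Exports.
Local Open Scope classical_set_scope.
Local Open Scope ring_scope.

(** * Operators preserving a submodule *)

(** Nilpotent elements of the base algebra have no common order. Hence the finite list of nilpotent
    coefficients occurring in [M], [x] and [t] is fixed; the ideal it generates is nilpotent, and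
    its powers filter an algebra of operators in which all exponentials are series of one fixed
    length. There, a combination of the basis operators with coefficients of matching parity is
    even: Koszul signs cancel and supercommutators become commutators. The Grassmann-valued formula
    for U enters this algebra because its multiplicative factors act on the fibre at a point by left
    multiplication.

    On L2 the representation is known only through unitarity and an L2 limit at the identity, so
    derivatives are taken in norm and equalities are tested against Schwartz functions. For a
    rank-one lower unipotent the automorphy factor is affine in the parameter and avoids the
    negative real axis, so its principal root is a one-parameter lift. A lift of the identity matrix
    may still be the non-trivial one; for m > 0 it is the fourth power of a lifted quarter turn. *)

Record submod (K : comNzRingType) (V : lmodType K) := Submod {
  smset :> V -> Prop ;
  sm0 : smset 0 ;
  smP : forall (c : K) u v, smset u -> smset v -> smset (c *: u + v) ;
  sm_neq0 : exists2 v, smset v & v != 0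
}.

Section Operators.
Variables (K : comNzRingType) (V : lmodType K) (S : submod V).

Definition preserving (T : V -> V) : Prop :=
  (forall v, S v -> S (T v)) /\
  (forall c u v, S u -> S v -> T (c *: u + v) = c *: T u + T v).

(* Operators are normalized to vanish outside S, so that they are determined by
   their restriction to S. *)
Record op := Op {
  opf :> V -> V ;
  op_prop : preserving opf /\ forall v, ~ S v -> opf v = 0
}.

HB.instance Definition _ := gen_eqMixin op.
HB.instance Definition _ := gen_choiceMixin op.

Lemma smD u v : S u -> S v -> S (u + v).
Proof. by move=> Su Sv; have := smP 1 Su Sv; rewrite scale1r. Qed.

Lemma smZ c u : S u -> S (c *: u).
Proof. by move=> Su; have := smP c Su (sm0 S); rewrite addr0. Qed.

Lemma smN u : S u -> S (- u).
Proof. by rewrite -scaleN1r; exact: smZ. Qed.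

Lemma sm_sum I (s : seq I) (P : pred I) (F : I -> V) :
  (forall i, P i -> S (F i)) -> S (\sum_(i <- s | P i) F i).
Proof. by move=> H; elim/big_rec: _ => [|i v /H]; [exact: sm0 | exact: smD]. Qed.

Lemma op_in (T : op) v : S v -> S (T v).
Proof. by move: T => [T [[+ _] _]] /=; apply. Qed.

Lemma opL (T : op) c u v : S u -> S v -> T (c *: u + v) = c *: T u + T v.
Proof. by move: T => [T [[_ +] _]] /=; apply. Qed.

Lemma op0 (T : op) : T 0 = 0.
Proof.
have := opL T (-1) (sm0 S) (sm0 S).
by rewrite scaleN1r oppr0 addr0 scaleN1r addNr.
Qed.

Lemma opD (T : op) u v : S u -> S v -> T (u + v) = T u + T v.
Proof. by move=> Su Sv; have := opL T 1 Su Sv; rewrite !scale1r. Qed.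

Lemma opZ (T : op) c u : S u -> T (c *: u) = c *: T u.
Proof. by move=> Su; have := opL T c Su (sm0 S); rewrite op0 !addr0. Qed.

Lemma opN (T : op) u : S u -> T (- u) = - T u.
Proof. by move=> Su; rewrite -scaleN1r opZ// scaleN1r. Qed.

Lemma op_sumv (T : op) I (s : seq I) (P : pred I) (F : I -> V) :
  (forall i, P i -> S (F i)) ->
  T (\sum_(i <- s | P i) F i) = \sum_(i <- s | P i) T (F i).
Proof.
move=> H; elim: s => [|i s IH]; first by rewrite !big_nil op0.
rewrite !big_cons; case: ifP => // Pi; rewrite opD ?IH//; first exact: H.
exact: sm_sum.
Qed.

Lemma op_ext (T U : op) : (forall v, S v -> T v = U v) -> T = U.
Proof.
case: T => T [Tp T0]; case: U => U [Up U0] /= TU.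
have E : T = U by apply/funext => v; case: (pselect (S v)) => [/TU//|nS]; rewrite T0// U0.
by subst U; congr Op; exact: Prop_irrelevance.
Qed.

Definition restr (T : V -> V) : V -> V := fun v => if pselect (S v) is left _ then T v else 0.

Lemma restrE T v : S v -> restr T v = T v.
Proof. by rewrite /restr; case: pselect. Qed.

Lemma restr_prop T : preserving T ->
  preserving (restr T) /\ forall v, ~ S v -> restr T v = 0.
Proof.
move=> [Ts Tl]; split; last by move=> v; rewrite /restr; case: pselect.
split=> [v Sv|c u v Su Sv]; first by rewrite restrE//; exact: Ts.
by rewrite !restrE//; [exact: Tl|exact: smP].
Qed.

Definition mkop (T : V -> V) (H : preserving T) : op := Op (restr_prop H).

Lemma mkopE T (H : preserving T) v : S v -> mkop H v = T v.
Proof. exact: restrE. Qed.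

Lemma pres0 : preserving (fun=> 0).
Proof. by split=> [v _|c u v _ _]; [exact: sm0|rewrite scaler0 addr0]. Qed.
Lemma pres1 : preserving id. Proof. by []. Qed.
Lemma presN (T : op) : preserving (fun v => - T v).
Proof.
split=> [v Sv|c u v Su Sv]; first by exact/smN/op_in.
by rewrite opL// opprD scalerN.
Qed.
Lemma presD (T U : op) : preserving (fun v => T v + U v).
Proof.
split=> [v Sv|c u v Su Sv]; first by apply: smD; exact: op_in.
by rewrite !opL// scalerDr addrACA.
Qed.
Lemma presM (T U : op) : preserving (fun v => T (U v)).
Proof.
split=> [v Sv|c u v Su Sv]; first by do 2!apply: op_in.
by rewrite !opL//; exact: op_in.
Qed.
Lemma presZ (c : K) (T : op) : preserving (fun v => c *: T v).
Proof.
split=> [v Sv|d u v Su Sv]; first by exact/smZ/op_in.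
by rewrite opL// scalerDr !scalerA mulrC.
Qed.

Definition op_zero := mkop pres0.
Definition op_one := mkop pres1.
Definition op_opp T := mkop (presN T).
Definition op_add T U := mkop (presD T U).
Definition op_mul T U := mkop (presM T U).
Definition op_scale c T := mkop (presZ c T).

Let E := (@mkopE, opD, opZ, opN, op0).

Fact op_addA : associative op_add.
Proof. by move=> T U W; apply: op_ext => v Sv; rewrite !mkopE// addrA. Qed.
Fact op_addC : commutative op_add.
Proof. by move=> T U; apply: op_ext => v Sv; rewrite !mkopE// addrC. Qed.
Fact op_add0 : left_id op_zero op_add.
Proof. by move=> T; apply: op_ext => v Sv; rewrite !mkopE// add0r. Qed.
Fact op_addN : left_inverse op_zero op_opp op_add.
Proof. by move=> T; apply: op_ext => v Sv; rewrite !mkopE// addNr. Qed.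

HB.instance Definition _ := GRing.isZmodule.Build op op_addA op_addC op_add0 op_addN.

Fact op_mulA : associative op_mul.
Proof. by move=> T U W; apply: op_ext => v Sv; rewrite !mkopE//; exact: op_in. Qed.
Fact op_mul1l : left_id op_one op_mul.
Proof. by move=> T; apply: op_ext => v Sv; rewrite !mkopE//; exact: op_in. Qed.
Fact op_mul1r : right_id op_one op_mul.
Proof. by move=> T; apply: op_ext => v Sv; rewrite !mkopE. Qed.
Fact op_mulDl : left_distributive op_mul op_add.
Proof. by move=> T U W; apply: op_ext => v Sv; rewrite !mkopE//; exact: op_in. Qed.
Fact op_mulDr : right_distributive op_mul op_add.
Proof. by move=> T U W; apply: op_ext => v Sv; rewrite !mkopE// opD//; exact: op_in. Qed.
Fact op_neq0 : op_one != op_zero.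
Proof.
have [v Sv v0] := sm_neq0 S; apply: contra v0 => /eqP e.
by have : op_one v = op_zero v by [rewrite e]; rewrite !mkopE// => ->.
Qed.

HB.instance Definition _ := GRing.Zmodule_isNzRing.Build op
  op_mulA op_mul1l op_mul1r op_mulDl op_mulDr op_neq0.

Fact op_scaleA c d T : op_scale c (op_scale d T) = op_scale (c * d) T.
Proof. by apply: op_ext => v Sv; rewrite !mkopE// scalerA. Qed.
Fact op_scale1 : left_id 1 op_scale.
Proof. by move=> T; apply: op_ext => v Sv; rewrite !mkopE// scale1r. Qed.
Fact op_scaleDr : right_distributive op_scale +%R.
Proof. by move=> c T U; apply: op_ext => v Sv; rewrite !mkopE// scalerDr. Qed.
Fact op_scaleDl T : {morph op_scale^~ T : c d / c + d}.
Proof. by move=> c d; apply: op_ext => v Sv; rewrite !mkopE// scalerDl. Qed.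

HB.instance Definition _ := GRing.Zmodule_isLmodule.Build K op
  op_scaleA op_scale1 op_scaleDr op_scaleDl.

Fact op_scalerAl (c : K) (T U : op) : c *: (T * U) = (c *: T) * U.
Proof. by apply: op_ext => v Sv; rewrite !mkopE//; exact: op_in. Qed.
HB.instance Definition _ := GRing.Lmodule_isLalgebra.Build K op op_scalerAl.
Fact op_scalerAr (c : K) (T U : op) : c *: (T * U) = T * (c *: U).
Proof. by apply: op_ext => v Sv; rewrite !mkopE// opZ//; exact: op_in. Qed.
HB.instance Definition _ := GRing.Lalgebra_isAlgebra.Build K op op_scalerAr.

Lemma opE0 v : S v -> (0 : op) v = 0. Proof. exact: mkopE. Qed.
Lemma opE1 v : S v -> (1 : op) v = v. Proof. exact: mkopE. Qed.
Lemma opED (T U : op) v : S v -> (T + U) v = T v + U v. Proof. exact: mkopE. Qed.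
Lemma opEN (T : op) v : S v -> (- T) v = - T v. Proof. exact: mkopE. Qed.
Lemma opEM (T U : op) v : S v -> (T * U) v = T (U v). Proof. exact: mkopE. Qed.
Lemma opEZ c (T : op) v : S v -> (c *: T) v = c *: T v. Proof. exact: mkopE. Qed.
Lemma opE_sum I (s : seq I) (P : pred I) (F : I -> op) v : S v ->
  (\sum_(i <- s | P i) F i) v = \sum_(i <- s | P i) F i v.
Proof.
move=> Sv; elim: s => [|i s IH]; first by rewrite !big_nil opE0.
by rewrite !big_cons; case: ifP; rewrite ?opED ?IH.
Qed.

End Operators.

(** * Nilpotent exponentials *)

Section DividedPowers.
Variables (Q : nzRingType) (iv : nat -> Q).
Hypothesis iv0 : iv 0 = 1.
Hypothesis ivC : forall k x, iv k * x = x * iv k.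
Hypothesis ivS : forall k, iv k.+1 *+ k.+1 = iv k.

(** [iv k] stands for $1/k!$. Only these central elements are asked of the ring, so that the series
    makes sense in [{poly B}], with [iv k] a constant polynomial. *)
Definition dexp (n : nat) (x : Q) : Q := \sum_(k < n) iv k * x ^+ k.

Lemma dexp_stab n m x : x ^+ n = 0 -> (n <= m)%N -> dexp m x = dexp n x.
Proof.
move=> xn /subnK <-; elim: (m - n)%N => // k IH.
by rewrite addSn /dexp big_ord_recr /= -/(dexp _ x) IH addnC exprD xn mul0r mulr0 addr0.
Qed.

Lemma iv_bin k : iv k.+2 *+ 'C(k.+2, 2) = iv 2 * iv k.
Proof.
have e2 : iv 2 *+ 2 = 1.
  have := ivS 0; rewrite mulr1n iv0 => e1.
  by rewrite ivS.
rewrite -[LHS]mul1r -e2 mulrnAl -mulrnAr -mulrnA -[RHS]mulr1n; congr (_ * _).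
have := bin_ffact k.+2 2; rewrite (_ : 2`! = 2%N)// !ffactnS ffactn0 muln1 /= => bE.
by rewrite bE mulrnA ivS ivS.
Qed.

(** Covers $f_k = [w^k, v]$ and $f_k = (w^k)'$ at once, with $d = [w,v]$ or $d = w'$. Moving each
    $d$ to the left gives $f_k = k\,d\,w^{k-1} + \binom k2 e\,w^{k-2}$, because $e = [w,d]$ commutes
    with $w$; summing yields $(d + e/2)e^w$, with the three truncation lengths that appear. *)
Lemma dexp_rec n (w d e : Q) (f : nat -> Q) : f 0 = 0 ->
  (forall k, f k.+1 = d * w ^+ k + w * f k) -> w * d = d * w + e -> w * e = e * w ->
  \sum_(k < n.+2) iv k * f k = d * dexp n.+1 w + iv 2 * e * dexp n w.
Proof.
move=> f0 fS wd we.
have K k : f k = d * w ^+ k.-1 *+ k + e * w ^+ k.-2 *+ 'C(k, 2).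
  elim: k => [|k IH]; first by rewrite f0 !mulr0n addr0.
  rewrite fS IH !mulrDr.
  case: k {IH} => [|k]; first by rewrite !mulr0n !mulr0 !addr0.
  rewrite !mulrnAr -[k.+1.-1]/k (mulrA w d) wd mulrDl -!mulrA -exprS mulrnDl.
  case: k => [|k].
    by rewrite mulr0n addr0 /= !mulr1n mulr2n !addrA.
  have -> : 'C(k.+3, 2) = (k.+2 + 'C(k.+2, 2))%N by rewrite [LHS]binS bin1 addnC.
  rewrite -[k.+2.-2]/k (mulrA w e) we -mulrA -exprS [_ *+ (k.+2 + _)]mulrnDr.
  rewrite [d * _ *+ k.+3]mulrS.
  by move: (d * _ *+ k.+2) (e * _ *+ k.+2) (e * _ *+ 'C(k.+2, 2)) => a b c; rewrite !addrA.
transitivity (\sum_(k < n.+2) iv k * (d * w ^+ k.-1 *+ k)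
   + \sum_(k < n.+2) iv k * (e * w ^+ k.-2 *+ 'C(k, 2))).
  by rewrite -big_split /=; apply: eq_bigr => k _; rewrite K mulrDr.
congr (_ + _).
- rewrite big_ord_recl mulr0n mulr0 add0r /dexp mulr_sumr; apply: eq_bigr => k _ /=.
  by rewrite mulrnAr -mulrnAl ivS mulrA ivC mulrA.
- rewrite !big_ord_recl /= !mulr0n !mulr0 !add0r /dexp mulr_sumr; apply: eq_bigr => k _ /=.
  rewrite mulrnAr -mulrnAl iv_bin.
  by rewrite -!mulrA; congr (_ * _); rewrite mulrA ivC mulrA.
Qed.

Lemma dexp_comm n (w v d e : Q) : w * v = v * w + d -> w * d = d * w + e ->
  w * e = e * w ->
  dexp n.+2 w * v = v * dexp n.+2 w + (d * dexp n.+1 w + iv 2 * e * dexp n w).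
Proof.
move=> wv wd we; rewrite -(@dexp_rec n w d e (fun k => w ^+ k * v - v * w ^+ k)) //.
- rewrite /dexp mulr_suml mulr_sumr -big_split /=; apply: eq_bigr => k _.
  by rewrite mulrA -ivC -!mulrA -mulrDr addrC subrK.
- by rewrite expr0 mul1r mulr1 subrr.
- move=> k; rewrite exprS mulrBr !mulrA wv mulrDl opprD.
  by rewrite [X in _ = _ + X]addrA [RHS]addrC subrK.
Qed.

End DividedPowers.

(** * Filtered algebras and truncated exponentials *)

Section Filtration.
Variables (K : numFieldType) (B : algType K).

Definition fac (k : nat) : K := (k`!%:R)^-1.

Lemma fac0 : fac 0 = 1. Proof. by rewrite /fac invr1. Qed.

Lemma facS k : fac k.+1 *+ k.+1 = fac k.
Proof.
rewrite /fac factS natrM invfM -mulrnAl -[X in X *+ _]mulr1 -mulr_natr mulr1.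
by rewrite mulVf ?mul1r// pnatr_eq0.
Qed.

(** Models operators with coefficients in the [k]-th power of a nilpotent ideal. The order
    [fl_order] is common to all elements, which makes a polynomial with coefficients in [fl 1]
    nilpotent, and not only each coefficient ([poly_nil]). *)
Record filtration := Filtration {
  fl :> nat -> B -> Prop ;
  fl_order : nat ;
  fl0 : fl 0 1 ;
  fl00 : forall k, fl k 0 ;
  flD : forall k x y, fl k x -> fl k y -> fl k (x + y) ;
  flZ : forall k c x, fl k x -> fl k (c *: x) ;
  flM : forall k x y, fl 1 x -> fl k y -> fl k.+1 (x * y) ;
  fl_nil : forall x, fl fl_order x -> x = 0
}.

Variable F : filtration.

Definition texp n (x : B) : B := \sum_(k < n) fac k *: x ^+ k.
(** The length is that of the longest sum in [dexp_rec] for [n = fl_order F]; on nilpotent arguments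
    of that order all three truncations agree. *)
Definition nexp (x : B) : B := texp (fl_order F).+2 x.

Lemma flX x k : F 1 x -> F k (x ^+ k).
Proof. by move=> Fx; elim: k => [|k IH]; [exact: fl0|rewrite exprS; exact: flM]. Qed.

End Filtration.

(** * The exponential identity for a moving exponent *)

Section ExpIdentity.
Variables (K : numFieldType) (B : algType K) (F : filtration B).
Local Notation fac := (fac K).

Lemma fl_sum k I (s : seq I) (P : pred I) (G : I -> B) :
  (forall i, P i -> F k (G i)) -> F k (\sum_(i <- s | P i) G i).
Proof. by move=> H; elim/big_rec: _ => [|i x /H]; [exact: fl00|exact: flD]. Qed.

Lemma expr_nil (Q : nzRingType) (x : Q) a k : x ^+ a = 0 -> (a <= k)%N -> x ^+ k = 0.
Proof. by move=> xa /subnK <-; rewrite exprD xa mulr0. Qed.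

Lemma texp_stab n m (x : B) : x ^+ n = 0 -> (n <= m)%N -> texp m x = texp n x.
Proof.
move=> xn /subnK <-; elim: (m - n)%N => // k IH.
rewrite addSn /texp big_ord_recr /= -/(texp _ x) IH.
by rewrite (expr_nil xn) ?leq_addl// scaler0 addr0.
Qed.

Lemma texp_nexp n x : F 1 x -> x ^+ n = 0 -> nexp F x = texp n x.
Proof.
move=> Fx xn; have xo : x ^+ fl_order F = 0 by apply/(fl_nil (f := F))/flX.
rewrite /nexp (texp_stab xo) ?(ltnW (ltnW (leqnn _)))//.
by have [/(texp_stab xo)|/ltnW/(texp_stab xn)] := leqP (fl_order F) n.
Qed.

Let ivB k : B := (fac k)%:A.
Let ivP k : {poly B} := (ivB k)%:P.

Let ivPC k (p : {poly B}) : ivP k * p = p * ivP k.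
Proof. by apply/polyP => i; rewrite coefCM coefMC /ivB mulr_algl mulr_algr. Qed.

Let ivP0 : ivP 0 = 1. Proof. by rewrite /ivP /ivB fac0 scale1r. Qed.

Let ivPS k : ivP k.+1 *+ k.+1 = ivP k.
Proof. by rewrite /ivP -polyCMn /ivB scalerMnl facS. Qed.

Lemma comm_poly_coef (p q : {poly B}) n :
  (p * q - q * p)`_n = \sum_(j < n.+1) (p`_j * q`_(n - j) - q`_(n - j) * p`_j).
Proof. by rewrite coefB coefM coefMr -sumrB. Qed.

Lemma poly_comm (p q : {poly B}) : (forall i j, p`_i * q`_j = q`_j * p`_i) -> p * q = q * p.
Proof.
move=> H; apply/eqP; rewrite -subr_eq0; apply/eqP/polyP => n.
by rewrite comm_poly_coef coef0 big1// => j _; rewrite H subrr.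
Qed.

Lemma poly_nil (w : {poly B}) : (forall i, F 1 w`_i) -> w ^+ fl_order F = 0.
Proof.
move=> Fw; suff H k i : F k (w ^+ k)`_i by apply/polyP => i; rewrite coef0; apply: fl_nil.
elim: k i => [|k IH] i; first by rewrite expr0 coef1; case: i => [|i]; [exact: fl0|exact: fl00].
by rewrite exprS coefM; apply: fl_sum => j _; apply: flM.
Qed.

Lemma deriv_exprS (w : {poly B}) k : (w ^+ k.+1)^`() = w^`() * w ^+ k + w * (w ^+ k)^`().
Proof. by rewrite exprS derivM. Qed.

(* The solution of E' = X E in formal power series. *)
Lemma poly_ode (X : B) (E : {poly B}) : E^`() = X%:P * E -> F 1 X ->
  E.[1] = nexp F X * E`_0.
Proof.
move=> EX FX.
have Ek k : E`_k = (fac k *: X ^+ k) * E`_0.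
  elim: k => [|k IH]; first by rewrite fac0 scale1r mul1r.
  have := congr1 (fun p : {poly B} => p`_k) EX; rewrite coef_deriv coefCM IH => e.
  rewrite -[E`_k.+1]scale1r -(@mulVf _ (k.+1%:R : K)) ?pnatr_eq0// -scalerA scaler_nat e.
  rewrite mulrA -scalerAr -exprS scalerAl scalerA; congr (_ *: _ * _).
  by rewrite -(facS K k) -[X in _ * X = _]mulr_natl mulKf ?pnatr_eq0.
have Xo : X ^+ fl_order F = 0 by apply/(fl_nil (f := F))/flX.
have Xz k : (fl_order F <= k)%N -> E`_k = 0 by move=> /(expr_nil Xo) Xk; rewrite Ek Xk scaler0 mul0r.
rewrite (@horner_coef_wide _ (maxn (size E) (fl_order F)))  ?leq_maxl//.
rewrite (texp_nexp FX (n := maxn (size E) (fl_order F))); last first.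
  by apply: expr_nil Xo _; rewrite leq_maxr.
by rewrite /texp mulr_suml; apply: eq_bigr => k _; rewrite expr1n mulr1 Ek.
Qed.

Let P1 (p : {poly B}) : forall q : {poly B}, (q * p).[1] = q.[1] * p.[1].
Proof. by move=> q; rewrite hornerM_comm// /comm_poly mulr1 mul1r. Qed.

Let dexp_horner n (w : {poly B}) : (dexp ivP n w).[1] = texp n w.[1].
Proof.
rewrite /dexp horner_sum; apply: eq_bigr => k _.
rewrite P1 hornerC /ivB mulr_algl; congr (_ *: _).
by elim: (k : nat) => [|j IH]; rewrite ?expr0 ?hornerC// !exprS P1 IH.
Qed.

Let dexp_coef0 n (w : {poly B}) : (dexp ivP n w)`_0 = texp n w`_0.
Proof.
rewrite /dexp coef_sum; apply: eq_bigr => k _.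
rewrite coefCM /ivB mulr_algl; congr (_ *: _).
by elim: (k : nat) => [|j IH]; rewrite ?expr0 ?coefC// !exprS coef0M IH.
Qed.

(** In the main application [D] is the operator of a nilpotent Lie algebra element $Y$, [y 0] that
    of $x - b$, [y k] that of $Y^k x$ for $k > 0$, and [be] that of $Y b$. Splitting the body $b$
    off from $x$ is what subtracts [be] in [Dy0]. [cen] collects scalars commuting with all of
    these. *)
Variables (D be kap c0 : B) (y z : nat -> B) (m : nat) (cen : B -> Prop).
Hypotheses (FD : F 1 D) (Fb : F 1 be) (Fk : F 1 kap) (Fc : F 1 c0).
Hypotheses (Fy : forall k, F 1 (y k)) (Fz : forall k, F 1 (z k)).
Hypothesis ym : forall k, (m < k)%N -> y k = 0.
Hypothesis Dy0 : D * y 0 = y 0 * D + (y 1 - be).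
Hypothesis DyS : forall k, D * y k.+1 = y k.+1 * D + y k.+2.
Hypothesis yb : forall k, y k * be = be * y k + z k.
Hypothesis cenB : forall a u v, cen u -> cen v -> cen (u - a *: v).
Hypothesis cenC : forall u v, cen u -> cen v -> u * v = v * u.
Hypothesis cen_D : forall u, cen u -> u * D = D * u.
Hypothesis cen_y : forall u k, cen u -> u * y k = y k * u.
Hypothesis cen_b : forall u, cen u -> u * be = be * u.
Hypothesis cen_z : forall k, cen (z k).
Hypotheses (cen_k : cen kap) (cen_c : cen c0).
Hypothesis yy : forall j k, cen (y j * y k - y k * y j).

(* With w(t) = \sum_k t^k y_k / k! + c(t), where c' = kap - [w, be] / 2, the
   polynomial E(t) = e^(w(t)) e^(t D) satisfies E' = (D + be + kap) E. *)
Lemma exp_identity :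
  nexp F (D + be + kap) * nexp F (y 0 + c0) =
  nexp F (\sum_(k < m.+1) fac k *: y k + c0 + kap
          - 2^-1 *: \sum_(k < m.+1) fac k.+1 *: z k) * nexp F D.
Proof.
set n := fl_order F.
have cen0 : cen 0 by rewrite -(subrr kap) -[X in _ - X]scale1r; exact: cenB.
have cenZ a u : cen u -> cen (a *: u).
  by move=> cu; have := cenB (- a) cen0 cu; rewrite scaleNr opprK add0r.
have cenD u v : cen u -> cen v -> cen (u + v).
  by move=> cu cv; rewrite -[v]opprK -[- v]scaleN1r; exact: cenB.
have z0 k : (m < k)%N -> z k = 0.
  by move=> /ym yk; have := yb k; rewrite yk mul0r mulr0 add0r => <-.
have [wy wyE wy1] : exists2 wy : {poly B}, forall k, wy`_k = fac k *: y k &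
    wy.[1] = \sum_(k < m.+1) fac k *: y k.
  exists (\poly_(k < m.+1) (fac k *: y k)) => [k|].
    by rewrite coef_poly; case: ltnP => // /ym ->; rewrite scaler0.
  by rewrite horner_poly; apply: eq_bigr => k _; rewrite expr1n mulr1.
pose cf k := (if k is 0%N then kap else 0) - 2^-1 *: (fac k.+1 *: z k).
have [c cE c1] : exists2 c : {poly B}, forall k, c`_k = (if k is k'.+1 then cf k' else c0) &
    c.[1] = c0 + kap - 2^-1 *: \sum_(k < m.+1) fac k.+1 *: z k.
  exists (c0%:P + (\poly_(k < m.+1) cf k) * 'X) => [k|].
    rewrite coefD coefC coefMX; case: k => [|k]; first by rewrite addr0.
    rewrite add0r /= coef_poly; case: ltnP => // km.
    by rewrite /cf z0// !scaler0 subr0; case: k km.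
  rewrite hornerD hornerC hornerMX mulr1 horner_poly -addrA; congr (_ + _).
  under eq_bigr do rewrite expr1n mulr1 /cf.
  rewrite sumrB scaler_sumr; congr (_ - _).
  by rewrite big_ord_recl big1 ?addr0.
have ccen k : cen c`_k.
  rewrite cE; case: k => [//|k]; apply: cenB; last exact: cenZ.
  by case: k.
pose w := wy + c.
have Fw i : F 1 w`_i.
  rewrite coefD wyE cE; apply: flD; first exact: flZ.
  case: i => [//|i]; apply: flD; last by rewrite -scaleN1r; do 3!apply: flZ.
  by case: i => // i; exact: fl00.
have wn : w ^+ n = 0 by exact: poly_nil.
pose dwy := wy^`().
have dwyE k : dwy`_k = fac k *: y k.+1.
  by rewrite coef_deriv wyE scalerMnl facS.
have dcE k : c^`()`_k = (if k is 0%N then kap else 0) - 2^-1 *: (fac k *: z k).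
  rewrite coef_deriv cE /cf mulrnBl scalerMnr scalerMnl facS.
  by case: k => [|k]; [rewrite mulr1n|rewrite mul0rn].
have polyC_cen (p q : {poly B}) : (forall i, cen p`_i) ->
    (forall i, exists a k, q`_i = a *: y k) -> p * q = q * p.
  move=> cp yq; apply: poly_comm => i j; have [a [k ->]] := yq j.
  by rewrite -scalerAl -scalerAr cen_y.
have ywy i : exists a k, wy`_i = a *: y k by exists (fac i), i.
have ydwy i : exists a k, dwy`_i = a *: y k by exists (fac i), i.+1.
have cdc i : cen c^`()`_i.
  rewrite dcE; apply: cenB; last exact: cenZ.
  by case: i.
have [e1 e1E] : exists e1, e1 = wy * dwy - dwy * wy by eexists.
have ce1 i : cen e1`_i.
  rewrite e1E comm_poly_coef; elim/big_rec: _ => [//|j u _ cu].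
  apply: cenD => //.
  rewrite wyE dwyE -!(scalerAl, scalerAr) !scalerA [X in _ - X *: _]mulrC -scalerBr.
  exact/cenZ/yy.
have cc : c * c^`() = c^`() * c by apply: poly_comm => i j; exact: cenC.
have wdw : w * w^`() = w^`() * w + e1.
  rewrite /w derivD -/dwy e1E !mulrDl !mulrDr (polyC_cen c) // (polyC_cen c^`()) // cc.
  move: (wy * dwy) (dwy * wy) (wy * c^`()) (dwy * c) (c^`() * c) => a b d e f.
  by rewrite [RHS]addrC -[b + e + _]addrA [RHS]addrA subrK -addrA [d + _]addrCA.
have we1 : w * e1 = e1 * w.
  rewrite /w mulrDl mulrDr -(polyC_cen e1 wy) //; congr (_ + _).
  by apply: poly_comm => i j; exact: cenC.
pose DX := D%:P * 'X : {poly B}.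
have DXE : DX^`() = D%:P by rewrite derivM derivC mul0r add0r derivX mulr1.
have FDX i : F 1 DX`_i.
  by rewrite coefMX; case: i => [|i]; rewrite ?coefC; [exact: fl00|case: i => // i; exact: fl00].
have DXn : DX ^+ n = 0 by exact: poly_nil.
have DDX : D%:P * DX = DX * D%:P by rewrite /DX -mulrA -commr_polyX mulrA.
pose X := dexp ivP n.+2 w; pose Y := dexp ivP n.+2 DX.
have stab p : p ^+ n = 0 -> (dexp ivP n.+1 p = dexp ivP n.+2 p) * (dexp ivP n p = dexp ivP n.+2 p).
  move=> pn; rewrite (dexp_stab ivP pn (leqnSn n)).
  by rewrite (dexp_stab ivP pn (m := n.+2)) // -addn2 leq_addr.
have dE (p : {poly B}) : (dexp ivP n.+2 p)^`() = \sum_(k < n.+2) ivP k * (p ^+ k)^`().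
  by rewrite /dexp (raddf_sum (@deriv B)); apply: eq_bigr => k _; exact: deriv_mulC.
have dX : X^`() = (w^`() + ivP 2 * e1) * X.
  rewrite /X dE (dexp_rec ivP0 ivPC ivPS n (f := fun k => (w ^+ k)^`()) _ _ wdw we1) ?derivC//; last first.
    by move=> k; exact: deriv_exprS.
  by rewrite !stab// mulrDl.
have dY : Y^`() = D%:P * Y.
  have DX0 : DX * DX^`() = DX^`() * DX + 0 by rewrite DXE addr0 DDX.
  rewrite /Y dE (dexp_rec ivP0 ivPC ivPS n (f := fun k => (DX ^+ k)^`()) _ _ DX0) ?mulr0 ?mul0r ?derivC//; last first.
    by move=> k; exact: deriv_exprS.
  by rewrite !stab// DXE addr0.
have [zb zbE zb1] : exists2 zb : {poly B}, zb = wy * be%:P - be%:P * wy & forall k, zb`_k = fac k *: z k.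
  eexists=> // k; rewrite coefB coefMC coefCM wyE -!(scalerAl, scalerAr) -scalerBr yb.
  by rewrite addrC addKr.
have wD : w * D%:P = D%:P * w + (be%:P - dwy).
  apply/polyP => i; rewrite /w coefD coefMC coefCM coefB coefC !coefD mulrDl mulrDr.
  rewrite [c`_i * D]cen_D // addrAC; congr (_ + _).
  rewrite wyE dwyE -!(scalerAl, scalerAr); case: i => [|i] /=; last first.
    by rewrite sub0r DyS scalerDr addrK.
  by rewrite fac0 !scale1r Dy0 -addrA -(opprB (y 1)) subrr addr0.
have ew : w * (be%:P - dwy) = (be%:P - dwy) * w + (zb - e1).
  have cb : c * be%:P = be%:P * c.
    by apply/polyP => i; rewrite coefMC coefCM cen_b.
  rewrite zbE e1E /w !mulrDl !mulrDr !mulrN !mulNr cb (polyC_cen c dwy) //.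
  move: (wy * dwy) (dwy * wy) (wy * be%:P) (be%:P * wy) (be%:P * c) (dwy * c) => a a' d d' e f.
  rewrite addrACA [RHS]addrC opprB [RHS]addrACA [d - d' + _]addrA subrK; congr (_ + _).
  by rewrite [a' - a]addrC addrA addrK.
have wzb : w * (zb - e1) = (zb - e1) * w.
  have zbc i : cen zb`_i by rewrite zb1; exact: cenZ.
  rewrite mulrBr mulrBl we1; congr (_ - _).
  rewrite /w mulrDl mulrDr (polyC_cen zb wy) //; congr (_ + _).
  by apply: poly_comm => i j; exact: cenC.
have XD : X * D%:P = D%:P * X + ((be%:P - dwy) * X + ivP 2 * (zb - e1) * X).
  by rewrite /X (dexp_comm ivP0 ivPC ivPS n wD ew wzb) !stab.
have c'E : c^`() = kap%:P - ivP 2 * zb.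
  apply/polyP => i; rewrite dcE coefB coefC coefCM zb1 /ivB mulr_algl.
  by rewrite (_ : fac 2 = 2^-1) //; case: i.
(* Here $X' = (w' + e_1/2)X$ and $XD = DX + (be - w_y')X + (zb - e_1)X/2$. In $X'Y + XDY$ the terms
   $w_y'$ and $e_1$ cancel, and $c' = kap - zb/2$ absorbs [zb]. *)
have ode : (X * Y)^`() = (D + be + kap)%:P * (X * Y).
  rewrite derivM dX dY !mulrA XD -!mulrDl; congr (_ * _).
  congr (_ * _); rewrite derivD -/dwy c'E mulrBr !polyCD.
  have ab (V : zmodType) (t g b a f e : V) : t + (g - b) + a + (f + (e - t + (b - a))) = f + e + g.
    have -> : t + (g - b) + a = g + (t - (b - a)).
      by rewrite addrCA -addrA opprB -[t - b + a]addrA [- b + a]addrC.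
    have -> : e - t + (b - a) = e - (t - (b - a)) by rewrite opprB -addrA [- t + _]addrC.
    by rewrite [RHS]addrC -addrA; congr (_ + _); rewrite addrCA [_ + (e - _)]addrC subrK.
  exact: ab.
have E1 := poly_ode ode (flD (flD FD Fb) Fk).
move: E1; rewrite /X /Y P1 !dexp_horner coef0M !dexp_coef0.
have -> : DX.[1] = D by rewrite /DX P1 hornerC hornerX mulr1.
have -> : DX`_0 = 0 by rewrite /DX coefMX.
have -> : w`_0 = y 0 + c0 by rewrite /w coefD wyE cE fac0 scale1r.
have -> : w.[1] = \sum_(k < m.+1) fac k *: y k + c0 + kap - 2^-1 *: \sum_(k < m.+1) fac k.+1 *: z k.
  by rewrite /w hornerD wy1 c1 !addrA.
have -> : texp n.+2 0 = 1 :> B.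
  by rewrite (@texp_stab 1 n.+2) ?expr1// /texp big_ord1 fac0 scale1r expr0.
by rewrite mulr1 => <-.
Qed.
End ExpIdentity.

(** * Baker-Campbell-Hausdorff with central commutator *)

Section ExpCorollaries.
Variables (K : numFieldType) (B : algType K) (F : filtration B).

Lemma nexp0 : nexp F 0 = 1.
Proof.
rewrite (texp_nexp (fl00 F 1) (expr1 0)) /texp (big_ord_recl 0) big_ord0.
by rewrite fac0 scale1r addr0.
Qed.

Lemma nexp_bch (a b z : B) : F 1 a -> F 1 b -> F 1 z -> a * b = b * a + z ->
  z * a = a * z -> z * b = b * z -> nexp F a * nexp F b = nexp F (a + b + 2^-1 *: z).
Proof.
move=> Fa Fb Fz ab za zb.
pose y k := match k with 1%N => a | 2%N => - z | _ => 0 end.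
pose cen v := exists c, v = c *: z.
have cz : cen z by exists 1; rewrite scale1r.
have c0 : cen 0 by exists 0; rewrite scale0r.
have Fy k : F 1 (y k).
  case: k => [|[|[|k]]] //=; [exact: fl00| |exact: fl00].
  by rewrite -scaleN1r; exact: flZ.
have := @exp_identity K B F b a (2^-1 *: z) 0 y (fun=> 0) 2 cen.
rewrite [y 0%N + 0]addr0 nexp0 mulr1 => H.
rewrite (addrC a b) {}H //.
- rewrite addr0 (big1 _ _ (fun k : 'I_3 => fac K k.+1 *: 0)) => [|i _]; last by rewrite scaler0.
  rewrite scaler0 subr0 !big_ord_recl big_ord0 /= scaler0 add0r addr0.
  rewrite (_ : fac K 1 = 1) ?scale1r; last by rewrite /fac invr1.
  by rewrite /fac scalerN addrNK.
- exact: flZ.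
- exact: fl00.
- by move=> k; exact: fl00.
- by case=> [|[|[]]].
- by rewrite /= mul0r mulr0 subrr addr0.
- case=> [|[|k]] /=; rewrite ?mulr0 ?mul0r ?addr0//; first by rewrite ab addrK.
  by rewrite mulrN mulNr zb.
- by case=> [|[|[|k]]] /=; rewrite ?mulr0 ?mul0r ?addr0// mulNr mulrN za.
- move=> c _ _ [u ->] [v ->]; exists (u - c * v).
  by rewrite scalerBl scalerA.
- by move=> _ _ [u ->] [v ->]; rewrite -!(scalerAl, scalerAr) scalerA mulrC -scalerA.
- by move=> _ [u ->]; rewrite -scalerAl -scalerAr zb.
- move=> _ k [u ->]; rewrite -scalerAl -scalerAr; congr (_ *: _).
  by case: k => [|[|[|k]]] /=; rewrite ?mulr0 ?mul0r// mulrN mulNr.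
- by move=> _ [u ->]; rewrite -scalerAl -scalerAr za.
- by exists 2^-1.
- have H j k : (j == 1%N) && (k == 2%N) || (j == 2%N) && (k == 1%N) || (y j * y k - y k * y j == 0).
    case: j => [|[|[|j]]]; case: k => [|[|[|k]]] //=; by rewrite ?mulr0 ?mul0r ?subrr.
  move=> j k; case/orP: (H j k) => [/orP[/andP[/eqP -> /eqP ->]|/andP[/eqP -> /eqP ->]]|/eqP -> //] /=;
    by exists 0; rewrite scale0r mulrN mulNr za subrr.
Qed.

Lemma nexpN (a : B) : F 1 a -> nexp F (- a) * nexp F a = 1.
Proof.
move=> Fa; rewrite (@nexp_bch _ _ 0) ?mulr0 ?mul0r//.
- by rewrite addNr scaler0 addr0 nexp0.
- by rewrite -scaleN1r; exact: flZ.
- exact: fl00.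
- by rewrite mulNr mulrN addr0.
Qed.

Lemma nexpC (a b : B) : F 1 a -> F 1 b -> a * b = b * a -> nexp F a * nexp F b = nexp F (a + b).
Proof.
move=> Fa Fb ab; rewrite (@nexp_bch _ _ 0) ?mulr0 ?mul0r ?addr0 ?scaler0 ?addr0//.
exact: fl00.
Qed.

Lemma nexp_conj (x y u : B) : u * x = y * u -> u * nexp F x = nexp F y * u.
Proof.
move=> uxy; rewrite mulr_sumr mulr_suml; apply: eq_bigr => k _.
rewrite -scalerAl -scalerAr; congr (_ *: _); elim: (k : nat) => [|j IH].
  by rewrite mulr1 mul1r.
by rewrite !exprS mulrA uxy -mulrA IH mulrA.
Qed.

End ExpCorollaries.

(** * The base algebra *)

Section BaseAlgebraTheory.
Variables (R : realType) (A : baseAlgebra R).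
Implicit Types (a b c : A) (p q : bool).

Lemma signA p : (-1) ^+ p = ((-1) ^+ p : R)%:A :> A.
Proof. by case: p; rewrite ?expr1 ?expr0 ?scaleN1r ?scale1r. Qed.

Lemma signAM p a : (-1) ^+ p * a = (-1) ^+ p *: a.
Proof. by rewrite signA mulr_algl. Qed.

Lemma homog_hpart p a : homog p (hpart A p a).
Proof. exact: hpart_id. Qed.

Lemma homogN p a : homog p a -> hpart A (~~ p) a = 0.
Proof. by move=> <-; exact: hpart_neg. Qed.

Lemma homogM p q a b : homog p a -> homog q b -> homog (p (+) q) (a * b).
Proof. by move=> <- <-; exact: hpart_mul. Qed.

Lemma homogD p a b : homog p a -> homog p b -> homog p (a + b).
Proof. by rewrite /homog linearD => -> ->. Qed.

Lemma homogZ p (x : R) a : homog p a -> homog p (x *: a).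
Proof. by rewrite /homog linearZ => /= ->. Qed.

Lemma homog0 p : homog p (0 : A). Proof. by rewrite /homog linear0. Qed.

Lemma homogNn p a : homog p a -> homog p (- a).
Proof. by rewrite /homog linearN => ->. Qed.

Lemma homog_sum p I (s : seq I) (P : pred I) (f : I -> A) :
  (forall i, P i -> homog p (f i)) -> homog p (\sum_(i <- s | P i) f i).
Proof. by move=> H; elim/big_rec: _ => [|i x /H]; [exact: homog0|exact: homogD]. Qed.

Lemma homog_comm p q a b : homog p a -> homog q b -> a * b = (-1) ^+ (p && q) *: (b * a).
Proof. by move=> <- <-; rewrite hpart_comm signAM. Qed.

Lemma homog_even_comm a b : homog false a -> a * b = b * a.
Proof.
move=> a0; rewrite -(hpart_sum b) mulrDr mulrDl.
rewrite (homog_comm a0 (homog_hpart false b)) (homog_comm a0 (homog_hpart true b)).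
by rewrite !scale1r.
Qed.

Lemma odd_sq a : homog true a -> a * a = 0.
Proof.
move=> a1; have := homog_comm a1 a1; rewrite expr1 scaleN1r => /eqP.
by rewrite -addr_eq0 -mulr2n -scaler_nat scaler_eq0 pnatr_eq0 => /eqP.
Qed.

Lemma body_odd a : homog true a -> body A a = 0.
Proof. by move=> a1; apply/body_eq0; exists 2%N; rewrite expr2 odd_sq. Qed.

(** Write $1 = e + o$ with $e$ even and $o$ odd. As $o^2 = 0$ and $eo = oe = o$, squaring gives $e^2
    + 2o = e + o$, whose odd part reads $2o = o$. *)
Lemma homog1 : homog false (1 : A).
Proof.
set e := hpart A false (1 : A); set o := hpart A true (1 : A).
have eo1 : e + o = 1 by exact: hpart_sum.
have oo : o * o = 0 by apply/odd_sq/homog_hpart.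
have eo : e * o = o by rewrite -[RHS]mul1r -eo1 mulrDl oo addr0.
have oe : o * e = o by rewrite -[RHS]mulr1 -eo1 mulrDr oo addr0.
have E : e * e + (o + o) = e + o.
  by rewrite [RHS]eo1 -[RHS]mulr1 -eo1 mulrDl !mulrDr eo oe oo addr0 addrA.
have ho : hpart A true o = o by exact: hpart_id.
have he : hpart A true e = 0 by exact: (hpart_neg false).
have hee : hpart A true (e * e) = 0.
  exact: (homogN (homogM (homog_hpart false 1) (homog_hpart false 1))).
have := congr1 (hpart A true) E; rewrite !linearD /= ho hee he !add0r => /eqP.
by rewrite -subr_eq0 addrK => /eqP o0; rewrite /homog -/e -[RHS]eo1 o0 addr0.
Qed.

Lemma homog_scalar (x : R) : homog false (x%:A : A).
Proof. exact/homogZ/homog1. Qed.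

Lemma twistE p q a : homog q a -> twist p a = (-1) ^+ (p && q) *: a.
Proof.
rewrite /twist signAM; case: q => aq.
  by rewrite (homogN aq) add0r aq andbT.
by rewrite (homogN aq) scaler0 addr0 aq andbF scale1r.
Qed.

Fact twist_linear p : linear (@twist R A p).
Proof.
move=> x a b; rewrite /twist !linearP /= !signAM !scalerDr !scalerA [_ * x]mulrC.
by rewrite addrACA.
Qed.
HB.instance Definition _ p := GRing.isLinear.Build R A A *:%R (@twist R A p) (twist_linear p).

Lemma twistD p a b : twist p (a + b) = twist p a + twist p b.
Proof. exact: (linearD (@twist R A p)). Qed.

Lemma twistZ p (x : R) a : twist p (x *: a) = x *: twist p a.
Proof. by have := twist_linear p x a 0; rewrite !addr0 => ->; rewrite (_ : twist p 0 = 0) ?addr0 // /twist !linear0 mulr0 addr0. Qed.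

Lemma twist0 a : twist false a = a.
Proof. by rewrite /twist mul1r hpart_sum. Qed.

Lemma homog_ind (P : A -> Prop) :
  (forall a b, P a -> P b -> P (a + b)) -> (forall q a, homog q a -> P a) -> forall a, P a.
Proof.
by move=> PD Ph a; rewrite -(hpart_sum a); apply: PD; apply: Ph; exact: homog_hpart.
Qed.

Lemma twist_twist p q a : twist p (twist q a) = twist (p (+) q) a.
Proof.
move: a; apply: homog_ind => [a b Ha Hb|u a au].
  by rewrite (twistD q a) (twistD p (twist q a)) (twistD _ a) Ha Hb.
rewrite (twistE q au) twistZ !(twistE _ au) scalerA -signr_addb.
by case: p q u {au} => [] [] [].
Qed.

Lemma twistM p a b : twist p (a * b) = twist p a * twist p b.
Proof.
move: a; apply: homog_ind => [a a' Ha Hb|u a au].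
  by rewrite mulrDl !twistD mulrDl Ha Hb.
move: b; apply: homog_ind => [b b' Ha Hb|v b bv].
  by rewrite mulrDr !twistD mulrDr Ha Hb.
rewrite (twistE p au) (twistE p bv) (twistE p (homogM au bv)).
rewrite -scalerAl -scalerAr scalerA -signr_addb.
by case: p u v {au bv} => [] [] [].
Qed.

Lemma twist1 p : twist p (1 : A) = 1.
Proof. by rewrite (twistE _ homog1) andbF scale1r. Qed.

Lemma homog_mul_twist p a b : homog p a -> b * a = a * twist p b.
Proof.
move=> ap; move: b; apply: homog_ind => [b b' Ha Hb|v b bv].
  by rewrite mulrDl !twistD mulrDr Ha Hb.
by rewrite (homog_comm bv ap) (twistE _ bv) -scalerAr andbC.
Qed.

(** * Nilpotent ideals with homogeneous generators *)

Section NilIdeals.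
Variable l : seq A.
Hypothesis l_homog : forall a, a \in l -> exists p, homog p a.

(** The [k]-th power of the ideal generated by [l], written with the generators on the left.
    Homogeneous generators make it two-sided, since they pass any element up to [twist]. *)
Fixpoint idl (k : nat) : A -> Prop :=
  match k with
  | 0 => fun=> True
  | k'.+1 => fun a => exists2 b : nat -> A, (forall i, idl k' (b i)) &
      a = \sum_(i < size l) l`_i * b i
  end.

Let lh (i : 'I_(size l)) : exists p, homog p l`_i.
Proof. by apply: l_homog; rewrite mem_nth. Qed.

Lemma idl_0 k : idl k 0.
Proof.
by elim: k => //= k IH; exists (fun=> 0) => //; rewrite big1// => i _; rewrite mulr0.
Qed.

Lemma idlD k a b : idl k a -> idl k b -> idl k (a + b).
Proof.
elim: k a b => //= k IH a b [f fk ->] [g gk ->]; exists (fun i => f i + g i).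
  by move=> i; exact: IH.
by rewrite -big_split; apply: eq_bigr => i _; rewrite mulrDr.
Qed.

Lemma idlZ k (x : R) a : idl k a -> idl k (x *: a).
Proof.
elim: k a => //= k IH a [f fk ->]; exists (fun i => x *: f i) => [i|]; first exact: IH.
by rewrite scaler_sumr; apply: eq_bigr => i _; rewrite scalerAr.
Qed.

Lemma idl_sum k I (s : seq I) (P : pred I) (f : I -> A) :
  (forall i, P i -> idl k (f i)) -> idl k (\sum_(i <- s | P i) f i).
Proof. by move=> H; elim/big_rec: _ => [|i x /H]; [exact: idl_0|exact: idlD]. Qed.

Lemma idl_twist k p a : idl k a -> idl k (twist p a).
Proof.
elim: k a => //= k IH a [f fk ->].
have [q qP] := choice (fun i : 'I_(size l) => lh i).
(* Coefficients are indexed by [nat] but parities by ordinals; 0 is the value outside the range. *)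
exists (fun i => if insub i is Some j then (-1) ^+ (p && q j) *: twist p (f i) else 0) => [i|].
  by case: insubP => [j _ _|_]; [exact/idlZ/IH|exact: idl_0].
rewrite linear_sum; apply: eq_bigr => i _ /=.
by rewrite valK twistM (twistE _ (qP i)) -scalerAl scalerAr.
Qed.

Lemma idlMr k a c : idl k a -> idl k (a * c).
Proof.
elim: k a => //= k IH a [f fk ->]; exists (fun i => f i * c) => [i|]; first exact: IH.
by rewrite mulr_suml; apply: eq_bigr => i _; rewrite mulrA.
Qed.

Lemma idlMl k a c : idl k a -> idl k (c * a).
Proof.
elim: k a c => //= k IH a c [f fk ->].
have [q qP] := choice (fun i : 'I_(size l) => lh i).
exists (fun i => if insub i is Some j then twist (q j) c * f i else 0) => [i|].
  by case: insubP => [j _ _|_]; [exact: IH|exact: idl_0].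
rewrite mulr_sumr; apply: eq_bigr => i _ /=.
by rewrite valK mulrA (homog_mul_twist _ (qP i)) -mulrA.
Qed.

Lemma idlS k a b : a \in l -> idl k b -> idl k.+1 (a * b).
Proof.
move=> al kb; exists (fun i => if i == index a l then b else 0) => [i|].
  by case: ifP => // _; exact: idl_0.
have il : (index a l < size l)%N by rewrite index_mem.
rewrite (bigD1 (Ordinal il)) //= eqxx nth_index// big1 ?addr0// => i.
by rewrite -val_eqE /= => /negbTE ->; rewrite mulr0.
Qed.

Lemma idlM j k a b : idl j a -> idl k b -> idl (j + k) (a * b).
Proof.
elim: j a => [|j IH] a; first by move=> _; exact: idlMl.
case=> f fj -> kb; rewrite mulr_suml addSn; apply: idl_sum => i _.
by rewrite -mulrA; apply: idlS; [rewrite mem_nth|exact: IH (fj i) kb].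
Qed.

Lemma idl_mono j k a : (j <= k)%N -> idl k a -> idl j a.
Proof.
elim: j k a => // j IH [//|k] a jk [f fk ->] /=; exists f => // i; exact: IH (fk i).
Qed.

(** The prefix [c] accumulates the generators already split off, so that the induction ends with
    complete words of length [k]. *)
Lemma idl_words k a c : (forall w : seq A, {subset w <= l} -> size w = k -> c * \prod_(x <- w) x = 0) ->
  idl k a -> c * a = 0.
Proof.
elim: k a c => [|k IH] a c H /=; first by have := H [::]; rewrite big_nil mulr1 => ->; rewrite ?mul0r.
move=> [f fk ->]; rewrite mulr_sumr big1// => i _; rewrite mulrA; apply: IH (fk i) => w wl wk.
have := H (l`_i :: w); rewrite big_cons /= wk mulrA; apply=> // x.
by rewrite inE => /predU1P[->|/wl//]; rewrite mem_nth.
Qed.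

Lemma prod_sort a w : a \in l -> {subset w <= l} ->
  exists e : bool, \prod_(x <- w) x =
    (-1) ^+ e *: (a ^+ count_mem a w * \prod_(x <- w | x != a) x).
Proof.
move=> al; elim: w => [|b w IH] wl.
  by exists false; rewrite !big_nil mulr1 scale1r.
have {}wl : b \in l /\ {subset w <= l}.
  by split=> [|x xw]; apply: wl; rewrite inE ?eqxx// xw orbT.
have [e we] := IH wl.2; rewrite !big_cons /= we -scalerAr.
case: eqVneq => [-> /=|ba]; first by exists e; rewrite exprS mulrA.
have [p ap] := l_homog al; have [q bq] := l_homog wl.1.
have [r ar] : exists r, homog r (a ^+ count_mem a w).
  elim: (count_mem a w) => [|n [r ar]]; first by exists false; exact: homog1.
  by exists (p (+) r); rewrite exprS; exact: homogM.
exists (e (+) (q && r)); rewrite add0n mulrA (homog_comm bq ar) -scalerAl scalerA.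
by rewrite -signr_addb mulrA.
Qed.

(** Pigeonhole: each generator $a$ has some order $n_a$ because its body vanishes, and a word longer
    than $\sum n_a$ repeats some letter at least $n_a$ times. By [prod_sort] these occurrences can
    be gathered up to sign. *)
Lemma idl_nil : (forall a, a \in l -> body A a = 0) -> exists K, forall a, idl K a -> a = 0.
Proof.
move=> l0.
have N a : exists n, a \in l -> a ^+ n = 0.
  have [al|/negP al] := boolP (a \in l); last by exists 0%N.
  by have [n an] := (body_eq0 a).1 (l0 a al); exists n.
have [n nP] := choice N.
exists (\sum_(a <- undup l) n a)%N.+1 => a aK; rewrite -[a]mul1r.
apply: idl_words aK => w wl wK; rewrite mul1r.
suff [b bl bn] : exists2 b, b \in l & (n b <= count_mem b w)%N.
  have [e ->] := prod_sort bl wl.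
  by rewrite -(subnK bn) exprD nP// mulr0 mul0r scaler0.
have [/hasP[b bl bn]|/hasPn H] := boolP (has (fun b => n b <= count_mem b w)%N (undup l)).
  by exists b => //; rewrite mem_undup in bl.
have : (size w <= (\sum_(b <- undup l) n b)%N)%N; last by rewrite wK ltnn.
have -> : size w = (\sum_(b <- undup l) count_mem b w)%N.
  rewrite -sum1_size [LHS](eq_big_seq (fun x => (\sum_(b <- undup l) (x == b))%N)) => [|x xw].
    rewrite exchange_big /=; apply: eq_bigr => b _; rewrite -sum1_count [RHS]big_mkcond.
    by apply: eq_bigr => x _ /=; case: eqP.
  have xl := wl x xw.
  rewrite (bigD1_seq x) ?mem_undup ?undup_uniq//= eqxx big1// => b /negbTE.
  by rewrite eq_sym => ->.
rewrite big_seq [in leqRHS]big_seq; apply: leq_sum => b /H.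
by rewrite -ltnNge => /ltnW.
Qed.

End NilIdeals.
End BaseAlgebraTheory.

(** * Schwartz functions *)

Section SchwartzTheory.
Variables (R : realType) (m : nat).
Local Notation V := 'rV[R]_m.
Local Notation e_ i := (delta_mx 0 i : V).
Implicit Types (f g h : V -> R).

Lemma is_derive_line f (x v : V) (l : R) :
  is_derive (0 : R) (1 : R) (fun t => f (t *: v + x)) l <-> is_derive x v f l.
Proof.
have E : 'D_v f x = 'D_(1 : R) (fun t : R => f (t *: v + x)) 0.
  have H : (fun h : R => h^-1 *: ((f \o shift x) (h *: v) - f x)) =
      (fun h : R => h^-1 *: (((fun t : R => f (t *: v + x)) \o shift 0) h%:A - f (0 *: v + x))).
    by apply/funext => h /=; rewrite addr0 scale0r add0r [h%:A]mulr1.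
  by rewrite /derive H.
have [d1 d2] := derivable1P f x v.
by split=> -[d e]; [apply: (DeriveDef (d2 d))|apply: (DeriveDef (d1 d))]; rewrite -e E.
Qed.

(** A coinduction principle: [schwartzR] quantifies over all iterated derivatives, so for a class
    stable under partial derivatives first-order information is enough. The closure properties below
    take for [P] the class of all functions of the required shape. *)
Lemma schwartzR_coind (P : (V -> R) -> Prop) :
  (forall g, P g -> [/\ forall i x, derivable g x (e_ i),
     forall k : 'I_m -> nat, exists C, forall x : V, `|(\prod_i x 0 i ^+ k i) * g x| <= C &
     forall i, P ('D_(e_ i) g)]) -> forall g, P g -> schwartzR g.
Proof.
move=> H g Pg.
have iP s : P (iter_partial s g) by elim: s => //= i s /H[_ _]; exact.
by split=> s; have [] := H _ (iP s).
Qed.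

Lemma schwartzR_derivable g i x : schwartzR g -> derivable g x (e_ i).
Proof. by case=> /(_ [::]) + _; apply. Qed.

Lemma schwartzR_is_derive g i x : schwartzR g -> is_derive x (e_ i) g ('D_(e_ i) g x).
Proof. by move=> Sg; exact/derivableP/schwartzR_derivable. Qed.

Lemma schwartzR_bound g (k : 'I_m -> nat) : schwartzR g ->
  exists C, forall x : V, `|(\prod_i x 0 i ^+ k i) * g x| <= C.
Proof. by case=> _ /(_ [::]); apply. Qed.

Lemma schwartzR_partial g i : schwartzR g -> schwartzR ('D_(e_ i) g).
Proof.
case=> Hd Hb; have E s : iter_partial s ('D_(e_ i) g) = iter_partial (rcons s i) g.
  by rewrite /iter_partial foldr_rcons.
by split=> s; rewrite E.
Qed.

Lemma schwartzR_lin (c : R) g h : schwartzR g -> schwartzR h ->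
  schwartzR (fun x => c * g x + h x).
Proof.
move=> Sg Sh; pose P f := exists g' h', [/\ schwartzR g', schwartzR h' & f = (fun x => c * g' x + h' x)].
apply: (schwartzR_coind (P := P)); last by exists g, h.
move=> _ [{}g [{}h [{}Sg {}Sh ->]]].
have D i x : is_derive x (e_ i) (fun x => c * g x + h x) (c * 'D_(e_ i) g x + 'D_(e_ i) h x).
  exact: (is_deriveD (is_deriveZ c (schwartzR_is_derive i x Sg)) (schwartzR_is_derive i x Sh)).
split=> [i x|k|i].
- by have [] := D i x.
- have [C HC] := schwartzR_bound k Sg; have [C' HC'] := schwartzR_bound k Sh.
  exists (`|c| * C + C') => x; rewrite mulrDr mulrCA; apply: (le_trans (ler_normD _ _)).
  by rewrite lerD// normrM ler_wpM2l.
- exists ('D_(e_ i) g), ('D_(e_ i) h); split; try exact: schwartzR_partial.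
  by apply/funext => x; have [_ ->] := D i x.
Qed.

Lemma schwartzR0 : schwartzR (fun _ : V => 0 : R).
Proof.
apply: (schwartzR_coind (P := fun f => f = fun=> 0)) => // _ ->; split=> [i x|k|i].
- exact: derivable_cst.
- by exists 0 => x; rewrite mulr0 normr0.
- by apply/funext => x; exact: derive_cst.
Qed.

Lemma schwartzR_scale (c : R) g : schwartzR g -> schwartzR (fun x => c * g x).
Proof.
move=> Sg; have := schwartzR_lin c Sg schwartzR0.
by rewrite (_ : (fun x => c * g x + 0) = fun x => c * g x)//; apply/funext => x; rewrite addr0.
Qed.

Lemma schwartzR_add g h : schwartzR g -> schwartzR h -> schwartzR (fun x => g x + h x).
Proof.
move=> Sg Sh; have := schwartzR_lin 1 Sg Sh.
by rewrite (_ : (fun x => 1 * g x + h x) = fun x => g x + h x)//; apply/funext => x; rewrite mul1r.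
Qed.

Lemma is_derive_coord (x : V) i j :
  is_derive x (e_ j) (fun y : V => y 0 i) ((i == j)%:R : R).
Proof.
apply/is_derive_line.
have -> : (fun t : R => (t *: e_ j + x) 0 i) = (fun t => (i == j)%:R * t + x 0 i).
  by apply/funext => t; rewrite !mxE eqxx /= eq_sym mulrC eq_sym.
have := is_deriveD (is_deriveZ ((i == j)%:R : R) (is_derive_id (0 : R) 1)) (is_derive_cst (x 0 i) (0 : R) 1).
by rewrite addr0 [_ *: 1]mulr1.
Qed.

Lemma schwartzR_mulx i g : schwartzR g -> schwartzR (fun x : V => x 0 i * g x).
Proof.
move=> Sg; pose P f := exists g' h', [/\ schwartzR g', schwartzR h' & f = (fun x : V => x 0 i * g' x + h' x)].
apply: (schwartzR_coind (P := P)); last first.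
  exists g, (fun=> 0); split=> //; first exact: schwartzR0.
  by apply/funext => x; rewrite addr0.
move=> _ [{}g [h [{}Sg Sh ->]]].
have D j x : is_derive x (e_ j) (fun x : V => x 0 i * g x + h x)
    (x 0 i * 'D_(e_ j) g x + ((i == j)%:R * g x + 'D_(e_ j) h x)).
  have := is_deriveD (is_deriveM (is_derive_coord x i j) (schwartzR_is_derive j x Sg)) (schwartzR_is_derive j x Sh).
  by rewrite -addrA [g x *: _]mulrC.
split=> [j x|k|j].
- by have [] := D j x.
- have [C HC] := schwartzR_bound (fun j => k j + (j == i))%N Sg; have [C' HC'] := schwartzR_bound k Sh.
  exists (C + C') => x; rewrite mulrDr; apply: (le_trans (ler_normD _ _)); rewrite lerD//.
  have := HC x; under eq_bigr do rewrite exprD.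
  rewrite big_split /= [X in _ * X * _](bigD1 i)//= eqxx expr1 [X in _ * (_ * X) * _]big1 ?mulr1 ?mulrA// => j.
  by move=> /negbTE ->; rewrite expr0.
- exists ('D_(e_ j) g), (fun x => (i == j)%:R * g x + 'D_(e_ j) h x); split.
  + exact: schwartzR_partial.
  + by apply: schwartzR_lin => //; exact: schwartzR_partial.
  + by apply/funext => x; have [_ ->] := D j x.
Qed.

Lemma schwartzR_prod (F : 'I_m -> R -> R) (r : seq 'I_m) g :
  (forall i g, schwartzR g -> schwartzR (fun x : V => F i (x 0 i) * g x)) ->
  schwartzR g -> schwartzR (fun x : V => (\prod_(i <- r) F i (x 0 i)) * g x).
Proof.
move=> HF Sg; elim: r => [|i r IH].
  rewrite (_ : (fun _ => _) = g)//; apply/funext => x; by rewrite big_nil mul1r.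
rewrite (_ : (fun _ => _) = fun x : V => F i (x 0 i) * ((\prod_(i <- r) F i (x 0 i)) * g x)).
  exact: HF.
by apply/funext => x; rewrite big_cons mulrA.
Qed.

Lemma schwartzR_bounded g : schwartzR g -> exists C, forall x, `|g x| <= C.
Proof.
move=> /(schwartzR_bound (fun=> 0%N))[C HC]; exists C => x.
by have := HC x; rewrite big1 ?mul1r// => i _; rewrite expr0.
Qed.

Lemma schwartzR_shift (a : V) g : schwartzR g -> schwartzR (fun x => g (x - a)).
Proof.
move=> Sg; pose P f := exists2 g', schwartzR g' & f = (fun x : V => g' (x - a)).
apply: (schwartzR_coind (P := P)); last by exists g.
move=> _ [{}g {}Sg ->].
have D i x : is_derive x (e_ i) (fun x => g (x - a)) ('D_(e_ i) g (x - a)).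
  have /is_derive_line D := schwartzR_is_derive i (x - a) Sg.
  apply/is_derive_line; rewrite (_ : (fun t : R => _) = (fun t : R => g (t *: e_ i + (x - a))))//.
  by apply/funext => t; rewrite addrA.
split=> [i x|k|i].
- by have [] := D i x.
- have [|C HC] := @schwartzR_bounded (fun x : V => (\prod_i (x 0 i + a 0 i) ^+ k i) * g x).
    apply: (schwartzR_prod (F := fun i y => (y + a 0 i) ^+ k i)) => // i h.
    elim: (k i) => [|n IH] Sh.
      by rewrite (_ : (fun _ => _) = h)//; apply/funext => x; rewrite mul1r.
    rewrite (_ : (fun _ => _) = fun x : V => x 0 i * ((x 0 i + a 0 i) ^+ n * h x) + a 0 i * ((x 0 i + a 0 i) ^+ n * h x)).
      by apply: schwartzR_add; [exact/schwartzR_mulx/IH|exact/schwartzR_scale/IH].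
    by apply/funext => x; rewrite exprS -mulrA mulrDl.
  exists C => x; have := HC (x - a).
  by under eq_bigr do rewrite !mxE subrK.
- exists ('D_(e_ i) g); first exact: schwartzR_partial.
  by apply/funext => x; have [_ ->] := D i x.
Qed.

(** The real form of multiplication by $e^{i\theta}$ with $\theta$ affine and linear part [la].
    Carrying a cosine and a sine term together makes the class stable under derivatives. *)
Lemma schwartzR_rotate (th : V -> R) (la : V -> R) g h :
  (forall t (v x : V), th (t *: v + x) = la v * t + th x) ->
  schwartzR g -> schwartzR h -> schwartzR (fun x => cos (th x) * g x + sin (th x) * h x).
Proof.
move=> thE Sg Sh; pose P f := exists g' h',
  [/\ schwartzR g', schwartzR h' & f = (fun x => cos (th x) * g' x + sin (th x) * h' x)].
apply: (schwartzR_coind (P := P)); last by exists g, h.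
move=> _ [{}g [{}h [{}Sg {}Sh ->]]].
have dth i x : is_derive x (e_ i) th (la (e_ i)).
  apply/is_derive_line.
  have -> : (fun t : R => th (t *: e_ i + x)) = (fun t => la (e_ i) * t + th x) by apply/funext => t.
  have := is_deriveD (is_deriveZ (la (e_ i)) (is_derive_id (0 : R) 1)) (is_derive_cst (th x) (0 : R) 1).
  by rewrite addr0 [_ *: 1]mulr1.
have dcos i x : is_derive x (e_ i) (cos \o th) (- sin (th x) * la (e_ i)).
  have /is_derive_line d := dth i x; apply/is_derive_line.
  have := @is_derive1_comp _ cos (fun t => th (t *: e_ i + x)) 0 _ _ _ d.
  by rewrite scale0r add0r; apply; exact: is_derive_cos.
have dsin i x : is_derive x (e_ i) (sin \o th) (cos (th x) * la (e_ i)).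
  have /is_derive_line d := dth i x; apply/is_derive_line.
  have := @is_derive1_comp _ sin (fun t => th (t *: e_ i + x)) 0 _ _ _ d.
  by rewrite scale0r add0r; apply; exact: is_derive_sin.
have D i x : is_derive x (e_ i) (fun x => cos (th x) * g x + sin (th x) * h x)
    (cos (th x) * (la (e_ i) * h x + 'D_(e_ i) g x) + sin (th x) * ((- la (e_ i)) * g x + 'D_(e_ i) h x)).
  have := is_deriveD (is_deriveM (dcos i x) (schwartzR_is_derive i x Sg))
                     (is_deriveM (dsin i x) (schwartzR_is_derive i x Sh)).
  by move=> /is_derive_eq; apply; rewrite /= /GRing.scale /=; ring.
split=> [i x|k|i].
- by have [] := D i x.
- have [C HC] := schwartzR_bound k Sg; have [C' HC'] := schwartzR_bound k Sh.
  exists (C + C') => x; rewrite mulrDr; apply: (le_trans (ler_normD _ _)); rewrite lerD//.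
    by rewrite mulrCA normrM -[leRHS]mul1r ler_pM// cos_max.
  by rewrite mulrCA normrM -[leRHS]mul1r ler_pM// sin_max.
- exists (fun x => la (e_ i) * h x + 'D_(e_ i) g x), (fun x => (- la (e_ i)) * g x + 'D_(e_ i) h x); split.
  + by apply: schwartzR_lin => //; exact: schwartzR_partial.
  + by apply: schwartzR_lin => //; exact: schwartzR_partial.
  + by apply/funext => x; have [_ ->] := D i x.
Qed.

(** The bound is a product of one-variable weights, rather than a power of the norm, so that it
    separates under iterated integration. *)
Lemma schwartzR_decay g : schwartzR g ->
  exists C, forall x : V, `|g x| <= C * \prod_i (1 + x 0 i ^+ 2)^-1.
Proof.
move=> Sg; have [|C HC] := @schwartzR_bounded (fun x : V => (\prod_i (1 + x 0 i ^+ 2)) * g x).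
  apply: (schwartzR_prod (F := fun i y => 1 + y ^+ 2)) => // i h Sh.
  rewrite (_ : (fun _ => _) = fun x : V => h x + x 0 i * (x 0 i * h x)).
    by apply: schwartzR_add => //; do 2!apply: schwartzR_mulx.
  by apply/funext => x; ring.
exists C => x; have w0 : 0 < \prod_i (1 + x 0 i ^+ 2).
  by apply: prodr_gt0 => i _; rewrite ltr_pwDl// sqr_ge0.
rewrite prodfV ler_pdivlMr// mulrC -(gtr0_norm w0) -normrM; exact: HC.
Qed.

End SchwartzTheory.

(** * Iterated integrals of tame functions *)

Section OneDimensional.
Variable R : realType.
Local Notation mu := (@lebesgue_measure R).
Implicit Types (F : R -> R).

Definition wt1 (x : R) : R := (1 + x ^+ 2)^-1.

Lemma wt1_gt0 x : 0 < wt1 x.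
Proof. by rewrite invr_gt0 ltr_pwDl// sqr_ge0. Qed.

Lemma wt1_le1 x : wt1 x <= 1.
Proof. by rewrite invf_le1 ?lerDl ?sqr_ge0// ltr_pwDl// sqr_ge0. Qed.

Definition lipschitz_ F := exists L, forall x y, `|F x - F y| <= L * `|x - y|.

Lemma lipschitz_cont F : lipschitz_ F -> continuous F.
Proof.
move=> [L HL] x; apply/cvgrPdist_le => e e0.
have L0 : 0 < `|L| + 1 by rewrite ltr_pwDr.
near=> y; apply: (le_trans (HL x y)).
apply: (@le_trans _ _ ((`|L| + 1) * `|x - y|)).
  by rewrite ler_wpM2r// (le_trans (ler_norm L))// lerDl.
rewrite -ler_pdivlMl// mulrC; near: y; apply: cvgr_dist_le; first exact: cvg_id.
by rewrite divr_gt0.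
Unshelve. all: by end_near. Qed.

Lemma wt1_continuous : continuous wt1.
Proof. exact: continuous_oneDsqrV. Qed.

Lemma wt1_integrable : mu.-integrable setT (EFin \o wt1).
Proof.
apply/integrableP; split.
  by apply/measurable_EFinP; exact: continuous_measurable_fun wt1_continuous.
under eq_integral do rewrite /= ger0_norm ?(ltW (wt1_gt0 _))//.
rewrite (ge0_symfun_integralT (f := wt1)); first last.
- by move=> x; rewrite /wt1 /= sqrrN.
- exact: wt1_continuous.
- by move=> x; exact/ltW/wt1_gt0.
by rewrite -set_itvcy integral0y_oneDsqr -EFinM ltry.
Qed.

Lemma tame1_integrable F (C : R) : continuous F -> (forall x, `|F x| <= C * wt1 x) ->
  mu.-integrable setT (EFin \o F).
Proof.
move=> cF HC.
apply: (@le_integrable _ _ _ mu _ measurableT _ (EFin \o (fun x => C * wt1 x))).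
- by apply/measurable_EFinP; exact: continuous_measurable_fun.
- move=> x _; rewrite /= lee_fin; apply: (le_trans (HC x)); exact: ler_norm.
- have := integrableZl measurableT C wt1_integrable.
  by apply: eq_integrable => // x _; rewrite /= EFinM.
Qed.

Lemma integral1_shift F (a : R) : continuous F -> (forall x, 0 <= F x) ->
  \int[mu]_x F (x - a) = \int[mu]_x F x.
Proof.
move=> cF F0; rewrite /Rintegral; congr fine; symmetry.
pose G (x : R) := x - a.
have dG (x : R) : is_derive x 1 G 1.
  have := is_deriveB (is_derive_id x (1 : R)) (is_derive_cst a x 1).
  by rewrite subr0.
have dGE : derive1 G = cst 1 by apply/funext => x; rewrite derive1E; have [_ ->] := dG x.
rewrite (increasing_ge0_integration_by_substitutionT (F := G)) //.
- by apply: eq_integral => x _; rewrite dGE /= fctE mulr1.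
- by move=> x y; rewrite /G ltrD2r.
- by rewrite dGE => x; exact: cvg_cst.
- by rewrite dGE; exact: is_cvg_cst.
- by rewrite dGE; exact: is_cvg_cst.
- apply/cvgrNyPle => M; near=> x; rewrite lerBlDr; near: x; exact: nbhs_ninfty_le (num_real _).
- apply/cvgryPge => M; near=> x; rewrite lerBrDr; near: x; exact: nbhs_pinfty_ge (num_real _).
Unshelve. all: by end_near. Qed.

Lemma integral1_eq0 F (C : R) : lipschitz_ F -> (forall x, `|F x| <= C * wt1 x) ->
  (forall x, 0 <= F x) -> \int[mu]_x F x = 0 -> forall x, F x = 0.
Proof.
move=> LF HC F0 iF x0; apply/eqP; rewrite eq_le F0 andbT leNgt; apply/negP => c0.
have cF := lipschitz_cont LF; have intF := tame1_integrable cF HC.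
have [L HL] := LF; set c := F x0 in c0.
(* With this radius the Lipschitz bound keeps $F \ge c/2$ on the whole interval around [x0], which
   contradicts the vanishing integral. *)
pose d := c / (2 * (`|L| + 1)).
have L0 : 0 < 2 * (`|L| + 1) by rewrite mulr_gt0// ltr_pwDr.
have d0 : 0 < d by rewrite divr_gt0.
have Fc x : x \in `[x0 - d, x0 + d] -> c / 2 <= F x.
  rewrite in_itv /= => xd.
  have xd' : `|x0 - x| <= d by rewrite ler_norml; apply/andP; split; lra.
  have Fxx : `|F x0 - F x| <= c / 2.
    apply: (le_trans (HL _ _)); apply: (@le_trans _ _ ((`|L| + 1) * d)).
      apply: (@le_trans _ _ ((`|L| + 1) * `|x0 - x|)).
        by rewrite ler_wpM2r// (le_trans (ler_norm L))// lerDl.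
      by rewrite ler_wpM2l// ltW// ltr_pwDr.
    rewrite /d; have L1 : `|L| + 1 != 0 by rewrite gt_eqF// ltr_pwDr.
    by rewrite le_eqVlt; apply/orP; left; apply/eqP; field; rewrite L1.
  have := le_trans (ler_norm _) Fxx; rewrite -/c; lra.
have fi : (\int[mu]_x (F x)%:E)%E = 0%E.
  by rewrite -[LHS]fineK ?integrable_fin_num//; congr (_%:E).
pose I : set R := `[x0 - d, x0 + d]%classic.
have mI : measurable I by exact: measurable_itv.
have mF : measurable_fun [set: R] (EFin \o F).
  by apply/measurable_EFinP; exact: continuous_measurable_fun.
have h1 : (\int[mu]_(x in I) (F x)%:E <= 0)%E.
  by rewrite -fi; apply: ge0_subset_integral => //= x _; rewrite lee_fin.
have h2 : (\int[mu]_(x in I) (c / 2)%:E <= \int[mu]_(x in I) (F x)%:E)%E.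
  apply: ge0_le_integral => //=.
  - by move=> x _; rewrite lee_fin divr_ge0// ltW.
  - exact: measurable_funS mF.
have := le_trans h2 h1; rewrite integral_cst//= lebesgue_measure_itv /= lte_fin.
rewrite ifT; last by rewrite ltrD2l; lra.
rewrite -EFinB -EFinM lee_fin => h3.
have : 0 < c / 2 * (x0 + d - (x0 - d)) by apply: mulr_gt0; lra.
by rewrite ltNge h3.
Qed.

End OneDimensional.

Section Tame.
Variable R : realType.
Local Notation mu := (@lebesgue_measure R).

Definition scons m (x : R) (y : 'rV[R]_m) : 'rV[R]_m.+1 := row_mx (x%:M : 'rV_1) y.

Lemma scons0 m x (y : 'rV[R]_m) : scons x y 0 ord0 = x.
Proof.
have := row_mxEl (x%:M : 'rV_1) y 0 (ord0 : 'I_1); rewrite [RHS]mxE eqxx mulr1n => H; rewrite -[RHS]H.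
by congr (fun_of_matrix _ _ _); exact/val_inj.
Qed.

Lemma sconsS m x (y : 'rV[R]_m) i : scons x y 0 (lift ord0 i) = y 0 i.
Proof.
rewrite -(row_mxEr (x%:M : 'rV_1) y 0 i).
by congr (fun_of_matrix _ _ _); exact/val_inj.
Qed.

Lemma scons_eta m (z : 'rV[R]_m.+1) : z = scons (z 0 ord0) (\row_i z 0 (lift ord0 i)).
Proof.
apply/rowP => i; case: (unliftP ord0 i) => [j ->|->]; by rewrite ?sconsS ?scons0 ?mxE.
Qed.

Definition wt m (x : 'rV[R]_m) : R := \prod_i wt1 (x 0 i).

Lemma wt_ge0 m (x : 'rV[R]_m) : 0 <= wt x.
Proof. by apply: prodr_ge0 => i _; exact/ltW/wt1_gt0. Qed.

Lemma wt_scons m x (y : 'rV[R]_m) : wt (scons x y) = wt1 x * wt y.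
Proof.
by rewrite /wt big_ord_recl scons0; congr (_ * _); apply: eq_bigr => i _; rewrite sconsS.
Qed.

Definition wt' m (i : 'I_m) (x : 'rV[R]_m) : R := \prod_(j | j != i) wt1 (x 0 j).

(** The second clause is a Lipschitz bound in one coordinate that keeps the weight in all the
    others. It survives integration over those others, so each partial integral is Lipschitz, hence
    continuous and measurable, in the remaining variable. *)
Definition tame m (f : 'rV[R]_m -> R) : Prop := exists C,
  (forall x, `|f x| <= C * wt x) /\
  (forall i x (t : R), `|f (t *: delta_mx 0 i + x) - f x| <= C * `|t| * wt' i x).

Lemma line_coord m (x : 'rV[R]_m) t i j :
  (t *: delta_mx 0 i + x) 0 j = (if j == i then t else 0) + x 0 j.
Proof. by rewrite !mxE eqxx /=; case: eqP; rewrite ?mulr1 ?mulr0. Qed.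

Lemma scons_delta0 m x t (y : 'rV[R]_m) : t *: delta_mx 0 ord0 + scons x y = scons (t + x) y.
Proof.
apply/rowP => i; case: (unliftP ord0 i) => [j ->|->]; rewrite line_coord ?sconsS ?scons0 ?eqxx//.
by rewrite add0r.
Qed.

Lemma scons_deltaS m x t i (y : 'rV[R]_m) :
  t *: delta_mx 0 (lift ord0 i) + scons x y = scons x (t *: delta_mx 0 i + y).
Proof.
apply/rowP => k; case: (unliftP ord0 k) => [j ->|->]; rewrite line_coord ?sconsS ?scons0.
  by rewrite line_coord (inj_eq lift_inj).
by rewrite add0r.
Qed.

Lemma wt'0 m x (y : 'rV[R]_m) : wt' ord0 (scons x y) = wt y.
Proof.
rewrite /wt' big_mkcond big_ord_recl eqxx /= mul1r; apply: eq_bigr => i _.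
by rewrite sconsS.
Qed.

Lemma wt'S m x i (y : 'rV[R]_m) : wt' (lift ord0 i) (scons x y) = wt1 x * wt' i y.
Proof.
rewrite /wt' big_mkcond big_ord_recl neq_lift scons0 [in RHS]big_mkcond; congr (_ * _).
by apply: eq_bigr => j _; rewrite sconsS (inj_eq lift_inj).
Qed.

Lemma tame_slice m (f : 'rV[R]_m.+1 -> R) x : tame f -> tame (fun y => f (scons x y)).
Proof.
move=> [C [H1 H2]]; exists (C * wt1 x); split=> [y|i y t].
  by have := H1 (scons x y); rewrite wt_scons mulrA.
have := H2 (lift ord0 i) (scons x y) t; rewrite scons_deltaS wt'S.
by rewrite -mulrA [_ * (wt1 x * _)]mulrCA mulrA !mulrA.
Qed.

Lemma tame_lin m c (f g : 'rV[R]_m -> R) : tame f -> tame g -> tame (fun x => c * f x + g x).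
Proof.
move=> [C [H1 H2]] [D [K1 K2]]; exists (`|c| * C + D); split=> [x|i x t].
  rewrite (le_trans (ler_normD _ _))// mulrDl lerD// normrM -mulrA.
  by rewrite ler_wpM2l.
rewrite opprD addrACA -mulrBr (le_trans (ler_normD _ _))// !mulrDl lerD// normrM -!mulrA.
by rewrite ler_wpM2l// mulrA.
Qed.

Lemma tame_diff m (f : 'rV[R]_m.+1 -> R) x x' : tame f ->
  tame (fun y => f (scons x y) - f (scons x' y)).
Proof.
move=> tf; have := tame_lin (-1) (tame_slice x' tf) (tame_slice x tf).
by congr (tame _); apply/funext => y; rewrite mulN1r addrC.
Qed.

Lemma tame_const_ge0 m (f : 'rV[R]_m -> R) C : (forall x, `|f x| <= C * wt x) -> 0 <= C.
Proof.
move=> /(_ 0) H; have w0 : 0 < wt (0 : 'rV[R]_m) by apply: prodr_gt0 => i _; exact: wt1_gt0.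
by rewrite -(pmulr_lge0 C w0) (le_trans _ H).
Qed.

Let Kw : R := \int[mu]_x wt1 x.

(* The three claims feed each other in the induction on the dimension: the
   partial integrals are again Lipschitz and dominated by the weight. *)
Lemma integral_tame m :
  [/\ forall (f : 'rV[R]_m -> R) C, tame f -> (forall x, `|f x| <= C * wt x) ->
        `|integral_Rn f| <= C * Kw ^+ m &
      forall c (f g : 'rV[R]_m -> R), tame f -> tame g ->
        integral_Rn (fun x => c * f x + g x) = c * integral_Rn f + integral_Rn g].
Proof.
elim: m => [|m [IHb IHl]].
  split=> [f C _ /(_ 0)|//]; by rewrite /wt big_ord0.
have out (f : 'rV[R]_m.+1 -> R) (F := fun x => integral_Rn (fun y => f (scons x y))) : tame f ->
    lipschitz_ F /\ forall C, (forall x, `|f x| <= C * wt x) -> forall x, `|F x| <= C * Kw ^+ m * wt1 x.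
  move=> tf; split; last first.
    move=> C HC x; rewrite mulrAC; apply: IHb; first exact: tame_slice.
    by move=> y; have := HC (scons x y); rewrite wt_scons mulrA.
  have [C [_ H2]] := tf; exists (C * Kw ^+ m) => x x'.
  have -> : F x - F x' = integral_Rn (fun y => f (scons x y) - f (scons x' y)).
    have := IHl (-1) _ _ (tame_slice x' tf) (tame_slice x tf).
    rewrite mulN1r addrC -/(F x) -/(F x') => <-; congr (integral_Rn _).
    by apply/funext => y; rewrite mulN1r addrC.
  rewrite mulrAC; apply: IHb; first exact: tame_diff.
  move=> y; have := H2 ord0 (scons x' y) (x - x').
  by rewrite scons_delta0 subrK wt'0.
have int (f : 'rV[R]_m.+1 -> R) : tame f ->
    mu.-integrable setT (EFin \o (fun x => integral_Rn (fun y => f (scons x y)))).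
  move=> tf; have [L B] := out f tf; have [C [HC _]] := tf.
  exact: tame1_integrable (lipschitz_cont L) (B C HC).
split=> [f C tf HC|c f g tf tg].
- have [_ /(_ C HC) B] := out f tf.
  rewrite /= (le_trans (le_normr_Rintegral measurableT (int f tf)))//.
  have -> : C * Kw ^+ m.+1 = \int[mu]_x (C * Kw ^+ m * wt1 x).
    by rewrite (RintegralZl _ measurableT (wt1_integrable R)) exprSr mulrA.
  apply: le_Rintegral => //.
  + have [L _] := out f tf; have [C' [HC' _]] := tf.
    apply: (@tame1_integrable _ _ (C * Kw ^+ m)) => [x|x].
      by apply: continuous_comp; [exact: lipschitz_cont L x|exact: norm_continuous].
    by rewrite normr_id.
  + apply: (@tame1_integrable _ _ `|C * Kw ^+ m|) => [x|x].
      by apply: cvgM; [exact: cvg_cst|exact: wt1_continuous].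
    by rewrite normrM [`|wt1 x|]ger0_norm// ltW// wt1_gt0.
- rewrite /= -(RintegralZl c measurableT (int f tf)) -RintegralD//; last exact: int.
    by congr (Rintegral _ _ _); apply/funext => x; exact: IHl (tame_slice x tf) (tame_slice x tg).
  have := integrableZl measurableT c (int f tf).
  by apply: eq_integrable => // x _; rewrite /= EFinM.
Qed.

Lemma integral_Rn_lin m c (f g : 'rV[R]_m -> R) : tame f -> tame g ->
  integral_Rn (fun x => c * f x + g x) = c * integral_Rn f + integral_Rn g.
Proof. by have [_] := integral_tame m; apply. Qed.

Lemma integral_Rn_ge0 m (f : 'rV[R]_m -> R) : (forall x, 0 <= f x) -> 0 <= integral_Rn f.
Proof.
elim: m f => [|m IH] f f0 /=; first exact: f0.
by apply: Rintegral_ge0 => x _; apply: IH.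
Qed.

Lemma integral_Rn_outer m (f : 'rV[R]_m.+1 -> R) : tame f ->
  lipschitz_ (fun x => integral_Rn (fun y => f (scons x y))) /\
  exists C, forall x, `|integral_Rn (fun y => f (scons x y))| <= C * wt1 x.
Proof.
move=> tf; have [B L] := integral_tame m; have [C [H1 H2]] := tf.
split; last first.
  exists (C * Kw ^+ m) => x; rewrite mulrAC; apply: B; first exact: tame_slice.
  by move=> y; have := H1 (scons x y); rewrite wt_scons mulrA.
exists (C * Kw ^+ m) => x x'.
have -> : integral_Rn (fun y => f (scons x y)) - integral_Rn (fun y => f (scons x' y))
    = integral_Rn (fun y => f (scons x y) - f (scons x' y)).
  have := L (-1) _ _ (tame_slice x' tf) (tame_slice x tf).
  rewrite mulN1r addrC => <-; congr (integral_Rn _).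
  by apply/funext => y; rewrite mulN1r addrC.
rewrite mulrAC; apply: B; first exact: tame_diff.
move=> y; have := H2 ord0 (scons x' y) (x - x').
by rewrite scons_delta0 subrK wt'0.
Qed.

Lemma integral_Rn_bound m (f : 'rV[R]_m -> R) C : tame f -> (forall x, `|f x| <= C * wt x) ->
  `|integral_Rn f| <= C * Kw ^+ m.
Proof. by have [+ _] := integral_tame m; apply. Qed.

Lemma integral_Rn_eq0 m (f : 'rV[R]_m -> R) : tame f -> (forall x, 0 <= f x) ->
  integral_Rn f = 0 -> forall x, f x = 0.
Proof.
elim: m f => [|m IH] f tf f0 /=; first by move=> f00 x; rewrite (thinmx0 x).
move=> If z; have [L [C HC]] := integral_Rn_outer tf.
have H x : integral_Rn (fun y => f (scons x y)) = 0.
  by apply: (integral1_eq0 L HC) => // x'; apply: integral_Rn_ge0.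
by rewrite (scons_eta z); apply: (IH (fun y => f (scons (z 0 ord0) y))) => //; exact: tame_slice.
Qed.

Lemma integral_Rn_shift m (f : 'rV[R]_m -> R) a : tame f -> (forall x, 0 <= f x) ->
  integral_Rn (fun x => f (x - a)) = integral_Rn f.
Proof.
elim: m f a => [|m IH] f a tf f0 /=; first by congr (f _); apply/rowP; case.
have [L _] := integral_Rn_outer tf.
rewrite -[RHS](integral1_shift (a 0 ord0) (lipschitz_cont L)); last first.
  by move=> x; apply: integral_Rn_ge0.
congr (Rintegral _ _ _); apply/funext => x.
rewrite -(IH (fun y => f (scons (x - a 0 ord0) y)) (\row_i a 0 (lift ord0 i))) //; last first.
  exact: tame_slice.
congr (integral_Rn _); apply/funext => y; congr (f _).
rewrite -/(scons x y); apply/rowP => i; rewrite [LHS]mxE.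
case: (unliftP ord0 i) => [j ->|->]; first by rewrite !sconsS !mxE.
by rewrite !scons0 mxE.
Qed.

End Tame.

(** * Real Weyl operators on Schwartz functions *)

Section MeanValue.
Variable R : realType.
Implicit Types g : R -> R.

Lemma mvt0 g (dg : R -> R) (t : R) : (forall s, is_derive s (1 : R) g (dg s)) ->
  exists2 c, `|c| <= `|t| & g t - g 0 = dg c * t.
Proof.
move=> H; have cg a b : {within `[a, b], continuous g}.
  apply: continuous_subspaceT => x; apply/differentiable_continuous/derivable1_diffP.
  by have [] := H x.
case: (ltrgtP t 0) => [t0|t0|->]; last by exists 0; rewrite ?normr0// subrr mulr0.
- have [c] := MVT t0 (fun x _ => H x) (cg t 0); rewrite in_itv /= => /andP[c1 c2] E.
  exists c; first by rewrite !ltr0_norm// lerN2 ltW.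
  by rewrite -opprB E sub0r mulrN opprK.
- have [c] := MVT t0 (fun x _ => H x) (cg 0 t); rewrite in_itv /= => /andP[c1 c2] E.
  by exists c; [rewrite !gtr0_norm// ltW|rewrite E subr0].
Qed.

Lemma taylor2 g (dg ddg : R -> R) (t M : R) : (forall s, is_derive s (1 : R) g (dg s)) ->
  (forall s, is_derive s (1 : R) dg (ddg s)) -> (forall s, `|s| <= `|t| -> `|ddg s| <= M) ->
  `|t|^-1 * `|g t - g 0 - t * dg 0| <= M * `|t|.
Proof.
move=> H1 H2 HM; have [c ct ->] := mvt0 t H1; have [c' cc' E] := mvt0 c H2.
have M0 : 0 <= M by rewrite (le_trans (normr_ge0 (ddg 0)))// HM// normr0.
rewrite [t * _]mulrC -mulrBl E !normrM.
have [->|t0] := eqVneq t 0; first by rewrite normr0 !mulr0.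
rewrite mulrC mulfK ?normr_eq0// ler_pM// HM// (le_trans cc')//.
Qed.

End MeanValue.

(** * Complex Schwartz functions and the real L2 pairing *)

Section ComplexSchwartz.
Variables (R : realType) (m : nat) (hbar : R).
Local Notation V := 'rV[R]_m.
Local Notation C := R[i].
Local Notation e_ i := (delta_mx 0 i : V).
Local Notation Re := complex.Re.
Local Notation Im := complex.Im.
Implicit Types (f g h : V -> C).

Lemma complex_ext (z w : C) : Re z = Re w -> Im z = Im w -> z = w.
Proof. by case: z w => [a b] [c d] /= -> ->. Qed.

Lemma ReD (z w : C) : Re (z + w) = Re z + Re w. Proof. by case: z w => [a b] [c d]. Qed.
Lemma ImD (z w : C) : Im (z + w) = Im z + Im w. Proof. by case: z w => [a b] [c d]. Qed.
Lemma ReN (z : C) : Re (- z) = - Re z. Proof. by case: z. Qed.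
Lemma ImN (z : C) : Im (- z) = - Im z. Proof. by case: z. Qed.
Lemma ReM (z w : C) : Re (z * w) = Re z * Re w - Im z * Im w.
Proof. by case: z w => [a b] [c d]. Qed.
Lemma ImM (z w : C) : Im (z * w) = Re z * Im w + Im z * Re w.
Proof. by case: z w => [a b] [c d] /=; rewrite [b * c]mulrC. Qed.
Definition reimE := (ReD, ImD, ReN, ImN, ReM, ImM).

Lemma schwartz_lin (c : C) f h : schwartz f -> schwartz h -> schwartz (fun x => c * f x + h x).
Proof.
move=> [f1 f2] [h1 h2]; split.
- rewrite (_ : (fun _ => _) = fun x => Re c * Re (f x) + (- Im c * Im (f x) + Re (h x))).
    by apply: schwartzR_lin => //; exact: schwartzR_lin.
  by apply/funext => x; rewrite !reimE; ring.
- rewrite (_ : (fun _ => _) = fun x => Re c * Im (f x) + (Im c * Re (f x) + Im (h x))).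
    by apply: schwartzR_lin => //; exact: schwartzR_lin.
  by apply/funext => x; rewrite !reimE; ring.
Qed.

Lemma schwartz0 : schwartz (fun _ : V => 0 : C).
Proof. by split; exact: schwartzR0. Qed.

Lemma schwartzD f h : schwartz f -> schwartz h -> schwartz (fun x => f x + h x).
Proof.
move=> Sf Sh; have := schwartz_lin 1 Sf Sh.
by congr schwartz; apply/funext => x; rewrite mul1r.
Qed.

Lemma schwartzZ (c : C) f : schwartz f -> schwartz (fun x => c * f x).
Proof.
move=> Sf; have := schwartz_lin c Sf schwartz0.
by congr schwartz; apply/funext => x; rewrite addr0.
Qed.

Definition cr (x : R) : C := Complex x 0.

Lemma schwartz_mulx i f : schwartz f -> schwartz (fun x : V => cr (x 0 i) * f x).
Proof.
move=> [f1 f2]; split.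
- have := schwartzR_mulx i f1; congr schwartzR; apply/funext => x.
  by rewrite ReM /= mul0r subr0.
- have := schwartzR_mulx i f2; congr schwartzR; apply/funext => x.
  by rewrite ImM /= mul0r addr0.
Qed.

Lemma schwartz_partial i f : schwartz f -> schwartz (partialC i f).
Proof. by move=> [f1 f2]; split; exact: schwartzR_partial. Qed.

Definition dot (a b : V) : R := \sum_i a 0 i * b 0 i.
Definition ei (t : R) : C := Complex (cos t) (sin t).

Lemma eiD s t : ei (s + t) = ei s * ei t.
Proof.
by apply: complex_ext; rewrite /= ?cosD ?sinD; ring.
Qed.

Lemma ei0 : ei 0 = 1. Proof. by apply: complex_ext; rewrite /= ?cos0 ?sin0. Qed.

Lemma dotDl a b c : dot (a + b) c = dot a c + dot b c.
Proof. by rewrite /dot -big_split; apply: eq_bigr => i _; rewrite mxE mulrDl. Qed.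
Lemma dotZl x a c : dot (x *: a) c = x * dot a c.
Proof. by rewrite /dot mulr_sumr; apply: eq_bigr => i _; rewrite mxE mulrA. Qed.
Lemma dotNl a c : dot (- a) c = - dot a c.
Proof. by rewrite -scaleN1r dotZl mulN1r. Qed.
Lemma dotC a b : dot a b = dot b a.
Proof. by apply: eq_bigr => i _; rewrite mulrC. Qed.
Lemma dotDr a b c : dot a (b + c) = dot a b + dot a c.
Proof. by rewrite dotC dotDl ![dot _ a]dotC. Qed.
Lemma dotZr x a c : dot a (x *: c) = x * dot a c.
Proof. by rewrite dotC dotZl dotC. Qed.
Lemma dot_delta a i : dot a (e_ i) = a 0 i.
Proof.
rewrite /dot (bigD1 i)//= mxE !eqxx mulr1 big1 ?addr0// => j ji.
by rewrite mxE (negbTE ji) andbF mulr0.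
Qed.

(* U_0(q, p, 0) in the notation of the paper. *)
Definition u0 (q p : V) f : V -> C :=
  fun y => ei (hbar * (2^-1 * dot q p - dot y p)) * f (y - q).

Lemma schwartz_u0 q p f : schwartz f -> schwartz (u0 q p f).
Proof.
move=> [f1 f2]; pose th y := hbar * (2^-1 * dot q p - dot y p).
have thE t (v x : V) : th (t *: v + x) = (- hbar * dot v p) * t + th x.
  by rewrite /th dotDl dotZl; ring.
split.
- rewrite (_ : (fun _ => _) = fun y => cos (th y) * Re (f (y - q)) + sin (th y) * - Im (f (y - q))).
    apply: (schwartzR_rotate thE); first exact: (schwartzR_shift q f1).
    rewrite (_ : (fun _ => _) = fun y => -1 * Im (f (y - q))).
      exact/schwartzR_scale/(schwartzR_shift q f2).
    by apply/funext => y; rewrite mulN1r.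
  by apply/funext => y; rewrite ReM mulrN.
- rewrite (_ : (fun _ => _) = fun y => cos (th y) * Im (f (y - q)) + sin (th y) * Re (f (y - q))).
    by apply: (schwartzR_rotate thE); [exact: (schwartzR_shift q f2)|exact: (schwartzR_shift q f1)].
  by apply/funext => y; rewrite ImM.
Qed.

Lemma u0_u0 q p q' p' f y : u0 q p (u0 q' p' f) y =
  ei (hbar / 2 * (dot q p' - dot q' p)) * u0 (q + q') (p + p') f y.
Proof.
rewrite /u0 !mulrA -!eiD; congr (ei _ * f _); last by rewrite opprD addrA.
by rewrite !(dotDl, dotDr, dotNl) ; field.
Qed.

Lemma u0_0 f : u0 0 0 f = f.
Proof.
apply/funext => y; have d0 a : dot a 0 = 0 by rewrite -(scale0r 0) dotZr mul0r.
by rewrite /u0 !d0 mulr0 subr0 mulr0 ei0 mul1r subr0.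
Qed.

Lemma u0_lin q p (c : C) f h : u0 q p (fun x => c * f x + h x) = fun x => c * u0 q p f x + u0 q p h x.
Proof. by apply/funext => y; rewrite /u0; ring. Qed.

(** By the mean value theorem an increment along $e_i$ is $t$ times a partial derivative at an
    intermediate point. The weight of coordinate [i] at that point is only known to be at most 1,
    which leaves [wt' i]. *)
Lemma schwartz_tame (g : V -> R) : schwartzR g -> tame g.
Proof.
move=> Sg; have [D HD] := schwartzR_decay Sg.
have [Di HDi] := choice (fun i => schwartzR_decay (schwartzR_partial i Sg)).
have Di0 i : 0 <= Di i by apply: (tame_const_ge0 (f := 'D_(e_ i) g)) => x; exact: HDi.
have D0 : 0 <= D by apply: (tame_const_ge0 (f := g)) => x; exact: HD.
exists (D + \sum_i Di i); split=> [x|i x t].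
  apply: (le_trans (HD x)); apply: ler_wpM2r; first exact: wt_ge0.
  by rewrite lerDl sumr_ge0.
have dg (s : R) : is_derive s (1 : R) (fun s => g (s *: e_ i + x)) ('D_(e_ i) g (s *: e_ i + x)).
  have /is_derive_line d := schwartzR_is_derive i (s *: e_ i + x) Sg.
  have dsh : is_derive s (1 : R) (fun u : R => u - s) 1.
    by have := is_deriveB (is_derive_id s (1 : R)) (is_derive_cst s s 1); rewrite subr0.
  have d' : is_derive (s - s) (1 : R) (fun t : R => g (t *: e_ i + (s *: e_ i + x)))
      ('D_(e_ i) g (s *: e_ i + x)) by rewrite subrr.
  have E : (fun s => g (s *: e_ i + x)) =
      (fun t : R => g (t *: e_ i + (s *: e_ i + x))) \o (fun u => u - s).
    by apply/funext => u /=; rewrite addrA -scalerDl subrK.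
  by rewrite E; apply: is_derive_eq; exact: mulr1.
have [c _] := mvt0 t dg; rewrite scale0r add0r => ->; rewrite normrM mulrAC.
apply: ler_wpM2r => //; apply: (le_trans (HDi i _)).
have w'0 : 0 <= wt' i x by apply: prodr_ge0 => j _; exact/ltW/wt1_gt0.
apply: (@le_trans _ _ (Di i * wt' i x)).
  apply: ler_wpM2l => //; rewrite (bigD1 i)//= /wt'.
  rewrite (eq_bigr (fun j => wt1 (x 0 j))) => [|j ji]; last first.
    by rewrite line_coord (negbTE ji) add0r.
  by rewrite ler_piMl// wt1_le1.
apply: ler_wpM2r => //; rewrite (bigD1 i)//= addrCA lerDl addr_ge0// sumr_ge0//.
Qed.

Lemma tame_mul (g k : V -> R) : tame g -> tame k -> tame (fun x => g x * k x).
Proof.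
move=> [D [H1 H2]] [E [K1 K2]].
have D0 := tame_const_ge0 H1; have E0 := tame_const_ge0 K1.
have w1 (x : V) : wt x <= 1.
  by apply: prodr_ile1 => i _; rewrite ltW ?wt1_gt0//= wt1_le1.
have b (F : V -> R) (A : R) : (forall x, `|F x| <= A * wt x) -> 0 <= A -> forall x, `|F x| <= A.
  by move=> H A0 x; rewrite (le_trans (H x))// ler_piMr.
exists (D * E + D * E); split=> [x|i x t].
  rewrite normrM mulrDl; apply: (@le_trans _ _ (D * E * wt x)).
    by rewrite -mulrA; apply: ler_pM => //; exact: b.
  by rewrite lerDl !mulr_ge0// wt_ge0.
set y := t *: _ + x; have -> : g y * k y - g x * k x = g y * (k y - k x) + (g y - g x) * k x.
  by ring.
apply: (le_trans (ler_normD _ _)); rewrite !normrM !mulrDl lerD//.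
  by rewrite -!mulrA; apply: ler_pM => //; [exact: b|rewrite mulrA; exact: K2].
rewrite [D * E]mulrC -!mulrA mulrC; apply: ler_pM => //; first exact: b.
by rewrite mulrA; exact: H2.
Qed.

(** The real part of the L2 inner product ([L2inner_re]), a symmetric real bilinear form. It still
    separates Schwartz functions, and derivatives along one-parameter groups become derivatives of
    real functions. *)
Definition Bf f h : R := integral_Rn (fun x => Re (f x) * Re (h x) + Im (f x) * Im (h x)).
Definition Nf f : R := Bf f f.

Lemma Bf_tame f h : schwartz f -> schwartz h -> tame (fun x => Re (f x) * Re (h x) + Im (f x) * Im (h x)).
Proof.
move=> [f1 f2] [h1 h2].
have := tame_lin 1 (tame_mul (schwartz_tame f1) (schwartz_tame h1)) (tame_mul (schwartz_tame f2) (schwartz_tame h2)).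
by congr tame; apply/funext => x; rewrite mul1r.
Qed.

Lemma BfC f h : Bf f h = Bf h f.
Proof. by congr integral_Rn; apply/funext => x; ring. Qed.

Lemma Bf_lin (c : R) f g h : schwartz f -> schwartz g -> schwartz h ->
  Bf (fun x => cr c * f x + g x) h = c * Bf f h + Bf g h.
Proof.
move=> Sf Sg Sh; rewrite /Bf -integral_Rn_lin; try exact: Bf_tame.
by congr integral_Rn; apply/funext => x; rewrite !reimE /=; ring.
Qed.

Lemma BfD f g h : schwartz f -> schwartz g -> schwartz h ->
  Bf (fun x => f x + g x) h = Bf f h + Bf g h.
Proof.
move=> Sf Sg Sh; have := Bf_lin 1 Sf Sg Sh; rewrite mul1r => <-.
by congr Bf; apply/funext => x; rewrite mul1r.
Qed.

Lemma BfZ (c : R) f h : schwartz f -> schwartz h -> Bf (fun x => cr c * f x) h = c * Bf f h.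
Proof.
move=> Sf Sh; have := Bf_lin c Sf schwartz0 Sh.
have -> : Bf (fun=> 0) h = 0.
  rewrite /Bf (_ : (fun _ => _) = fun x : V => 0 * (Re (h x) * Re (h x) + Im (h x) * Im (h x)) +
    (-1 * 0 + 0)); last by apply/funext => x /=; ring.
  have t0 : tame (fun _ : V => 0 : R) by exact: (schwartz_tame (@schwartzR0 _ _)).
  have -> : (fun x => 0 * (Re (h x) * Re (h x) + Im (h x) * Im (h x)) + (-1 * 0 + 0)) =
     (fun x : V => -1 * 0 + 0 : R) by apply/funext => x; ring.
  by rewrite (integral_Rn_lin (-1) t0 t0) mulN1r addNr.
by rewrite addr0 => <-; congr Bf; apply/funext => x; rewrite addr0.
Qed.

Lemma Nf_ge0 f : 0 <= Nf f.
Proof. by apply: integral_Rn_ge0 => x; rewrite -!expr2 addr_ge0// sqr_ge0. Qed.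

Lemma Nf_eq0 f : schwartz f -> Nf f = 0 -> forall x, f x = 0.
Proof.
move=> Sf Nf0 x.
have H y : 0 <= Re (f y) * Re (f y) + Im (f y) * Im (f y) by rewrite -!expr2 addr_ge0// sqr_ge0.
have := integral_Rn_eq0 (Bf_tame Sf Sf) H Nf0 x => /eqP.
rewrite -!expr2 paddr_eq0 ?sqr_ge0// !sqrf_eq0 => /andP[/eqP a /eqP b].
exact: complex_ext.
Qed.

Lemma NfD f h : schwartz f -> schwartz h ->
  Nf (fun x => f x + h x) = Nf f + 2 * Bf f h + Nf h.
Proof.
move=> Sf Sh; have Sfh := schwartzD Sf Sh.
by rewrite /Nf BfD// ![Bf _ (fun x => f x + h x)]BfC !BfD// (BfC h f); ring.
Qed.

Lemma NfZ (c : R) f : schwartz f -> Nf (fun x => cr c * f x) = c ^+ 2 * Nf f.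
Proof.
by move=> Sf; rewrite /Nf BfZ//; [rewrite BfC BfZ// mulrA|exact: schwartzZ].
Qed.

Lemma NfD_le f h : schwartz f -> schwartz h ->
  Nf (fun x => f x + h x) <= 2 * (Nf f + Nf h).
Proof.
move=> Sf Sh; have := Nf_ge0 (fun x => f x + cr (-1) * h x).
rewrite NfD//; last exact: schwartzZ.
by rewrite NfD// BfC BfZ// NfZ// (BfC h); lra.
Qed.

Lemma Bf_CS f h : schwartz f -> schwartz h -> `|Bf f h| <= Num.sqrt (Nf f) * Num.sqrt (Nf h).
Proof.
move=> Sf Sh; set b := Bf f h; set N := Nf f; set M := Nf h.
have P (t : R) : 0 <= N + 2 * t * b + t ^+ 2 * M.
  have := Nf_ge0 (fun x => f x + cr t * h x).
  by rewrite NfD ?NfZ//; [rewrite BfC BfZ// (BfC h) mulrA|exact: schwartzZ].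
rewrite -sqrtrM ?Nf_ge0// -sqrtr_sqr ler_sqrt ?mulr_ge0 ?Nf_ge0//.
have M0 : 0 <= M by exact: Nf_ge0.
have [M00|Mn0] := eqVneq M 0.
  have [->|b0] := eqVneq b 0; first by rewrite expr0n /= mulr_ge0// Nf_ge0.
  (* For [M = 0] the polynomial is affine in $t$; this value of $t$ makes it equal to $-1$. *)
  have := P (- (N + 1) / (2 * b)); rewrite M00 mulr0 addr0.
  have -> : N + 2 * (- (N + 1) / (2 * b)) * b = -1 by field; rewrite b0.
  by move=> abs; exfalso; lra.
have Mp : 0 < M by rewrite lt_neqAle eq_sym Mn0.
have := P (- b / M); have -> : N + 2 * (- b / M) * b + (- b / M) ^+ 2 * M = N - b ^+ 2 / M.
  by field.
by rewrite subr_ge0 ler_pdivrMr.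
Qed.

Lemma Bf_bilin (t : R) (u v f h : V -> C) : schwartz u -> schwartz v -> schwartz f -> schwartz h ->
  Bf (fun x => cr t * u x + f x) (fun x => cr t * v x + h x) =
  t ^+ 2 * Bf u v + t * Bf u h + t * Bf f v + Bf f h.
Proof.
move=> Su Sv Sf Sh; rewrite Bf_lin//; last exact: schwartz_lin.
rewrite (BfC u) (BfC f) !Bf_lin// (BfC v u) (BfC h u) (BfC v f) (BfC h f); ring.
Qed.

(** Differentiability at 0 in the L2 norm, [Nf] being the squared norm. This is the only kind of
    derivative that [mp_differential] supplies, so the Weyl operators are differentiated in the same
    sense. *)
Definition sdiff (F : R -> V -> C) f f' : Prop :=
  Nf (fun x => cr t^-1 * (F t x - f x) - f' x) @[t --> 0^'] --> (0 : R).

(** The product rule: with $F_t = f + t(f' + r_t)$ and $H_t = h + t(h' + s_t)$ the difference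
    quotient of the pairing differs from its limit by terms that Cauchy-Schwarz bounds through
    $\|r_t\|$, $\|s_t\|$ and $|t|$. *)
Lemma sdiff_Bf (F H : R -> V -> C) f f' h h' :
  (forall t, schwartz (F t)) -> (forall t, schwartz (H t)) ->
  schwartz f' -> schwartz h' -> F 0 = f -> H 0 = h ->
  sdiff F f f' -> sdiff H h h' ->
  is_derive (0 : R) (1 : R) (fun t => Bf (F t) (H t)) (Bf f' h + Bf f h').
Proof.
move=> SF SH Sf' Sh' F0 H0 dF dH.
have Sf : schwartz f by rewrite -F0. have Sh : schwartz h by rewrite -H0.
pose r t x := cr t^-1 * (F t x - f x) - f' x.
pose s t x := cr t^-1 * (H t x - h x) - h' x.
have subE g (k : V -> C) : (fun x => g x - k x) = (fun x => cr (-1) * k x + g x).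
  by apply/funext => x; rewrite addrC; congr (_ + _); apply: complex_ext; rewrite !reimE /=; ring.
have SB g k : schwartz g -> schwartz k -> schwartz (fun x => g x - k x).
  by move=> Sg Sk; rewrite subE; exact: schwartz_lin.
have Sr t : schwartz (r t) by apply: (SB) => //; apply: schwartzZ; exact: SB.
have Ss t : schwartz (s t) by apply: (SB) => //; apply: schwartzZ; exact: SB.
have FE t : t != 0 -> F t = (fun x => cr t * (r t x + f' x) + f x).
  move=> t0; apply/funext => x; rewrite /r subrK mulrA.
  have -> : cr t * cr t^-1 = 1 by apply: complex_ext; rewrite !reimE /= ?divff//; ring.
  by rewrite mul1r subrK.
have HE t : t != 0 -> H t = (fun x => cr t * (s t x + h' x) + h x).
  move=> t0; apply/funext => x; rewrite /s subrK mulrA.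
  have -> : cr t * cr t^-1 = 1 by apply: complex_ext; rewrite !reimE /= ?divff//; ring.
  by rewrite mul1r subrK.
pose a := Num.sqrt (Nf f) + Num.sqrt (Nf f'); pose b := Num.sqrt (Nf h) + Num.sqrt (Nf h').
pose u t := Num.sqrt (Nf (r t)); pose v t := Num.sqrt (Nf (s t)).
have cu : u t @[t --> 0^'] --> (0 : R).
  by have := cvg_comp _ _ dF (@sqrt_continuous R 0); rewrite sqrtr0.
have cv : v t @[t --> 0^'] --> (0 : R).
  by have := cvg_comp _ _ dH (@sqrt_continuous R 0); rewrite sqrtr0.
pose l := Bf f' h + Bf f h'.
have key t : t != 0 -> `|t^-1 * (Bf (F t) (H t) - Bf f h) - l| <=
    u t * b + a * v t + `|t| * ((u t + a) * (v t + b)).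
  move=> t0.
  have Sra : schwartz (fun x => r t x + f' x) by exact: schwartzD.
  have Ssa : schwartz (fun x => s t x + h' x) by exact: schwartzD.
  have -> : t^-1 * (Bf (F t) (H t) - Bf f h) - l =
      Bf (r t) h + Bf f (s t) + t * Bf (fun x => r t x + f' x) (fun x => s t x + h' x).
    rewrite FE// HE// Bf_bilin// (BfD _ _ Sh)//.
    have -> : Bf f (fun x => s t x + h' x) = Bf f (s t) + Bf f h'.
      by rewrite BfC BfD// (BfC f) (BfC f).
    by rewrite /l; field.
  have CS g k := @Bf_CS g k.
  have ge x : 0 <= Num.sqrt x :> R by exact: sqrtr_ge0.
  have tri g k : schwartz g -> schwartz k ->
      Num.sqrt (Nf (fun x => g x + k x)) <= Num.sqrt (Nf g) + Num.sqrt (Nf k).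
    move=> Sg Sk; rewrite -(ler_pXn2r (n := 2)) ?nnegrE ?addr_ge0// sqr_sqrtr ?Nf_ge0//.
    rewrite NfD// sqrrD !sqr_sqrtr ?Nf_ge0// lerD2r lerD2l -[leRHS]mulr_natl ler_wpM2l//.
    by rewrite (le_trans (ler_norm _))// CS.
  apply: (le_trans (ler_normD _ _)); apply: lerD.
    apply: (le_trans (ler_normD _ _)); apply: lerD.
      by rewrite (le_trans (CS _ _ _ _))// /u /b ler_wpM2l// lerDl.
    by rewrite (le_trans (CS _ _ _ _))// /v /a ler_wpM2r// lerDl.
  rewrite normrM; apply: ler_wpM2l => //; apply: (le_trans (CS _ _ _ _)) => //.
  apply: ler_pM => //; apply: (le_trans (tri _ _ _ _)) => //; rewrite lerD2l.
    by rewrite /a lerDr.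
  by rewrite /b lerDr.
pose be t := u t * b + a * v t + `|t| * ((u t + a) * (v t + b)).
have cb : be t @[t --> 0^'] --> (0 : R).
  suff : be t @[t --> 0^'] --> 0 * b + a * 0 + `|0 : R| * ((0 + a) * (0 + b)).
    by rewrite normr0 !mul0r mulr0 !addr0.
  have ct : `|t| @[t --> (0 : R)^'] --> `|0 : R|.
    by apply: cvg_within_filter; exact: (@norm_continuous _ R).
  apply: cvgD; first by apply: cvgD; apply: cvgM => //; exact: cvg_cst.
  by apply: cvgM => //; apply: cvgM; apply: cvgD => //; exact: cvg_cst.
have lim : (fun t : R => t^-1 *: ((fun t => Bf (F t) (H t)) (t *: 1 + 0) - Bf (F 0) (H 0))) @ 0^' --> l.
  apply/cvgrPdist_le => e e0.
  have /cvgrPdist_le /(_ e e0) cbe := cb; near=> t.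
  rewrite distrC addr0 [t *: 1]mulr1 F0 H0; apply: (@le_trans _ _ (be t)).
    by apply: key; near: t; exact: nbhs_dnbhs_neq.
  apply: (@le_trans _ _ `|0 - be t|); first by rewrite sub0r normrN ler_norm.
  by near: t; exact: cbe.
by apply: DeriveDef; [apply/cvg_ex; exists l|exact: cvg_lim].
Unshelve. all: by end_near. Qed.
End ComplexSchwartz.

(** * Polynomial multiples of a Gaussian *)

Section Gaussian.
Variables (R : realType) (m : nat).
Local Notation V := 'rV[R]_m.
Local Notation e_ i := (delta_mx 0 i : V).

(** Spans the polynomials times $e^{-|x|^2}$, a class stable under derivatives. It serves to exhibit
    one Schwartz function with value 1 at the origin. *)
Inductive gaussian_span : (V -> R) -> Prop :=
| gs_base : gaussian_span (fun x => expR (- \sum_i x 0 i ^+ 2))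
| gs_mul i g : gaussian_span g -> gaussian_span (fun x => x 0 i * g x)
| gs_lin c g h : gaussian_span g -> gaussian_span h -> gaussian_span (fun x => c * g x + h x).

(** For $|x| > 1$ one has $|x|^n \le x^{2n}$, and $e^{x^2} = (e^{x^2/n})^n \ge (x^2/n)^n$. *)
Lemma expr_gauss (n : nat) (x : R) : `|x| ^+ n * expR (- x ^+ 2) <= 1 + n%:R ^+ n.
Proof.
have e1 : expR (- x ^+ 2) <= 1 by rewrite -expR0 ler_expR oppr_le0 sqr_ge0.
have [x1|x1] := leP `|x| 1.
  rewrite (@le_trans _ _ 1)//; last by rewrite lerDl exprn_ge0.
  by rewrite mulr_ile1 ?exprn_ge0 ?expR_ge0 ?exprn_ile1.
case: n => [|n]; first by rewrite mul1r (le_trans e1)// lerDl expr0.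
have n0 : 0 < n.+1%:R :> R by rewrite ltr0n.
have H : (x ^+ 2 / n.+1%:R) ^+ n.+1 <= expR (x ^+ 2).
  have -> : expR (x ^+ 2) = expR (x ^+ 2 / n.+1%:R) ^+ n.+1.
    by rewrite -expRM_natl mulrC divfK// gt_eqF.
  rewrite lerXn2r ?nnegrE ?expR_ge0 ?divr_ge0 ?sqr_ge0 ?ler0n//.
  by rewrite (le_trans _ (expR_ge1Dx _))// lerDr.
rewrite expRN ler_pdivrMr ?expR_gt0// (@le_trans _ _ (n.+1%:R ^+ n.+1 * expR (x ^+ 2)))//.
  apply: (@le_trans _ _ (n.+1%:R ^+ n.+1 * (x ^+ 2 / n.+1%:R) ^+ n.+1)).
    rewrite expr_div_n mulrC divfK ?expf_neq0 ?gt_eqF//.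
    by rewrite lerXn2r ?nnegrE// ?sqr_ge0// -real_normK ?num_real// ler_eXnr// ltW.
  by rewrite ler_pM2l// exprn_gt0.
by rewrite ler_pM2r ?expR_gt0// lerDr.
Qed.

Lemma gaussian_deriv g i : gaussian_span g ->
  exists2 g', gaussian_span g' & forall x, is_derive x (e_ i) g (g' x).
Proof.
elim=> [|j {}g Gg [g' Gg' Hg']|c {}g h _ [g' Gg' Hg'] _ [h' Gh' Hh']].
(* The vanishing summands give the derivative the shape required by [gs_lin]; zero itself is
   obtained as $-g + g$. *)
- exists (fun x : V => -2 * (x 0 i * expR (- \sum_j x 0 j ^+ 2)) + (0 * expR (- \sum_j x 0 j ^+ 2) + 0 * expR (- \sum_j x 0 j ^+ 2))).
    have G0 := gs_base.
    rewrite (_ : (fun _ => _) = fun x : V => -2 * (x 0 i * expR (- \sum_j x 0 j ^+ 2)) +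
      (-1 * expR (- \sum_j x 0 j ^+ 2) + expR (- \sum_j x 0 j ^+ 2))); last first.
      by apply/funext => x; ring.
    by apply: gs_lin; [exact: gs_mul|exact: gs_lin].
  move=> x; apply/is_derive_line.
  pose th (t : R) := - (t * t + 2 * x 0 i * t + \sum_j x 0 j ^+ 2).
  have E : (fun t : R => expR (- \sum_j (t *: e_ i + x) 0 j ^+ 2)) = expR \o th.
    apply/funext => t /=; congr (expR (- _)).
    rewrite (bigD1 i)//= line_coord eqxx (eq_bigr (fun j => x 0 j ^+ 2)) => [|j /negbTE ji].
      by rewrite [in RHS](bigD1 i)//=; ring.
    by rewrite line_coord ji add0r.
  rewrite E.
  have dth : is_derive (0 : R) (1 : R) th (- (2 * x 0 i)).
    have D1 := is_deriveM (is_derive_id (0 : R) (1 : R)) (is_derive_id (0 : R) (1 : R)).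
    have D2 := is_deriveZ (2 * x 0 i) (is_derive_id (0 : R) (1 : R)).
    have D3 := is_derive_cst (\sum_j x 0 j ^+ 2) (0 : R) (1 : R).
    have := is_deriveN (is_deriveD (is_deriveD D1 D2) D3).
    rewrite /th => /is_derive_eq; apply; rewrite /= /GRing.scale /=; ring.
  have de : is_derive (th 0) (1 : R) expR (expR (th 0)) by exact: is_derive_expR.
  have := is_derive1_comp de dth; move=> /is_derive_eq; apply.
  by rewrite /th /= !mulr0 !add0r; ring.
- exists (fun x : V => x 0 j * g' x + (j == i)%:R * g x).
    rewrite (_ : (fun _ => _) = fun x : V => (j == i)%:R * g x + x 0 j * g' x).
      by apply: gs_lin => //; exact: gs_mul.
    by apply/funext => x; rewrite addrC.
  move=> x; have := is_deriveM (is_derive_coord x j i) (Hg' x).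
  by move=> /is_derive_eq; apply; rewrite /= /GRing.scale /=; ring.
- exists (fun x : V => c * g' x + h' x); first exact: gs_lin.
  by move=> x; exact: (is_deriveD (is_deriveZ c (Hg' x)) (Hh' x)).
Qed.

Lemma gaussian_schwartz g : gaussian_span g -> schwartzR g.
Proof.
apply: schwartzR_coind => {}g gg; split=> [i x|k|i].
- by have [g' _ /(_ x)[]] := gaussian_deriv i gg.
- elim: gg k => [|i {}g _ IH|c {}g h _ IHg _ IHh] k.
  + exists (\prod_i (1 + (k i)%:R ^+ k i)) => x.
    rewrite -sumrN expR_sum -big_split normr_prod; apply: ler_prod => i _.
    by rewrite normr_ge0 normrM normrX [`|expR _|]ger0_norm ?expR_ge0// expr_gauss.
  + have [D HD] := IH (fun j => k j + (j == i))%N; exists D => x.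
    have := HD x; under eq_bigr do rewrite exprD.
    rewrite big_split /= [X in _ * X * _](bigD1 i)//= eqxx expr1 [X in _ * (_ * X) * _]big1 ?mulr1 ?mulrA// => j.
    by move=> /negbTE ->; rewrite expr0.
  + have [C HC] := IHg k; have [D HD] := IHh k.
    exists (`|c| * C + D) => x; rewrite mulrDr mulrCA; apply: (le_trans (ler_normD _ _)).
    by rewrite lerD// normrM ler_wpM2l.
- have [g' Gg' Hg'] := gaussian_deriv i gg.
  by rewrite (_ : 'D__ g = g')//; apply/funext => x; have [_ ->] := Hg' x.
Qed.

Lemma schwartz_neq0 : exists2 f : V -> R[i], schwartz f & f 0 = 1.
Proof.
exists (fun x => Complex (expR (- \sum_i x 0 i ^+ 2)) 0).
  by split; [apply: gaussian_schwartz; exact: gs_base|exact: schwartzR0].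
by rewrite big1 ?oppr0 ?expR0// => i _; rewrite mxE expr0n.
Qed.

End Gaussian.

(** * Derivatives in the L2 norm *)

Section StrongDerivatives.
Variables (R : realType) (m : nat) (hbar : R).
Local Notation V := 'rV[R]_m.
Local Notation C := R[i].
Local Notation e_ i := (delta_mx 0 i : V).
Local Notation Re := complex.Re.
Local Notation Im := complex.Im.
Local Notation u0 := (u0 hbar).
Implicit Types (f g h : V -> C).

Lemma crM (a b : R) : cr (a * b) = cr a * cr b.
Proof. by apply: complex_ext; rewrite /= ?mulr0 ?mul0r ?subr0 ?addr0. Qed.
Lemma crD (a b : R) : cr (a + b) = cr a + cr b.
Proof. by apply: complex_ext; rewrite /= ?addr0. Qed.
Lemma cr1 : cr 1 = 1 :> C. Proof. by []. Qed.
Lemma crN (a : R) : cr (- a) = - cr a. Proof. by apply: complex_ext; rewrite /= ?oppr0. Qed.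

Lemma schwartzN f : schwartz f -> schwartz (fun x => - f x).
Proof.
by move=> /(schwartzZ (-1)); congr schwartz; apply/funext => x; rewrite mulN1r.
Qed.

Lemma schwartzB f h : schwartz f -> schwartz h -> schwartz (fun x => f x - h x).
Proof. by move=> Sf /schwartzN; exact: schwartzD. Qed.

Lemma schwartz_sum I (s : seq I) (F : I -> V -> C) :
  (forall i, schwartz (F i)) -> schwartz (fun x => \sum_(i <- s) F i x).
Proof.
move=> H; elim: s => [|i s IH].
  by have := @schwartz0 R m; congr schwartz; apply/funext => x; rewrite big_nil.
have := schwartzD (H i) IH; congr schwartz; apply/funext => x; by rewrite big_cons.
Qed.

Lemma Nf_u0 q p f : schwartz f -> Nf (u0 q p f) = Nf f.
Proof.
move=> Sf; rewrite /Nf /Bf -(integral_Rn_shift q (Bf_tame Sf Sf)); last first.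
  by move=> x; rewrite -!expr2 addr_ge0// sqr_ge0.
congr integral_Rn; apply/funext => y; rewrite /u0 !reimE /ei /=.
set t := hbar * _; have := cos2Dsin2 t; set a := Re _; set b := Im _ => H.
rewrite -[RHS]mul1r -H; ring.
Qed.

Lemma cvg0_le (a b : R -> R) : (forall t, t != 0 -> `|t| <= 1 -> `|a t| <= b t) ->
  b t @[t --> 0^'] --> (0 : R) -> a t @[t --> 0^'] --> (0 : R).
Proof.
move=> ab cb; apply/cvgrPdist_le => e e0; have /cvgrPdist_le /(_ e e0) cbe := cb.
near=> t; rewrite sub0r normrN; apply: (@le_trans _ _ (b t)).
  apply: ab; first by near: t; exact: nbhs_dnbhs_neq.
  near: t; apply: nbhs_dnbhs; near=> t; rewrite -[t]subr0 distrC.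
  by near: t; exact: (@cvgr_dist_le _ _ _ _ _ id 0 (@cvg_id _ _)).
apply: (@le_trans _ _ `|0 - b t|); first by rewrite sub0r normrN ler_norm.
by near: t; exact: cbe.
Unshelve. all: by end_near. Qed.

Lemma Nf0 : Nf (fun _ : V => 0 : C) = 0.
Proof.
have := NfZ 0 (@schwartz0 R m); rewrite expr2 !mul0r => H; rewrite -[RHS]H.
by congr Nf; apply/funext => x; rewrite mulr0.
Qed.

Lemma sdiff_cst h : sdiff (fun=> h) h (fun=> 0).
Proof.
apply: (cvg0_le (b := fun=> 0)) => [t _ _|]; last exact: cvg_cst.
rewrite (_ : (fun x => _) = fun=> 0); first by rewrite Nf0 normr0.
by apply/funext => x; rewrite subrr mulr0 subr0.
Qed.

(** Divide $W_tF_t - f = W_t(F_t - f - tf') + t(W_tf' - f') + tf' + (W_tf - f)$ by $t$. Isometry of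
    $W_t$ controls the first term, and differentiability of $W_t$ at $f'$ makes the second one
    negligible. *)
Lemma sdiff_comp (W : R -> (V -> C) -> V -> C) (F : R -> V -> C) f f' (Af Af' : V -> C) :
  (forall t g, schwartz g -> schwartz (W t g)) ->
  (forall t c g h, schwartz g -> schwartz h ->
     W t (fun x => c * g x + h x) = fun x => c * W t g x + W t h x) ->
  (forall t g, schwartz g -> Nf (W t g) = Nf g) ->
  (forall t, schwartz (F t)) -> schwartz f -> schwartz f' -> schwartz Af -> schwartz Af' ->
  sdiff (fun t => W t f) f Af -> sdiff (fun t => W t f') f' Af' -> sdiff F f f' ->
  sdiff (fun t => W t (F t)) f (fun x => Af x + f' x).
Proof.
move=> WS WL WI SF Sf Sf' SA SA' d1 d2 d3.
pose q t (g k : V -> C) x := cr t^-1 * (g x - k x).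
have Sq t g k : schwartz g -> schwartz k -> schwartz (q t g k).
  by move=> Sg Sk; apply: schwartzZ; exact: schwartzB.
pose n1 t := Nf (fun x => q t (W t f) f x - Af x).
pose n2 t := Nf (fun x => q t (W t f') f' x - Af' x).
pose n3 t := Nf (fun x => q t (F t) f x - f' x).
apply: (cvg0_le (b := fun t => 2 * (n3 t + 2 * (t ^+ 2 * (2 * (n2 t + Nf Af')) + n1 t)))) => [t t0 _|].
  rewrite ger0_norm ?Nf_ge0//.
  have -> : (fun x => cr t^-1 * (W t (F t) x - f x) - (Af x + f' x)) =
     (fun x => W t (fun x => q t (F t) f x - f' x) x + ((W t f' x - f' x) + (q t (W t f) f x - Af x))).
    have Sk : schwartz (fun x => -2 * f' x + f' x) by exact: schwartz_lin.
    have -> : (fun x => q t (F t) f x - f' x) =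
        (fun x => cr t^-1 * F t x + (fun x => cr (- t^-1) * f x + (fun x => -2 * f' x + f' x) x) x).
      by apply/funext => x; rewrite /q crN; ring.
    rewrite (WL t (cr t^-1) (F t) _ (SF t) (schwartz_lin _ Sf Sk)).
    rewrite (WL t (cr (- t^-1)) f _ Sf Sk) (WL t (-2) f' _ Sf' Sf').
    by apply/funext => x; rewrite /q crN; ring.
  have S1 : schwartz (fun x => q t (F t) f x - f' x) by apply: schwartzB => //; exact: Sq.
  have S2 : schwartz (fun x => W t f' x - f' x) by apply: schwartzB => //; exact: WS.
  have S3 : schwartz (fun x => q t (W t f) f x - Af x).
    by apply: schwartzB => //; apply: Sq => //; exact: WS.
  apply: (le_trans (NfD_le _ _)); [exact: WS|exact: schwartzD|].
  rewrite WI// ler_pM2l// lerD2l; apply: (le_trans (NfD_le _ _)) => //.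
  rewrite ler_pM2l// lerD2r.
  have S4 : schwartz (fun x => q t (W t f') f' x - Af' x).
    by apply: schwartzB => //; apply: Sq => //; exact: WS.
  have -> : (fun x => W t f' x - f' x) = (fun x => cr t * ((q t (W t f') f' x - Af' x) + Af' x)).
    by apply/funext => x; rewrite /q subrK mulrA -crM divff// mul1r.
  by rewrite NfZ//; [rewrite ler_wpM2l ?sqr_ge0// NfD_le|exact: schwartzD].
have c0 : id t @[t --> (0 : R)^'] --> (0 : R) by apply: cvg_within_filter; exact: cvg_id.
suff : 2 * (n3 t + 2 * (t ^+ 2 * (2 * (n2 t + Nf Af')) + n1 t)) @[t --> 0^'] -->
    2 * (0 + 2 * (0 ^+ 2 * (2 * (0 + Nf Af')) + 0)).
  by rewrite expr0n /= !(mul0r, addr0, mulr0).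
apply: cvgM; first exact: cvg_cst.
apply: cvgD; first exact: d3.
apply: cvgM; first exact: cvg_cst.
apply: cvgD; last exact: d1.
apply: cvgM; first by apply: (@cvgM _ _ _ _ id id).
apply: cvgM; first exact: cvg_cst.
by apply: cvgD; [exact: d2|exact: cvg_cst].
Qed.

(** The generator $q\,U_*(a_i) + p\,U_*(b_i)$ on functions of the even variables alone. *)
Definition Ae i (q p : R) f : V -> C := fun x =>
  - (cr q * partialC i f x) - Complex 0 (hbar * p * x 0 i) * f x.

Lemma schwartz_Ae i q p f : schwartz f -> schwartz (Ae i q p f).
Proof.
move=> Sf; have := schwartzB (schwartzZ (- cr q) (schwartz_partial i Sf))
  (schwartzZ (Complex 0 (hbar * p)) (schwartz_mulx i Sf)).
congr schwartz; apply/funext => x; rewrite /Ae mulNr; congr (_ - _).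
by rewrite mulrA; congr (_ * _); apply: complex_ext; rewrite !reimE /=; ring.
Qed.

Lemma schwartzR_line (g : V -> R) i x (s : R) : schwartzR g ->
  is_derive s (1 : R) (fun s => g (s *: e_ i + x)) ('D_(e_ i) g (s *: e_ i + x)).
Proof.
move=> Sg; have /is_derive_line d := schwartzR_is_derive i (s *: e_ i + x) Sg.
have dsh : is_derive s (1 : R) (fun u : R => u - s) 1.
  by have := is_deriveB (is_derive_id s (1 : R)) (is_derive_cst s s 1); rewrite subr0.
have d' : is_derive (s - s) (1 : R) (fun t : R => g (t *: e_ i + (s *: e_ i + x)))
    ('D_(e_ i) g (s *: e_ i + x)) by rewrite subrr.
have E : (fun s => g (s *: e_ i + x)) =
    (fun t : R => g (t *: e_ i + (s *: e_ i + x))) \o (fun u => u - s).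
  by apply/funext => u /=; rewrite addrA -scalerDl subrK.
by rewrite E; apply: is_derive_eq; exact: mulr1.
Qed.

Let ue i q p (s : R) f := u0 ((s * q) *: e_ i) ((s * p) *: e_ i) f.

Lemma ue_deriv i q p f y (s : R) : schwartz f ->
  is_derive s (1 : R) (fun s => Re (ue i q p s f y)) (Re (ue i q p s (Ae i q p f) y)) /\
  is_derive s (1 : R) (fun s => Im (ue i q p s f y)) (Im (ue i q p s (Ae i q p f) y)).
Proof.
move=> [f1 f2].
have dl : is_derive s (1 : R) (fun s : R => - q * s) (- q).
  by have := is_deriveZ (- q) (is_derive_id s (1 : R)); rewrite [_ *: 1]mulr1.
have dline (g : V -> R) : schwartzR g ->
    is_derive s (1 : R) (fun s => g ((- q * s) *: e_ i + y)) ('D_(e_ i) g ((- q * s) *: e_ i + y) * - q).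
  move=> Sg; have d := @schwartzR_line g i y (- q * s) Sg.
  exact: (@is_derive1_comp _ (fun s => g (s *: e_ i + y)) (fun s : R => - q * s) s _ _ d dl).
pose th (s : R) := hbar * q * p / 2 * (s * s) + - (hbar * p * y 0 i) * s.
have dth : is_derive s (1 : R) th (hbar * q * p * s - hbar * p * y 0 i).
  have D1 := is_deriveZ (hbar * q * p / 2) (is_deriveM (is_derive_id s (1 : R)) (is_derive_id s (1 : R))).
  have D2 := is_deriveZ (- (hbar * p * y 0 i)) (is_derive_id s (1 : R)).
  by have := is_deriveD D1 D2; rewrite /th => /is_derive_eq; apply; rewrite /= /GRing.scale /=; field.
have dc := is_derive1_comp (is_derive_cos (th s)) dth.
have ds := is_derive1_comp (is_derive_sin (th s)) dth.
have E g (u : R) : ue i q p u g y = ei (th u) * g ((- q * u) *: e_ i + y).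
  rewrite /ue /u0 !dotZl !dotZr !dot_delta mxE eqxx eqxx; congr (ei _ * g _).
    by rewrite /th /=; field.
  by rewrite addrC -scaleNr mulNr (mulrC q).
have zi : ((- q * s) *: e_ i + y) 0 i = y 0 i - q * s.
  by rewrite line_coord eqxx; ring.
rewrite !E /Ae; split.
- rewrite (_ : (fun s => _) = fun s => cos (th s) * Re (f ((- q * s) *: e_ i + y)) -
     sin (th s) * Im (f ((- q * s) *: e_ i + y))); last by apply/funext => u; rewrite E reimE.
  have := is_deriveB (is_deriveM dc (dline _ f1)) (is_deriveM ds (dline _ f2)).
  move=> /is_derive_eq; apply; rewrite /= /GRing.scale /= !reimE /= zi; ring.
- rewrite (_ : (fun s => _) = fun s => cos (th s) * Im (f ((- q * s) *: e_ i + y)) +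
     sin (th s) * Re (f ((- q * s) *: e_ i + y))); last by apply/funext => u; rewrite E reimE.
  have := is_deriveD (is_deriveM dc (dline _ f2)) (is_deriveM ds (dline _ f1)).
  move=> /is_derive_eq; apply; rewrite /= /GRing.scale /= !reimE /= zi; ring.
Qed.

(** Peetre's inequality for the weight $(1 + x^2)^{-1}$ in coordinate [i], uniform for $|s| \le
    1$. *)
Lemma wt_shift i (q s : R) (y : V) : `|s| <= 1 ->
  wt ((- q * s) *: e_ i + y) <= 2 * (1 + q ^+ 2) * wt y.
Proof.
move=> s1; rewrite /wt (bigD1 i)//= [in leRHS](bigD1 i)//= line_coord eqxx mulrA.
rewrite (eq_bigr (fun j => wt1 (y 0 j))) => [|j /negbTE ji]; last by rewrite line_coord ji add0r.
apply: ler_wpM2r; first by apply: prodr_ge0 => j _; exact/ltW/wt1_gt0.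
set a := - q * s; set z := y 0 i.
have a2 : a ^+ 2 <= q ^+ 2.
  by rewrite /a exprMn sqrrN ler_piMr ?sqr_ge0// -real_normK ?num_real// exprn_ile1.
rewrite /wt1; have A0 : 0 < 1 + (a + z) ^+ 2 by rewrite ltr_pwDl// sqr_ge0.
have Z0 : 0 < 1 + z ^+ 2 by rewrite ltr_pwDl// sqr_ge0.
rewrite ler_pdivlMr// mulrC ler_pdivrMr//.
have -> : z ^+ 2 = (a + z) ^+ 2 - 2 * (a + z) * a + a ^+ 2 by ring.
set w := a + z; have w2 := sqr_ge0 w; have aw := sqr_ge0 (w + a); have q2 := sqr_ge0 q.
have : 0 <= q ^+ 2 * w ^+ 2 by rewrite mulr_ge0.
move: aw; have -> : (w + a) ^+ 2 = w ^+ 2 + 2 * w * a + a ^+ 2 by ring.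
move=> aw qw; have -> : 2 * (1 + q ^+ 2) * (1 + w ^+ 2) = 2 + 2 * w ^+ 2 + 2 * q ^+ 2 + 2 * (q ^+ 2 * w ^+ 2) by ring.
by lra.
Qed.

Lemma schwartz_wt f : schwartz f -> exists D, 0 <= D /\ forall x, `|Re (f x)| + `|Im (f x)| <= D * wt x.
Proof.
move=> [/schwartzR_decay[D HD] /schwartzR_decay[E HE]].
exists (D + E); split=> [|x]; last by rewrite mulrDl lerD.
by apply: addr_ge0; [exact: (tame_const_ge0 HD)|exact: (tame_const_ge0 HE)].
Qed.

(** The pointwise second derivative in the parameter is the Weyl operator applied to $A^2 f$,
    bounded by a multiple of the weight through [wt_shift]. Taylor's formula bounds the error of the
    difference quotient by $E\,|t|$ times the weight, and its squared norm by $O(t^2)$. *)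
Lemma sdiff_ue i q p f : schwartz f -> sdiff (fun t => ue i q p t f) f (Ae i q p f).
Proof.
move=> Sf; have SA := schwartz_Ae i q p Sf; have SAA := schwartz_Ae i q p SA.
have [D [D0 HD]] := schwartz_wt SAA.
pose E := D * (2 * (1 + q ^+ 2)).
have E0 : 0 <= E by rewrite mulr_ge0// mulr_ge0// addr_ge0// sqr_ge0.
have u00 g : ue i q p 0 g = g by rewrite /ue !mul0r !scale0r u0_0.
have bnd y s : `|s| <= 1 -> `|Re (ue i q p s (Ae i q p (Ae i q p f)) y)| <= E * wt y /\
    `|Im (ue i q p s (Ae i q p (Ae i q p f)) y)| <= E * wt y.
  move=> s1; move: HD; rewrite /ue /u0; move: (Ae i q p (Ae i q p f)) => g HD.
  have -> : y - (s * q) *: e_ i = (- q * s) *: e_ i + y by rewrite addrC -scaleNr mulrC mulNr.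
  set z := _ + y; set c := ei _.
  have [c1 c2] : `|Re c| <= 1 /\ `|Im c| <= 1 by split; [exact: cos_max|exact: sin_max].
  have Hz : `|Re (g z)| + `|Im (g z)| <= E * wt y.
    by rewrite (le_trans (HD z))// /E -mulrA ler_wpM2l// wt_shift.
  rewrite !reimE; split; apply: le_trans Hz.
    by apply: (le_trans (ler_normB _ _)); rewrite !normrM; apply: lerD; rewrite ler_piMl.
  by apply: (le_trans (ler_normD _ _)); rewrite !normrM addrC; apply: lerD; rewrite ler_piMl.
have [K HK] : exists K, forall F : V -> R, forall c, tame F -> (forall x, `|F x| <= c * wt x) ->
    `|integral_Rn F| <= c * K.
  by eexists => F c tF HF; exact: integral_Rn_bound.
apply: (cvg0_le (b := fun t => 2 * E ^+ 2 * t ^+ 2 * K)) => [t t0 t1|]; last first.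
  have c0 : id t @[t --> (0 : R)^'] --> (0 : R) by apply: cvg_within_filter; exact: cvg_id.
  suff : 2 * E ^+ 2 * t ^+ 2 * K @[t --> 0^'] --> 2 * E ^+ 2 * 0 ^+ 2 * K.
    by rewrite expr0n /= mulr0 mul0r.
  by apply: cvgM; [apply: cvgM; [exact: cvg_cst|apply: (@cvgM _ _ _ _ id id)]|exact: cvg_cst].
have Sr : schwartz (fun x => cr t^-1 * (ue i q p t f x - f x) - Ae i q p f x).
  by apply: schwartzB => //; apply: schwartzZ; apply: schwartzB => //; exact: schwartz_u0.
apply: HK; first exact: Bf_tame.
move=> y; have tay (P : C -> R) (HP : forall s f, schwartz f ->
    is_derive s (1 : R) (fun s => P (ue i q p s f y)) (P (ue i q p s (Ae i q p f) y)))
    (HL : P (cr t^-1 * (ue i q p t f y - f y) - Ae i q p f y) =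
          t^-1 * (P (ue i q p t f y) - P (f y) - t * P (Ae i q p f y)))
    (HB : forall s, `|s| <= 1 -> `|P (ue i q p s (Ae i q p (Ae i q p f)) y)| <= E * wt y) :
    `|P (cr t^-1 * (ue i q p t f y - f y) - Ae i q p f y)| <= E * wt y * `|t|.
  have := @taylor2 _ _ _ _ t (E * wt y) (fun s => HP s f Sf) (fun s => HP s _ SA)
    (fun s st => HB s (le_trans st t1)).
  by rewrite !u00 HL normrM normfV.
have b1 : `|Re (cr t^-1 * (ue i q p t f y - f y) - Ae i q p f y)| <= E * wt y * `|t|.
  refine (tay (@complex.Re R) _ _ _) => [s g Sg||s s1]; first by have [] := ue_deriv i q p y s Sg.
    by rewrite !reimE /=; field.
  by have [] := bnd y s s1.
have b2 : `|Im (cr t^-1 * (ue i q p t f y - f y) - Ae i q p f y)| <= E * wt y * `|t|.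
  refine (tay (@complex.Im R) _ _ _) => [s g Sg||s s1]; first by have [] := ue_deriv i q p y s Sg.
    by rewrite !reimE /=; field.
  by have [] := bnd y s s1.
rewrite ger0_norm -?expr2 ?addr_ge0 ?sqr_ge0//.
have sq (a b : R) : `|a| <= b -> a ^+ 2 <= b ^+ 2.
  move=> ab; rewrite -real_normK ?num_real//; apply: lerXn2r => //.
  by rewrite nnegrE (le_trans _ ab).
apply: (le_trans (lerD (sq _ _ b1) (sq _ _ b2))).
have -> : (E * wt y * `|t|) ^+ 2 + (E * wt y * `|t|) ^+ 2 = (2 * E ^+ 2 * t ^+ 2) * wt y ^+ 2.
  by rewrite -(real_normK (num_real t)); ring.
apply: ler_wpM2l; first by apply: mulr_ge0; [apply: mulr_ge0 => //|]; exact: sqr_ge0.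
rewrite expr2 ler_piMr ?wt_ge0//.
by apply: prodr_ile1 => j _; rewrite ltW ?wt1_gt0//= wt1_le1.
Qed.

Definition ustar (q p : V) f : V -> C := fun x => \sum_i Ae i (q 0 i) (p 0 i) f x.

Lemma schwartz_ustar q p f : schwartz f -> schwartz (ustar q p f).
Proof. by move=> Sf; apply: schwartz_sum => i; exact: schwartz_Ae. Qed.

(** Distinct coordinate planes are orthogonal for the symplectic form, so the Weyl operator factors
    over them without a phase; coordinates are added one at a time by [sdiff_comp]. *)
Lemma sdiff_u0 q p f : schwartz f -> sdiff (fun t => u0 (t *: q) (t *: p) f) f (ustar q p f).
Proof.
move=> Sf.
pose part (r : seq 'I_m) (v : V) := \sum_(i <- r) v 0 i *: e_ i.
suff H r : uniq r -> sdiff (fun t => u0 (t *: part r q) (t *: part r p) f) f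
    (fun x => \sum_(i <- r) Ae i (q 0 i) (p 0 i) f x).
  have := H (index_enum 'I_m) (index_enum_uniq _).
  by rewrite /part -!row_sum_delta.
elim: r => [|i r IH] /=.
  have E1 : (fun t : R => u0 (t *: part [::] q) (t *: part [::] p) f) = (fun=> f).
    by apply/funext => t; rewrite /part !big_nil !scaler0 u0_0.
  have E2 : (fun x => \sum_(i <- [::]) Ae i (q 0 i) (p 0 i) f x) = (fun=> 0).
    by apply/funext => x; rewrite big_nil.
  by move=> _; rewrite E1 E2; exact: sdiff_cst.
move=> /andP[ir /IH{}IH].
have pr v j : j \notin r -> part r v 0 j = 0.
  move=> jr; rewrite /part summxE big1_seq// => k /andP[_ kr]; rewrite !mxE.
  by have [jk|_] := eqVneq j k; [rewrite jk kr in jr|rewrite andbF mulr0].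
have -> : (fun t => u0 (t *: part (i :: r) q) (t *: part (i :: r) p) f) =
    (fun t => ue i (q 0 i) (p 0 i) t (u0 (t *: part r q) (t *: part r p) f)).
  apply/funext => t; apply/funext => y; rewrite /ue u0_u0 !dotZl !dotZr.
  rewrite dot_delta dotC dot_delta !pr// !mulr0 subrr mulr0 ei0 mul1r.
  by rewrite /part !big_cons !scalerDr !scalerA.
have -> : (fun x => \sum_(j <- i :: r) Ae j (q 0 j) (p 0 j) f x) =
    (fun x => Ae i (q 0 i) (p 0 i) f x + \sum_(j <- r) Ae j (q 0 j) (p 0 j) f x).
  by apply/funext => x; rewrite big_cons.
have Sg : schwartz (fun x => \sum_(j <- r) Ae j (q 0 j) (p 0 j) f x).
  by apply: schwartz_sum => j; exact: schwartz_Ae.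
apply: (sdiff_comp (W := fun t => ue i (q 0 i) (p 0 i) t) (Af' := Ae i (q 0 i) (p 0 i) (fun x => \sum_(j <- r) Ae j (q 0 j) (p 0 j) f x))) => //.
- by move=> t g Sg'; exact: schwartz_u0.
- by move=> t c g h _ _; exact: u0_lin.
- by move=> t g Sg'; exact: Nf_u0.
- by move=> t; exact: schwartz_u0.
- exact: schwartz_Ae.
- exact: schwartz_Ae.
- exact: sdiff_ue.
- exact: sdiff_ue.
Qed.

(** Polarization of [Nf_u0]. *)
Lemma Bf_u0 q p f h : schwartz f -> schwartz h -> Bf (u0 q p f) (u0 q p h) = Bf f h.
Proof.
move=> Sf Sh; have Su := schwartz_u0 hbar q p.
have := Nf_u0 q p (schwartzD Sf Sh).
have -> : u0 q p (fun x => f x + h x) = fun x => u0 q p f x + u0 q p h x.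
  by apply/funext => y; rewrite /u0 mulrDr.
by rewrite !NfD ?Nf_u0//; [lra|exact: Su|exact: Su].
Qed.

Lemma Bf_eq f g : schwartz f -> schwartz g ->
  (forall h, schwartz h -> Bf f h = Bf g h) -> f = g.
Proof.
move=> Sf Sg H; have Sd := schwartzB Sf Sg.
apply/funext => x; apply/eqP; rewrite -subr_eq0; apply/eqP.
apply: (Nf_eq0 Sd); rewrite /Nf.
have E h : schwartz h -> Bf (fun x => f x - g x) h = Bf f h - Bf g h.
  move=> Sh; rewrite -mulN1r addrC -Bf_lin//; congr Bf; apply/funext => y.
  by rewrite crN mulN1r addrC.
by rewrite E// H// subrr.
Qed.

End StrongDerivatives.

(** * Symmetry of second partial derivatives *)

Section Clairaut.
Variables (R : realType) (m : nat).
Local Notation V := 'rV[R]_m.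
Local Notation C := R[i].
Local Notation e_ i := (delta_mx 0 i : V).
Implicit Types (f g h : V -> C).

Lemma Ae_0 i q p f x : Ae 0 i q p f x = - (cr q * partialC i f x).
Proof.
rewrite /Ae; have -> : Complex 0 (0 * p * x 0 i) = 0 :> C.
  by apply: complex_ext; rewrite /= ?mul0r.
by rewrite mul0r subr0.
Qed.

Lemma sdiff_shift i f : schwartz f ->
  sdiff (fun t => u0 0 (t *: e_ i) 0 f) f (fun x => - partialC i f x).
Proof.
move=> Sf; have := sdiff_u0 0 (e_ i) 0 Sf.
have -> : (fun t : R => u0 0 (t *: e_ i) (t *: 0) f) = (fun t => u0 0 (t *: e_ i) 0 f).
  by apply/funext => t; rewrite scaler0.
have -> // : ustar 0 (e_ i) 0 f = fun x => - partialC i f x.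
apply/funext => x; rewrite /ustar (bigD1 i)//= big1 => [|j ji].
  by rewrite Ae_0 !mxE !eqxx cr1 mul1r addr0.
rewrite Ae_0 !mxE (negbTE ji) andbF.
by have -> : cr 0 = 0 :> C by []; rewrite mul0r oppr0.
Qed.

(** Integration by parts, obtained by differentiating the translation invariance of [Bf] at 0. *)
Lemma Bf_partial i f h : schwartz f -> schwartz h ->
  Bf (partialC i f) h = - Bf f (partialC i h).
Proof.
move=> Sf Sh.
have := sdiff_Bf (fun t => schwartz_u0 0 (t *: e_ i) 0 Sf) (fun t => schwartz_u0 0 (t *: e_ i) 0 Sh)
  (schwartzN (schwartz_partial i Sf)) (schwartzN (schwartz_partial i Sh)).
rewrite !scale0r !u0_0 => /(_ _ _ erefl erefl (sdiff_shift i Sf) (sdiff_shift i Sh)).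
rewrite (_ : (fun t => _) = fun=> Bf f h); last by apply/funext => t; exact: Bf_u0.
move=> [_]; rewrite derive_cst => H.
have N g k : schwartz g -> schwartz k -> Bf (fun x => - g x) k = - Bf g k.
  move=> Sg Sk; rewrite -mulN1r -BfZ//; congr Bf; apply/funext => x.
  by rewrite crN mulN1r.
move: H; rewrite N ?(BfC f) ?N//; try exact: schwartz_partial.
by rewrite (BfC _ f) => /eqP; rewrite eq_sym -opprD oppr_eq0 addr_eq0 => /eqP.
Qed.

(** Tested weakly: with $\tau_t$ the translation along $e_i$, which commutes with $\partial_j$, the
    two sides of $\langle \tau_t \partial_j f, h\rangle = -\langle \tau_t f, \partial_j h\rangle$
    are differentiated at 0. Thus only directional derivatives along the axes occur. *)
Lemma partialC_comm i j f : schwartz f -> partialC i (partialC j f) = partialC j (partialC i f).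
Proof.
move=> Sf; have Si := schwartz_partial i Sf; have Sj := schwartz_partial j Sf.
apply: Bf_eq; try exact: schwartz_partial.
move=> h Sh; have Sjh := schwartz_partial j Sh.
have tr t : u0 0 (t *: e_ i) 0 (partialC j f) = partialC j (u0 0 (t *: e_ i) 0 f).
  have uE g : u0 0 (t *: e_ i) 0 g = fun x : V => g (x - t *: e_ i).
    by apply/funext => x; rewrite /u0 mul0r ei0 mul1r.
  rewrite !uE; apply/funext => x; case: Sf => f1 f2.
  have D (g : V -> R) : schwartzR g ->
      'D_(e_ j) (fun y => g (y - t *: e_ i)) x = 'D_(e_ j) g (x - t *: e_ i).
    move=> Sg; have /is_derive_line d := schwartzR_is_derive j (x - t *: e_ i) Sg.
    suff : is_derive x (e_ j) (fun y => g (y - t *: e_ i)) ('D_(e_ j) g (x - t *: e_ i)) by case.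
    apply/is_derive_line; rewrite (_ : (fun s : R => _) = (fun s : R => g (s *: e_ j + (x - t *: e_ i))))//.
    by apply/funext => s; rewrite addrA.
  by rewrite /partialC (D _ f1) (D _ f2).
have d1 := sdiff_Bf (fun t => schwartz_u0 0 (t *: e_ i) 0 Sj) (fun=> Sh)
  (schwartzN (schwartz_partial i Sj)) (@schwartz0 R m).
have d2 := sdiff_Bf (fun t => schwartz_u0 0 (t *: e_ i) 0 Sf) (fun=> Sjh)
  (schwartzN Si) (@schwartz0 R m).
move: d1 d2; rewrite !scale0r !u0_0.
move=> /(_ _ _ erefl erefl (sdiff_shift i Sj) (sdiff_cst h)) d1.
move=> /(_ _ _ erefl erefl (sdiff_shift i Sf) (sdiff_cst _)) d2.
have E : (fun t => Bf (u0 0 (t *: e_ i) 0 (partialC j f)) h) =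
    (fun t => - Bf (u0 0 (t *: e_ i) 0 f) (partialC j h)).
  by apply/funext => t; rewrite tr Bf_partial//; exact: schwartz_u0.
have B0 g : schwartz g -> Bf g (fun=> 0) = 0.
  move=> Sg; have H := BfZ 0 (@schwartz0 R m) Sg.
  rewrite BfC -[RHS](mul0r (Bf (fun=> 0) g)) -H.
  by congr Bf; apply/funext => x; rewrite mulr0.
have N g k : schwartz g -> schwartz k -> Bf (fun x => - g x) k = - Bf g k.
  move=> Sg Sk; rewrite -mulN1r -BfZ//; congr Bf; apply/funext => x.
  by rewrite crN mulN1r.
have [_ e1] := d1; have [_ e2] := is_deriveN d2.
have v := etrans (esym e1) (etrans (congr1 (fun F : R -> R => 'D_(1 : R) F 0) E) e2).
have v1 : Bf (fun x => - partialC i (partialC j f) x) h + Bf (partialC j f) (fun=> 0) =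
    - Bf (partialC i (partialC j f)) h.
  by rewrite (B0 _ Sj) addr0 (N _ _ (schwartz_partial i Sj) Sh).
have v2 : Bf (fun x => - partialC i f x) (partialC j h) + Bf f (fun=> 0) =
    Bf (partialC j (partialC i f)) h.
  by rewrite (B0 _ Sf) addr0 (N _ _ Si Sjh) -(Bf_partial j Si Sh).
apply: oppr_inj; apply: (etrans (esym v1)); apply: (etrans v).
exact: (congr1 (fun z : R => - z) v2).
Qed.

End Clairaut.

(** * Operators on the Schroedinger space *)

Section FockSigns.
Variables (n : nat) (K : comNzRingType) (Z : lmodType K).
Implicit Types (J : {set 'I_n}) (w : {set 'I_n} -> Z) (k l : 'I_n).

Definition below k J : nat := #|[set j in J | (j < k)%N]|.

Lemma below_setU1 k l J : l \notin J -> below k (l |: J) = ((l < k) + below k J)%N.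
Proof.
move=> lJ; rewrite /below; case: ltnP => lk.
  rewrite (_ : [set _ in _ | _] = l |: [set j in J | (j < k)%N]); last first.
    by apply/finset.setP => j; rewrite !inE; case: eqP => [->|_]; rewrite ?lk.
  by rewrite cardsU1 inE (negbTE lJ).
congr #|pred_of_set _|; apply/finset.setP => j; rewrite !inE; case: eqP => [->|_] //.
by rewrite ltnNge lk (negbTE lJ).
Qed.

Lemma below_setD1 k l J : l \in J -> below k J = ((l < k) + below k (J :\ l))%N.
Proof. by move=> lJ; rewrite -{1}(finset.setD1K lJ) below_setU1// !inE eqxx. Qed.

(** With [gd], the creation and annihilation operators: [gen_mul] and [gen_deriv] restricted to one
    fibre, with coefficients in an arbitrary module. *)
Definition gm k w : {set 'I_n} -> Z := fun J =>
  if k \in J then (-1) ^+ below k J *: w (J :\ k) else 0.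
Definition gd k w : {set 'I_n} -> Z := fun J =>
  if k \in J then 0 else (-1) ^+ below k J *: w (k |: J).

Let sgn2 (a b : nat) (z : Z) : (-1) ^+ a *: ((-1) ^+ b *: z) = (-1) ^+ (a + b) *: z.
Proof. by rewrite scalerA exprD. Qed.

Let sgn_eq (a b : nat) (z : Z) : odd a = odd b -> (-1) ^+ a *: z = (-1) ^+ b *: z.
Proof. by move=> ab; rewrite -signr_odd ab signr_odd. Qed.

Let sgn_neq (a b : nat) (z : Z) : odd a = ~~ odd b -> (-1) ^+ a *: z = - ((-1) ^+ b *: z).
Proof. by move=> ab; rewrite -signr_odd ab -[in RHS]signr_odd signrN scaleNr. Qed.

Lemma gm_gm k l w J : gm k (gm l w) J = - gm l (gm k w) J.
Proof.
rewrite /gm !in_setD1; have [->|kl] := eqVneq k l.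
  by rewrite /= scaler0 if_same oppr0.
rewrite ?[l == k]eq_sym ?(negbTE kl) /=.
case kJ: (k \in J); case lJ: (l \in J); rewrite ?scaler0 ?oppr0//.
rewrite !sgn2 !finset.setDDl [[set l] :|: _]finset.setUC; apply: sgn_neq.
rewrite (below_setD1 k lJ) (below_setD1 l kJ) !oddD.
by case: (ltngtP k l) (kl) => // [||/val_inj ->]; rewrite ?eqxx//= => _ _; do 2!case: odd.
Qed.

Lemma gd_gd k l w J : gd k (gd l w) J = - gd l (gd k w) J.
Proof.
rewrite /gd !in_setU1; have [->|kl] := eqVneq k l.
  by rewrite /= scaler0 if_same oppr0.
rewrite ?[l == k]eq_sym ?(negbTE kl) /=.
case kJ: (k \in J); case lJ: (l \in J); rewrite ?scaler0 ?oppr0//.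
rewrite !sgn2 finset.setUCA; apply: sgn_neq.
rewrite (below_setU1 k (negbT lJ)) (below_setU1 l (negbT kJ)) !oddD.
by case: (ltngtP k l) (kl) => // [||/val_inj ->]; rewrite ?eqxx//= => _ _; do 2!case: odd.
Qed.

Lemma gd_gm k l w J : gd k (gm l w) J + gm l (gd k w) J = (k == l)%:R *: w J.
Proof.
rewrite /gm /gd !in_setD1 !in_setU1; have [<-|kl] := eqVneq k l.
  rewrite /= scale1r; case kJ: (k \in J).
    rewrite /= sgn2 finset.setD1K// add0r (below_setD1 k kJ) ltnn add0n.
    by rewrite (sgn_eq (b := 0)) ?scale1r// oddD addbb.
  rewrite addr0 /= finset.setU1K ?kJ// sgn2 (below_setU1 k (negbT kJ)) ltnn add0n.
  by rewrite (sgn_eq (b := 0)) ?scale1r// oddD addbb.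
rewrite scale0r ?[l == k]eq_sym ?(negbTE kl) /=.
case kJ: (k \in J); case lJ: (l \in J); rewrite ?scaler0 ?addr0//.
rewrite !sgn2.
have -> : (k |: J) :\ l = k |: J :\ l.
  by apply/finset.setP => j; rewrite !inE; case: (eqVneq j k) => [->|]; rewrite ?kl.
apply/eqP; rewrite addr_eq0; apply/eqP/sgn_neq.
rewrite (below_setD1 k lJ) (below_setU1 l (negbT kJ)) !oddD.
by case: (ltngtP k l) (kl) => // [||/val_inj ->]; rewrite ?eqxx//= => _ _; do 2!case: odd.
Qed.

End FockSigns.

(** * Position, derivative, Grassmann and Weyl operators *)

Section OperatorAlgebra.
Variables (R : realType) (m r s : nat).
Local Notation V := 'rV[R]_m.
Local Notation C := R[i].
Local Notation n := (r + s)%N.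
Local Notation H := ('rV[R]_m -> {set 'I_(r + s)} -> R[i]).
Local Notation e_ i := (delta_mx 0 i : V).

Fact Hsmooth0 : Hsmooth (0 : H).
Proof. by move=> J; exact: schwartz0. Qed.
Fact HsmoothP (c : C) (f h : H) : Hsmooth f -> Hsmooth h -> Hsmooth (c *: f + h).
Proof. by move=> Sf Sh J; exact: (schwartz_lin c (Sf J) (Sh J)). Qed.
Fact Hsmooth_neq0 : exists2 f : H, Hsmooth f & f != 0.
Proof.
have [f Sf f1] := schwartz_neq0 R m; exists (fun x _ => f x) => [J//|].
apply/eqP => /(congr1 (fun g : H => g 0 finset.set0)) /=; rewrite f1 => /eqP.
by rewrite (_ : (0 : H) 0 finset.set0 = 0)// oner_eq0.
Qed.
Definition Hsub : submod H := Submod Hsmooth0 HsmoothP Hsmooth_neq0.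

Local Notation opH := (op Hsub).

Lemma Hlift (T : (V -> C) -> V -> C) :
  (forall f, schwartz f -> schwartz (T f)) ->
  (forall (c : C) f h, schwartz f -> schwartz h -> T (fun x => c * f x + h x) = fun x => c * T f x + T h x) ->
  preserving Hsub (fun (f : H) x J => T (fun y => f y J) x).
Proof.
move=> TS TL; split=> [f Sf J|c f h Sf Sh]; first exact: TS.
by apply/funext => x; apply/funext => J; rewrite (TL c _ _ (Sf J) (Sh J)).
Qed.

Lemma partialC_lin i (c : C) (f h : V -> C) : schwartz f -> schwartz h ->
  partialC i (fun x => c * f x + h x) = fun x => c * partialC i f x + partialC i h x.
Proof.
move=> [f1 f2] [h1 h2]; apply/funext => x; apply: complex_ext; rewrite !reimE /=.
- rewrite (_ : (fun y => _) = fun y => complex.Re c * complex.Re (f y) +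
      (- complex.Im c * complex.Im (f y) + complex.Re (h y))); last first.
    by apply/funext => y; rewrite !reimE; ring.
  have := is_deriveD (is_deriveZ (complex.Re c) (schwartzR_is_derive i x f1))
    (is_deriveD (is_deriveZ (- complex.Im c) (schwartzR_is_derive i x f2)) (schwartzR_is_derive i x h1)).
  by case=> _ ->; rewrite /GRing.scale /=; ring.
- rewrite (_ : (fun y => _) = fun y => complex.Re c * complex.Im (f y) +
      (complex.Im c * complex.Re (f y) + complex.Im (h y))); last first.
    by apply/funext => y; rewrite !reimE; ring.
  have := is_deriveD (is_deriveZ (complex.Re c) (schwartzR_is_derive i x f2))
    (is_deriveD (is_deriveZ (complex.Im c) (schwartzR_is_derive i x f1)) (schwartzR_is_derive i x h2)).
  by case=> _ ->; rewrite /GRing.scale /=; ring.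
Qed.

Lemma mulx_pres i : preserving Hsub (fun (f : H) x J => cr (x 0 i) * f x J).
Proof.
apply: (Hlift (T := fun f x => cr (x 0 i) * f x)) => [f|c f h _ _]; first exact: schwartz_mulx.
by apply/funext => x; ring.
Qed.
Lemma partial_pres i : preserving Hsub (@Hpartial R m r s i).
Proof. by apply: Hlift => [f|c f h]; [exact: schwartz_partial|exact: partialC_lin]. Qed.
Lemma u0_pres hbar q p : preserving Hsub (fun (f : H) x J => u0 hbar q p (fun y => f y J) x).
Proof. by apply: Hlift => [f|c f h _ _]; [exact: schwartz_u0|exact: u0_lin]. Qed.
Lemma gen_mul_pres k : preserving Hsub (@gen_mul R m r s k).
Proof.
split=> [f Sf J|c f h Sf Sh].
  rewrite /gen_mul; case: (k \in J); last exact: schwartz0.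
  exact: (schwartzZ _ (Sf _)).
apply/funext => x; apply/funext => J.
have -> : (c *: gen_mul k f + gen_mul k h : H) x J = c * gen_mul k f x J + gen_mul k h x J by [].
rewrite /gen_mul; case: ifP => _; rewrite ?mulr0 ?addr0//.
have E L : (c *: f + h : H) x L = c * f x L + h x L by [].
by rewrite E; ring.
Qed.
Lemma gen_deriv_pres k : preserving Hsub (@gen_deriv R m r s k).
Proof.
split=> [f Sf J|c f h Sf Sh].
  rewrite /gen_deriv; case: (k \in J); first exact: schwartz0.
  exact: (schwartzZ _ (Sf _)).
apply/funext => x; apply/funext => J.
have -> : (c *: gen_deriv k f + gen_deriv k h : H) x J = c * gen_deriv k f x J + gen_deriv k h x J by [].
rewrite /gen_deriv; case: ifP => _; rewrite ?mulr0 ?addr0//.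
have E L : (c *: f + h : H) x L = c * f x L + h x L by [].
by rewrite E; ring.
Qed.

Definition opX i : opH := mkop (mulx_pres i).
Definition opP i : opH := mkop (partial_pres i).
Definition opG k : opH := mkop (gen_mul_pres k).
Definition opD_ k : opH := mkop (gen_deriv_pres k).
Definition opW hbar q p : opH := mkop (u0_pres hbar q p).

Let ext (T U : opH) : (forall f x J, Hsmooth f -> T f x J = U f x J) -> T = U.
Proof.
move=> TU; apply: op_ext => f Sf; apply/funext => x; apply/funext => J; exact: TU.
Qed.

Lemma S_in (T : opH) (f : H) : Hsmooth f -> Hsmooth (T f).
Proof. exact: (@op_in _ _ Hsub). Qed.

Local Ltac hs := do ?[assumption|apply: S_in].

Lemma opXE i f x J : Hsmooth f -> opX i f x J = cr (x 0 i) * f x J.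
Proof. by move=> Sf; rewrite /opX mkopE. Qed.
Lemma opPE i f x J : Hsmooth f -> opP i f x J = partialC i (fun y => f y J) x.
Proof. by move=> Sf; rewrite /opP mkopE. Qed.
Lemma opGE k f x J : Hsmooth f -> opG k f x J = gm k (f x) J.
Proof. by move=> Sf; rewrite /opG mkopE. Qed.
Lemma opDE k f x J : Hsmooth f -> opD_ k f x J = gd k (f x) J.
Proof. by move=> Sf; rewrite /opD_ mkopE. Qed.
Lemma opWE hbar q p f x J : Hsmooth f -> opW hbar q p f x J = u0 hbar q p (fun y => f y J) x.
Proof. by move=> Sf; rewrite /opW mkopE. Qed.
Lemma opHM (T U : opH) f x J : Hsmooth f -> (T * U) f x J = T (U f) x J.
Proof. by move=> Sf; rewrite opEM. Qed.
Lemma opHD (T U : opH) f x J : Hsmooth f -> (T + U) f x J = T f x J + U f x J.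
Proof. by move=> Sf; rewrite opED. Qed.
Lemma opHN (T : opH) f x J : Hsmooth f -> (- T) f x J = - T f x J.
Proof. by move=> Sf; rewrite opEN. Qed.
Lemma opHZ c (T : opH) f x J : Hsmooth f -> (c *: T) f x J = c * T f x J.
Proof. by move=> Sf; rewrite opEZ. Qed.
Lemma opH1 f x J : Hsmooth f -> (1 : opH) f x J = f x J.
Proof. by move=> Sf; rewrite opE1. Qed.

Lemma opXX i j : opX i * opX j = opX j * opX i.
Proof.
by apply: ext => f x J Sf; rewrite !opHM; hs; rewrite !opXE; hs; rewrite mulrCA.
Qed.

Lemma opPP i j : opP i * opP j = opP j * opP i.
Proof.
apply: ext => f x J Sf; rewrite !opHM; hs; rewrite !opPE; hs.
have E k : (fun y => opP k f y J) = partialC k (fun y => f y J).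
  by apply/funext => y; rewrite opPE.
by rewrite !E partialC_comm.
Qed.

Lemma partialC_mulx i j (f : V -> C) x : schwartz f ->
  partialC i (fun x => cr (x 0 j) * f x) x = cr (x 0 j) * partialC i f x + (i == j)%:R * f x.
Proof.
move=> [f1 f2]; rewrite eq_sym.
have nE : (j == i)%:R = cr (j == i)%:R :> C by case: eqP.
apply: complex_ext; rewrite nE !reimE /= !mul0r ?subr0 ?addr0.
- rewrite (_ : (fun y => _) = fun y : V => y 0 j * complex.Re (f y)); last first.
    by apply/funext => y; rewrite !reimE /= mul0r subr0.
  have := is_deriveM (is_derive_coord x j i) (schwartzR_is_derive i x f1).
  by case=> _ ->; rewrite /GRing.scale /= [complex.Re _ * _]mulrC.
- rewrite (_ : (fun y => _) = fun y : V => y 0 j * complex.Im (f y)); last first.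
    by apply/funext => y; rewrite !reimE /= mul0r addr0.
  have := is_deriveM (is_derive_coord x j i) (schwartzR_is_derive i x f2).
  by case=> _ ->; rewrite /GRing.scale /= [complex.Im _ * _]mulrC.
Qed.

Lemma opPX i j : opP i * opX j = opX j * opP i + ((i == j)%:R : C)%:A.
Proof.
apply: ext => f x J Sf; rewrite opHD; hs; rewrite !opHM; hs.
rewrite opHZ; hs; rewrite opH1; hs; rewrite opPE; hs; rewrite opXE; hs; rewrite opPE; hs.
have -> : (fun y => opX j f y J) = (fun y => cr (y 0 j) * f y J).
  by apply/funext => y; rewrite opXE.
exact: partialC_mulx.
Qed.

Lemma opGG k l : opG k * opG l = - (opG l * opG k).
Proof.
apply: ext => f x J Sf; rewrite opHN; hs; rewrite !opHM; hs; rewrite !opGE; hs.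
have E k' : opG k' f x = gm k' (f x) by apply/funext => L; rewrite opGE.
by rewrite !E gm_gm.
Qed.

Lemma opDD k l : opD_ k * opD_ l = - (opD_ l * opD_ k).
Proof.
apply: ext => f x J Sf; rewrite opHN; hs; rewrite !opHM; hs; rewrite !opDE; hs.
have E k' : opD_ k' f x = gd k' (f x) by apply/funext => L; rewrite opDE.
by rewrite !E gd_gd.
Qed.

Lemma opDG k l : opD_ k * opG l = - (opG l * opD_ k) + ((k == l)%:R : C)%:A.
Proof.
apply: ext => f x J Sf; rewrite opHD; hs; rewrite opHN; hs; rewrite !opHM; hs.
rewrite opDE; hs; rewrite opGE; hs; rewrite opHZ; hs; rewrite opH1; hs.
have -> : opG l f x = gm l (f x) by apply/funext => L; rewrite opGE.
have -> : opD_ k f x = gd k (f x) by apply/funext => L; rewrite opDE.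
by rewrite addrC; exact: (canRL (addrK _) (gd_gm k l (f x) J)).
Qed.

(** [T] acts on the function variable alone, while [U] acts on the Grassmann index as a monomial
    matrix: component [J] of the image is a multiple of component [L J]. *)
Lemma comm_pointwise (T : (V -> C) -> V -> C) (U : opH) (HT : preserving Hsub (fun (f : H) x J => T (fun y => f y J) x))
  (L : {set 'I_n} -> {set 'I_n}) (c : {set 'I_n} -> C) :
  (forall (a : C) f, schwartz f -> T (fun x => a * f x) = fun x => a * T f x) ->
  (forall f x J, Hsmooth f -> U f x J = c J * f x (L J)) ->
  mkop HT * U = U * mkop HT.
Proof.
move=> TL UE; apply: ext => f x J Sf; rewrite !opHM; hs; rewrite UE; hs; rewrite !mkopE; hs.
have -> : (fun y => U f y J) = (fun y => c J * f y (L J)) by apply/funext => y; rewrite UE.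
by rewrite (TL _ _ (Sf _)).
Qed.

Lemma gmE (k : 'I_n) (w : {set 'I_n} -> C) (J : {set 'I_n}) : gm k w J = (if k \in J then (-1) ^+ below k J else 0) * w (J :\ k) :> C.
Proof. by rewrite /gm; case: ifP; rewrite ?mul0r. Qed.
Lemma gdE (k : 'I_n) (w : {set 'I_n} -> C) (J : {set 'I_n}) : gd k w J = (if k \in J then 0 else (-1) ^+ below k J) * w (k |: J) :> C.
Proof. by rewrite /gd; case: ifP; rewrite ?mul0r. Qed.

Lemma comm_G (T : (V -> C) -> V -> C) (HT : preserving Hsub (fun (f : H) x J => T (fun y => f y J) x)) k :
  (forall (a : C) f, schwartz f -> T (fun x => a * f x) = fun x => a * T f x) ->
  mkop HT * opG k = opG k * mkop HT.
Proof.
move=> TL; apply: (@comm_pointwise T _ HT (fun J => J :\ k)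
  (fun J => if k \in J then (-1) ^+ below k J else 0) TL).
by move=> f x J Sf; rewrite opGE// gmE.
Qed.

Lemma comm_D (T : (V -> C) -> V -> C) (HT : preserving Hsub (fun (f : H) x J => T (fun y => f y J) x)) k :
  (forall (a : C) f, schwartz f -> T (fun x => a * f x) = fun x => a * T f x) ->
  mkop HT * opD_ k = opD_ k * mkop HT.
Proof.
move=> TL; apply: (@comm_pointwise T _ HT (fun J => k |: J)
  (fun J => if k \in J then 0 else (-1) ^+ below k J) TL).
by move=> f x J Sf; rewrite opDE// gdE.
Qed.

Let linX i (a : C) (f : V -> C) : schwartz f ->
  (fun f (x : V) => cr (x 0 i) * f x) (fun x => a * f x) = fun x => a * (cr (x 0 i) * f x).
Proof. by move=> _; apply/funext => x; rewrite mulrCA. Qed.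
Let linP i (a : C) (f : V -> C) : schwartz f ->
  partialC i (fun x => a * f x) = fun x => a * partialC i f x.
Proof.
move=> Sf; have := partialC_lin i a Sf (@schwartz0 R m).
have -> : (fun x => a * f x + 0) = fun x => a * f x by apply/funext => x; rewrite addr0.
move=> ->; apply/funext => x.
have -> : partialC i (fun _ : V => 0 : C) x = 0.
  by apply: complex_ext; rewrite /= derive_cst.
by rewrite addr0.
Qed.
Let linW hbar q p (a : C) (f : V -> C) : schwartz f ->
  u0 hbar q p (fun x => a * f x) = fun x => a * u0 hbar q p f x.
Proof. by move=> _; apply/funext => x; rewrite /u0 mulrCA. Qed.

Lemma opXG i k : opX i * opG k = opG k * opX i. Proof. exact: (comm_G _ _ (@linX i)). Qed.
Lemma opXD i k : opX i * opD_ k = opD_ k * opX i. Proof. exact: (comm_D _ _ (@linX i)). Qed.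
Lemma opPG i k : opP i * opG k = opG k * opP i. Proof. exact: (comm_G _ _ (@linP i)). Qed.
Lemma opPD i k : opP i * opD_ k = opD_ k * opP i. Proof. exact: (comm_D _ _ (@linP i)). Qed.
Lemma opWG hbar q p k : opW hbar q p * opG k = opG k * opW hbar q p. Proof. exact: (comm_G _ _ (@linW hbar q p)). Qed.
Lemma opWD hbar q p k : opW hbar q p * opD_ k = opD_ k * opW hbar q p. Proof. exact: (comm_D _ _ (@linW hbar q p)). Qed.

Lemma opXW hbar q p i : opX i * opW hbar q p = opW hbar q p * (opX i + (cr (q 0 i))%:A).
Proof.
apply: ext => f x J Sf; rewrite !opHM; hs; rewrite opXE; hs; rewrite !opWE; hs.
rewrite /u0 opHD; hs; rewrite opXE; hs; rewrite opHZ; hs; rewrite opH1; hs.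
rewrite -mulrDl -crD !mxE subrK; ring.
Qed.

Lemma partialC_u0 hbar q p i (f : V -> C) x : schwartz f ->
  partialC i (u0 hbar q p f) x =
  u0 hbar q p (partialC i f) x - Complex 0 (hbar * p 0 i) * u0 hbar q p f x.
Proof.
move=> [f1 f2]; pose th (y : V) := hbar * (2^-1 * dot q p - dot y p).
have dth : is_derive x (e_ i) th (- (hbar * p 0 i)).
  apply/is_derive_line.
  have -> : (fun t : R => th (t *: e_ i + x)) = (fun t => - (hbar * p 0 i) * t + th x).
    by apply/funext => t; rewrite /th dotDl dotZl [dot (e_ i) p]dotC dot_delta; ring.
  have := is_deriveD (is_deriveZ (- (hbar * p 0 i)) (is_derive_id (0 : R) 1)) (is_derive_cst (th x) (0 : R) 1).
  by rewrite addr0 [_ *: 1]mulr1.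
have dsh (g : V -> R) : schwartzR g -> is_derive x (e_ i) (fun y => g (y - q)) ('D_(e_ i) g (x - q)).
  move=> Sg; have /is_derive_line d := schwartzR_is_derive i (x - q) Sg.
  apply/is_derive_line; rewrite (_ : (fun t : R => _) = (fun t : R => g (t *: e_ i + (x - q))))//.
  by apply/funext => t; rewrite addrA.
have dcs (F : R -> R) (dF : R) : is_derive (th x) (1 : R) F dF ->
    is_derive x (e_ i) (fun y => F (th y)) (dF * - (hbar * p 0 i)).
  have /is_derive_line d := dth; move=> dF'; apply/is_derive_line.
  have dF0 : is_derive (th (0 *: e_ i + x)) (1 : R) F dF by rewrite scale0r add0r.
  exact: (@is_derive1_comp _ F (fun t => th (t *: e_ i + x)) 0 _ _ dF0 d).
have dc := dcs _ _ (is_derive_cos (th x)); have ds := dcs _ _ (is_derive_sin (th x)).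
apply: complex_ext; rewrite /u0 -/(th x) !reimE /=.
- rewrite (_ : (fun y => _) = fun y => cos (th y) * complex.Re (f (y - q)) - sin (th y) * complex.Im (f (y - q))); last first.
    by apply/funext => y; rewrite !reimE.
  by have [_ ->] := is_deriveB (is_deriveM dc (dsh _ f1)) (is_deriveM ds (dsh _ f2)); rewrite /GRing.scale /=; ring.
- rewrite (_ : (fun y => _) = fun y => cos (th y) * complex.Im (f (y - q)) + sin (th y) * complex.Re (f (y - q))); last first.
    by apply/funext => y; rewrite !reimE.
  by have [_ ->] := is_deriveD (is_deriveM dc (dsh _ f2)) (is_deriveM ds (dsh _ f1)); rewrite /GRing.scale /=; ring.
Qed.

Lemma opPW hbar q p i : opP i * opW hbar q p =
  opW hbar q p * (opP i - (Complex 0 (hbar * p 0 i))%:A).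
Proof.
rewrite mulrBr -scalerAr mulr1.
apply: ext => f x J Sf; rewrite opHD; hs; rewrite opHN; hs; rewrite opHZ; hs; rewrite !opHM; hs.
rewrite opPE; hs; rewrite !opWE; hs.
have -> : (fun y => opW hbar q p f y J) = u0 hbar q p (fun y => f y J).
  by apply/funext => y; rewrite opWE.
have -> : (fun y => opP i f y J) = partialC i (fun y => f y J).
  by apply/funext => y; rewrite opPE.
exact: partialC_u0.
Qed.

End OperatorAlgebra.

(** * Superlinear extension to the base algebra *)

Section SuperOperators.
Variables (R : realType) (A : baseAlgebra R) (m r s : nat).
Local Notation V := 'rV[R]_m.
Local Notation C := R[i].
Local Notation H := ('rV[R]_m -> {set 'I_(r + s)} -> R[i]).
Local Notation AHF := ('rV[R]_m -> {set 'I_(r + s)} -> A * A).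
Local Notation opH := (op (Hsub R m r s)).
Local Notation tn := (fun af : A * H => tens af.1 af.2 : AHF).

Definition smooths (l : seq (A * H)) := all (fun af => `[< Hsmooth af.2 >]) l.
Definition tsum (l : seq (A * H)) : AHF := \sum_(af <- l) tens af.1 af.2.

Lemma tensE a (f : H) x J : (tens a f : AHF) x J = (complex.Re (f x J) *: a, complex.Im (f x J) *: a).
Proof. by []. Qed.
Lemma pairD (a b c d : A) : (a, b) + (c, d) = (a + c, b + d) :> A * A. Proof. by []. Qed.
Lemma pairZ k (a b : A) : k *: (a, b) = (k *: a, k *: b) :> A * A. Proof. by []. Qed.
Lemma AHfE (f g : AHF) : (forall x J, f x J = g x J) -> f = g.
Proof. by move=> fg; apply/funext => x; apply/funext => J. Qed.

Lemma tensD a b (f : H) : tens (a + b) f = tens a f + tens b f :> AHF.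
Proof. by apply: AHfE => x J; rewrite /tens !scalerDr. Qed.
Lemma tensDr a (f g : H) : tens a (f + g) = tens a f + tens a g :> AHF.
Proof.
apply: AHfE => x J; rewrite /tens; have -> : (f + g : H) x J = f x J + g x J by [].
by rewrite !raddfD /= !scalerDl.
Qed.
Lemma tensZ k a (f : H) : tens (k *: a) f = k *: (tens a f : AHF).
Proof. by apply: AHfE => x J; rewrite /tens; congr pair; rewrite !scalerA mulrC. Qed.
Lemma tens0 a : tens a (0 : H) = 0 :> AHF.
Proof. by apply: AHfE => x J; rewrite /tens !scale0r. Qed.
Lemma tens0l (f : H) : tens 0 f = 0 :> AHF.
Proof. by apply: AHfE => x J; rewrite /tens !scaler0. Qed.
Lemma tensZr k a (f : H) : tens a (cr k *: f : H) = k *: (tens a f : AHF).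
Proof.
apply: AHfE => x J; rewrite /tens.
have -> : (cr k *: f : H) x J = cr k * f x J by [].
have -> (g : AHF) : (k *: g) x J = k *: g x J by [].
by case: (f x J) => u v; rewrite pairZ /= !mul0r subr0 addr0 !scalerA.
Qed.

Lemma tsum_cat l l' : tsum (l ++ l') = tsum l + tsum l'.
Proof. by rewrite /tsum big_cat. Qed.
Lemma tsumZ k l : tsum [seq (k *: bf.1, bf.2) | bf <- l] = k *: tsum l.
Proof. by rewrite /tsum big_map scaler_sumr; apply: eq_bigr => af _; rewrite tensZ. Qed.
Lemma smooths_cat l l' : smooths (l ++ l') = smooths l && smooths l'.
Proof. exact: all_cat. Qed.

Lemma AH_P (phi : AHF) : AH phi <-> exists2 l, smooths l & phi = tsum l.
Proof. by split=> [[l []]|[l Sl ->]]; exists l. Qed.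

Fact AH0 : AH (0 : AHF).
Proof. by apply/AH_P; exists [::]; rewrite ?/tsum ?big_nil. Qed.
Fact AHP (k : R) (f g : AHF) : AH f -> AH g -> AH (k *: f + g).
Proof.
move=> /AH_P[l Sl ->] /AH_P[l' Sl' ->]; apply/AH_P.
exists ([seq (k *: bf.1, bf.2) | bf <- l] ++ l'); last by rewrite tsum_cat tsumZ.
by rewrite smooths_cat Sl' andbT /smooths all_map.
Qed.
Lemma AH_tens a (f : H) : Hsmooth f -> AH (tens a f : AHF).
Proof.
move=> Sf; apply/AH_P; exists [:: (a, f)]; last by rewrite /tsum big_seq1.
by rewrite /smooths /= andbT; apply/asboolP.
Qed.
Fact AH_neq0 : exists2 f : AHF, AH f & f != 0.
Proof.
have [f Sf f1] := schwartz_neq0 R m; exists (tens 1 (fun x _ => f x)); first by apply: AH_tens => J.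
apply/eqP => /(congr1 (fun g : AHF => (g 0 finset.set0).1)); rewrite tensE f1 /= scale1r => /eqP.
by rewrite oner_eq0.
Qed.
Definition AHsub : submod AHF := Submod AH0 AHP AH_neq0.
Local Notation opA := (op AHsub).

(* The key fact on tensor products over a field: a relation sum a_k (x) f_k = 0
   is preserved by L (x) T. *)
Lemma tens_wd (L : {linear A -> A}) (T : opH) l : smooths l -> tsum l = 0 ->
  tsum [seq (L bf.1, T bf.2) | bf <- l] = 0.
Proof.
move: {2}(size l) (leqnn (size l)) => n; elim: n l => [|n IH] l.
  by rewrite leqn0 size_eq0 => /eqP -> _ _; rewrite /tsum big_nil.
case: l => [|[a0 f0] l]; first by move=> _ _ _; rewrite /tsum big_nil.
rewrite ltnS => sl /andP[/asboolP Sf0 Sl] E; change (is_true (smooths l)) in Sl; change (Hsmooth f0) in Sf0.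
(* If $a_0$ is a combination of the other coefficients, it can be eliminated by adding multiples of
   $f_0$ to the other functions, which shortens the relation. Otherwise $f_0$ must vanish. *)
have [[c cE]|nspan] := pselect (exists c : 'I_(size l) -> R, a0 = \sum_k c k *: (nth (0, 0) l k).1).
  pose l' := [seq ((nth (0, 0) l k).1, (nth (0, 0) l k).2 + cr (c k) *: f0) | k : 'I_(size l) <- enum 'I_(size l)].
  have Sk (k : 'I_(size l)) : Hsmooth (nth (0, 0) l k).2.
    by apply/asboolP; exact: (allP Sl _ (mem_nth _ (ltn_ord k))).
  have Sl' : smooths l'.
    apply/allP => bf /mapP[k _ ->] /=; apply/asboolP.
    by apply: (@smD _ _ (Hsub R m r s)); [exact: Sk|exact: (@smZ _ _ (Hsub R m r s))].
  have sumE (F : A * H -> AHF) : \sum_(bf <- l) F bf = \sum_(k < size l) F (nth (0, 0) l k).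
    by rewrite (big_nth (0, 0)) big_mkord.
  have E' : tsum l' = 0.
    rewrite -E /tsum big_cons big_map big_enum /= sumE.
    under eq_bigr do rewrite tensDr tensZr.
    rewrite big_split /= addrC; congr (_ + _); rewrite cE.
    rewrite (big_morph (fun a => tens a f0 : AHF) (fun a b => tensD a b f0) (tens0l f0)).
    by apply: eq_bigr => k _; rewrite tensZ.
  have := IH l' _ Sl' E'; rewrite size_map size_enum_ord => /(_ sl) <-.
  rewrite [RHS](_ : _ = \sum_(k < size l) tens (L (nth (0, 0) l k).1) (T ((nth (0, 0) l k).2 + cr (c k) *: f0))); last first.
    by rewrite /tsum /l' big_map [LHS]big_map big_enum.
  rewrite [LHS](_ : _ = tens (L a0) (T f0) + \sum_(k < size l) tens (L (nth (0, 0) l k).1) (T (nth (0, 0) l k).2)); last first.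
    by rewrite /tsum /= big_cons big_map sumE.
  have Tl (k : 'I_(size l)) : T ((nth (0, 0) l k).2 + cr (c k) *: f0) = T (nth (0, 0) l k).2 + cr (c k) *: T f0.
    have Sz : Hsub R m r s (cr (c k) *: f0) by exact: (@smZ _ _ (Hsub R m r s)).
    by rewrite (opD T (Sk k) Sz) (opZ T (c k)%:C%C Sf0).
  move: (T f0) Tl => g Tl.
  transitivity (\sum_(k < size l) tens (L (nth (0, 0) l k).1) (T (nth (0, 0) l k).2) +
     \sum_(k < size l) c k *: (tens (L (nth (0, 0) l k).1) g : AHF)).
    rewrite addrC; congr (_ + _); rewrite cE linear_sum.
    rewrite (big_morph (fun a => tens a g : AHF) (fun a b => tensD a b g) (tens0l g)).
    by apply: eq_bigr => k _; rewrite linearZ tensZ.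
  by rewrite -big_split; apply: eq_bigr => k _; rewrite Tl tensDr tensZr.
(* At a point where a real or imaginary part of $f_0$ is non-zero, the relation itself would express
   $a_0$ through the other coefficients. *)
have f00 : f0 = 0.
  apply/funext => x; apply/funext => J; apply: complex_ext => /=; apply: contrapT => nz.
  - apply: nspan; exists (fun k => - (complex.Re (f0 x J))^-1 * complex.Re ((nth (0, 0) l k).2 x J)).
    have := congr1 (fun g : AHF => (g x J).1) E; rewrite /tsum big_cons.
    have -> (g h : AHF) : ((g + h) x J).1 = (g x J).1 + (h x J).1 by [].
    rewrite [X in _ + X](_ : _ = \sum_(k < size l) complex.Re ((nth (0, 0) l k).2 x J) *: (nth (0, 0) l k).1); last first.
      rewrite (big_nth (0, 0)) big_mkord.
      by elim/big_ind2 : _ => // u1 u2 v1 v2 <- <-.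
    rewrite /= => /eqP; rewrite addr_eq0 => /eqP h.
    have nz' : complex.Re (f0 x J) != 0 by apply/eqP.
    apply: (scalerI nz'); rewrite h scaler_sumr -sumrN; apply: eq_bigr => k _.
    by rewrite scalerA mulrA mulrN mulfV// mulN1r scaleNr.
  - apply: nspan; exists (fun k => - (complex.Im (f0 x J))^-1 * complex.Im ((nth (0, 0) l k).2 x J)).
    have := congr1 (fun g : AHF => (g x J).2) E; rewrite /tsum big_cons.
    have -> (g h : AHF) : ((g + h) x J).2 = (g x J).2 + (h x J).2 by [].
    rewrite [X in _ + X](_ : _ = \sum_(k < size l) complex.Im ((nth (0, 0) l k).2 x J) *: (nth (0, 0) l k).1); last first.
      rewrite (big_nth (0, 0)) big_mkord.
      by elim/big_ind2 : _ => // u1 u2 v1 v2 <- <-.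
    rewrite /= => /eqP; rewrite addr_eq0 => /eqP h.
    have nz' : complex.Im (f0 x J) != 0 by apply/eqP.
    apply: (scalerI nz'); rewrite h scaler_sumr -sumrN; apply: eq_bigr => k _.
    by rewrite scalerA mulrA mulrN mulfV// mulN1r scaleNr.
move: E; rewrite /tsum big_cons /= f00 tens0 add0r => E.
rewrite big_cons [X in X + _](_ : _ = 0) ?add0r; first exact: IH.
by rewrite (op0 T) tens0.
Qed.

Lemma tens_wd2 (L : {linear A -> A}) (T : opH) l l' : smooths l -> smooths l' -> tsum l = tsum l' ->
  tsum [seq (L bf.1, T bf.2) | bf <- l] = tsum [seq (L bf.1, T bf.2) | bf <- l'].
Proof.
move=> Sl Sl' E; apply/eqP; rewrite -subr_eq0 -scaleN1r; apply/eqP.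
have S : smooths (l ++ [seq ((-1) *: bf.1, bf.2) | bf <- l']) by rewrite smooths_cat Sl {1}/smooths all_map.
have Z : tsum (l ++ [seq ((-1) *: bf.1, bf.2) | bf <- l']) = 0 by rewrite tsum_cat tsumZ E scaleN1r subrr.
rewrite -(tens_wd L T S Z) map_cat tsum_cat; congr (_ + _); rewrite -tsumZ -!map_comp.
by congr tsum; apply: eq_map => bf /=; rewrite linearZ.
Qed.

Definition dec (phi : AHF) : seq (A * H) :=
  if pselect (exists2 l, smooths l & phi = tsum l) is left h then projT1 (cid2 h) else [::].
Lemma decP phi : AH phi -> smooths (dec phi) /\ phi = tsum (dec phi).
Proof.
by move/AH_P => h; rewrite /dec; case: pselect => // h'; case: (cid2 h') => l.
Qed.

(** Defined through a chosen decomposition; [tens_wd2] makes it independent of the choice and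
    thereby linear. *)
Definition lift (L : {linear A -> A}) (T : opH) (phi : AHF) : AHF :=
  tsum [seq (L bf.1, T bf.2) | bf <- dec phi].

Lemma lift_tsum L T l : smooths l -> lift L T (tsum l) = tsum [seq (L bf.1, T bf.2) | bf <- l].
Proof.
move=> Sl; have [|Sd E] := @decP (tsum l); first by apply/AH_P; exists l.
exact: tens_wd2.
Qed.

Lemma smooths_map (L : {linear A -> A}) (T : opH) l : smooths l -> smooths [seq (L bf.1, T bf.2) | bf <- l].
Proof.
rewrite /smooths all_map => Sl; apply/allP => bf bfl /=; apply/asboolP; apply: S_in.
by apply/asboolP; exact: (allP Sl).
Qed.

Fact lift_pres L T : preserving AHsub (lift L T).
Proof.
split=> [f /AH_P[l Sl ->]|k f g /AH_P[l Sl ->] /AH_P[l' Sl' ->]].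
  by apply/AH_P; rewrite lift_tsum//; exists [seq (L bf.1, T bf.2) | bf <- l] => //; exact: smooths_map.
rewrite -tsumZ -tsum_cat lift_tsum ?smooths_cat ?Sl' ?andbT ?/smooths ?all_map//.
rewrite map_cat tsum_cat !lift_tsum// -tsumZ -!map_comp; congr (tsum _ + _); apply: eq_map => bf /=.
by rewrite linearZ.
Qed.

Definition liftop L T : opA := mkop (lift_pres L T).

Lemma liftopE L T l : smooths l -> liftop L T (tsum l) = tsum [seq (L bf.1, T bf.2) | bf <- l].
Proof. by move=> Sl; rewrite /liftop mkopE ?lift_tsum//; apply/AH_P; exists l. Qed.

Lemma opA_ext (T U : opA) : (forall a f, Hsmooth f -> T (tens a f) = U (tens a f)) -> T = U.
Proof.
move=> TU; apply: op_ext => phi /AH_P[l Sl ->]; rewrite /tsum !big_seq.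
rewrite !(@op_sumv _ _ AHsub); last 2 first.
- by move=> [a f] /= /(allP Sl)/asboolP; exact: AH_tens.
- by move=> [a f] /= /(allP Sl)/asboolP; exact: AH_tens.
by apply: eq_bigr => -[a f] /(allP Sl)/asboolP; exact: TU.
Qed.

Lemma liftop_tens L T a f : Hsmooth f -> liftop L T (tens a f) = tens (L a) (T f).
Proof.
move=> Sf; have -> : tens a f = tsum [:: (a, f)] by rewrite /tsum big_seq1.
by rewrite liftopE ?/tsum ?big_seq1//; rewrite /smooths /= andbT; apply/asboolP.
Qed.

Definition lmul (a : A) : A -> A := fun b => a * b.
Fact lmul_linear a : linear (lmul a).
Proof. by move=> k b c; rewrite /lmul mulrDr scalerAr. Qed.
HB.instance Definition _ a := GRing.isLinear.Build R A A *:%R (lmul a) (lmul_linear a).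
Definition La (a : A) : opA := liftop (lmul a) 1.
(** The operator $1 \otimes T$ for [T] regarded as having parity [p]: [twist p] is the Koszul sign
    of moving [T] past the coefficient. *)
Definition hat (p : bool) (T : opH) : opA := liftop (@twist R A p) T.

Lemma La_tens a b f : Hsmooth f -> La a (tens b f) = tens (a * b) f.
Proof. by move=> Sf; rewrite /La liftop_tens// (@opE1 _ _ (Hsub R m r s)). Qed.
Lemma hat_tens p T b f : Hsmooth f -> hat p T (tens b f) = tens (twist p b) (T f).
Proof. by move=> Sf; rewrite /hat liftop_tens. Qed.

Local Ltac ah := do ?[assumption|apply: AH_tens|apply: S_in].

Lemma hatM p q T U : hat p T * hat q U = hat (p (+) q) (T * U).
Proof.
apply: opA_ext => a f Sf; rewrite (@opEM _ _ AHsub); ah.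
rewrite !hat_tens; ah; rewrite twist_twist (@opEM _ _ (Hsub R m r s))//.
Qed.
Lemma hatD p T U : hat p (T + U) = hat p T + hat p U.
Proof.
apply: opA_ext => a f Sf; rewrite (@opED _ _ AHsub); ah.
by rewrite !hat_tens; ah; rewrite (@opED _ _ (Hsub R m r s))// tensDr.
Qed.
Lemma hatZ p k T : hat p (cr k *: T) = k *: hat p T.
Proof.
apply: opA_ext => a f Sf; rewrite (@opEZ _ _ AHsub); ah.
by rewrite !hat_tens; ah; rewrite (@opEZ _ _ (Hsub R m r s))// tensZr.
Qed.
Lemma hat0 p : hat p 0 = 0.
Proof.
have := hatZ p 0 0; rewrite scaler0 scale0r //.
Qed.
Lemma hat_sum p I (l : seq I) (P : pred I) F : hat p (\sum_(i <- l | P i) F i) = \sum_(i <- l | P i) hat p (F i).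
Proof. by apply: (big_morph (hat p)); [exact: hatD|exact: hat0]. Qed.
Lemma hatN p T : hat p (- T) = - hat p T.
Proof. by have := hatZ p (-1) T; rewrite crN !scaleN1r. Qed.
Lemma hat1 : hat false 1 = 1.
Proof.
apply: opA_ext => a f Sf; rewrite hat_tens; ah; rewrite twist0 !(@opE1 _ _ _)//; ah.
Qed.
Lemma LaM a b : La a * La b = La (a * b).
Proof.
apply: opA_ext => c f Sf; rewrite (@opEM _ _ AHsub); ah.
by rewrite !La_tens; ah; rewrite mulrA.
Qed.
Lemma LaD a b : La (a + b) = La a + La b.
Proof.
apply: opA_ext => c f Sf; rewrite (@opED _ _ AHsub); ah.
by rewrite !La_tens; ah; rewrite mulrDl tensD.
Qed.
Lemma LaZ k a : La (k *: a) = k *: La a.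
Proof.
apply: opA_ext => c f Sf; rewrite (@opEZ _ _ AHsub); ah.
by rewrite !La_tens; ah; rewrite -scalerAl tensZ.
Qed.
Lemma La1 : La 1 = 1.
Proof.
by apply: opA_ext => a f Sf; rewrite La_tens; ah; rewrite mul1r (@opE1 _ _ AHsub); ah.
Qed.
Lemma La0 : La 0 = 0. Proof. by have := LaZ 0 0; rewrite !scale0r. Qed.
Lemma LaN a : La (- a) = - La a. Proof. by have := LaZ (-1) a; rewrite !scaleN1r. Qed.
Lemma La_sum I (l : seq I) (P : pred I) F : La (\sum_(i <- l | P i) F i) = \sum_(i <- l | P i) La (F i).
Proof. by apply: (big_morph La); [exact: LaD|exact: La0]. Qed.
Lemma hat_La p T a : hat p T * La a = La (twist p a) * hat p T.
Proof.
apply: opA_ext => c f Sf; rewrite !(@opEM _ _ AHsub); ah.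
by rewrite !La_tens ?hat_tens ?La_tens; ah; rewrite twistM.
Qed.

(** The passage from [tens_op], used in the definitions of both representations, to the operator
    algebra. *)
Lemma tens_opE a p (T : H -> H) (T' : opH) phi : (forall f, Hsmooth f -> T f = T' f) -> AH phi ->
  tens_op a p T phi = (La a * hat p T') phi.
Proof.
move=> TT' Sphi; rewrite /tens_op; case: pselect => // h; case: (cid h) => l [Sl El].
change (tens_sum [seq (a * twist p bf.1, T bf.2) | bf <- l] = (La a * hat p T') phi).
rewrite (@opEM _ _ AHsub)//.
have El' : phi = tsum l by [].
rewrite [in RHS]El' /hat liftopE// /La liftopE ?smooths_map// -map_comp /tens_sum /tsum !big_map.
rewrite !big_seq; apply: eq_bigr => -[b f] /(allP Sl)/asboolP /= Sf.
rewrite TT'//; congr tens; apply/esym; apply: (restrE (S := Hsub R m r s)); exact: (S_in T' Sf).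
Qed.

(** * The filtration of operators by powers of the ideal *)

Section Filtration.
Variable l : seq A.
Hypothesis lH : forall a, a \in l -> exists p, homog p a.
Hypothesis lB : forall a, a \in l -> body A a = 0.

Definition sup (p : bool) (S : opA) := forall a, S * La a = La (twist p a) * S.
(** Finite sums of $aS$ with $a$ in the [k]-th power of the ideal. Each $S$ passes coefficients up
    to [twist], so in a product of two such sums all coefficients can be collected on the left and
    the powers add up. *)
Inductive Fl (k : nat) : opA -> Prop :=
| Fl_nil : Fl k 0
| Fl_cons a p S X : idl l k a -> sup p S -> Fl k X -> Fl k (La a * S + X).

Lemma sup1 : sup false 1. Proof. by move=> a; rewrite mul1r mulr1 twist0. Qed.
Lemma supM p q S T : sup p S -> sup q T -> sup (p (+) q) (S * T).
Proof. by move=> Sp Tq a; rewrite -mulrA Tq mulrA Sp -mulrA twist_twist. Qed.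
Lemma sup_hat p T : sup p (hat p T).
Proof. by move=> a; exact: hat_La. Qed.

Lemma FlD k X Y : Fl k X -> Fl k Y -> Fl k (X + Y).
Proof.
by move=> FX FY; elim: FX => [|a p S Z ia sS _ IH]; rewrite ?add0r// -addrA; exact: Fl_cons.
Qed.
Lemma FlE k a p S : idl l k a -> sup p S -> Fl k (La a * S).
Proof. by move=> ia sS; rewrite -[_ * _]addr0; apply: Fl_cons ia sS _; exact: Fl_nil. Qed.
Lemma Fl_La k a : idl l k a -> Fl k (La a).
Proof. by move=> ia; rewrite -[La a]mulr1; exact: FlE ia sup1. Qed.
Lemma FlZ k c X : Fl k X -> Fl k (c *: X).
Proof.
elim=> [|a p S Z ia sS _ IH]; first by rewrite scaler0; exact: Fl_nil.
by rewrite scalerDr scalerAl -LaZ; apply: Fl_cons sS IH; exact: idlZ.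
Qed.
Lemma Fl_sum k I (t : seq I) (P : pred I) F : (forall i, P i -> Fl k (F i)) -> Fl k (\sum_(i <- t | P i) F i).
Proof. by move=> H; elim/big_rec: _ => [|i x /H]; [exact: Fl_nil|exact: FlD]. Qed.
Lemma FlM k X Y : Fl 1 X -> Fl k Y -> Fl k.+1 (X * Y).
Proof.
move=> FX FY; elim: FX => [|a p S Z ia sS _ IH]; first by rewrite mul0r; exact: Fl_nil.
rewrite mulrDl; apply: FlD IH; elim: FY => [|b q T W ib sT _ IH]; first by rewrite mulr0; exact: Fl_nil.
rewrite mulrDr; apply: FlD IH; rewrite -mulrA (mulrA S) sS -mulrA mulrA LaM; apply: FlE (supM sS sT).
by apply: (idlM lH ia); exact: idl_twist.
Qed.
Lemma Fl_nilp : exists K, forall X, Fl K X -> X = 0.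
Proof.
have [K KP] := idl_nil lH lB; exists K => X; elim=> // a p S Z /KP -> _ _ ->.
by rewrite La0 mul0r addr0.
Qed.

Lemma Fl0 : Fl 0 1.
Proof. by rewrite -[1]mul1r -{1}La1; apply: FlE sup1. Qed.
Definition AFl : filtration opA :=
  Filtration Fl0 Fl_nil FlD FlZ FlM (projT2 (cid Fl_nilp)).
End Filtration.

End SuperOperators.

(** * The operators U_* and mu_* *)

Section HeisenbergOps.
Variables (R : realType) (hbar : R) (m r s : nat).
Local Notation C := R[i].
Local Notation N := (dim_E m r s).
Local Notation H := ('rV[R]_m -> {set 'I_(r + s)} -> R[i]).
Local Notation opH := (op (Hsub R m r s)).
Local Notation om := (omega R m r s).
Local Notation ih := (Complex 0 hbar : C).

(** This and the next five definitions write every $U_*(e_k)$ in the uniform shape $\alpha X_i +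
    \beta P_i$ or $\gamma G_j + \delta D_j$, so that all commutation relations follow from three
    bilinear computations. *)
Definition ev_idx (k : 'I_(m + m)) : 'I_m := match fintype.split k with inl i => i | inr i => i end.
Definition ev_x (k : 'I_(m + m)) : C := match fintype.split k with inl _ => 0 | inr _ => - ih end.
Definition ev_p (k : 'I_(m + m)) : C := match fintype.split k with inl _ => -1 | inr _ => 0 end.
Definition od_idx (k : 'I_(dim_odd r s)) : 'I_(r + s) :=
  match fintype.split k with
  | inl k => match fintype.split k with inl a => theta s a | inr a => theta s a end
  | inr k => match fintype.split k with inl c => zeta r c | inr c => zeta r c end end.
Definition od_g (k : 'I_(dim_odd r s)) : C :=
  match fintype.split k with
  | inl k => match fintype.split k with inl a => 0 | inr a => ih end
  | inr k => match fintype.split k with inl c => Complex 0 (hbar / 2) | inr c => Complex (hbar / 2) 0 end end.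
Definition od_d (k : 'I_(dim_odd r s)) : C :=
  match fintype.split k with
  | inl k => match fintype.split k with inl a => -1 | inr a => 0 end
  | inr k => match fintype.split k with inl c => -1 | inr c => Complex 0 (-1) end end.

Definition Uop (k : 'I_N) : opH :=
  match fintype.split k with
  | inl k => ev_x k *: opX R r s (ev_idx k) + ev_p k *: opP R r s (ev_idx k)
  | inr k => od_g k *: opG R m (od_idx k) + od_d k *: opD_ R m (od_idx k)
  end.

Lemma UopE k f : Hsmooth f -> Ustar_basis hbar k f = Uop k f.
Proof.
move=> Sf; apply/funext => x; apply/funext => J.
have mulN (f' : H) : (- f' : H) x J = - f' x J by [].
have addE (f' h' : H) : (f' + h' : H) x J = f' x J + h' x J by [].
rewrite /Ustar_basis /Uop /ev_x /ev_p /ev_idx /od_g /od_d /od_idx.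
case: (fintype.split k) => j; [|case: (fintype.split j) => {}j]; case: (fintype.split j) => i; cbv beta iota.
- by rewrite opHD// !opHZ// opPE// mul0r add0r mulN mulN1r.
- rewrite opHD// !opHZ// opXE// mul0r addr0; apply: complex_ext; rewrite !reimE /=; ring.
- by rewrite opHD// !opHZ// opDE// mul0r add0r mulN mulN1r.
- by rewrite opHD// !opHZ// opGE// mul0r addr0.
- by rewrite opHD// !opHZ// opGE// opDE// addE mulN mulN1r addrC.
- by rewrite opHD// !opHZ// opGE// opDE// addE addrC.
Qed.

Definition sg (p : bool) : C := (-1) ^+ p.

Lemma zmod_swap (Z : zmodType) (x1 x2 x3 x4 d1 d2 : Z) :
  x1 + x2 + (x3 + d1 + x4) = x1 + x3 + (x2 + d2 + x4) + (d1 - d2).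
Proof. by rewrite !addrA [RHS](ACl (1*3*2*6*5*4*7)) /= addrK. Qed.

Lemma zmod_swapN (Z : zmodType) (x1 x2 x3 x4 d1 d2 : Z) :
  - x1 + x2 + (- x3 + d1 - x4) = - (x1 + x3 + (- x2 + d2 + x4)) + (d1 + d2).
Proof. by rewrite !opprD opprK !addrA [RHS](ACl (1*3*2*6*5*7*4)) /= addrK. Qed.

Lemma XP_comm (a b a' b' : C) (i j : 'I_m) :
  (a *: opX R r s i + b *: opP R r s i) * (a' *: opX R r s j + b' *: opP R r s j) =
  (a' *: opX R r s j + b' *: opP R r s j) * (a *: opX R r s i + b *: opP R r s i)
  + ((i == j)%:R * (b * a' - a * b'))%:A :> opH.
Proof.
have PXij := opPX R r s i j; have PXji := opPX R r s j i; rewrite eq_sym in PXji.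
move: ((i == j)%:R : C) PXij PXji => d PXij PXji.
rewrite !mulrDl !mulrDr -!scalerAl -!scalerAr !scalerA.
rewrite (opXX R r s i j) (opPP R r s i j) PXij PXji !scalerDr !scalerA.
have -> : d * (b * a') + d * - (a * b') = b * a' * d - a * b' * d :> C by ring.
rewrite scalerBl.
rewrite [a' * a]mulrC [a' * b]mulrC [b' * a]mulrC [b' * b]mulrC.
exact: zmod_swap.
Qed.

Lemma GD_comm (a b a' b' : C) (i j : 'I_(r + s)) :
  (a *: opG R m i + b *: opD_ R m i) * (a' *: opG R m j + b' *: opD_ R m j) =
  - ((a' *: opG R m j + b' *: opD_ R m j) * (a *: opG R m i + b *: opD_ R m i))
  + ((i == j)%:R * (b * a' + a * b'))%:A :> opH.
Proof.
have PXij := opDG R m i j; have PXji := opDG R m j i; rewrite eq_sym in PXji.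
move: ((i == j)%:R : C) PXij PXji => d PXij PXji.
rewrite !mulrDl !mulrDr -!scalerAl -!scalerAr !scalerA.
rewrite (opGG R m i j) (opDD R m i j) PXij PXji !scalerDr !scalerN !scalerA.
have -> : d * (b * a') + d * (a * b') = b * a' * d + a * b' * d :> C by ring.
rewrite scalerDl.
rewrite [a' * a]mulrC [a' * b]mulrC [b' * a]mulrC [b' * b]mulrC.
exact: zmod_swapN.
Qed.

Lemma XG_comm (a b a' b' : C) (i : 'I_m) (j : 'I_(r + s)) :
  (a *: opX R r s i + b *: opP R r s i) * (a' *: opG R m j + b' *: opD_ R m j) =
  (a' *: opG R m j + b' *: opD_ R m j) * (a *: opX R r s i + b *: opP R r s i) :> opH.
Proof.
rewrite !mulrDl !mulrDr -!scalerAl -!scalerAr !scalerA.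
rewrite (opXG R i j) (opXD R i j) (opPG R i j) (opPD R i j).
rewrite [a' * a]mulrC [a' * b]mulrC [b' * a]mulrC [b' * b]mulrC.
by rewrite addrACA.
Qed.

Lemma par_l (k : 'I_(m + m)) : par (lshift (dim_odd r s) k : 'I_N) = false.
Proof. by rewrite /par /= leqNgt ltn_ord. Qed.
Lemma par_r (k : 'I_(dim_odd r s)) : par (rshift (m + m) k : 'I_N) = true.
Proof. by rewrite /par /= leq_addr. Qed.
Lemma Uop_l (k : 'I_(m + m)) : Uop (lshift (dim_odd r s) k) =
  ev_x k *: opX R r s (ev_idx k) + ev_p k *: opP R r s (ev_idx k).
Proof. by rewrite /Uop (unsplitK (inl k)). Qed.
Lemma Uop_r (k : 'I_(dim_odd r s)) : Uop (rshift (m + m) k) =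
  od_g k *: opG R m (od_idx k) + od_d k *: opD_ R m (od_idx k).
Proof. by rewrite /Uop (unsplitK (inr k)). Qed.

Lemma split_l p q (k : 'I_p) : fintype.split (lshift q k) = inl k.
Proof. exact: (unsplitK (inl k)). Qed.
Lemma split_r p q (k : 'I_q) : fintype.split (rshift p k) = inr k.
Proof. exact: (unsplitK (inr k)). Qed.
Lemma scal_ext (a b : C) : a = b -> a%:A = b%:A :> opH. Proof. by move=> ->. Qed.

Lemma UU i j : Uop i * Uop j = (-1 : C) ^+ (par i && par j) *: (Uop j * Uop i) + (ih * cr (om i j))%:A.
Proof.
have [[a -> _]|[a -> _]] := par_cases i; have [[b -> _]|[b -> _]] := par_cases j.
- rewrite !par_l !Uop_l XP_comm expr0 scale1r; congr (_ + _); apply: scal_ext.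
  rewrite /omega block_mxEul /omega_even /ev_x /ev_p /ev_idx -(splitK a) -(splitK b).
  case: (fintype.split a) => k /=; case: (fintype.split b) => l /=; rewrite ?split_l ?split_r.
  + by rewrite block_mxEul mxE; apply: complex_ext; rewrite !reimE /=; ring.
  + by rewrite block_mxEur mxE; case: eqP => _; apply: complex_ext; rewrite !reimE /=; ring.
  + by rewrite block_mxEdl !mxE; case: eqP => _; apply: complex_ext; rewrite !reimE /=; ring.
  + by rewrite block_mxEdr mxE; apply: complex_ext; rewrite !reimE /=; ring.
- rewrite par_l par_r !Uop_l !Uop_r XG_comm expr0 scale1r /omega block_mxEur mxE.
  by rewrite (_ : cr 0 = 0)// mulr0 scale0r addr0.
- rewrite par_l par_r !Uop_l !Uop_r XG_comm expr0 scale1r /omega block_mxEdl mxE.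
  by rewrite (_ : cr 0 = 0)// mulr0 scale0r addr0.
- rewrite !par_r !Uop_r GD_comm expr1 scaleN1r; congr (_ + _); apply: scal_ext.
  rewrite /omega block_mxEdr /omega_odd /od_g /od_d /od_idx -(splitK a) -(splitK b).
  case: (fintype.split a) => k /=; case: (fintype.split b) => l /=; rewrite ?split_l ?split_r.
  + rewrite block_mxEul -(splitK k) -(splitK l).
    case: (fintype.split k) => k' /=; case: (fintype.split l) => l' /=; rewrite ?split_l ?split_r /theta eq_lshift.
    * by rewrite block_mxEul mxE; apply: complex_ext; rewrite !reimE /=; ring.
    * by rewrite block_mxEur !mxE; case: eqP => _; apply: complex_ext; rewrite !reimE /=; ring.
    * by rewrite block_mxEdl !mxE; case: eqP => _; apply: complex_ext; rewrite !reimE /=; ring.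
    * by rewrite block_mxEdr mxE; apply: complex_ext; rewrite !reimE /=; ring.
  + rewrite block_mxEur mxE -(splitK k) -(splitK l).
    by case: (fintype.split k) => k' /=; case: (fintype.split l) => l' /=; rewrite ?split_l ?split_r /theta /zeta eq_lrshift; apply: complex_ext; rewrite !reimE /=; ring.
  + rewrite block_mxEdl mxE -(splitK k) -(splitK l).
    by case: (fintype.split k) => k' /=; case: (fintype.split l) => l' /=; rewrite ?split_l ?split_r /theta /zeta eq_rlshift; apply: complex_ext; rewrite !reimE /=; ring.
  + rewrite block_mxEdr -(splitK k) -(splitK l) !mxE.
    case: (fintype.split k) => k' /=; case: (fintype.split l) => l' /=; rewrite ?split_l ?split_r /zeta eq_rshift ?eq_lshift ?eq_rshift ?eq_lrshift ?eq_rlshift.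
    * by case: eqP => _; apply: complex_ext; rewrite !reimE /=; field.
    * by case: eqP => _; apply: complex_ext; rewrite !reimE /=; field.
    * by case: eqP => _; apply: complex_ext; rewrite !reimE /=; field.
    * by case: eqP => _; apply: complex_ext; rewrite !reimE /=; field.
Qed.

Definition quadop i k : opH := ih^-1 *: (Uop i * Uop k + ((-1 : C) ^+ (par i && par k)) *: (Uop k * Uop i)).

Lemma mu_quadE i k f : Hsmooth f -> mu_quad hbar i k f = quadop i k f.
Proof.
move=> Sf; have SU j : Hsmooth (Uop j f) by exact: (@op_in _ _ (Hsub R m r s)).
rewrite /mu_quad !UopE//; apply/funext => x; apply/funext => J.
by rewrite /quadop opHZ// opHD// opHZ// !opHM.
Qed.

Hypothesis hb0 : hbar != 0.
Lemma ih_neq0 : ih != 0.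
Proof. by rewrite eq_complex /= (negbTE hb0) andbF. Qed.

Definition spc (B : 'M[R]_N) i k : C := cr ((B *m om^T) i k).

Lemma spc_C p B i k : spo p B -> spc B k i = (-1) ^+ (par i && par k) * spc B i k.
Proof.
move=> SB; rewrite /spc (spo_coef i k SB).
by case: (par i && par k); rewrite ?expr0 ?expr1 ?mul1r// mulN1r mulN1r crN.
Qed.

Lemma spc_par p B i k : spo p B -> par i (+) par k != p -> spc B i k = 0.
Proof.
case=> Bp _ ik; rewrite /spc (_ : (B *m om^T) i k = 0)//.
rewrite mxE big1// => l _; rewrite mxE.
have [e|/omega_par ->] := eqVneq (par k) (par l); last by rewrite mulr0.
by rewrite Bp ?mul0r// -e.
Qed.

Lemma cr_nat k : cr k%:R = k%:R :> C.
Proof. by elim: k => [//|k IH]; rewrite -!natr1 crD IH. Qed.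
Lemma cr_div (x : R) k : cr (x / k.+1%:R) = cr x / k.+1%:R.
Proof.
have k0 : (k.+1%:R : C) != 0 by rewrite pnatr_eq0.
by apply: (mulIf k0); rewrite mulfVK// -cr_nat -crM mulfVK// pnatr_eq0.
Qed.

Lemma spc_om B i j : \sum_k spc B i k * cr (om k j) = cr (B i j).
Proof.
have E : B *m om^T *m om = B by rewrite -mulmxA omega_tr_mul mulmx1.
rewrite -[in RHS]E mxE.
have crs (F : 'I_N -> R) : cr (\sum_k F k) = \sum_k cr (F k).
  by apply: (big_morph (@cr R)) => // x y; rewrite crD.
by rewrite crs; apply: eq_bigr => k _; rewrite /spc -crM.
Qed.

Section Abstract.
Variables (Q : algType C) (u : 'I_N -> Q).
Hypothesis uu : forall i j,
  u i * u j = (-1 : C) ^+ (par i && par j) *: (u j * u i) + (ih * cr (om i j))%:A.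

(** The quadratic element attached to [B] in any algebra whose generators satisfy [uu]; for [Uop] it
    is the operator of [mu_star]. The commutation rules below depend on [uu] alone. *)
Definition amu (B : 'M[R]_N) : Q := \sum_i \sum_k cr ((B *m om^T) i k / 4) *:
  (ih^-1 *: (u i * u k + ((-1 : C) ^+ (par i && par k)) *: (u k * u i))).

Lemma twice (x : Q) : x + x = (2 : C) *: x.
Proof. by rewrite scaler_nat mulr2n. Qed.

(** By [spc_C] the coefficients are symmetric up to the same sign as the quadratic elements, so both
    orderings of a pair contribute equally. *)
Lemma amu_half p B : spo p B ->
  amu B = (2 * ih)^-1 *: \sum_i \sum_k spc B i k *: (u i * u k).
Proof.
move=> SB.
have E1 : amu B = (4 * ih)^-1 *: (\sum_i \sum_k spc B i k *: (u i * u k)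
  + \sum_i \sum_k spc B k i *: (u k * u i)).
  rewrite -big_split /= scaler_sumr; apply: eq_bigr => i _.
  rewrite -big_split /= scaler_sumr; apply: eq_bigr => k _.
  rewrite (spc_C i k SB) !scalerDr !scalerA cr_div /spc.
  by congr (_ *: _ + _ *: _); rewrite invfM; ring.
rewrite E1 [X in _ + X]exchange_big /= twice scalerA; congr (_ *: _).
by field; rewrite ih_neq0.
Qed.

Lemma half_sum (x : Q) : (2 * ih)^-1 *: (ih *: x + ih *: x) = x.
Proof.
rewrite twice !scalerA mulVf ?scale1r// mulf_neq0 ?pnatr_eq0// ih_neq0//.
Qed.

(** Moving [u j] through the two factors of a quadratic term leaves two contractions. By the
    symmetry of [spc B] they give the same sum, which compensates the factor $1/2$ in [amu_half]. *)
Lemma amu_comm p B j : spo p B ->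
  amu B * u j = (-1 : C) ^+ (p && par j) *: (u j * amu B) + \sum_i cr (B i j) *: u i.
Proof.
move=> SB; rewrite (amu_half SB) -scalerAl -scalerAr scalerA [_ * (2 * ih)^-1]mulrC -scalerA.
rewrite -[\sum_i cr (B i j) *: u i]half_sum -scalerDr; congr (_ *: _).
have T i k : u i * u k * u j = ((-1 : C) ^+ (par k && par j) * (-1) ^+ (par i && par j)) *: (u j * (u i * u k))
   + ((-1 : C) ^+ (par k && par j) * (ih * cr (om i j))) *: u k + (ih * cr (om k j)) *: u i.
  rewrite -mulrA uu mulrDr -scalerAr -scalerAr mulr1; congr (_ + _).
  by rewrite (mulrA (u i)) (uu i j) mulrDl -scalerAl -scalerAl mul1r scalerDr !scalerA (mulrA (u j)).
transitivity (\sum_i \sum_k ((-1 : C) ^+ (p && par j) *: (u j * (spc B i k *: (u i * u k)))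
   + (spc B i k * ((-1 : C) ^+ (par k && par j) * (ih * cr (om i j)))) *: u k
   + (spc B i k * (ih * cr (om k j))) *: u i)).
  rewrite mulr_suml; apply: eq_bigr => i _; rewrite mulr_suml; apply: eq_bigr => k _.
  rewrite -scalerAl T !scalerDr !scalerA -scalerAr scalerA; congr (_ *: _ + _ + _).
  have [e|/(spc_par SB) ->] := eqVneq (par i (+) par k) p; last by rewrite mulr0 mul0r.
  by rewrite -e; case: (par i); case: (par k); case: (par j); rewrite /= ?expr0 ?expr1; ring.
under eq_bigr do rewrite !big_split /=.
rewrite !big_split /= -addrA; congr (_ + _).
  rewrite mulr_sumr scaler_sumr; apply: eq_bigr => i _.
  by rewrite mulr_sumr scaler_sumr; apply: eq_bigr => k _.
congr (_ + _).
  rewrite exchange_big scaler_sumr; apply: eq_bigr => k _ /=.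
  rewrite -scaler_suml scalerA; congr (_ *: _).
  rewrite -spc_om mulr_sumr; apply: eq_bigr => i _; rewrite (spc_C i k SB).
  have [e|/omega_par ->] := eqVneq (par i) (par j); last first.
    by rewrite (_ : cr 0 = 0)// !mulr0.
  by rewrite e andbC; case: (_ && _); rewrite ?expr0 ?expr1; ring.
rewrite scaler_sumr; apply: eq_bigr => i _.
rewrite -scaler_suml scalerA -spc_om mulr_sumr; congr (_ *: _).
by apply: eq_bigr => k _; ring.
Qed.

Definition evenv (b : 'cV[R]_N) := forall i, par i -> b i 0 = 0.

Lemma om_odd b i : evenv b -> par i -> (om *m b) i 0 = 0.
Proof.
move=> bE pi; rewrite mxE big1// => l _.
have [pl|pl] := boolP (par l); first by rewrite bE ?mulr0.
by rewrite omega_par ?mul0r// pi (negbTE pl).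
Qed.

(** Conjugation by [W] adds to each generator a scalar proportional to $(\omega b)_j$. Expanding the
    quadratic form produces the linear term twice, which gives the operator of $Bb$, and a constant
    equal to $\frac{i\hbar}{2}\omega(Bb, b)$. *)
Lemma amu_W p B b (W : Q) : spo p B -> evenv b ->
  (forall j, u j * W = W * (u j + (ih * cr ((om *m b) j 0))%:A)) ->
  amu B * W = W * (amu B + \sum_i cr ((B *m b) i 0) *: u i
     + (ih / 2 * cr ((b^T *m om^T *m (B *m b)) 0 0))%:A).
Proof.
move=> SB bE UW; rewrite (amu_half SB).
pose e j : C := ih * cr ((om *m b) j 0).
have crs (F : 'I_N -> R) : cr (\sum_k F k) = \sum_k cr (F k).
  by apply: (big_morph (@cr R)) => // x y; rewrite crD.
have Ce i : \sum_k spc B i k * e k = ih * cr ((B *m b) i 0).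
  have E : B *m om^T *m (om *m b) = B *m b by rewrite mulmxA -(mulmxA B) omega_tr_mul mulmx1.
  rewrite -E [in RHS]mxE crs mulr_sumr.
  by apply: eq_bigr => k _; rewrite /e /spc crM; ring.
have e_odd i : par i -> e i = 0 by move=> pi; rewrite /e om_odd// (_ : cr 0 = 0)// mulr0.
rewrite -scalerAl mulr_suml.
under eq_bigr => i _ do rewrite mulr_suml.
transitivity ((2 * ih)^-1 *: \sum_i \sum_k W * (spc B i k *: (u i * u k)
   + (spc B i k * e k) *: u i + (spc B i k * e i) *: u k + (spc B i k * (e i * e k))%:A)).
  congr (_ *: _); apply: eq_bigr => i _; apply: eq_bigr => k _.
  rewrite -scalerAl -(mulrA (u i)) (UW k) (mulrA (u i)) (UW i) -(mulrA W) scalerAr; congr (_ * _).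
  rewrite -/(e i) -/(e k) mulrDl !mulrDr -!scalerAl -!scalerAr !mul1r !mulr1 !scalerDr !scalerA !addrA.
  by congr (_ + _ *: _); rewrite mulrA.
under eq_bigr => i _ do rewrite -mulr_sumr.
rewrite -mulr_sumr scalerAr; congr (_ * _).
under eq_bigr => i _ do rewrite !big_split /=.
rewrite !big_split /=.
have -> : \sum_i \sum_k (spc B i k * e k) *: u i = ih *: \sum_i cr ((B *m b) i 0) *: u i.
  by rewrite scaler_sumr; apply: eq_bigr => i _; rewrite -scaler_suml Ce scalerA.
have -> : \sum_i \sum_k (spc B i k * e i) *: u k = ih *: \sum_i cr ((B *m b) i 0) *: u i.
  rewrite exchange_big scaler_sumr; apply: eq_bigr => k _ /=; rewrite -scaler_suml scalerA -Ce; congr (_ *: _).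
  apply: eq_bigr => i _; rewrite (spc_C k i SB).
  by have [pi|pi] := boolP (par i); rewrite ?(e_odd i pi) ?mulr0// andbF expr0 mul1r.
rewrite -[X in X + _]addrA 2!scalerDr half_sum; congr (_ + _).
under eq_bigr => i _ do rewrite -scaler_suml.
rewrite -scaler_suml scalerA; congr (_ *: _).
have -> : \sum_i \sum_k spc B i k * (e i * e k) = ih * ih * cr ((b^T *m om^T *m (B *m b)) 0 0).
  rewrite -trmx_mul mxE crs mulr_sumr.
  apply: eq_bigr => i _; under eq_bigr do rewrite mulrCA; rewrite -mulr_sumr Ce.
  by rewrite [_^T _ _]mxE crM /e; ring.
rewrite invfM.
by field; rewrite ih_neq0.
Qed.

End Abstract.

Definition muop (B : 'M[R]_N) : opH := amu Uop B.

Lemma mu_starE B f : Hsmooth f -> mu_star hbar B f = muop B f.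
Proof.
move=> Sf; apply/funext => x; apply/funext => J.
rewrite /mu_star /muop (@opE_sum _ _ (Hsub R m r s))// !fct_sumE; apply: eq_bigr => i _.
rewrite (@opE_sum _ _ (Hsub R m r s))// !fct_sumE; apply: eq_bigr => k _.
by rewrite opHZ// /Hscale mu_quadE.
Qed.

Lemma mu_comm p B j : spo p B ->
  muop B * Uop j = (-1 : C) ^+ (p && par j) *: (Uop j * muop B) + \sum_i cr (B i j) *: Uop i.
Proof. exact/amu_comm/UU. Qed.

Definition Wop (b : 'cV[R]_N) : opH :=
  opW r s hbar (\row_i b (ia r s i) 0) (\row_i b (ib r s i) 0).
Lemma opGW q p k : opG R m k * opW r s hbar q p = opW r s hbar q p * opG R m k :> opH.
Proof. by rewrite opWG. Qed.
Lemma opDW q p k : opD_ R m k * opW r s hbar q p = opW r s hbar q p * opD_ R m k :> opH.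
Proof. by rewrite opWD. Qed.

Lemma UW b j : evenv b -> Uop j * Wop b = Wop b * (Uop j + (ih * cr ((om *m b) j 0))%:A).
Proof.
move=> bE; rewrite mulrDr -scalerAr mulr1.
have [[a -> _]|[a -> _]] := par_cases j.
- rewrite Uop_l /Wop mulrDl -!scalerAl opXW opPW.
  rewrite !mulrDr !mulrN -!scalerAr !mulr1 !scalerDr scalerN !scalerA addrACA -scalerBl; congr (_ + _ *: _).
  rewrite -[b in om *m b](vsubmxK (m1 := m + m)) /omega mul_block_col mul0mx addr0 col_mxEu.
  rewrite -[b in usubmx b](vsubmxK (m1 := m + m)) -[usubmx (col_mx _ _)](vsubmxK (m1 := m)).
  rewrite col_mxKu /omega_even mul_block_col !mul0mx mul1mx mulNmx mul1mx add0r addr0.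
  rewrite /ev_x /ev_p /ev_idx -(splitK a); case: (fintype.split a) => k /=; rewrite ?split_l ?split_r.
  + rewrite col_mxEu !mxE mul0r sub0r mulN1r opprK /ib.
    by apply: complex_ext; rewrite !reimE /=; ring.
  + rewrite col_mxEd !mxE mul0r subr0 /ia.
    by apply: complex_ext; rewrite !reimE /=; ring.
- rewrite Uop_r /Wop mulrDl -!scalerAl opGW opDW mulrDr -!scalerAr.
  rewrite om_odd ?par_r//.
  by rewrite (_ : cr 0 = 0)// mulr0 scale0r addr0.
Qed.

Lemma mu_W p B b : spo p B -> evenv b ->
  muop B * Wop b = Wop b * (muop B + \sum_i cr ((B *m b) i 0) *: Uop i
     + (ih / 2 * cr ((b^T *m om^T *m (B *m b)) 0 0))%:A).
Proof. move=> SB bE; exact: (amu_W SB bE (fun j => UW j bE)). Qed.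

End HeisenbergOps.

(** * Intertwining along unipotent one-parameter groups *)

Section RealIntertwining.
Variables (R : realType) (hbar : R) (m r s : nat).
Variable mu : mp_elt R m -> ('rV[R]_m -> R[i]) -> 'rV[R]_m -> R[i].
Hypothesis Hmu : metaplectic_rep r s hbar mu.
Hypothesis hb0 : hbar != 0.
Local Notation V := 'rV[R]_m.
Local Notation C := R[i].
Local Notation N := (dim_E m r s).
Local Notation H := ('rV[R]_m -> {set 'I_(r + s)} -> R[i]).
Local Notation opH := (op (Hsub R m r s)).
Local Notation ih := (Complex 0 hbar : C).
Local Notation oe := (omega_even R m).

(** Constant in the Grassmann index: [mp_differential] is phrased for functions with values in the
    Grassmann algebra, and single functions are read back at the component [set0]. *)
Definition ext (f : V -> C) : H := fun x _ => f x.
Lemma ext_smooth f : schwartz f -> Hsmooth (ext f). Proof. by move=> Sf J. Qed.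

Definition bigB (B : 'M[R]_(m + m)) : 'M[R]_N := block_mx B 0 0 0.
Definition bigX (X : 'cV[R]_(m + m)) : 'cV[R]_N := col_mx X 0.

Lemma spo_bigB B : B^T *m oe + oe *m B = 0 -> spo false (bigB B).
Proof.
move=> HB; split=> [i j|j k].
  have [[a -> ->]|[a -> ->]] := par_cases i; have [[b -> ->]|[b -> ->]] := par_cases j => //= _.
    by rewrite /bigB block_mxEur mxE.
  by rewrite /bigB block_mxEdl mxE.
rewrite expr0 mul1r; have -> : (bigB B)^T *m omega R m r s = block_mx (B^T *m oe) 0 0 0.
  by rewrite /bigB /omega tr_block_mx !trmx0 mulmx_block !(mul0mx, mulmx0, addr0, add0r).
have -> : omega R m r s *m bigB B = block_mx (oe *m B) 0 0 0.
  by rewrite /bigB /omega mulmx_block !(mul0mx, mulmx0, addr0, add0r).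
have -> (P Q : 'M[R]_N) : P j k + Q j k = (P + Q) j k by rewrite mxE.
by rewrite add_block_mx !addr0 HB block_mx0 mxE.
Qed.

Definition dA B (f : V -> C) : V -> C := fun x => muop hbar (bigB B) (ext f) x finset.set0.

Lemma schwartz_dA B f : schwartz f -> schwartz (dA B f).
Proof. by move=> Sf; apply: (@op_in _ _ (Hsub R m r s)); exact: ext_smooth. Qed.

Lemma L2inner_re (f h : V -> C) : complex.Re (L2inner f h) = Bf f h.
Proof.
rewrite /L2inner /= /Bf; congr integral_Rn; apply/funext => x.
by case: (f x) (h x) => [a b] [c d] /=; ring.
Qed.

Lemma sdiff_mu gam B f : mp_one_parameter gam B -> schwartz f ->
  sdiff (fun t => mu (gam t) f) f (dA B f).
Proof.
move=> Hg Sf; have H := mp_differential Hmu finset.set0 Hg (ext_smooth Sf).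
pose q t : V -> C := fun x => Complex t^-1 0 * (mu (gam t) (fun y => ext f y finset.set0) x
  - ext f x finset.set0) - mu_star hbar (block_mx B 0 0 0) (ext f) x finset.set0.
have E : (fun t => Nf (fun x => cr t^-1 * (mu (gam t) f x - f x) - dA B f x)) =
    (fun t => complex.Re (L2inner (q t) (q t))).
  apply/funext => t; rewrite L2inner_re /Nf (_ : (fun x => _) = q t)//.
  apply/funext => x; rewrite /q /dA mu_starE//; exact: ext_smooth.
by rewrite /sdiff E.
Qed.

Lemma Bf_mu g f h : Mp2m g -> schwartz f -> schwartz h -> Bf (mu g f) (mu g h) = Bf f h.
Proof. by move=> Hg Sf Sh; rewrite -!L2inner_re (mp_unitary Hmu). Qed.

Lemma Nf_mu g f : Mp2m g -> schwartz f -> Nf (mu g f) = Nf f.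
Proof. by move=> Hg Sf; rewrite /Nf Bf_mu. Qed.

Lemma one_param0 gam B f : mp_one_parameter gam B -> gam 0 = mp_one R m -> schwartz f -> mu (gam 0) f = f.
Proof. by move=> _ -> Sf; rewrite (mp_rep_one Hmu). Qed.

(** The derivative at 0 of $\langle \mu_t f, \mu_t h\rangle = \langle f, h\rangle$. *)
Lemma dA_skew gam B f h : mp_one_parameter gam B -> gam 0 = mp_one R m -> schwartz f -> schwartz h ->
  Bf (dA B f) h + Bf f (dA B h) = 0.
Proof.
move=> Hg g0 Sf Sh; have Mg t : Mp2m (gam t) by case: Hg.
have := sdiff_Bf (fun t => mp_smooth Hmu (Mg t) Sf) (fun t => mp_smooth Hmu (Mg t) Sh)
  (schwartz_dA B Sf) (schwartz_dA B Sh) (one_param0 Hg g0 Sf) (one_param0 Hg g0 Sh)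
  (sdiff_mu Hg Sf) (sdiff_mu Hg Sh).
have -> : (fun t => Bf (mu (gam t) f) (mu (gam t) h)) = fun=> Bf f h.
  by apply/funext => t; rewrite Bf_mu.
by case=> _ <-; rewrite derive_cst.
Qed.

Definition cq (X : 'cV[R]_(m + m)) : V := (usubmx X)^T.
Definition cp (X : 'cV[R]_(m + m)) : V := (dsubmx X)^T.
Definition uX X f := u0 hbar (cq X) (cp X) f.
Definition omX (X Y : 'cV[R]_(m + m)) : R := dot (cq X) (cp Y) - dot (cq Y) (cp X).

Lemma uX_uX X Y f y : uX X (uX Y f) y = ei (hbar / 2 * omX X Y) * uX (X + Y) f y.
Proof. by rewrite /uX u0_u0 /omX /cq /cp !linearD. Qed.

Lemma omXD X Y Z : omX X (Y + Z) = omX X Y + omX X Z.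
Proof. by rewrite /omX /cq /cp !linearD /= dotDr dotDl; ring. Qed.
Lemma omXC X Y : omX X Y = - omX Y X. Proof. by rewrite /omX opprB. Qed.
Lemma omXX X : omX X X = 0. Proof. by rewrite /omX subrr. Qed.

Lemma uX_scale e X : uX (e *: X) = u0 hbar (e *: cq X) (e *: cp X).
Proof. by rewrite /uX /cq /cp !linearZ. Qed.

Lemma cqZ a X : cq (a *: X) = a *: cq X. Proof. by rewrite /cq !linearZ. Qed.
Lemma cpZ a X : cp (a *: X) = a *: cp X. Proof. by rewrite /cp !linearZ. Qed.
Lemma ustar_scale a (q p : V) g z : ustar hbar (a *: q) (a *: p) g z = cr a * ustar hbar q p g z :> C.
Proof.
rewrite /ustar mulr_sumr; apply: eq_bigr => i _; rewrite /Ae !mxE.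
by apply: complex_ext; rewrite !reimE /=; ring.
Qed.

Lemma Wop_ext X f : schwartz f -> Wop hbar (bigX X) (ext f) = ext (uX X f).
Proof.
move=> Sf; apply/funext => x; apply/funext => J; rewrite /Wop opWE; last exact: ext_smooth.
rewrite /ext /uX; congr (u0 _ _ _ _ _).
  by apply/rowP => i; rewrite mxE /bigX /ia col_mxEu !mxE.
by apply/rowP => i; rewrite mxE /bigX /ib col_mxEu !mxE.
Qed.

Lemma evenv_bigX X : evenv (bigX X).
Proof.
move=> i; have [[a -> ->//]|[a -> _]] := par_cases i.
by rewrite /bigX col_mxEd mxE.
Qed.

Lemma Uop_ext X f x : schwartz f ->
  (\sum_i cr (bigX X i 0) *: Uop hbar i : opH) (ext f) x finset.set0 = ustar hbar (cq X) (cp X) f x.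
Proof.
move=> Sf; have Se := ext_smooth Sf.
have split2 (F : 'I_N -> C) : \sum_i F i = \sum_i F (lshift _ i) + \sum_i F (rshift _ i) by rewrite big_split_ord.
have split1 (F : 'I_(m + m) -> C) : \sum_i F i = \sum_i F (lshift _ i) + \sum_i F (rshift _ i) by rewrite big_split_ord.
rewrite (@opE_sum _ _ (Hsub R m r s))// !fct_sumE split2 [X in _ + X]big1 ?addr0; last first.
  by move=> i _; rewrite opHZ// /bigX col_mxEd mxE mul0r.
rewrite split1 /ustar -big_split; apply: eq_bigr => i _.
rewrite !opHZ// !Uop_l /ev_x /ev_p /ev_idx !split_l !split_r !opHD// !opHZ// opXE// opPE//.
rewrite /bigX !col_mxEu /Ae !mxE.
by apply: complex_ext; rewrite !reimE /=; ring.
Qed.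

Lemma omX_mx X Y : (( (bigX X)^T *m (omega R m r s)^T *m bigX Y) 0 0) = omX Y X.
Proof.
rewrite /bigX tr_col_mx /omega tr_block_mx !trmx0 mul_row_block !mulmx0 !addr0 mul_row_col mulmx0 addr0.
rewrite -[X]vsubmxK -[Y]vsubmxK tr_col_mx omega_even_tr /omega_even.
rewrite opp_block_mx !oppr0 opprK mul_row_block !mulmx0 mulmxN !mulmx1 add0r addr0 mul_row_col.
rewrite /omX /cq /cp !col_mxKu !col_mxKd mulNmx [LHS]mxE; congr (_ + _).
- by rewrite mxE /dot; apply: eq_bigr => i _; rewrite !mxE mulrC.
- by rewrite mxE; congr (- _); rewrite mxE /dot; apply: eq_bigr => i _; rewrite !mxE.
Qed.

Lemma ustar_uX Z X f x : schwartz f ->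
  ustar hbar (cq Z) (cp Z) (uX X f) x =
  uX X (ustar hbar (cq Z) (cp Z) f) x + ih * cr (omX Z X) * uX X f x.
Proof.
move=> Sf; have Se := ext_smooth Sf.
have Su : schwartz (uX X f) by exact: schwartz_u0.
pose UZ : opH := \sum_i cr (bigX Z i 0) *: Uop hbar i.
have E : UZ * Wop hbar (bigX X) = Wop hbar (bigX X) * (UZ + (ih * cr (omX Z X))%:A).
  rewrite /UZ mulr_suml mulrDr mulr_sumr.
  under eq_bigr => i _ do rewrite -scalerAl (UW hbar i (evenv_bigX X)) mulrDr scalerDr.
  rewrite big_split /=; congr (_ + _); first by apply: eq_bigr => i _; rewrite scalerAr.
  under eq_bigr => i _ do rewrite -scalerAr mulr1 scalerA.
  rewrite -scalerAr mulr1 -scaler_suml; congr (_ *: _).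
  have -> : omX Z X = ((bigX Z)^T *m (omega R m r s *m bigX X)) 0 0.
    have := omX_mx X Z; rewrite -[in LHS](trmxK ((bigX X)^T *m _ *m _)) [LHS]mxE !trmx_mul !trmxK.
    by move=> ->.
  rewrite mxE (big_morph (@cr R) (fun x y => crD x y) (erefl : cr 0 = 0)) mulr_sumr.
  by apply: eq_bigr => i _; rewrite [_^T _ _]mxE crM; ring.
rewrite -Uop_ext// -/UZ.
have := congr1 (fun T : opH => T (ext f)) E; rewrite !opEM// Wop_ext// => E2.
rewrite (congr1 (fun g : H => g x finset.set0) E2).
rewrite /Wop opWE; last exact: (@op_in _ _ (Hsub R m r s)).
have -> : \row_i (bigX X) (ia r s i) 0 = cq X by apply/rowP => i; rewrite mxE /bigX /ia col_mxEu !mxE.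
have -> : \row_i (bigX X) (ib r s i) 0 = cp X by apply/rowP => i; rewrite mxE /bigX /ib col_mxEu !mxE.
rewrite /uX /u0 opHD// opHZ// opH1// Uop_ext// /ext; ring.
Qed.

Lemma sdiff_iso Y (F : R -> V -> C) f f' : (forall t, schwartz (F t)) -> schwartz f -> schwartz f' ->
  sdiff F f f' -> sdiff (fun t => uX Y (F t)) (uX Y f) (uX Y f').
Proof.
move=> SF Sf Sf'; rewrite /sdiff.
have E : (fun t => Nf (fun x => cr t^-1 * (uX Y (F t) x - uX Y f x) - uX Y f' x)) =
  (fun t => Nf (fun x => cr t^-1 * (F t x - f x) - f' x)); last by rewrite E.
apply/funext => t; have Sq : schwartz (fun x => cr t^-1 * (F t x - f x) - f' x).
  by apply: schwartzB => //; apply: schwartzZ; apply: schwartzB.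
rewrite -(Nf_u0 hbar (cq Y) (cp Y) Sq); congr Nf; apply/funext => x.
rewrite /uX /u0; ring.
Qed.

Lemma dA_uX B X f : B^T *m oe + oe *m B = 0 -> schwartz f ->
  dA B (uX X f) = fun y => uX X (dA B f) y + uX X (ustar hbar (cq (B *m X)) (cp (B *m X)) f) y
      + ih / 2 * cr (omX (B *m X) X) * uX X f y.
Proof.
move=> HB Sf; have Se := ext_smooth Sf.
have := mu_W hb0 (spo_bigB HB) (evenv_bigX X).
move/(congr1 (fun T : opH => T (ext f))); rewrite !opEM// Wop_ext// => E.
apply/funext => y; rewrite /dA (congr1 (fun g : H => g y finset.set0) E).
rewrite /Wop opWE; last exact: (@op_in _ _ (Hsub R m r s)).
have -> : \row_i (bigX X) (ia r s i) 0 = cq X by apply/rowP => i; rewrite mxE /bigX /ia col_mxEu !mxE.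
have -> : \row_i (bigX X) (ib r s i) 0 = cp X by apply/rowP => i; rewrite mxE /bigX /ib col_mxEu !mxE.
have BX : bigB B *m bigX X = bigX (B *m X) by rewrite /bigB /bigX mul_block_col !mul0mx ?mulmx0 !addr0.
rewrite BX omX_mx -/(uX X _) /uX /u0 !opHD// opHZ// opH1// Uop_ext// -/(dA B f _).
by rewrite /ext; ring.
Qed.

(* Because t |-> <mu_t U(X) f, U(S_t X) mu_t h> has zero derivative. *)
Lemma intertwine_param gam B X f :
  mp_one_parameter gam B -> gam 0 = mp_one R m -> B^T *m oe + oe *m B = 0 ->
  (forall t, (gam t).1 = 1%:M + t *: B) -> schwartz f ->
  forall t, mu (gam t) (uX X f) = uX ((gam t).1 *m X) (mu (gam t) f).
Proof.
move=> Hg g0 HB gE Sf t.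
have Mg u : Mp2m (gam u) by case: Hg.
have gD u v : gam (u + v) = mp_mul (gam u) (gam v) by case: Hg.
have Su Y k : schwartz k -> schwartz (uX Y k) by exact: schwartz_u0.
have Sm u k : schwartz k -> schwartz (mu (gam u) k) by exact: (mp_smooth Hmu (Mg u)).
have mD u v k : schwartz k -> mu (gam (u + v)) k = mu (gam u) (mu (gam v) k).
  by move=> Sk; rewrite gD (mp_rep_mul Hmu).
have m0 k : schwartz k -> mu (gam 0) k = k by exact: one_param0 Hg g0.
have local Y k l : schwartz k -> schwartz l ->
    is_derive (0 : R) (1 : R) (fun e => Bf (mu (gam e) k) (uX ((gam e).1 *m Y) (mu (gam e) l))) 0.
  move=> Sk Sl.
  pose D := B *m Y.
  have pathE e : (gam e).1 *m Y = Y + e *: D by rewrite gE mulmxDl mul1mx -scalemxAl.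
  (* The symmetric splitting $U(Y + eD) = U(eD/2)\,U(Y)\,U(eD/2)$ is free of phases, as $\omega(Y,
     eD/2)$ and $\omega(eD/2, Y)$ cancel. *)
  pose D2 := 2^-1 *: D.
  have uYE e g : uX (Y + e *: D) g = uX (e *: D2) (uX Y (uX (e *: D2) g)).
    apply/funext => y; have D2E : e *: D2 + (Y + e *: D2) = Y + e *: D.
      rewrite addrCA -scalerDr -scalerDl; congr (_ + _ *: _); rewrite -[RHS]scale1r; congr (_ *: _).
      by rewrite -div1r -splitr.
    have -> : uX Y (uX (e *: D2) g) = fun y => ei (hbar / 2 * omX Y (e *: D2)) * uX (Y + e *: D2) g y.
      by apply/funext => z; rewrite uX_uX.
    have uXZ Z c g' z : uX Z (fun z => c * g' z) z = c * uX Z g' z by rewrite /uX /u0 mulrCA.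
    rewrite uXZ.
    rewrite uX_uX D2E mulrA -eiD.
    have -> : hbar / 2 * omX Y (e *: D2) + hbar / 2 * omX (e *: D2) (Y + e *: D2) = 0; last by rewrite ei0 mul1r.
    clear; move: (e *: D2) => Z; rewrite omXD omXX (omXC Z); ring.
  pose F e := mu (gam e) l.
  have uE e : uX (e *: D2) = u0 hbar (e *: cq D2) (e *: cp D2) by exact: uX_scale.
  have SF e : schwartz (F e) by exact: Sm.
  have SdA k' : schwartz k' -> schwartz (dA B k') by exact: schwartz_dA.
  have Sus k' : schwartz k' -> schwartz (ustar hbar (cq D2) (cp D2) k') by exact: schwartz_ustar.
  have d1 : sdiff (fun e => uX (e *: D2) (F e)) l (fun x => ustar hbar (cq D2) (cp D2) l x + dA B l x).
    have -> : (fun e => uX (e *: D2) (F e)) = (fun e => u0 hbar (e *: cq D2) (e *: cp D2) (F e)).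
      by apply/funext => e; rewrite uE.
    apply: (sdiff_comp (W := fun e => u0 hbar (e *: cq D2) (e *: cp D2))
        (Af' := ustar hbar (cq D2) (cp D2) (dA B l))); rewrite //; auto.
    - by move=> e g; exact: schwartz_u0.
    - by move=> e c g g' _ _; exact: u0_lin.
    - by move=> e g; exact: Nf_u0.
    - exact: sdiff_u0.
    - by apply: sdiff_u0; exact: schwartz_dA.
    - exact: sdiff_mu.
  pose f1 := fun x => ustar hbar (cq D2) (cp D2) l x + dA B l x.
  have Sf1 : schwartz f1 by apply: schwartzD; auto.
  have S1 e : schwartz (uX (e *: D2) (F e)) by exact: Su.
  have d2 := sdiff_iso Y S1 Sl Sf1 d1.
  have d3 : sdiff (fun e => uX ((gam e).1 *m Y) (F e)) (uX Y l)
      (fun x => ustar hbar (cq D2) (cp D2) (uX Y l) x + uX Y f1 x).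
    have -> : (fun e => uX ((gam e).1 *m Y) (F e)) =
        (fun e => u0 hbar (e *: cq D2) (e *: cp D2) (uX Y (uX (e *: D2) (F e)))).
      by apply/funext => e; rewrite pathE uYE uE.
    apply: (sdiff_comp (W := fun e => u0 hbar (e *: cq D2) (e *: cp D2))
        (Af' := ustar hbar (cq D2) (cp D2) (uX Y f1))); rewrite //; auto.
    - by move=> e g; exact: schwartz_u0.
    - by move=> e c g g' _ _; exact: u0_lin.
    - by move=> e g; exact: Nf_u0.
    - by apply: sdiff_u0; auto.
    - by apply: sdiff_u0; auto.
  (* The two halves combine with [dA_uX]: the second argument of the pairing has derivative
     $A\,U(Y)l$, with $A$ the generator [dA B], and skew-symmetry of $A$ makes the total derivative
     vanish. *)
  have d3E : (fun x => ustar hbar (cq D2) (cp D2) (uX Y l) x + uX Y f1 x) = dA B (uX Y l).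
    apply/funext => x; rewrite dA_uX// ustar_uX//.
    have c2 : 2 * cr (2^-1 : R) = 1 by rewrite -[2]/(2%:R) -cr_nat -crM mulfV ?pnatr_eq0.
    have usE g z : ustar hbar (cq D) (cp D) g z = 2 * ustar hbar (cq D2) (cp D2) g z.
      have -> : cq D2 = 2^-1 *: cq D by exact: cqZ.
      have -> : cp D2 = 2^-1 *: cp D by exact: cpZ.
      by rewrite ustar_scale mulrA c2 mul1r.
    have -> : ustar hbar (cq D) (cp D) l = fun z => 2 * ustar hbar (cq D2) (cp D2) l z.
      by apply/funext => z; rewrite usE.
    have -> : omX D2 Y = 2^-1 * omX D Y.
      by rewrite /omX /cq /cp !linearZ /= dotZr dotZl; ring.
    have n2 : (2 : C) != 0 by rewrite pnatr_eq0.
    have c3 : cr (2^-1 : R) = 2^-1 by apply: (mulfI n2); rewrite c2 mulfV.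
    rewrite -/D crM c3 /uX /u0 /f1.
    by field.
  rewrite d3E in d3.
  have dk := sdiff_mu Hg Sk.
  have := sdiff_Bf (fun e => Sm e k Sk) (fun e => Su ((gam e).1 *m Y) _ (SF e)) (SdA _ Sk)
    (SdA _ (Su Y _ Sl)) (m0 k Sk) _ dk d3.
  rewrite (dA_skew Hg g0 Sk (Su Y _ Sl)).
  by apply; rewrite /F m0// g0 mul1mx.
pose X0 := X.
have const (h : V -> C) : schwartz h -> forall t,
    Bf (mu (gam t) (uX X f)) (uX ((gam t).1 *m X) (mu (gam t) h)) = Bf f h.
  move=> Sh; pose phi t := Bf (mu (gam t) (uX X f)) (uX ((gam t).1 *m X) (mu (gam t) h)).
  (* The group law brings an arbitrary parameter [u] back to 0, with $X$ replaced by $S_uX$ and both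
     functions moved by $\mu_u$. *)
  have d u : is_derive u (1 : R) phi 0.
    have := local ((gam u).1 *m X) _ _ (Sm u _ (Su X _ Sf)) (Sm u _ Sh).
    have -> : (fun e => Bf (mu (gam e) (mu (gam u) (uX X f))) (uX ((gam e).1 *m ((gam u).1 *m X)) (mu (gam e) (mu (gam u) h))))
       = (fun e : R => phi (e *: 1 + u)).
      by apply/funext => e; rewrite /phi [e *: 1]mulr1 !mD//; [rewrite gD /= mulmxA|exact: Su].
    move=> d0; have du : is_derive u (1 : R) (fun v : R => v - u) 1.
      by have := is_deriveB (is_derive_id u (1 : R)) (is_derive_cst u u (1 : R)); rewrite subr0.
    have d0' : is_derive (u - u) (1 : R) (fun e : R => phi (e *: 1 + u)) 0 by rewrite subrr.
    have := @is_derive1_comp _ (fun e : R => phi (e *: 1 + u)) (fun v => v - u) u _ _ d0' du.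
    rewrite (_ : _ \o _ = phi); last by apply/funext => v; rewrite /= [(v - u) *: 1]mulr1 subrK.
    by rewrite ?mulr0 ?mul0r.
  have p0 : phi 0 = Bf f h by rewrite /phi !m0//; [rewrite g0 mul1mx Bf_u0|exact: Su].
  move=> u; rewrite -p0 -/(phi u); exact: (@is_derive_0_is_cst R phi u 0 d).
have SL : schwartz (mu (gam t) (uX X f)) by apply: Sm; exact: Su.
have SR : schwartz (uX ((gam t).1 *m X) (mu (gam t) f)) by apply: Su; exact: Sm.
apply: Bf_eq => // h' Sh'.
(* Chosen so that $U(S_tX)\mu_t h = h'$; thus the constant pairing tests against every Schwartz
   function. *)
pose h := mu (gam (- t)) (uX (- ((gam t).1 *m X)) h').
have Sh : schwartz h by apply: Sm; exact: Su.
have mh : uX ((gam t).1 *m X) (mu (gam t) h) = h'.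
  rewrite /h -mD ?subrr ?m0; [|exact: Su|exact: Su].
  apply/funext => y; rewrite uX_uX subrr.
  have -> : omX ((gam t).1 *m X) (- ((gam t).1 *m X)) = 0.
    rewrite /omX /cq /cp !linearN /= -[- (dsubmx _)^T]scaleN1r -[- (usubmx _)^T]scaleN1r dotZr dotZl.
    by rewrite subrr.
  rewrite mulr0 ei0 mul1r /uX /cq /cp !linear0 u0_0 //.
by rewrite -mh const// -/h Bf_u0 ?Bf_mu//; exact: Sm.
Qed.

End RealIntertwining.

(** * The Siegel upper half-space *)

Section Siegel.
Variables (R : realType) (m : nat).
Local Notation C := R[i].
Local Notation M := ('M[R[i]^o]_m).
Local Notation sieg := (@siegel R m).

Definition rk1 (v : 'cV[R]_m) : 'M[R]_m := v *m v^T.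
Definition quadf (v : 'cV[R]_m) (tau : M) : C := ((cplx_mx v)^T *m tau *m cplx_mx v) 0 0.

Definition uE (E : 'M[R]_m) : 'M[R]_(m + m) := block_mx 1%:M E 0 1%:M.
Definition lE (E : 'M[R]_m) : 'M[R]_(m + m) := block_mx 1%:M 0 E 1%:M.

Lemma uE_D E F : uE E *m uE F = uE (E + F).
Proof. by rewrite /uE mulmx_block !mulmx1 !mul1mx !mul0mx !mulmx0 !addr0 add0r addrC. Qed.
Lemma lE_D E F : lE E *m lE F = lE (E + F).
Proof. by rewrite /lE mulmx_block !mulmx1 !mul1mx !mul0mx !mulmx0 !addr0 !add0r addrC. Qed.

Lemma uE_symp E : E^T = E -> (uE E)^T *m omega_even R m *m uE E = omega_even R m.
Proof.
move=> ET; rewrite /uE /omega_even tr_block_mx !trmx1 trmx0 ET !mulmx_block.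
by rewrite !(mulmx1, mul1mx, mul0mx, mulmx0, addr0, add0r, mulmxN, mulNmx) ?addNr ?subrr.
Qed.
Lemma lE_symp E : E^T = E -> (lE E)^T *m omega_even R m *m lE E = omega_even R m.
Proof.
move=> ET; rewrite /lE /omega_even tr_block_mx !trmx1 trmx0 ET !mulmx_block.
by rewrite !(mulmx1, mul1mx, mul0mx, mulmx0, addr0, add0r, mulmxN, mulNmx) ?addNr ?subrr.
Qed.

Lemma cplx_mxE p q (S : 'M[R]_(p, q)) i j : cplx_mx S i j = Complex (S i j) 0.
Proof. by rewrite mxE. Qed.
Lemma cplx_mxT p q (S : 'M[R]_(p, q)) : cplx_mx S^T = (cplx_mx S)^T.
Proof. by apply/matrixP => i j; rewrite !mxE. Qed.
Lemma cplx_mx1 n : cplx_mx (1%:M : 'M[R]_n) = 1%:M.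
Proof. by apply/matrixP => i j; rewrite !mxE; case: eqP. Qed.
Lemma cplx_mx0 p q : cplx_mx (0 : 'M[R]_(p, q)) = 0.
Proof. by apply/matrixP => i j; rewrite !mxE. Qed.
Lemma cplx_mxM p q n (S : 'M[R]_(p, q)) (T : 'M[R]_(q, n)) : cplx_mx (S *m T) = cplx_mx S *m cplx_mx T.
Proof.
apply/matrixP => i j; rewrite !mxE; apply/eqP; rewrite eq_complex /=.
rewrite !raddf_sum /=; apply/andP; split; apply/eqP; last first.
  by rewrite big1// => k _; rewrite !mxE /= mulr0 mul0r addr0.
by apply: eq_bigr => k _; rewrite !mxE /= mulr0 subr0.
Qed.

Lemma den_uE E tau : siegel_den (uE E) tau = 1%:M.
Proof. by rewrite /siegel_den block_mxKdl block_mxKdr cplx_mx0 cplx_mx1 mul0mx add0r. Qed.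
Lemma act_uE E tau : siegel_act (uE E) tau = tau + cplx_mx E.
Proof. by rewrite /siegel_act den_uE invmx1 mulmx1 block_mxKul block_mxKur cplx_mx1 mul1mx. Qed.
Lemma siegel_addE E tau : E^T = E -> sieg tau -> sieg (tau + cplx_mx E).
Proof.
move=> ET [tT tP]; split; first by rewrite linearD /= tT -cplx_mxT ET.
move=> v v0; have -> : map_mx (@complex.Im R) (tau + cplx_mx E) = map_mx (@complex.Im R) tau.
  by apply/matrixP => i j; rewrite !mxE /=; case: (tau i j) => a b /=; rewrite addr0.
exact: tP.
Qed.

Lemma quadf_im v (tau : M) : complex.Im (quadf v tau) = (v^T *m map_mx (@complex.Im R) tau *m v) 0 0.
Proof.
rewrite /quadf !mxE raddf_sum; apply: eq_bigr => k _.
rewrite cplx_mxE !mxE.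
case E : (\sum_j _) => [a b] /=; rewrite mulr0 add0r; congr (_ * _).
have -> : b = complex.Im (Complex a b) by [].
rewrite -E raddf_sum; apply: eq_bigr => j _; rewrite !mxE /=.
by case: (tau j k) => x y /=; rewrite mul0r addr0.
Qed.

Lemma cplx_mxZ p q t (S : 'M[R]_(p, q)) : cplx_mx (t *: S) = (Complex t 0 : R[i]^o) *: cplx_mx S.
Proof.
by apply/matrixP => i j; rewrite !mxE /=; apply/eqP; rewrite eq_complex /= !(mul0r, mulr0) subr0 addr0 !eqxx.
Qed.
Lemma den_lE v (t : R) tau :
  siegel_den (lE (t *: rk1 v)) tau = 1%:M + (Complex t 0 : C) *: (cplx_mx v *m ((cplx_mx v)^T *m tau)).
Proof.
rewrite /siegel_den block_mxKdl block_mxKdr cplx_mx1 addrC; congr (_ + _).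
rewrite mulmxA -cplx_mxT -cplx_mxM (@scalemxAl (R[i]^o)).
have <- : cplx_mx (t *: rk1 v) = (Complex t 0 : C) *: cplx_mx (v *m v^T) by apply: cplx_mxZ.
by [].
Qed.
(** The matrix determinant lemma, from two block triangular factorizations of the same matrix
    [Q]. *)
Lemma det_rk1 (F : fieldType) n (c : F) (x : 'cV[F]_n) (y : 'rV[F]_n) :
  \det (1%:M + c *: (x *m y)) = 1 + c * (y *m x) 0 0.
Proof.
pose Q : 'M[F]_(n + 1) := block_mx 1%:M (- c *: x) y 1%:M.
have E1 : \det Q = 1 + c * (y *m x) 0 0.
  have -> : Q = block_mx 1%:M 0 y 1%:M *m block_mx 1%:M (- c *: x) 0 (1%:M + c *: (y *m x)).
    rewrite /Q mulmx_block !mul1mx !mul0mx !mulmx1 !addr0 -scalemxAr scaleNr.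
    by rewrite scaleNr [1%:M + _]addrC addrA addNr add0r.
  by rewrite det_mulmx det_lblock det_ublock !det1 !mul1r det_mx11 !mxE.
rewrite -E1.
have -> : Q = block_mx (1%:M + c *: (x *m y)) (- c *: x) 0 1%:M *m block_mx 1%:M 0 y 1%:M.
  rewrite /Q mulmx_block !mulmx1 !mul1mx !mul0mx !mulmx0 !add0r -scalemxAl -addrA.
  by rewrite !scaleNr (subrr (c *: (x *m y))) addr0.
by rewrite det_mulmx det_ublock det_lblock !det1 !mulr1.
Qed.

(** The automorphy factor of a rank-one lower unipotent. It is affine in [t], and its imaginary part
    has the sign of [t] when $v \ne 0$: hence the restriction to rank one, where a principal root
    can be taken along the whole parameter line. *)
Definition lfac (v : 'cV[R]_m) (t : R) (tau : M) : C := 1 + Complex t 0 * quadf v tau.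

Lemma det_den_lE v t tau : \det (siegel_den (lE (t *: rk1 v)) tau) = lfac v t tau.
Proof. by rewrite den_lE (@det_rk1 (R[i]) m) /lfac /quadf. Qed.

Lemma quadf_im_gt0 v tau : v != 0 -> sieg tau -> 0 < complex.Im (quadf v tau).
Proof. by move=> v0 [_ tP]; rewrite quadf_im; exact: tP. Qed.

Lemma lfac_neq0 v t tau : sieg tau -> lfac v t tau != 0.
Proof.
move=> st; have [->|v0] := eqVneq v 0.
  by rewrite /lfac /quadf cplx_mx0 mulmx0 mxE mulr0 addr0 oner_eq0.
have [->|t0] := eqVneq t 0; first by rewrite /lfac (_ : Complex 0 0 = 0)// mul0r addr0 oner_eq0.
have q0 := quadf_im_gt0 v0 st; rewrite /lfac eq_complex negb_and; apply/orP; right.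
by rewrite /=; case: (quadf v tau) q0 => a b /= b0; rewrite mul0r addr0 add0r mulf_neq0// gt_eqF.
Qed.

(** The Sherman-Morrison formula for the inverse of a rank-one perturbation of the identity. *)
Lemma act_lE v t tau : sieg tau ->
  siegel_act (lE (t *: rk1 v)) tau =
  tau - (Complex t 0 / lfac v t tau : C) *: (tau *m cplx_mx v *m ((cplx_mx v)^T *m tau)).
Proof.
move=> st; rewrite /siegel_act block_mxKul block_mxKur cplx_mx0 cplx_mx1 mul1mx addr0.
have du : siegel_den (lE (t *: rk1 v)) tau \in unitmx.
  by rewrite unitmxE det_den_lE unitfE lfac_neq0.
apply: (canLR (mulmxK du)); rewrite den_lE mulmxBl mulmxDr mulmx1.
set x := cplx_mx v; set y : 'rV_m := _ *m tau.
rewrite -scalemxAr -scalemxAl mulmxDr mulmx1 -scalemxAr (mulmxA tau x y).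
have -> : tau *m x *m y *m (x *m y) = quadf v tau *: (tau *m x *m y).
  rewrite (mulmxA (tau *m x *m y)) -(mulmxA (tau *m x) y x) (mx11_scalar (y *m x)) mul_mx_scalar -scalemxAl.
  by rewrite /quadf /y.
move: (tau *m x *m y) => Z.
have := lfac_neq0 v t st; rewrite /lfac => l0.
move: (Complex t 0) (quadf v tau) l0 => T q l0.
suff -> : T *: Z = (T / (1 + T * q)) *: (Z + T *: (q *: Z)) by rewrite addrK.
rewrite -{2}[Z]scale1r !scalerA -scalerDl scalerA.
by have -> : T / (1 + T * q) * (1 + T * q) = T by rewrite mulfVK.
Qed.

Lemma quad_lin (F : comNzRingType) n (T : 'M[F]_n) (z x : 'cV[F]_n) (a c : F) : T^T = T ->
  ((a *: z + c *: x)^T *m T *m (a *: z + c *: x)) 0 0 =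
  a ^+ 2 * (z^T *m T *m z) 0 0 + 2 * a * c * (z^T *m T *m x) 0 0 + c ^+ 2 * (x^T *m T *m x) 0 0.
Proof.
move=> TT; have -> : (a *: z + c *: x)^T = a *: z^T + c *: x^T by apply/matrixP => i j; rewrite !mxE.
have -> : (z^T *m T *m x) 0 0 = (x^T *m T *m z) 0 0.
  rewrite -[x^T *m T *m z]trmxK [RHS]mxE !trmx_mul trmxK TT mulmxA //.
rewrite !mulmxDl !mulmxDr -!scalemxAl -!scalemxAr !scalerA.
have E (X Y : 'M[F]_1) : (X + Y) 0 0 = X 0 0 + Y 0 0 by rewrite mxE.
have EZ k (X : 'M[F]_1) : (k *: X) 0 0 = k * X 0 0 by rewrite mxE.
rewrite !E !EZ.
have -> : (z^T *m T *m x) 0 0 = (x^T *m T *m z) 0 0.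
  rewrite -[x^T *m T *m z]trmxK [RHS]mxE !trmx_mul trmxK TT mulmxA //.
ring.
Qed.

(** With $L = 1 + tq$, the right side is the Hermitian form of $\mathrm{Im}\,\tau$ at the complex
    vector $Lw - tbv$, written out on its real and imaginary parts; here $w$, $b$, $q$ stand for the
    values of $\tau$ on $(w,w)$, $(w,v)$, $(v,v)$. *)
Lemma im_identity (w b q : C) (t L1 L2 : R) : 0 < L1 ^+ 2 + L2 ^+ 2 ->
  L1 = 1 + t * complex.Re q -> L2 = t * complex.Im q ->
  (L1 ^+ 2 + L2 ^+ 2) * complex.Im (w - Complex t 0 / Complex L1 L2 * b ^+ 2) =
  (L1 ^+ 2 * complex.Im w + 2 * L1 * (- t * complex.Re b) * complex.Im b + (- t * complex.Re b) ^+ 2 * complex.Im q)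
  + (L2 ^+ 2 * complex.Im w + 2 * L2 * (- t * complex.Im b) * complex.Im b + (- t * complex.Im b) ^+ 2 * complex.Im q).
Proof.
case: w b q => [w1 w2] [b1 b2] [q1 q2] /= N0 _ L2E.
have -> : (- t * b1) ^+ 2 * q2 = t * b1 ^+ 2 * L2 by rewrite L2E; ring.
have -> : (- t * b2) ^+ 2 * q2 = t * b2 ^+ 2 * L2 by rewrite L2E; ring.
by field; rewrite gt_eqF.
Qed.

(** By [im_identity] the value times $|L|^2$ is a sum of two values of the positive form
    $\mathrm{Im}\,\tau$. If both vanished, [w] would be a real multiple of [v], and then zero. *)
Lemma im_quad_pos v t tau (w : 'cV[R]_m) : sieg tau -> w != 0 ->
  0 < (w^T *m map_mx (@complex.Im R) (siegel_act (lE (t *: rk1 v)) tau) *m w) 0 0.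
Proof.
move=> st w0; have l0 := lfac_neq0 v t st.
rewrite -quadf_im.
have tT : tau^T = tau by case: st.
pose x := cplx_mx v; pose z := cplx_mx w.
pose b := (z^T *m tau *m x) 0 0 : C.
have E1 : quadf w (siegel_act (lE (t *: rk1 v)) tau) = quadf w tau - Complex t 0 / lfac v t tau * b ^+ 2.
  rewrite act_lE// /quadf -/z mulmxBr mulmxBl mxE; congr (_ + _).
  rewrite mxE; congr (- _); rewrite -scalemxAr -scalemxAl mxE; congr (_ * _).
  have -> : z^T *m (tau *m x *m (x^T *m tau)) *m z = (z^T *m tau *m x) *m (z^T *m tau *m x)^T.
    by rewrite !trmx_mul trmxK tT !mulmxA.
  by rewrite mxE big_ord1 [_^T _ _]mxE expr2.
pose L := lfac v t tau.
(* real vector p + u q with tau-form equal, where z - (t b / L) x *)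
have quadD (a c : R) : complex.Im (quadf (a *: w + c *: v) tau) =
   a ^+ 2 * complex.Im (quadf w tau) + 2 * a * c * complex.Im b + c ^+ 2 * complex.Im (quadf v tau).
  have -> : quadf (a *: w + c *: v) tau =
     Complex a 0 ^+ 2 * quadf w tau + 2 * Complex a 0 * Complex c 0 * b + Complex c 0 ^+ 2 * quadf v tau.
    rewrite /quadf; have -> : cplx_mx (a *: w + c *: v) = (Complex a 0 : R[i]^o) *: z + (Complex c 0 : R[i]^o) *: x.
      by rewrite -!cplx_mxZ; apply/matrixP => i j; rewrite !mxE /=; apply/eqP; rewrite eq_complex /= addr0 !eqxx.
    exact: (quad_lin (F := R[i]) z x _ _ tT).
  clear; move: b (quadf w tau) (quadf v tau) => [b1 b2] [w1 w2] [v1 v2] /=; ring.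
rewrite E1 -/L.
have [v0|v0] := eqVneq v 0.
  have -> : b = 0 by rewrite /b /x v0 cplx_mx0 mulmx0 mxE.
  by rewrite expr0n mulr0 subr0; exact: quadf_im_gt0.
have qv := quadf_im_gt0 v0 st.
have LE : L = Complex (1 + t * complex.Re (quadf v tau)) (t * complex.Im (quadf v tau)).
  rewrite /L /lfac; case: (quadf v tau) => q1 q2.
  by apply/eqP; rewrite eq_complex /= !mul0r subr0 addr0 add0r !eqxx.
move: LE l0; rewrite -/L; case: (L) => L1 L2 [L1E L2E] l0.
have N0 : 0 < L1 ^+ 2 + L2 ^+ 2.
  rewrite lt_def addr_ge0 ?sqr_ge0// andbT paddr_eq0 ?sqr_ge0// !sqrf_eq0.
  by move: l0; rewrite eq_complex /=.
have key : (L1 ^+ 2 + L2 ^+ 2) * complex.Im (quadf w tau - Complex t 0 / Complex L1 L2 * b ^+ 2) =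
  complex.Im (quadf (L1 *: w + (- t * complex.Re b) *: v) tau)
  + complex.Im (quadf (L2 *: w + (- t * complex.Im b) *: v) tau).
  rewrite [X in _ = X + _]quadD [X in _ = _ + X]quadD.
  exact: im_identity.
suff : 0 < complex.Im (quadf (L1 *: w + (- t * complex.Re b) *: v) tau)
  + complex.Im (quadf (L2 *: w + (- t * complex.Im b) *: v) tau) by rewrite -key pmulr_rgt0.
have ge (u : 'cV_m) : 0 <= complex.Im (quadf u tau).
  have [->|u0] := eqVneq u 0; last exact/ltW/quadf_im_gt0.
  by rewrite /quadf cplx_mx0 mulmx0 mxE.
have [t0|t0] := eqVneq t 0.
  apply: ltr_pwDl; [|exact: ge]; apply: quadf_im_gt0 => //.
  by rewrite t0 oppr0 mul0r scale0r addr0 L1E t0 mul0r addr0 scale1r.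
rewrite lt_def addr_ge0 ?ge// andbT paddr_eq0 ?ge//; apply/negP => /andP[/eqP h1 /eqP h2].
have z0 (u : 'cV_m) : complex.Im (quadf u tau) = 0 -> u = 0.
  by move=> e; apply/eqP/negPn/negP => u0; have := quadf_im_gt0 u0 st; rewrite e ltxx.
move/z0: h1 => h1; move/z0: h2 => h2.
have L20 : L2 != 0 by rewrite L2E mulf_neq0// gt_eqF.
(* then w is proportional to v, w = k v, and b = k q, so t b = k (L - 1) *)
have wE : w = (t * complex.Im b / L2) *: v.
  apply: (scalerI L20); rewrite scalerA mulrCA divff// mulr1.
  by apply/eqP; rewrite -subr_eq0 -scaleNr mulNr in h2 *; rewrite h2.
pose k := t * complex.Im b / L2.
have bE : b = Complex k 0 * quadf v tau.
  by rewrite /b /z wE -/k cplx_mxZ linearZ /= -!scalemxAl mxE.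
move: h1; rewrite wE -/k scalerA -scalerDl => /eqP; rewrite scaler_eq0 (negbTE v0) orbF bE => /eqP.
rewrite L1E; case: (quadf v tau) => q1 q2 /=.
rewrite mul0r subr0 => h; have k0 : k = 0 by rewrite -h; ring.
by move: w0; rewrite wE -/k k0 scale0r eqxx.
Qed.

Lemma siegel_lE v t tau : sieg tau -> sieg (siegel_act (lE (t *: rk1 v)) tau).
Proof.
move=> st; split; last by move=> w w0; exact: im_quad_pos.
have tT : tau^T = tau by case: st.
rewrite act_lE// linearB /= linearZ /= tT; congr (_ - _ *: _).
by rewrite !trmx_mul trmxK tT.
Qed.

Definition seg (a b : M) (t : R) : M := (Complex (1 - t) 0 : R[i]^o) *: a + (Complex t 0 : R[i]^o) *: b.
Lemma siegel_seg a b t : 0 <= t <= 1 -> sieg a -> sieg b -> sieg (seg a b t).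
Proof.
move=> /andP[t0 t1] [aT aP] [bT bP]; split.
  by rewrite /seg linearD /= !linearZ /= aT bT.
move=> v v0; have -> : map_mx (@complex.Im R) (seg a b t) =
   (1 - t) *: map_mx (@complex.Im R) a + t *: map_mx (@complex.Im R) b.
  apply/matrixP => i j; rewrite !mxE; case: (a i j) => a1 a2; case: (b i j) => b1 b2 /=.
  by rewrite !mul0r !addr0.
have ap := aP v v0; have bp := bP v v0.
rewrite mulmxDr mulmxDl -!scalemxAr -!scalemxAl.
move: (v^T *m _ *m v) (v^T *m _ *m v) ap bp => X Y ap bp; rewrite !mxE.
have [->|tn] := eqVneq t 0; first by rewrite subr0 mul1r mul0r addr0.
rewrite addrC ltr_wpDr// ?mulr_ge0 ?subr_ge0// ?ltW//.
by rewrite mulr_gt0// lt_def tn.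
Qed.

Definition iI : M := (Complex 0 1 : R[i]^o) *: 1%:M.
Lemma siegel_iI : sieg iI.
Proof.
split; first by rewrite /iI linearZ /= trmx1.
move=> v v0; have -> : map_mx (@complex.Im R) iI = 1%:M.
  apply/matrixP => i j; rewrite !mxE; case: eqP => _ /=; rewrite ?mulr0 ?mulr1 ?mul0r ?addr0 ?add0r//.
rewrite mulmx1 mxE.
have : v != 0 by [].
rewrite lt_def sumr_ge0 => [_|i _]; last by rewrite mxE -expr2 sqr_ge0.
rewrite andbT psumr_eq0 => [|i _]; last by rewrite mxE -expr2 sqr_ge0.
apply: contra v0 => /allP h; apply/eqP/matrixP => i j; rewrite [j]ord1 mxE.
have /= := h i (mem_index_enum i); by rewrite mxE mulf_eq0 orbb => /eqP.
Qed.

End Siegel.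

(** * Generation of the symplectic group *)

Section SymmetricGeneration.
Variables (F : realFieldType) (n : nat).
Variable P : 'M[F]_n -> Prop.
Hypothesis Psym : forall A, A^T = A -> A \in unitmx -> P A.
Hypothesis PM : forall A B, P A -> P B -> P (A *m B).
Local Notation e k := (delta_mx k 0 : 'cV[F]_n).

Lemma ee k : (e k)^T *m e k = 1%:M.
Proof. by rewrite trmx_delta mul_delta_mx; apply/matrixP => i j; rewrite !ord1 !mxE. Qed.

Lemma unit_of (A B : 'M[F]_n) : A *m B = 1%:M -> A \in unitmx.
Proof. by case/mulmx1_unit. Qed.

Lemma P1 : P 1%:M. Proof. by apply: Psym; rewrite ?trmx1 ?unitmx1. Qed.

(** A shear is a product of two symmetric matrices. With $c = e_k - z^T$ and $b = -|z|^2$ one has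
    $c^Tc = 1 - b$, so $N_2 = 1 - cc^T$ has inverse $N_1 = 1 + b^{-1}cc^T$, and $(N_1 + e_ke_k^T)N_2
    = 1 + e_kz$ because $e_k^Tc = 1$. The order of the field gives $b \ne 0$. *)
Lemma P_shear k (z : 'rV[F]_n) : z 0 k = 0 -> P (1%:M + e k *m z).
Proof.
move=> zk; have [->|z0] := eqVneq z 0; first by rewrite mulmx0 addr0; exact: P1.
have ze : z *m e k = 0.
  by apply/matrixP => i j; rewrite !ord1 -colE !mxE.
have ez : (e k)^T *m z^T = 0 by rewrite -trmx_mul ze trmx0.
pose c := e k - z^T.
pose b := - (z *m z^T) 0 0.
have b0 : b != 0.
  rewrite oppr_eq0 mxE psumr_eq0 => [|i _]; last by rewrite mxE -expr2 sqr_ge0.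
  apply: contra z0 => /allP h; apply/eqP/matrixP => i j; rewrite ord1 mxE.
  by have /= := h j (mem_index_enum j); rewrite mxE mulf_eq0 orbb => /eqP.
have cT : c^T = (e k)^T - z by apply/matrixP => i j; rewrite !mxE.
have cc : c^T *m c = (1 - b)%:M.
  rewrite cT mulmxBl !mulmxBr ee ez ze subr0 sub0r opprK.
  rewrite (mx11_scalar (z *m z^T)) -raddfD /=; congr (_%:M).
  by rewrite /b opprK.
have ec : (e k)^T *m c = 1%:M by rewrite /c mulmxBr ee ez subr0.
pose N1 := 1%:M + b^-1 *: (c *m c^T); pose N2 := 1%:M - c *m c^T.
have N12 : N1 *m N2 = 1%:M.
  rewrite /N1 /N2 mulmxDl mul1mx mulmxBr mulmx1 -scalemxAl.
  have -> : c *m c^T *m (c *m c^T) = (1 - b) *: (c *m c^T).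
    by rewrite mulmxA -(mulmxA c) cc mul_mx_scalar -scalemxAl.
  rewrite scalerA -addrA; move: (c *m c^T) => X.
  rewrite -[in - X](scale1r X) -!scalerBl -scaleNr -scalerDl.
  have -> : -1 + (b^-1 - b^-1 * (1 - b)) = 0 by field.
  by rewrite scale0r addr0.
have M2 : (N1 + e k *m (e k)^T) *m N2 = 1%:M + e k *m z.
  rewrite mulmxDl N12 /N2 mulmxBr mulmx1 -(mulmxA (e k)) (mulmxA (e k)^T) ec mul1mx -mulmxBr.
  by rewrite cT opprB addrCA subrr addr0.
have MU : 1%:M + e k *m z \in unitmx.
  apply: (@unit_of _ (1%:M - e k *m z)).
  rewrite mulmxDl mul1mx mulmxBr mulmx1 -(mulmxA (e k)) (mulmxA z) ze mul0mx mulmx0 subr0.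
  by rewrite subrK.
have tS (x : 'cV[F]_n) : (x *m x^T)^T = x *m x^T by rewrite trmx_mul trmxK.
have U2 : N2 \in unitmx by case/mulmx1_unit: N12.
rewrite -M2; apply: PM; apply: Psym => //.
- have -> : (N1 + e k *m (e k)^T)^T = 1%:M^T + b^-1 *: (c *m c^T)^T + (e k *m (e k)^T)^T.
    by apply/matrixP => i j; rewrite !mxE.
  by rewrite trmx1 !tS.
- have : (N1 + e k *m (e k)^T) *m N2 \in unitmx by rewrite M2.
  by rewrite unitmx_mul => /andP[].
- by rewrite linearB /= trmx1 tS.
Qed.

(** The identity matrix with row [k] replaced by [w]: a diagonal matrix times a shear. *)
Lemma P_row k (w : 'rV[F]_n) : w 0 k != 0 ->
  (1%:M + e k *m (w - (e k)^T) \in unitmx) /\ P (1%:M + e k *m (w - (e k)^T)).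
Proof.
move=> wk; pose z := (w 0 k)^-1 *: w - (e k)^T.
have zk : z 0 k = 0 by rewrite !mxE !eqxx mulVf// subrr.
pose D : 'M[F]_n := 1%:M + (w 0 k - 1) *: (e k *m (e k)^T).
have E : D *m (1%:M + e k *m z) = 1%:M + e k *m (w - (e k)^T).
  rewrite /D mulmxDl mul1mx mulmxDr mulmx1 -scalemxAl.
  have -> : e k *m (e k)^T *m (e k *m z) = e k *m z by rewrite mulmxA -(mulmxA (e k)) ee mulmx1.
  have Zs : e k *m w = w 0 k *: (e k *m z) + w 0 k *: (e k *m (e k)^T).
    by rewrite -scalerDr -mulmxDr /z subrK -scalemxAr scalerA divff// scale1r.
  rewrite -addrA; congr (_ + _); rewrite [RHS]mulmxBr [e k *m w]Zs.
  move: (e k *m z) (e k *m (e k)^T) => Z X; rewrite !scalerBl !scale1r.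
  by rewrite addrC -addrA subrK addrC addrA.
have DU : D \in unitmx.
  apply: (@unit_of _ (1%:M + ((w 0 k)^-1 - 1) *: (e k *m (e k)^T))).
  rewrite /D mulmxDl mul1mx mulmxDr mulmx1 -scalemxAl -scalemxAr.
  have -> : e k *m (e k)^T *m (e k *m (e k)^T) = e k *m (e k)^T by rewrite mulmxA -(mulmxA (e k)) ee mulmx1.
  rewrite -addrA scalerA -!scalerDl.
  have -> : (w 0 k)^-1 - 1 + (w 0 k - 1 + (w 0 k - 1) * ((w 0 k)^-1 - 1)) = 0 by field; exact: wk.
  by rewrite scale0r addr0.
have ZU : 1%:M + e k *m z \in unitmx.
  apply: (@unit_of _ (1%:M - e k *m z)).
  have ze : z *m e k = 0 by apply/matrixP => i j; rewrite !ord1 -colE mxE zk mxE.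
  have E0 : e k *m z *m (e k *m z) = 0 by rewrite mulmxA -(mulmxA (e k)) ze mulmx0 mul0mx.
  by rewrite mulmxDl mul1mx [_ *m (1%:M - _)]mulmxBr mulmx1 E0 subr0 subrK.
rewrite -E unitmx_mul DU ZU; split=> //; apply: PM; last exact: P_shear.
apply: Psym => //; rewrite linearD /= linearZ /= trmx1 trmx_mul trmxK //.
Qed.

Lemma row_M k j (w : 'rV[F]_n) :
  row j (1%:M + e k *m (w - (e k)^T)) = delta_mx 0 j + (j == k)%:R *: (w - delta_mx 0 k).
Proof.
by apply/rowP => i; rewrite !mxE big_ord1 !mxE !eqxx /= !andbT [i == j]eq_sym.
Qed.

Definition badrows (A : 'M[F]_n) : {set 'I_n} := [set j | row j A != delta_mx 0 j]%SET.

(** Gaussian elimination, by induction on the number of rows that differ from those of the identity.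
    Transpositions are symmetric, and [P_row] clears one row without disturbing the good ones. *)
Lemma P_unit A : A \in unitmx -> P A.
Proof.
move: {2}(#|badrows A|) (leqnn #|badrows A|) => N; elim: N A => [|N IH] A.
  rewrite leqn0 finset.cards_eq0 => /eqP A0 _; rewrite (_ : A = 1%:M); first exact: P1.
  apply/row_matrixP => i; rewrite row1; apply/eqP/negPn.
  by have := finset.in_set0 i; rewrite -A0 inE => ->.
move=> cA UA; have [A0|/finset.set0Pn[k kI]] := eqVneq (badrows A) finset.set0.
  by apply: IH => //; rewrite A0 cards0.
(* A pivot exists among the bad columns: otherwise row [k] would be a combination of the good rows,
   which are unit vectors, against invertibility. *)
have [l lI Akl] : exists2 l, l \in badrows A & A k l != 0.
  apply/exists_inP; apply: contraT; rewrite negb_exists => /forallP h0.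
  have h j : j \in badrows A -> ~~ (A k j != 0) by move=> jb; have := h0 j; rewrite jb.
  exfalso.
  move: (kI); rewrite inE => /negP; apply.
  have E : row k A = (\sum_(j | j \notin badrows A) A k j *: delta_mx 0 j) *m A.
    rewrite mulmx_suml [LHS]row_sum_delta (bigID (mem (badrows A))) /= big1 ?add0r.
      by apply: eq_bigr => j; rewrite inE negbK => /eqP rj; rewrite -scalemxAl -rowE rj mxE.
    by move=> j /h; rewrite negbK mxE => /eqP ->; rewrite scale0r.
  move: E; rewrite rowE => /(can_inj (mulmxK UA)) E.
  have := congr1 (fun v : 'rV_n => v 0 k) E; rewrite mxE !eqxx summxE big1 => [/eqP|j]; first by rewrite oner_eq0.
  move=> jb; rewrite !mxE eqxx /=; case: (k =P j) => [kj|]; last by rewrite mulr0.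
  by rewrite -kj kI in jb.
pose A1 := A *m tperm_mx k l.
have A1kk : A1 k k != 0 by rewrite /A1 -xcolE mxE tpermL.
have A1r j : j \notin badrows A -> row j A1 = delta_mx 0 j.
  move=> jb; have jk : j != k by apply: contraNneq jb => ->.
  have jl : j != l by apply: contraNneq jb => ->.
  move: (jb); rewrite inE negbK => /eqP rj; rewrite /A1 row_mul rj.
  rewrite -rowE; apply/rowP => i; rewrite !mxE tpermD 1?eq_sym//.
pose M := 1%:M + e k *m (row k A1 - (e k)^T).
have [MU PMM] : M \in unitmx /\ P M by apply: P_row; rewrite mxE.
have kM : row k M = row k A1 by rewrite row_M eqxx scale1r addrCA subrr addr0.
have jM j : j != k -> row j M = delta_mx 0 j.
  by move=> jk; rewrite row_M (negbTE jk) scale0r addr0.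
pose A2 := A1 *m invmx M.
have -> : A = A2 *m M *m tperm_mx k l.
  by rewrite mulmxKV// /A1 -mulmxA -perm_mxM tperm2 perm_mx1 mulmx1.
have TU : (tperm_mx k l : 'M[F]_n) \in unitmx by exact: unitmx_perm.
apply: PM; last first.
  apply: Psym => //; by rewrite tr_perm_mx tpermV.
apply: PM => //; apply: IH; last by rewrite unitmx_mul unitmx_mul UA TU unitmx_inv.
rewrite -ltnS; apply: leq_trans cA; apply: proper_card; apply/fintype.properP; split.
  apply/fintype.subsetP => j; apply: contraLR => jb; rewrite inE negbK; apply/eqP.
  have jk : j != k by apply: contraNneq jb => ->.
  by rewrite /A2 row_mul A1r// -{1}(jM j jk) -row_mul mulmxV// row1.
exists k => //; rewrite inE negbK; apply/eqP.
by rewrite /A2 row_mul -kM -row_mul mulmxV// row1.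
Qed.

End SymmetricGeneration.

(** * Unipotent generators of the symplectic group *)

Section SpGeneration.
Variables (F : realFieldType) (m : nat).
Local Notation Sp := ('M[F]_(m + m)).
Variable G : Sp -> Prop.
Definition uM (E : 'M[F]_m) : Sp := block_mx 1%:M E 0 1%:M.
Definition lM (E : 'M[F]_m) : Sp := block_mx 1%:M 0 E 1%:M.
Definition Jm : Sp := block_mx 0 1%:M (- 1%:M) 0.
Hypothesis Gu : forall E, E^T = E -> G (uM E).
Hypothesis Gl : forall E, E^T = E -> G (lM E).
Hypothesis GM : forall S T, G S -> G T -> G (S *m T).

Lemma G_Ji : G (block_mx 0 (- 1%:M) 1%:M 0).
Proof.
have -> : (block_mx 0 (- 1%:M) 1%:M 0 : Sp) = uM (- 1%:M) *m lM 1%:M *m uM (- 1%:M).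
  by rewrite /uM /lM !mulmx_block !(mulmx0, mul0mx, mulmx1, mul1mx, addr0, add0r, mulmxN, mulNmx, opprK, oppr0) subrr !(mulmx0, mul0mx, mulmx1, mul1mx, addr0, add0r, mulmxN, mulNmx, opprK, oppr0) addNr.
by apply: GM; [apply: GM|]; [apply: Gu|apply: Gl|apply: Gu]; rewrite ?linearN /= trmx1.
Qed.

Definition dg (A : 'M[F]_m) : Sp := block_mx A 0 0 (invmx A)^T.

(** The unipotent factors used here have blocks $A$ and $-A^{-1}$, which is where symmetry of $A$
    enters; general [A] are reached by [P_unit]. *)
Lemma G_dg_sym A : A^T = A -> A \in unitmx -> G (dg A).
Proof.
move=> AT AU; have IT : (invmx A)^T = invmx A by rewrite trmx_inv AT.
have -> : dg A = uM A *m lM (- invmx A) *m uM A *m block_mx 0 (- 1%:M) 1%:M 0.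
  by rewrite /dg IT /uM /lM !mulmx_block !(mulmx0, mul0mx, mulmx1, mul1mx, addr0, add0r, mulmxN, mulNmx, opprK, oppr0) ?mulmxV ?mulVmx// ?(mulmx0, mul0mx, mulmx1, mul1mx, addr0, add0r, mulmxN, mulNmx, opprK, oppr0) ?subrr ?addNr ?oppr0 ?mul0mx ?add0r ?mulNmx ?mulVmx ?opprK ?addr0.
apply: GM; last exact: G_Ji.
by apply: GM; [apply: GM|]; [apply: Gu|apply: Gl|apply: Gu]; rewrite ?linearN /= ?IT.
Qed.

Lemma G_dg A : A \in unitmx -> G (dg A).
Proof.
move=> UA; suff : A \in unitmx /\ G (dg A) by case.
apply: (@P_unit _ _ (fun A => A \in unitmx /\ G (dg A))) => // [B BT BU|B C [BU GB] [CU GC]].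
  by split=> //; exact: G_dg_sym.
split; first by rewrite unitmx_mul BU.
have -> : dg (B *m C) = dg B *m dg C; last exact: GM.
rewrite /dg mulmx_block !(mulmx0, mul0mx, mulmx1, mul1mx, addr0, add0r, mulmxN, mulNmx, opprK, oppr0) -trmx_mul; congr (block_mx _ _ _ (_^T)); rewrite -[LHS]mulmx1.
by apply: (canLR (mulKmx _)); rewrite ?unitmx_mul ?BU// -mulmxA mulKVmx ?mulmxV.
Qed.

Lemma poly_sq_nonroot (p : {poly F}) : p != 0 -> exists z : F, p.[z ^+ 2] != 0.
Proof.
move=> p0.
pose rs : seq F := [seq (i%:R) ^+ 2 | i <- iota 0 (size p)].
have urs : uniq rs.
  rewrite map_inj_in_uniq ?iota_uniq// => i j _ _ /eqP.
  by rewrite eqrXn2 ?ler0n// eqr_nat => /eqP.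
have : ~~ all (root p) rs.
  apply/negP => /(max_poly_roots p0)/(_ urs); by rewrite size_map size_iota ltnn.
by rewrite -has_predC => /hasP[x /mapP[i _ ->] h]; exists i%:R.
Qed.

Lemma symp_tr S : S^T *m Jm *m S = Jm -> S *m Jm *m S^T = Jm.
Proof.
move=> HS.
have JJ : Jm *m Jm = - 1%:M.
  by rewrite /Jm mulmx_block !(mulmx0, mul0mx, mulmx1, mul1mx, addr0, add0r, mulmxN, mulNmx, opprK, oppr0) (scalar_mx_block m m) opp_block_mx !(mulmx0, mul0mx, mulmx1, mul1mx, addr0, add0r, mulmxN, mulNmx, opprK, oppr0).
have SU : (- Jm *m S^T *m Jm) *m S = 1%:M.
  by rewrite -!mulmxA (mulmxA S^T) HS mulNmx JJ opprK.
have h := mulmx1C SU.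
have : S *m (- Jm *m S^T *m Jm) *m Jm = Jm by rewrite h mul1mx.
by rewrite -!mulmxA JJ !mulmxN mulmx1 !mulNmx mulmxN opprK !mulmxA.
Qed.

(** If the lower right block $D$ is invertible, unipotent factors reduce [S] to a block diagonal
    matrix. In general $D$ is first replaced by $zC + D$, by means of [uM (z *: 1)]. As $DC^T$ is
    symmetric, $DD^T - z^2CC^T = (zC + D)(D - zC)^T$, so it is enough that the determinant of the
    left side, a polynomial in $z^2$, is not identically zero. *)
Lemma symp_gen S : S^T *m Jm *m S = Jm -> G S.
Proof.
move=> HS; have HS' := symp_tr HS.
pose A := ulsubmx S; pose B := ursubmx S; pose C := dlsubmx S; pose D := drsubmx S.
have SE : S = block_mx A B C D by rewrite submxK.
move: HS'; rewrite SE /Jm tr_block_mx !mulmx_block !(mulmx0, mul0mx, mulmx1, mul1mx, addr0, add0r, mulmxN, mulNmx, opprK, oppr0) => /eq_block_mx [r1 r2 r3 r4].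
have CD : D *m C^T = C *m D^T by apply/eqP; rewrite eq_sym -subr_eq0 addrC; apply/eqP.
have AD : D *m A^T - C *m B^T = 1%:M.
  by rewrite -[RHS]opprK -r3 opprD opprK addrC.
(* A row vector in the kernel has $|wD|^2 + |wC|^2 = 0$, and then $w = w(DA^T - CB^T) = 0$. *)
have UQ : D *m D^T + C *m C^T \in unitmx.
  rewrite -row_free_unit -kermx_eq0; apply/eqP/row_matrixP => i; rewrite row0.
  set w := row i _.
  have : w *m (D *m D^T + C *m C^T) = 0.
    by rewrite /w -row_mul mulmx_ker row0.
  move/(congr1 (fun X => (X *m w^T) 0 0)).
  have sq (X : 'M[F]_m) : (w *m (X *m X^T) *m w^T) 0 0 = \sum_j (w *m X) 0 j ^+ 2.
    rewrite !mulmxA -mulmxA -trmx_mul mxE; apply: eq_bigr => j _.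
    by rewrite [X in _ * X]mxE expr2.
  rewrite mulmxDr mulmxDl mul0mx [LHS]mxE !sq mxE => /eqP.
  have pos (X : 'M[F]_m) : 0 <= \sum_j (w *m X) 0 j ^+ 2 by apply: sumr_ge0 => j _; exact: sqr_ge0.
  have z (X : 'M[F]_m) : \sum_j (w *m X) 0 j ^+ 2 == 0 -> w *m X = 0.
    rewrite psumr_eq0 => [/allP h|j _]; last exact: sqr_ge0.
    apply/matrixP => a j; rewrite ord1 [RHS]mxE; apply/eqP.
    by have := h j (mem_index_enum j); rewrite sqrf_eq0.
  rewrite paddr_eq0// => /andP[/z wD /z wC].
  by rewrite -[w]mulmx1 -AD mulmxBr !mulmxA wD wC !mul0mx subr0.
(* The variable stands for $z^2$; the value at $-1$ is the determinant of [UQ], so [q] is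
   non-zero. *)
pose q : {poly F} := \det (map_mx polyC (D *m D^T) - 'X *: map_mx polyC (C *m C^T)).
have qE z : q.[z] = \det (D *m D^T - z *: (C *m C^T)).
  rewrite /q -horner_evalE -det_map_mx; congr (\det _); apply/matrixP => i j.
  by rewrite !mxE /= horner_evalE !hornerE.
have q0 : q != 0.
  apply/eqP => q0; move: UQ; rewrite unitmxE unitfE.
  have := qE (-1); by rewrite q0 horner0 scaleN1r opprK => <-; rewrite eqxx.
have [z] := poly_sq_nonroot q0; rewrite qE => dz.
have DU : z *: C + D \in unitmx.
  have E : D *m D^T - z ^+ 2 *: (C *m C^T) = (z *: C + D) *m (D - z *: C)^T.
    have -> : (D - z *: C)^T = D^T - z *: C^T by apply/matrixP => i j; rewrite !mxE.
    rewrite mulmxBr !mulmxDl -!scalemxAl -!scalemxAr CD !scalerA -expr2.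
    by rewrite [z *: _ + D *m _]addrC opprD addrACA subrr addr0.
  by move: dz; rewrite E det_mulmx mulf_eq0 negb_or unitmxE unitfE => /andP[].
pose S1 := S *m uM (z *: 1%:M).
have S1E : S1 = block_mx A (z *: A + B) C (z *: C + D).
  by rewrite /S1 SE /uM mulmx_block !(mulmx0, mul0mx, mulmx1, mul1mx, addr0, add0r, mulmxN, mulNmx, opprK, oppr0) -!scalemxAr !mulmx1.
have zT : (z *: 1%:M : 'M[F]_m)^T = z *: 1%:M by rewrite linearZ /= trmx1.
have -> : block_mx A B C D = S1 *m uM (- (z *: 1%:M)).
  by rewrite S1E /uM mulmx_block !(mulmx0, mul0mx, mulmx1, mul1mx, addr0, add0r, mulmxN, mulNmx, opprK, oppr0) -!scalemxAr !mulmx1 !addKr.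
apply: GM; last by apply: Gu; rewrite linearN /= zT.
move: S1E; set B1 := z *: A + B; set D1 := z *: C + D => S1E.
have uS E : E^T = E -> (uM E)^T *m Jm *m uM E = Jm.
  by move=> ET; rewrite /uM /Jm tr_block_mx ?trmx1 ?trmx0 ET !mulmx_block !(mulmx0, mul0mx, mulmx1, mul1mx, addr0, add0r, mulmxN, mulNmx, opprK, oppr0) ?addNr ?subrr.
have lS E : E^T = E -> (lM E)^T *m Jm *m lM E = Jm.
  by move=> ET; rewrite /lM /Jm tr_block_mx ?trmx1 ?trmx0 ET !mulmx_block !(mulmx0, mul0mx, mulmx1, mul1mx, addr0, add0r, mulmxN, mulNmx, opprK, oppr0) ?addNr ?subrr.
have sM (X Y : Sp) : X^T *m Jm *m X = Jm -> Y^T *m Jm *m Y = Jm -> (X *m Y)^T *m Jm *m (X *m Y) = Jm.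
  by move=> hX hY; rewrite trmx_mul !mulmxA -(mulmxA _ X^T) -(mulmxA _ (X^T *m Jm)) hX.
have HS1 : S1^T *m Jm *m S1 = Jm by apply: sM => //; exact: uS.
have CD1 : D1 *m C^T = C *m D1^T.
  by rewrite /D1 linearD /= linearZ /= mulmxDl mulmxDr -scalemxAl -scalemxAr CD.
pose E1 := invmx D1 *m C.
have E1T : E1^T = E1.
  rewrite /E1 trmx_mul trmx_inv; apply: (canLR (mulmxK _)); first by rewrite unitmx_tr.
  by rewrite -mulmxA -CD1 mulKmx.
pose S2 := S1 *m lM (- E1).
have S2E : S2 = block_mx (A - B1 *m E1) B1 0 D1.
  by rewrite /S2 S1E /lM mulmx_block !(mulmx0, mul0mx, mulmx1, mul1mx, addr0, add0r, mulmxN, mulNmx, opprK, oppr0) /E1 mulKVmx// subrr.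
have -> : S1 = S2 *m lM E1.
  by rewrite S2E S1E /lM mulmx_block !(mulmx0, mul0mx, mulmx1, mul1mx, addr0, add0r, mulmxN, mulNmx, opprK, oppr0) subrK /E1 mulKVmx.
apply: GM; last exact: Gl.
have HS2 : S2^T *m Jm *m S2 = Jm by apply: sM => //; apply: lS; rewrite linearN /= E1T.
move: HS2; rewrite S2E; set A2 := A - _.
rewrite /Jm tr_block_mx !mulmx_block trmx0 !(mulmx0, mul0mx, mulmx1, mul1mx, addr0, add0r, mulmxN, mulNmx, opprK, oppr0) => /eq_block_mx [_ t2 _ t4].
have AU : A2^T \in unitmx by case/mulmx1_unit: t2.
have A2U : A2 \in unitmx by rewrite -unitmx_tr.
have D1E : (invmx A2)^T = D1 by rewrite trmx_inv -[invmx _]mulmx1 -t2 mulKmx.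
have -> : block_mx A2 B1 0 D1 = dg A2 *m uM (invmx A2 *m B1).
  by rewrite /dg /uM mulmx_block !(mulmx0, mul0mx, mulmx1, mul1mx, addr0, add0r, mulmxN, mulNmx, opprK, oppr0) mulKVmx// D1E.
apply: GM; first exact: G_dg.
apply: Gu; have -> : invmx A2 = D1^T by rewrite -D1E trmxK.
rewrite trmx_mul trmxK; apply/eqP; rewrite -subr_eq0 addrC; apply/eqP.
by rewrite -[RHS]t4 addrC.
Qed.

End SpGeneration.

(** * Generators of the metaplectic group *)

Section PrincipalRoot.
Variable R : realType.
Local Notation C := R[i].

Definition psqrt (z : C) : C := if complex.Re (sqrtC z) < 0 then - sqrtC z else sqrtC z.

Lemma psqrtK z : psqrt z ^+ 2 = z.
Proof. by rewrite /psqrt; case: ifP => _; rewrite ?sqrrN sqrtCK. Qed.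

Lemma psqrt_ge0 z : 0 <= complex.Re (psqrt z).
Proof.
rewrite /psqrt; case: ltP => //; case: (sqrtC z) => a b /= a0.
by rewrite oppr_ge0 ltW.
Qed.

Lemma psqrt_gt0 z : (complex.Im z != 0) || (0 < complex.Re z) -> 0 < complex.Re (psqrt z).
Proof.
move=> hz; rewrite lt_def psqrt_ge0 andbT; apply: contraL hz => /eqP e.
rewrite -(psqrtK z); move: e; case: (psqrt z) => a b /= ->.
by rewrite !mul0r mulr0 addr0 eqxx sub0r oppr_gt0 -expr2 -leNgt sqr_ge0.
Qed.

Lemma psqrt_eq z w : w ^+ 2 = z -> 0 < complex.Re w -> psqrt z = w.
Proof.
move=> wz w0; have /eqP := psqrtK z; rewrite -wz eqf_sqr => /orP[/eqP ->//|/eqP e].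
have := psqrt_ge0 (w ^+ 2); rewrite e; case: w w0 {wz e} => a b /= a0.
by rewrite oppr_ge0 leNgt a0.
Qed.

Lemma psqrt1 : psqrt 1 = 1.
Proof. by apply: psqrt_eq; rewrite ?expr1n //= ltr01. Qed.

Lemma im_psqrt z : complex.Im z = 2 * complex.Re (psqrt z) * complex.Im (psqrt z).
Proof. by rewrite -[in LHS](psqrtK z); case: (psqrt z) => a b /=; ring. Qed.

(** For $p^2 = z_0$ and $p'^2 = z$ one has $|p - p'|\,|p + p'| = |z_0 - z|$, and $|p + p'| \ge
    \mathrm{Re}\,p > 0$ because both roots have non-negative real part. *)
Lemma psqrt_cvg (T : Type) (F : set_system T) (FF : Filter F) (z : T -> R[i]^o) (z0 : R[i]^o) :
  0 < complex.Re (psqrt z0) -> z x @[x --> F] --> z0 -> (psqrt (z x) : R[i]^o) @[x --> F] --> (psqrt z0 : R[i]^o).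
Proof.
move=> p0 cz; apply/cvgrPdist_le => e e0.
set p := psqrt z0; have Cp : 0 < (complex.Re p)%:C%C :> C by rewrite ltcR.
have ep : 0 < e * (complex.Re p)%:C%C by rewrite mulr_gt0.
have /cvgrPdist_le /(_ _ ep) := cz; apply: filterS => x.
have -> : z0 - z x = (p - psqrt (z x)) * (p + psqrt (z x)).
  by rewrite -[in LHS](psqrtK z0) -[in LHS](psqrtK (z x)) subr_sqr.
rewrite normrM => h; rewrite -(ler_pM2r Cp); apply: le_trans h.
rewrite ler_wpM2l ?normr_ge0//.
have : (complex.Re p)%:C%C <= (`|complex.Re (p + psqrt (z x))|)%:C%C :> C.
  rewrite lecR; apply: le_trans (ler_norm _); rewrite ReD lerDl psqrt_ge0 //.
by move/le_trans; apply; exact: normc_ge_Re.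
Qed.

Lemma cvg_cr (t : R) : (Complex y 0 : R[i]^o) @[y --> t] --> (Complex t 0 : R[i]^o).
Proof.
apply/cvgrPdist_le => e e0.
have [a1 [a0 ae]] : exists a : R, 0 < a /\ e = a%:C%C.
  case: e e0 => a b; rewrite ltcE /= => /andP[/eqP -> a0]; by exists a.
have /cvgrPdist_le /(_ _ a0) := @cvg_id _ (nbhs t); apply: filterS => y h.
have -> : (Complex t 0 : R[i]^o) - Complex y 0 = (t - y)%:C%C.
  by apply/eqP; rewrite eq_complex /= subrr !eqxx.
by rewrite normc_def /= expr0n addr0 sqrtr_sqr ae lecR.
Qed.

End PrincipalRoot.

(** * Lifts of unipotent matrices to the metaplectic group *)

Section Generators.
Variables (R : realType) (m : nat).
Local Notation C := R[i].
Local Notation M := ('M[R[i]^o]_m).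
Local Notation sieg := (@siegel R m).

Definition gl (v : 'cV[R]_m) (t : R) : mp_elt R m :=
  (lE (t *: rk1 v), fun tau => if `[< sieg tau >] then psqrt (lfac v t tau) else 0).
Definition gu (E : 'M[R]_m) (t : R) : mp_elt R m :=
  (uE (t *: E), fun tau => if `[< sieg tau >] then 1 else 0).

Lemma rk1T (v : 'cV[R]_m) : (rk1 v)^T = rk1 v. Proof. by rewrite /rk1 trmx_mul trmxK. Qed.
Lemma scT t (E : 'M[R]_m) : E^T = E -> (t *: E)^T = t *: E.
Proof. by move=> ET; apply/matrixP => i j; rewrite -{2}ET !mxE. Qed.

Lemma mx_cancel (K : fieldType) n (X Y Z W : 'M[K]_n) : W = Y *m Z -> W \in unitmx -> Z \in unitmx ->
  X *m Z *m invmx W = X *m invmx Y.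
Proof.
move=> -> UW UZ; have UY : Y \in unitmx by move: UW; rewrite unitmx_mul => /andP[].
by rewrite -mulmxA; congr (_ *m _); rewrite -[LHS](mulKmx UY) (mulmxA Y) mulmxV ?mulmx1.
Qed.

Lemma den_mul (S T : 'M[R]_(m + m)) tau : siegel_den T tau \in unitmx ->
  siegel_den (S *m T) tau = siegel_den S (siegel_act T tau) *m siegel_den T tau /\
  cplx_mx (ulsubmx (S *m T)) *m tau + cplx_mx (ursubmx (S *m T)) =
   (cplx_mx (ulsubmx S) *m siegel_act T tau + cplx_mx (ursubmx S)) *m siegel_den T tau.
Proof.
move=> U.
have E : siegel_act T tau *m siegel_den T tau = cplx_mx (ulsubmx T) *m tau + cplx_mx (ursubmx T).
  by rewrite /siegel_act mulmxKV.
have cD (P Q : 'M[R]_m) : cplx_mx (P + Q) = cplx_mx P + cplx_mx Q.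
  by apply/matrixP => i j; rewrite !mxE; apply/eqP; rewrite eq_complex /= addr0 !eqxx.
have ST : S *m T = block_mx
    (ulsubmx S *m ulsubmx T + ursubmx S *m dlsubmx T) (ulsubmx S *m ursubmx T + ursubmx S *m drsubmx T)
    (dlsubmx S *m ulsubmx T + drsubmx S *m dlsubmx T) (dlsubmx S *m ursubmx T + drsubmx S *m drsubmx T).
  by rewrite -{1}(submxK S) -{1}(submxK T) mulmx_block.
rewrite {1}/siegel_den (mulmxDl _ _ (siegel_den T tau)) -(mulmxA _ (siegel_act T tau)) E.
rewrite (mulmxDl (_ *m siegel_act T tau)) -(mulmxA _ (siegel_act T tau)) E /siegel_den.
rewrite ST block_mxKdl block_mxKdr block_mxKul block_mxKur.
by rewrite !cD !cplx_mxM !mulmxDl !mulmxDr !mulmxA; split; rewrite addrACA.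
Qed.

Lemma act_mul (S T : 'M[R]_(m + m)) tau : siegel_den T tau \in unitmx -> siegel_den (S *m T) tau \in unitmx ->
  siegel_act S (siegel_act T tau) = siegel_act (S *m T) tau.
Proof.
move=> UT; have [E1 E2] := den_mul S UT => UST.
by rewrite /siegel_act E2 (mx_cancel _ E1 UST UT).
Qed.

Lemma lfac_unit v t tau : sieg tau -> siegel_den (lE (t *: rk1 v)) tau \in unitmx.
Proof. by move=> st; rewrite unitmxE det_den_lE unitfE lfac_neq0. Qed.

Lemma lfac_cocycle v t u tau : sieg tau ->
  lfac v (t + u) tau = lfac v t (siegel_act (lE (u *: rk1 v)) tau) * lfac v u tau.
Proof.
move=> st; rewrite -!det_den_lE -det_mulmx; congr (\det _).
by rewrite scalerDl -lE_D; have [->] := den_mul (lE (t *: rk1 v)) (lfac_unit v u st).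
Qed.

Lemma lfac_im (v : 'cV[R]_m) t tau : complex.Im (lfac v t tau) = t * complex.Im (quadf v tau).
Proof. by rewrite /lfac; case: (quadf v tau) => a b /=; rewrite mul0r add0r addr0. Qed.

Lemma lfac_v0 t tau : lfac (0 : 'cV[R]_m) t tau = 1.
Proof. by rewrite /lfac /quadf cplx_mx0 mulmx0 mxE mulr0 addr0. Qed.

Lemma lfac_t0 (v : 'cV[R]_m) tau : lfac v 0 tau = 1.
Proof. by rewrite /lfac (_ : Complex 0 0 = 0)// mul0r addr0. Qed.

Lemma lfac_pos v t tau : sieg tau -> 0 < complex.Re (psqrt (lfac v t tau)).
Proof.
move=> st; apply: psqrt_gt0; rewrite lfac_im.
have [->|v0] := eqVneq v 0; first by rewrite lfac_v0 /= ltr01 orbT.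
have [->|t0] := eqVneq t 0; first by rewrite lfac_t0 /= ltr01 orbT.
by rewrite mulf_neq0// gt_eqF// quadf_im_gt0.
Qed.

(** Only $p_3 = -p_1p_2$ has to be excluded. Positivity of the real parts would then force
    $\mathrm{Im}\,p_1\,\mathrm{Im}\,p_2 > 0$; as these imaginary parts have the signs of [t] and
    [u], the three numbers [t], [u], [t + u] share one sign, whereas $\mathrm{Im}\,p_3 =
    -\mathrm{Im}(p_1p_2)$ would have the opposite one. *)
Lemma root_sign (p1 p2 p3 : C) (t u Q1 Q2 : R) :
  0 < complex.Re p1 -> 0 < complex.Re p2 -> 0 < complex.Re p3 ->
  t * Q1 = 2 * complex.Re p1 * complex.Im p1 -> u * Q2 = 2 * complex.Re p2 * complex.Im p2 ->
  (t + u) * Q2 = 2 * complex.Re p3 * complex.Im p3 -> 0 < Q1 -> 0 < Q2 ->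
  p3 ^+ 2 = (p1 * p2) ^+ 2 -> p3 = p1 * p2.
Proof.
move=> + + + + + + + + /eqP; rewrite eqf_sqr => + + + + + + + + /orP[/eqP -> //|/eqP].
case: p1 p2 p3 => [a1 b1] [a2 b2] [a3 b3] /= p1 p2 p3 i1 i2 i3 q1 q2 [ea eb]; exfalso.
have [bb|bb] := lerP (b1 * b2) 0.
  have : 0 < a1 * a2 by rewrite mulr_gt0.
  lra.
have a2' (a : R) : 0 < a -> 0 < 2 * a by move=> a0; rewrite mulr_gt0// ltr0n.
have c1 : (0 < b1) = (0 < t) by rewrite -(pmulr_rgt0 b1 (a2' _ p1)) -i1 pmulr_lgt0.
have c2 : (0 < b2) = (0 < u) by rewrite -(pmulr_rgt0 b2 (a2' _ p2)) -i2 pmulr_lgt0.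
have c3 : (0 < b3) = (0 < t + u) by rewrite -(pmulr_rgt0 b3 (a2' _ p3)) -i3 pmulr_lgt0.
have d1 : (b1 < 0) = (t < 0) by rewrite -(pmulr_rlt0 b1 (a2' _ p1)) -i1 pmulr_llt0.
have d2 : (b2 < 0) = (u < 0) by rewrite -(pmulr_rlt0 b2 (a2' _ p2)) -i2 pmulr_llt0.
have d3 : (b3 < 0) = (t + u < 0) by rewrite -(pmulr_rlt0 b3 (a2' _ p3)) -i3 pmulr_llt0.
have [b1p|b1n|b10] := ltgtP 0 b1; last by rewrite -b10 mul0r ltxx in bb.
  have b2p : 0 < b2 by rewrite -(pmulr_rgt0 b2 b1p).
  have tp : 0 < t by rewrite -c1.
  have up : 0 < u by rewrite -c2.
  have b3p : 0 < b3 by rewrite c3 addr_gt0.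
  have h1 : 0 < a1 * b2 by rewrite mulr_gt0.
  have h2 : 0 < b1 * a2 by rewrite mulr_gt0.
  by move: b3p; rewrite eb; lra.
have b2n : b2 < 0 by rewrite -(nmulr_rgt0 b2 b1n).
have tn : t < 0 by rewrite -d1.
have un : u < 0 by rewrite -d2.
have b3n : b3 < 0 by rewrite d3; lra.
have h1 : a1 * b2 < 0 by rewrite pmulr_rlt0.
have h2 : b1 * a2 < 0 by rewrite pmulr_llt0.
by move: b3n; rewrite eb; lra.
Qed.

Lemma psqrt_cocycle v t u tau : sieg tau ->
  psqrt (lfac v (t + u) tau) = psqrt (lfac v t (siegel_act (lE (u *: rk1 v)) tau)) * psqrt (lfac v u tau).
Proof.
move=> st; have st' := siegel_lE v u st.
have [v0|v0] := eqVneq v 0; first by rewrite v0 !lfac_v0 psqrt1 mulr1.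
have q1 := quadf_im_gt0 v0 st'; have q2 := quadf_im_gt0 v0 st.
have e2 : psqrt (lfac v (t + u) tau) ^+ 2 =
  (psqrt (lfac v t (siegel_act (lE (u *: rk1 v)) tau)) * psqrt (lfac v u tau)) ^+ 2.
  by rewrite [RHS]exprMn psqrtK lfac_cocycle//; apply: f_equal2; rewrite psqrtK.
apply: (root_sign (t := t) (u := u) _ _ _ _ _ _ q1 q2 e2); rewrite -?im_psqrt ?lfac_im//; exact: lfac_pos.
Qed.

Lemma cvg_sum_gen (K : numFieldType) (W : normedModType K) (T : Type) (F : set_system T) (FF : Filter F)
  (I : Type) (s : seq I) (g : I -> T -> W) (l : I -> W) : (forall i, g i y @[y --> F] --> l i) ->
  \sum_(i <- s) g i y @[y --> F] --> \sum_(i <- s) l i.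
Proof.
move=> cg; elim: s => [|a s IH].
  by rewrite big_nil (_ : (fun y => _) = fun=> 0); [exact: cvg_cst|apply/funext => y; rewrite big_nil].
rewrite big_cons (_ : (fun y => _) = fun y => g a y + \sum_(i <- s) g i y); first exact: cvgD.
by apply/funext => y; rewrite big_cons.
Qed.

Definition cont_at (f : M -> R[i]^o) (x : M) := f y @[y --> x] --> f x.
Lemma cont_cst c x : cont_at (fun=> c) x. Proof. exact: (@cvg_cst _ c _ (nbhs x) (nbhs_filter x)). Qed.
Lemma cont_entry i j x : cont_at (fun y => y i j) x.
Proof. exact: coord_continuous. Qed.
Lemma contD f g x : cont_at f x -> cont_at g x -> cont_at (fun y => f y + g y) x.
Proof. exact: (@cvgD _ _ _ (nbhs x) (nbhs_filter x)). Qed.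
Lemma contM f g x : cont_at f x -> cont_at g x -> cont_at (fun y => (f y * g y : R[i])) x.
Proof. exact: (@cvgM _ _ (nbhs x) (nbhs_filter x)). Qed.
Lemma contN f x : cont_at f x -> cont_at (fun y => - f y) x.
Proof. exact: (@cvgN _ _ _ (nbhs x) (nbhs_filter x)). Qed.
Lemma contV f x : f x != 0 -> cont_at f x -> cont_at (fun y => (f y : R[i])^-1) x.
Proof. exact: (@cvgV _ _ (nbhs x) (nbhs_filter x)). Qed.
Lemma cont_sum I (s : seq I) (f : I -> M -> R[i]^o) x : (forall i, cont_at (f i) x) ->
  cont_at (fun y => \sum_(i <- s) f i y) x.
Proof.
exact: (@cvg_sum_gen _ _ _ _ (nbhs_filter x)).
Qed.

Lemma cont_quadf v x : cont_at (fun y => quadf v y : R[i]^o) x.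
Proof.
have -> : (fun y => quadf v y : R[i]^o) = fun y => \sum_j (\sum_k Complex (v k 0) 0 * y k j) * Complex (v j 0) 0.
  apply/funext => y; rewrite /quadf mxE; apply: eq_bigr => j _; rewrite mxE cplx_mxE; congr (_ * _).
  by apply: eq_bigr => k _; rewrite mxE cplx_mxE.
apply: cont_sum => j; apply: contM; last exact: cont_cst.
by apply: cont_sum => k; apply: contM; [exact: cont_cst|exact: cont_entry].
Qed.

Lemma cont_lfac v t x : cont_at (fun y => lfac v t y : R[i]^o) x.
Proof. by apply: contD; [exact: cont_cst|apply: contM; [exact: cont_cst|exact: cont_quadf]]. Qed.

Lemma within_of_cont (g : M -> R[i]^o) :
  (forall x, sieg x -> cont_at g x) -> {within sieg, continuous (fun x => if `[< sieg x >] then g x else 0)}.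
Proof.
move=> cg; set G := (fun x0 => _).
have GE y : sieg y -> G y = g y by move=> sy; rewrite /G asboolT.
apply/subspace_continuousP => x sx; change (G y @[y --> within sieg (nbhs x)] --> G x); rewrite GE//.
have : g y @[y --> within sieg (nbhs x)] --> g x by apply: cvg_within_filter; exact: cg.
apply: cvg_trans; apply: near_eq_cvg; rewrite near_withinE.
by apply: (@filterS _ _ (nbhs_filter x) setT) => [y _ sy|]; [rewrite GE|exact: filterT].
Qed.

Lemma gl_Mp v t : Mp2m (gl v t).
Proof.
split=> /=.
- exact/lE_symp/scT/rk1T.
- apply: (@within_of_cont (fun y => psqrt (lfac v t y))) => x sx.
  have p := lfac_pos v t sx; have c := @cont_lfac v t x.
  exact: (@psqrt_cvg _ _ _ (nbhs_filter x) _ _ p c).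
- by move=> tau st; rewrite asboolT// psqrtK det_den_lE.
- by move=> tau st; rewrite asboolF.
Qed.

Lemma gu_Mp E t : E^T = E -> Mp2m (gu E t).
Proof.
move=> ET; split=> /=.
- exact/uE_symp/scT.
- by apply: (@within_of_cont (fun=> 1)) => x sx; exact: cont_cst.
- by move=> tau st; rewrite asboolT// den_uE det1 expr1n.
- by move=> tau st; rewrite asboolF.
Qed.

Lemma is_derive_affine (a b : R) : is_derive (0 : R) (1 : R) (fun t => a + t * b) b.
Proof.
have := is_deriveD (is_derive_cst a (0 : R) 1) (is_deriveZ b (is_derive_id (0 : R) (1 : R))).
rewrite add0r [b *: 1]mulr1 => h.
by rewrite (_ : (fun t => _) = (cst a + b \*: id))//; apply/funext => t; rewrite /= mulrC.
Qed.

Definition lB (v : 'cV[R]_m) : 'M[R]_(m + m) := block_mx 0 0 (rk1 v) 0.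
Definition uB (E : 'M[R]_m) : 'M[R]_(m + m) := block_mx 0 E 0 0.

Lemma lE_aff v t : lE (t *: rk1 v) = 1%:M + t *: lB v.
Proof. by rewrite /lE /lB scale_block_mx !scaler0 (scalar_mx_block m m) add_block_mx !addr0 add0r. Qed.
Lemma uE_aff E t : uE (t *: E) = 1%:M + t *: uB E.
Proof. by rewrite /uE /uB scale_block_mx !scaler0 (scalar_mx_block m m) add_block_mx !addr0 add0r. Qed.

Lemma gl_param v : mp_one_parameter (gl v) (lB v).
Proof.
split.
- exact: gl_Mp.
- move=> t u; rewrite /gl /mp_mul /=; congr pair; first by rewrite scalerDl lE_D.
  apply/funext => tau; case: asboolP => st; last by rewrite mulr0.
  by rewrite asboolT ?psqrt_cocycle//; exact: siegel_lE.
- move=> tau st t /=; rewrite asboolT//; apply: psqrt_cvg; first exact: lfac_pos.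
  rewrite /lfac; apply: cvgD; first exact: cvg_cst.
  apply: (@cvgM _ _ _ _ (fun t : R => Complex t 0 : R[i]^o)); last exact: cvg_cst.
  exact: cvg_cr.
- move=> i j; have -> : (fun t => (gl v t).1 i j) = fun t => (1%:M : 'M[R]_(m + m)) i j + t * lB v i j.
    by apply/funext => t; rewrite /= lE_aff mxE [X in _ + X]mxE.
  exact: is_derive_affine.
Qed.

Lemma gu_param E : E^T = E -> mp_one_parameter (gu E) (uB E).
Proof.
move=> ET; split.
- by move=> t; exact: gu_Mp.
- move=> t u; rewrite /gu /mp_mul /=; congr pair; first by rewrite scalerDl uE_D.
  apply/funext => tau; case: asboolP => st; last by rewrite mulr0.
  by rewrite asboolT ?mulr1// act_uE; apply: siegel_addE => //; exact: scT.
- by move=> tau st t /=; exact: cvg_cst.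
- move=> i j; have -> : (fun t => (gu E t).1 i j) = fun t => (1%:M : 'M[R]_(m + m)) i j + t * uB E i j.
    by apply/funext => t; rewrite /= uE_aff mxE [X in _ + X]mxE.
  exact: is_derive_affine.
Qed.

Lemma gl0 v : gl v 0 = mp_one R m.
Proof.
rewrite /gl /mp_one; congr pair; first by rewrite lE_aff scale0r addr0.
by apply/funext => tau; case: asboolP => st //; rewrite lfac_t0 psqrt1.
Qed.
Lemma gu0 E : gu E 0 = mp_one R m.
Proof. by rewrite /gu /mp_one; congr pair; rewrite uE_aff scale0r addr0. Qed.

Lemma lB_sp v : (lB v)^T *m omega_even R m + omega_even R m *m lB v = 0.
Proof.
rewrite /lB /omega_even tr_block_mx !trmx0 rk1T !mulmx_block.
by rewrite !(mulmx0, mul0mx, mulmx1, mul1mx, addr0, add0r, mulmxN, mulNmx) add_block_mx !addr0 addNr block_mx0.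
Qed.
Lemma uB_sp E : E^T = E -> (uB E)^T *m omega_even R m + omega_even R m *m uB E = 0.
Proof.
move=> ET; rewrite /uB /omega_even tr_block_mx !trmx0 ET !mulmx_block.
by rewrite !(mulmx0, mul0mx, mulmx1, mul1mx, addr0, add0r, mulmxN, mulNmx) add_block_mx !addr0 subrr block_mx0.
Qed.

(** What right multiplication by [h] requires in order to stay in [Mp2m]. It is checked on the
    unipotent generators, whose action on the half-space is explicit. *)
Definition nice (h : mp_elt R m) := [/\ Mp2m h, forall tau, sieg tau -> siegel_den h.1 tau \in unitmx,
  forall tau, sieg tau -> sieg (siegel_act h.1 tau) &
  forall tau, sieg tau -> siegel_act h.1 x @[x --> within sieg (nbhs tau)] --> siegel_act h.1 tau].

Lemma nice_gu E t : E^T = E -> nice (gu E t).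
Proof.
move=> ET; split; first exact: gu_Mp.
    by move=> tau st /=; rewrite den_uE unitmx1.
  by move=> tau st /=; rewrite act_uE; apply: siegel_addE => //; exact: scT.
move=> tau st /=; rewrite act_uE.
under eq_fun do rewrite act_uE.
by apply: cvgD; [exact: cvg_within|exact: cvg_cst].
Qed.

Lemma nice_gl v t : nice (gl v t).
Proof.
split; [exact: gl_Mp|by move=> tau st /=; exact: lfac_unit|by move=> tau st /=; exact: siegel_lE|move=> tau st].
pose f i j (y : M) : R[i]^o := y i j - Complex t 0 / lfac v t y * ((\sum_k y i k * Complex (v k 0) 0) * \sum_k Complex (v k 0) 0 * y k j).
have fE y : sieg y -> siegel_act (gl v t).1 y = \sum_i \sum_j f i j y *: delta_mx i j.
  move=> sy; rewrite /= act_lE// [LHS]matrix_sum_delta; apply: eq_bigr => i _; apply: eq_bigr => j _.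
  congr (_ *: _); rewrite !mxE; congr (_ - _ * _); rewrite big_ord1 !mxE; congr (_ * _).
    by apply: eq_bigr => k _; rewrite cplx_mxE.
  by apply: eq_bigr => k _; rewrite mxE cplx_mxE.
have cf i j : cont_at (f i j) tau.
  apply: contD; first exact: cont_entry.
  apply: contN; apply: contM.
    apply: contM; first exact: cont_cst.
    by apply: contV; [exact: lfac_neq0|exact: cont_lfac].
  apply: contM; apply: cont_sum => k; apply: contM; try exact: cont_cst; exact: cont_entry.
have : \sum_i \sum_j f i j y *: delta_mx i j @[y --> within sieg (nbhs tau)] --> (\sum_i \sum_j f i j tau *: delta_mx i j : M).
  apply: (@cvg_sum_gen _ _ _ _ (within_filter sieg (nbhs_filter tau))) => i.
  apply: (@cvg_sum_gen _ _ _ _ (within_filter sieg (nbhs_filter tau))) => j.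
  apply: (@cvgZr_tmp _ _ _ _ (within_filter sieg (nbhs_filter tau))).
  by apply: cvg_within_filter; exact: cf.
rewrite -fE//; apply: cvg_trans; apply: near_eq_cvg; rewrite near_withinE.
by apply: (@filterS _ _ (nbhs_filter tau) setT) => [y _ sy|]; [rewrite fE|exact: filterT].
Qed.

Lemma nice_mul g h : Mp2m g -> nice h -> Mp2m (mp_mul g h).
Proof.
move=> [gS gc gq g0] [[hS hc hq h0] hu hs hcont]; split=> /=.
- by rewrite trmx_mul !mulmxA -(mulmxA h.1^T) -(mulmxA h.1^T) gS.
- apply/subspace_continuousP => x sx /=; apply: cvgM; last first.
    by move/subspace_continuousP : hc; apply.
  move/subspace_continuousP : gc => /(_ _ (hs _ sx)) gx U /gx.
  rewrite /nbhs /= /within /= => nU.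
  have := hcont _ sx _ nU; rewrite /nbhs /= /within /= => hU.
  apply: filterS hU => y yU sy; apply: yU => //; exact: hs.
- move=> tau st; have st' := hs _ st.
  rewrite exprMn gq// hq//.
  by have [-> _] := den_mul g.1 (hu _ st); rewrite det_mulmx.
- by move=> tau st; rewrite h0// mulr0.
Qed.

(** The half-space is convex: along the segment from $iI$ a continuous function with values $\pm 1$
    is constant, by the intermediate value theorem. *)
Lemma siegel_cst_sign (phi : M -> R[i]^o) : {within sieg, continuous phi} ->
  (forall tau, sieg tau -> (phi tau : R[i]) ^+ 2 = 1) ->
  forall tau, sieg tau -> phi tau = phi (iI R m).
Proof.
move=> cphi sq tau st; have s0 := @siegel_iI R m.
have pm x : sieg x -> phi x = 1 \/ phi x = -1.
  move=> sx; have /eqP := sq _ sx; rewrite -[X in _ == X](expr1n _ 2) eqf_sqr => /orP[/eqP ->|/eqP ->]; [left|right] => //.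
pose psi t := complex.Re (phi (seg (iI R m) tau t)).
have seg0 : seg (iI R m) tau 0 = iI R m.
  by rewrite /seg subr0 (_ : Complex 1 0 = 1)// (_ : Complex 0 0 = 0)// scale1r scale0r addr0.
have seg1 : seg (iI R m) tau 1 = tau.
  by rewrite /seg subrr (_ : Complex 1 0 = 1)// (_ : Complex 0 0 = 0)// scale1r scale0r add0r.
have cc t : (Complex y 0 : R[i]^o) @[y --> t] --> (Complex t 0 : R[i]^o).
  exact: cvg_cr.
have cseg t : seg (iI R m) tau y @[y --> t] --> seg (iI R m) tau t.
  apply: cvgD; apply: cvgZr_tmp; last exact: cc.
  have h : (fun y : R => Complex (1 - y) 0 : R[i]^o) = fun y => 1 - (Complex y 0 : R[i]^o).
    by apply/funext => y; apply/eqP; rewrite eq_complex /= subr0 !eqxx.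
  have -> : (Complex (1 - t) 0 : R[i]^o) = 1 - (Complex t 0 : R[i]^o) by move/(congr1 (fun f => f t)): h.
  by rewrite h; exact: (@cvgB _ _ _ (nbhs t) (nbhs_filter t) _ _ _ _ (@cvg_cst _ _ _ (nbhs t) (nbhs_filter t)) (cc t)).
have st01 t : `[0, 1]%classic t -> sieg (seg (iI R m) tau t).
  by move=> /= t01; apply: siegel_seg => //; move: t01; rewrite in_itv.
have cpsi : {within `[0, 1], continuous psi}.
  apply/subspace_continuousP => t t01.
  have h : phi y @[y --> within sieg (nbhs (seg (iI R m) tau t))] --> phi (seg (iI R m) tau t).
    by move/subspace_continuousP : (cphi) => /(_ _ (st01 _ t01)).
  change (psi y @[y --> within `[0, 1]%classic (nbhs t)] --> psi t).
  apply/cvgrPdist_le => e e0.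
  have ec : 0 < e%:C%C :> R[i] by rewrite ltcR.
  have {}h : \forall y \near nbhs (seg (iI R m) tau t), sieg y -> `|phi (seg (iI R m) tau t) - phi y| <= e%:C%C.
    by have /cvgrPdist_le /(_ _ ec) := h; rewrite near_withinE.
  have hn : \forall y \near nbhs t, sieg (seg (iI R m) tau y) ->
      `|phi (seg (iI R m) tau t) - phi (seg (iI R m) tau y)| <= e%:C%C := cseg t _ h.
  rewrite near_withinE; apply: (@filterS _ _ (nbhs_filter t) _ _ _ hn) => y hy y01.
  rewrite -lecR; apply: le_trans (hy (st01 _ y01)).
  rewrite /psi -raddfB /=; exact: normc_ge_Re.
have psi1 t : `[0, 1]%classic t -> psi t != 0.
  by move=> /st01 /pm[]; rewrite /psi => ->; rewrite ?raddfN /= ?oppr_eq0 oner_eq0.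
have := IVT (ler01 : (0 : R) <= 1) cpsi; rewrite /psi seg0 seg1 => ivt.
have [e1|e1] := pm _ st; have [e0|e0] := pm _ s0; rewrite ?e1 ?e0//; exfalso.
  have [|c c01 pc] := ivt 0.
    by rewrite e1 e0 raddfN /= ge_min le_max ler01 lerN10 ?orbT.
  by have := @psi1 c c01; rewrite /psi pc eqxx.
have [|c c01 pc] := ivt 0.
  by rewrite e1 e0 raddfN /= ge_min le_max ler01 lerN10 ?orbT.
by have := @psi1 c c01; rewrite /psi pc eqxx.
Qed.

End Generators.

(** * Intertwining by the metaplectic representation *)

Section MetaplecticIntertwining.
Variables (R : realType) (hbar : R) (m r s : nat).
Variable mu : mp_elt R m -> ('rV[R]_m -> R[i]) -> 'rV[R]_m -> R[i].
Hypothesis Hmu : metaplectic_rep r s hbar mu.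
Hypothesis hb0 : hbar != 0.
Local Notation V := 'rV[R]_m.
Local Notation C := R[i].
Local Notation M := ('M[R[i]^o]_m).
Local Notation sieg := (@siegel R m).
Local Notation uX := (@uX R hbar m).

(** Surjectivity on Schwartz functions is carried along because it passes to products; it later
    gives the inverse of [mu g] and enough test functions, without inverses in [Mp2m]. *)
Definition good (g : mp_elt R m) :=
  (forall X f, schwartz f -> mu g (uX X f) = uX (g.1 *m X) (mu g f)) /\
  (forall h, schwartz h -> exists2 f, schwartz f & mu g f = h).

Lemma suX X f : schwartz f -> schwartz (uX X f). Proof. exact: schwartz_u0. Qed.

Lemma good_one : good (mp_one R m).
Proof.
split=> [X f Sf|h Sh]; last by exists h => //; rewrite (mp_rep_one Hmu).
by rewrite !(mp_rep_one Hmu) ?mul1mx//; exact: suX.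
Qed.

Lemma good_mul g h : Mp2m g -> Mp2m h -> good g -> good h -> good (mp_mul g h).
Proof.
move=> Mg Mh [g1 g2] [h1 h2]; split=> [X f Sf|k Sk].
  rewrite !(mp_rep_mul Hmu)//; last exact: suX.
  by rewrite h1// g1 ?mulmxA//; exact: (mp_smooth Hmu).
have [k1 Sk1 e1] := g2 _ Sk; have [k2 Sk2 e2] := h2 _ Sk1.
by exists k2 => //; rewrite (mp_rep_mul Hmu)// e2.
Qed.

Lemma good_param gam B t : mp_one_parameter gam B -> gam 0 = mp_one R m ->
  B^T *m omega_even R m + omega_even R m *m B = 0 ->
  (forall u, (gam u).1 = 1%:M + u *: B) -> good (gam t).
Proof.
move=> Hg g0 HB gE; split=> [X f Sf|h Sh]; first exact: (intertwine_param Hmu hb0 X Hg g0 HB gE Sf).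
have Mg u : Mp2m (gam u) by case: Hg.
exists (mu (gam (- t)) h); first exact: (mp_smooth Hmu).
have gD u v : gam (u + v) = mp_mul (gam u) (gam v) by case: Hg.
by rewrite -(mp_rep_mul Hmu)// -gD subrr g0 (mp_rep_one Hmu).
Qed.

Lemma good_gl v t : good (gl v t).
Proof. by apply: (good_param t (gl_param v)); [exact: gl0|exact: lB_sp|move=> u; exact: lE_aff]. Qed.
Lemma good_gu E t : E^T = E -> good (gu E t).
Proof.
by move=> ET; apply: (good_param t (gu_param ET)); [exact: gu0|exact: uB_sp|move=> u; exact: uE_aff].
Qed.

Definition allgood (S : 'M[R]_(m + m)) := forall phi, Mp2m (S, phi) -> good (S, phi).

(** An arbitrary lift of [S] is recovered as $((S,\varphi)h)h'$, in which $(S,\varphi)h$ is a lift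
    of $Sh$ and $h'$ is good. *)
Lemma allgood_cancel S h h' : nice h -> nice h' -> mp_mul h h' = mp_one R m -> good h' ->
  allgood (S *m h.1) -> allgood S.
Proof.
move=> nh nh' hh' gh' aS phi Mg.
have Mg' := nice_mul Mg nh.
have [Mh' hu' hs' _] := nh'; have [Mh hu hs _] := nh.
have E : (S, phi) = mp_mul (mp_mul (S, phi) h) h'.
  have e1 : h.1 *m h'.1 = 1%:M by exact: (congr1 fst hh').
  rewrite /mp_mul /=; congr pair; first by rewrite -mulmxA e1 mulmx1.
  apply/funext => tau; have [st|st] := pselect (sieg tau); last first.
    have z1 : phi tau = 0 by case: Mg => _ _ _ /(_ tau st).
    have z2 : h'.2 tau = 0 by case: Mh' => _ _ _ /(_ tau st).
    by rewrite z1 z2 mulr0.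
  have aE : siegel_act h.1 (siegel_act h'.1 tau) = tau.
    have d1 : siegel_den (1%:M : 'M[R]_(m + m)) tau = 1%:M.
      by have := den_uE (0 : 'M[R]_m) tau; rewrite /uE -scalar_mx_block.
    rewrite act_mul ?e1 ?d1 ?unitmx1//; last exact: hu'.
    by have := act_uE (0 : 'M[R]_m) tau; rewrite /uE -scalar_mx_block cplx_mx0 addr0.
  have := congr1 (fun g : mp_elt R m => g.2 tau) hh'; rewrite /= asboolT// aE => e2.
  by rewrite -mulrA e2 mulr1.
by rewrite E; apply: good_mul => //; exact: (aS _ Mg').
Qed.

(** A matrix that may be stripped off on the right. The property is multiplicative, so [symp_gen]
    applies to it, and every lift of [S] is treated at once. *)
Definition killer (w : 'M[R]_(m + m)) := forall S, allgood (S *m w) -> allgood S.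

Lemma killerM w w' : killer w -> killer w' -> killer (w *m w').
Proof. by move=> kw kw' S; rewrite mulmxA => /kw' /kw. Qed.

Lemma killer_u E : E^T = E -> killer (uE E).
Proof.
move=> ET S; have gD : mp_mul (gu E 1) (gu E (-1)) = mp_one R m.
  by have [_ <- _ _] := gu_param ET; rewrite subrr gu0.
have := @allgood_cancel S (gu E 1) (gu E (-1)) (nice_gu 1 ET) (nice_gu (-1) ET) gD (good_gu _ ET).
by rewrite /= scale1r.
Qed.

Lemma killer_rk1 t v : killer (lE (t *: rk1 v)).
Proof.
move=> S; have gD : mp_mul (gl v t) (gl v (- t)) = mp_one R m.
  by have [_ <- _ _] := gl_param v; rewrite subrr gl0.
exact: (@allgood_cancel S (gl v t) (gl v (- t)) (nice_gl _ _) (nice_gl _ _) gD (good_gl _ _)).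
Qed.

(** Polarization, which reduces a symmetric block to the rank-one blocks for which [gl] provides
    lifts. *)
Lemma sym_rk1 (E : 'M[R]_m) : E^T = E ->
  E = \sum_i \sum_j (E i j / 2) *: (rk1 (delta_mx i 0 + delta_mx j 0)
     - rk1 (delta_mx i 0) - rk1 (delta_mx j 0)).
Proof.
move=> ET; have polar (i j : 'I_m) : rk1 (delta_mx i 0 + delta_mx j 0) - rk1 (delta_mx i 0) - rk1 (delta_mx j 0)
    = delta_mx i j + delta_mx j i :> 'M[R]_m.
  rewrite /rk1 linearD /= mulmxDl !mulmxDr !trmx_delta !mul_delta_mx.
  move: (delta_mx i i) (delta_mx i j) (delta_mx j i) (delta_mx j j) => a b c d.
  by rewrite !addrA [LHS](ACl (1*5*4*6*2*3)) /= subrr add0r subrr add0r.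
under eq_bigr => i _ do under eq_bigr => j _ do rewrite polar scalerDr.
under eq_bigr do rewrite big_split /=.
rewrite big_split /= [X in _ + X]exchange_big /= {1}(matrix_sum_delta E) -big_split /=; apply: eq_bigr => i _.
rewrite -big_split /=; apply: eq_bigr => j _; rewrite -scalerDl.
have -> : E j i = E i j by rewrite -{1}ET mxE.
by rewrite -splitr.
Qed.

Lemma killer_l E : E^T = E -> killer (lE E).
Proof.
move=> ET; rewrite (sym_rk1 ET).
have k0 : killer (lE 0) by have := @killer_rk1 0 0; rewrite scale0r.
have kD a b : killer (lE a) -> killer (lE b) -> killer (lE (a + b)).
  by move=> ka kb; rewrite -lE_D; exact: killerM.
apply: (big_ind (fun a => killer (lE a))) => // i _.
apply: (big_ind (fun a => killer (lE a))) => // j _.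
rewrite !scalerBr -!scaleNr.
exact: (kD _ _ (kD _ _ (@killer_rk1 _ _) (@killer_rk1 _ _)) (@killer_rk1 _ _)).
Qed.

Lemma mx0n (X Y : 'M[R]_(m + m)) : m = 0%N -> X = Y.
Proof. by move=> m0; apply/matrixP => -[i im]; exfalso; rewrite m0 in im. Qed.

(** In dimension 0 the half-space is a point, the Weyl operators are trivial and every element is
    its own inverse. The case is separate since [allgood1] needs a coordinate to rotate in. *)
Lemma allgood0 S : m = 0%N -> allgood S.
Proof.
move=> m0 phi Mg; have I0 : 'I_m -> False by case=> i; rewrite m0.
have uE0 X f : uX X f = f.
  apply/funext => y; rewrite /uX /u0 /dot.
  have s0 (F : 'I_m -> R) : \sum_i F i = 0 by rewrite big1// => i; case: (I0 i).
  rewrite !s0 mulr0 subr0 mulr0 ei0 mul1r; congr f.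
  by apply/rowP => i; case: (I0 i).
have sq : mp_mul (S, phi) (S, phi) = mp_one R m.
  rewrite /mp_mul /mp_one /=; congr pair; first exact: mx0n.
  apply/funext => tau; case: asboolP => st; last first.
    have z1 : phi tau = 0 by case: Mg => _ _ _ /(_ tau st).
    by rewrite z1 mulr0.
  have -> : siegel_act S tau = tau by apply/matrixP => i; case: (I0 i).
  rewrite -expr2; case: Mg => _ _ -> // _.
  have -> : siegel_den S tau = 1%:M by apply/matrixP => i; case: (I0 i).
  by rewrite det1.
split=> [X f Sf|h Sh]; first by rewrite !uE0.
exists (mu (S, phi) h); first exact: (mp_smooth Hmu).
by rewrite -(mp_rep_mul Hmu)// sq (mp_rep_one Hmu).
Qed.

(** By [siegel_cst_sign] a lift of the identity is [mp_one] or its negative. The negative one is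
    realized by good elements as the fourth power of a lifted quarter turn in one symplectic
    coordinate plane. *)
Lemma allgood1 : allgood 1%:M.
Proof.
have [/allgood0//|m0] := eqVneq m 0%N.
have i0 : 'I_m by case: (m) m0 => // n _; exact: ord0.
pose v : 'cV[R]_m := delta_mx i0 0; pose E := rk1 v.
have ET : E^T = E by exact: rk1T.
have EE : E *m E = E by rewrite /E /rk1 trmx_delta mul_delta_mx mul_delta_mx.
pose U := gu E 1; pose L := gl v (-1).
have nU : nice U by exact: nice_gu. have nL : nice L by exact: nice_gl.
have MU : Mp2m U by case: nU. have ML : Mp2m L by case: nL.
have GU : good U by exact: good_gu. have GL : good L by exact: good_gl.
(* Right multiplication by $ULU$, a quarter turn in the plane of [i0]. It fixes $iI$, so each step
   multiplies the value at $iI$ by the principal root $p$ of $-i$; four steps give $p^4 = -1$ over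
   the identity matrix. *)
pose step g := mp_mul (mp_mul (mp_mul g U) L) U.
have stepP g : Mp2m g -> good g -> Mp2m (step g) /\ good (step g).
  move=> Mg Gg; have M1 := nice_mul Mg nU; have M2 := nice_mul M1 nL; have M3 := nice_mul M2 nU.
  by split=> //; do 3!(apply: good_mul => //).
have Mone : Mp2m (mp_one R m) by rewrite -(gl0 v); exact: gl_Mp.
pose w := step (step (step (step (mp_one R m)))).
have [Mw Gw] : Mp2m w /\ good w.
  have [a1 b1] := stepP _ Mone good_one; have [a2 b2] := stepP _ a1 b1.
  have [a3 b3] := stepP _ a2 b2; exact: stepP.
have sI := @siegel_iI R m.
pose x : 'cV[R[i]^o]_m := cplx_mx v.
have xE : x = delta_mx i0 0.
  by apply/matrixP => i j; rewrite cplx_mxE !mxE; case: (_ && _).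
have EcE : cplx_mx E = x *m x^T by rewrite /E /rk1 cplx_mxM cplx_mxT.
have xx : x^T *m x = 1%:M.
  by rewrite xE trmx_delta mul_delta_mx; apply/matrixP => i j; rewrite !ord1 !mxE.
(* orbit of i under u, l, u *)
pose t1 : M := iI R m + cplx_mx E.
have s1 : sieg t1 by exact: siegel_addE.
have t1x : t1 *m x = (Complex 1 1 : R[i]^o) *: x.
  rewrite /t1 mulmxDl EcE -mulmxA xx mulmx1 /iI -scalemxAl mul1mx -[X in _ + X]scale1r -scalerDl.
  by congr (_ *: _); apply/eqP; rewrite eq_complex /= add0r addr0 !eqxx.
have xt1 : x^T *m t1 = (Complex 1 1 : R[i]^o) *: x^T.
  by apply: trmx_inj; rewrite trmx_mul trmxK; case: s1 => -> _; rewrite t1x; apply/matrixP => i j; rewrite !mxE.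
have q1 : quadf v t1 = Complex 1 1.
  by rewrite /quadf -/x xt1 -scalemxAl xx !mxE eqxx mulr1.
have l1 : lfac v (-1) t1 = Complex 0 (-1).
  by rewrite /lfac q1; apply/eqP; rewrite eq_complex /= !mulN1r mul0r subr0 addr0 subrr add0r !eqxx.
have a1 : siegel_act U.1 (iI R m) = t1 by rewrite /= scale1r act_uE.
have a2 : siegel_act L.1 t1 = iI R m - cplx_mx E.
  rewrite /= act_lE// -/x l1 t1x xt1 -scalemxAl -scalemxAr scalerA -EcE scalerA /t1.
  rewrite -addrA; congr (_ + _); rewrite -{1}[cplx_mx E]scale1r -scalerBl -[RHS]scaleN1r; congr (_ *: _).
  have n0 : (Complex 0 (-1) : C) != 0 by rewrite eq_complex /= oppr_eq0 oner_eq0 andbF.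
  have -> : (Complex (-1) 0 : C) / Complex 0 (-1) = Complex 0 (-1).
    by apply: (canLR (mulfK n0)); apply/eqP; rewrite eq_complex /=; apply/andP; split; apply/eqP; ring.
  by apply/eqP; rewrite eq_complex /= ; apply/andP; split; apply/eqP; ring.
have a3 : siegel_act U.1 (iI R m - cplx_mx E) = iI R m by rewrite /= scale1r act_uE subrK.
have s2 : sieg (iI R m - cplx_mx E) by rewrite -a2; case: nL => _ _ h _; exact: h.
pose p := psqrt (Complex 0 (-1) : C).
have stepI g : (step g).2 (iI R m) = g.2 (iI R m) * p :> C.
  rewrite /step /mp_mul. cbn [snd].
  rewrite a1 a2 a3 /U /L /gu /gl; cbn [snd]; rewrite !asboolT// l1 -/p.
  by rewrite mulr1 mulr1.
have w2 : w.2 (iI R m) = -1.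
  rewrite /w !stepI /mp_one; cbn [snd]; rewrite asboolT// mul1r.
  have pp : p * p = Complex 0 (-1) by rewrite -expr2 psqrtK.
  rewrite -!mulrA [p * (p * p)]mulrA -mulrA pp mulrA pp.
  by apply/eqP; rewrite eq_complex /=; apply/andP; split; apply/eqP; ring.
have w1 : w.1 = 1%:M.
  rewrite /w /step /mp_mul; cbn [fst]; rewrite mul1mx /U /L /gu /gl; cbn [fst].
  rewrite scale1r scaleN1r -/E.
  set J := uE E; set K := lE (- E).
  have JKJ : J *m K *m J = block_mx (1%:M - E) E (- E) (1%:M - E).
    rewrite /J /K /uE /lE !mulmx_block !(mulmx0, mul0mx, mulmx1, mul1mx, addr0, add0r, mulmxN, mulNmx, mulmxDl, EE).
    by rewrite ?(mulmxBl, mul1mx, EE) ?addNr ?subrr ?add0r ?addr0 ?[- E + 1%:M]addrC ?subrK.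
  rewrite -!mulmxA !(mulmxA J K) !(mulmxA (J *m K)) !mulmxA.
  rewrite JKJ -!(mulmxA _ J K) -!(mulmxA _ (J *m K) J) JKJ.
  have P2 : (block_mx (1%:M - E) E (- E) (1%:M - E) : 'M[R]_(m + m)) *m block_mx (1%:M - E) E (- E) (1%:M - E)
     = block_mx (1%:M - E - E) 0 0 (1%:M - E - E).
    rewrite mulmx_block !(mulmxBl, mulmxBr, mulmx1, mul1mx, mulmxN, mulNmx, EE) !subrr !subr0 ?oppr0 ?addr0 ?add0r ?subr0.
    by congr block_mx; rewrite ?addNr ?subrr ?opprK ?[- E + _]addrC ?oppr0.
  rewrite P2 -mulmxA P2 mulmx_block !mulmx0 !mul0mx !addr0 add0r.
  have -> : (1%:M - E - E) *m (1%:M - E - E) = 1%:M :> 'M[R]_m.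
    rewrite !mulmxBr !mulmxBl !mulmx1 !mul1mx EE [E - E]subrr sub0r !opprK.
    by rewrite subrK subrK.
  by rewrite -scalar_mx_block.
move=> phi [/= _ cphi sphi zphi].
have d1 tau : siegel_den (1%:M : 'M[R]_(m + m)) tau = 1%:M.
  by have := den_uE (0 : 'M[R]_m) tau; rewrite /uE -scalar_mx_block.
have sq tau : sieg tau -> (phi tau : C) ^+ 2 = 1 by move=> st; rewrite sphi// d1 det1.
have cphi0 := siegel_cst_sign cphi sq.
have /eqP := sq _ sI; rewrite -[X in _ == X](expr1n _ 2) eqf_sqr => /orP[/eqP e|/eqP e].
  rewrite (_ : (1%:M, phi) = mp_one R m); first exact: good_one.
  rewrite /mp_one; congr pair; apply/funext => tau; case: asboolP => st; last exact: zphi.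
  by rewrite cphi0.
rewrite (_ : (1%:M, phi) = w) //.
case: Mw => _ cw sw zw; rewrite [w]surjective_pairing w1; congr pair; apply/funext => tau.
have [st|st] := pselect (sieg tau); last by rewrite zphi// zw.
rewrite cphi0// (siegel_cst_sign cw _ st) ?w2//.
by move=> y sy; rewrite sw// w1 d1 det1.
Qed.

(** $S' = S^{-1}$ is symplectic, hence a killer; as $SS' = 1$ has only good lifts, so has $S$. *)
Theorem real_intertwine g : Mp2m g -> good g.
Proof.
case: g => S phi Mg; case: (Mg) => SS _ _ _ .
have trS := @symp_tr R m S SS.
pose om := omega_even R m.
have oo : om *m om = - 1%:M by exact: omega_even_sq.
pose S' := - (om *m S^T *m om).
have ST : S *m S' = 1%:M.
  by rewrite /S' mulmxN !mulmxA (_ : S *m om *m S^T = om) ?oo ?opprK.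
have S'S : S'^T *m om *m S' = om.
  have oT : om^T = - om by exact: omega_even_tr.
  have tN (X : 'M[R]_(m + m)) : (- X)^T = - X^T by apply/matrixP=> i j; rewrite !mxE.
  rewrite /S' tN !trmx_mul trmxK oT !(mulNmx, mulmxN) !opprK !mulmxA.
  have trS' : S *m om *m S^T = om := trS.
  rewrite -(mulmxA (om *m S) om om) oo mulmxN mulmx1 !mulNmx.
  by rewrite -(mulmxA om S om) -(mulmxA om (S *m om)) trS' oo mulNmx mul1mx opprK.
have kS' : killer S'.
  apply: (@symp_gen R m killer) => // [E ET|E ET|a b]; [exact: killer_u|exact: killer_l|exact: killerM].
by apply: (kS' S _ phi Mg); rewrite ST; exact: allgood1.
Qed.

End MetaplecticIntertwining.

(** * The spinor representation *)

Section Clifford.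
Variables (R : realType) (n : nat).
Local Notation C := R[i].
Variables (Q : algType C) (g : 'I_n -> Q).
Implicit Types (I J K : {set 'I_n}).

Definition gp J : Q := \prod_(i <- enum J) g i.

Lemma ord_enum_sorted J : sorted (fun i j : 'I_n => (i < j)%N) (enum J).
Proof.
have -> : enum J = [seq i <- enum 'I_n | i \in J] by rewrite enumT.
rewrite sorted_filter//; first by move=> x y z; exact: ltn_trans.
by have := iota_ltn_sorted 0 n; rewrite -val_enum_ord sorted_map.
Qed.

Lemma enum_min (l : 'I_n) (J : {set 'I_n}) : (forall j, j \in J -> (l < j)%N) -> enum (l |: J) = l :: enum J.
Proof.
move=> lJ; apply: (@irr_sorted_eq _ (fun i j : 'I_n => (i < j)%N)).
- by move=> x y z; exact: ltn_trans.
- by move=> x; rewrite /= ltnn.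
- exact: ord_enum_sorted.
- rewrite /= path_min_sorted ?ord_enum_sorted//.
  by apply/allP => j; rewrite mem_enum => /lJ.
- by move=> j; rewrite inE !mem_enum in_setU1.
Qed.

Lemma gp0 : gp finset.set0 = 1.
Proof. by rewrite /gp enum_set0 big_nil. Qed.

Lemma gp_min (l : 'I_n) (J : {set 'I_n}) : (forall j, j \in J -> (l < j)%N) -> gp (l |: J) = g l * gp J.
Proof. by move=> lJ; rewrite /gp enum_min// big_cons. Qed.

(** [enum] lists a set in increasing order, so adjoining a new minimum multiplies the ordered
    product [gp] on the left. *)
Lemma set_min_ind (P : {set 'I_n} -> Prop) : P finset.set0 ->
  (forall (l : 'I_n) (J : {set 'I_n}), (forall j, j \in J -> (l < j)%N) -> P J -> P (l |: J)) ->
  forall J, P J.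
Proof.
move=> P0 PS J; move: {2}#|J| (leqnn #|J|) => N; elim: N J => [|N IH] J.
  by rewrite leqn0 cards_eq0 => /eqP ->.
move=> cJ; have [->//|/set0Pn[i0 iJ]] := eqVneq J finset.set0.
have [l lJ lmin] := @arg_minnP _ i0 (mem J) (@nat_of_ord n) iJ.
have {}lJ : l \in J := lJ.
rewrite -(finset.setD1K lJ); apply: PS => [j|].
  by rewrite in_setD1 => /andP[jl jJ]; rewrite ltn_neqAle lmin// andbT eq_sym.
by apply: IH; rewrite -ltnS; apply: leq_trans cJ; rewrite [ltnRHS](cardsD1 l) lJ.
Qed.

Let notin_min (l : 'I_n) (J : {set 'I_n}) : (forall j, j \in J -> (l < j)%N) -> l \notin J.
Proof. by move=> lJ; apply/negP => /lJ; rewrite ltnn. Qed.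

Definition tog k J := if k \in J then J :\ k else k |: J.

Lemma below_min (l : 'I_n) (J : {set 'I_n}) : (forall j, j \in J -> (l < j)%N) -> below l J = 0%N.
Proof.
move=> lJ; rewrite /below; apply/eqP; rewrite cards_eq0; apply/eqP/finset.setP => j.
rewrite finset.in_set finset.in_set0; apply/negbTE; rewrite negb_and -implybE; apply/implyP => /lJ.
by move/ltnW; rewrite -leqNgt.
Qed.

Lemma inversionsE I J : inversions I J = (\sum_(i in I) below i J)%N.
Proof.
rewrite /inversions -sum1_card.
rewrite (eq_bigl (fun p : 'I_n * 'I_n => (p.1 \in I) && ((p.2 \in J) && (p.2 < p.1)%N))); last first.
  move=> p; rewrite unfold_in; apply/idP/idP => [/asboolP //|h]; exact/asboolP.
rewrite -(pair_big_dep (fun i => i \in I) (fun i j => (j \in J) && (j < i)%N) (fun _ _ => 1%N)) /=.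
by apply: eq_bigr => i _; rewrite sum1_card /below; apply: eq_card => j; rewrite finset.in_set.
Qed.

Definition sdiffs I J : {set 'I_n} := (I :\: J) :|: (J :\: I).

Lemma in_sdiffs I J i : (i \in sdiffs I J) = (i \in I) (+) (i \in J).
Proof. by rewrite !inE; case: (i \in I); case: (i \in J). Qed.

Lemma sdiffsK I : involutive (sdiffs I).
Proof. by move=> J; apply/finset.setP => i; rewrite !in_sdiffs addbA addbb addFb. Qed.

Variable sq : 'I_n -> R.
Hypothesis gg : forall i j, i != j -> g i * g j = - (g j * g i).
Hypothesis gsq : forall i, g i * g i = (cr (sq i))%:A.

Lemma g_gp k J : g k * gp J =
  ((-1) ^+ below k J * (if k \in J then cr (sq k) else 1)) *: gp (tog k J).
Proof.
elim/set_min_ind: J => [|l J lJ IH].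
  rewrite finset.in_set0 /tog finset.in_set0 below_min ?expr0 ?mul1r ?scale1r; last by move=> j; rewrite finset.in_set0.
  by rewrite gp_min// => j; rewrite finset.in_set0.
have lnJ := notin_min lJ.
have [kl|lk|kl] := ltngtP k l.
- have kJ j : j \in l |: J -> (k < j)%N.
    by rewrite in_setU1 => /orP[/eqP ->//|/lJ]; exact: ltn_trans.
  have knJ := notin_min kJ.
  by rewrite /tog (negbTE knJ) (below_min kJ) (gp_min kJ) expr0 mul1r scale1r.
- have kl : k != l by apply: contraTneq lk => ->; rewrite ltnn.
  rewrite gp_min// mulrA gg// mulNr -mulrA IH -scalerAr.
  rewrite below_setU1// lk /tog !in_setU1 (negbTE kl) /=.
  rewrite exprD expr1 mulN1r mulNr scaleNr; congr (- _); congr (_ *: _).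
  case kJ: (k \in J).
    rewrite -gp_min; last by move=> j; rewrite in_setD1 => /andP[_ /lJ].
    congr gp; apply/finset.setP => j; rewrite !inE.
    by case: (eqVneq j l) => [->|//]; rewrite eq_sym kl.
  rewrite -gp_min; last by move=> j; rewrite in_setU1 => /orP[/eqP ->|/lJ].
  by congr gp; rewrite finset.setUCA.
- have {kl} -> : k = l by apply: val_inj.
  rewrite gp_min// mulrA gsq -scalerAl mul1r /tog !finset.setU11 finset.setU1K//.
  by rewrite below_setU1// ltnn add0n below_min// expr0 mul1r.
Qed.

(** The multiplication table behind [cl_mul]: reordering gives the sign, each repeated generator its
    square, and the symmetric difference remains. *)
Lemma gp_gp I J : gp I * gp J =
  ((-1) ^+ inversions I J * \prod_(i in I :&: J) cr (sq i)) *: gp (sdiffs I J).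
Proof.
elim/set_min_ind: I => [|l I lI IH].
  rewrite gp0 mul1r inversionsE big1 ?finset.set0I ?big1 ?expr0 ?mul1r ?scale1r//.
  - by congr gp; apply/finset.setP => i; rewrite in_sdiffs finset.in_set0.
  - by move=> i; rewrite finset.in_set0.
  - by move=> i; rewrite finset.in_set0.
have lnI := notin_min lI.
rewrite gp_min// -mulrA IH -scalerAr g_gp scalerA.
have bE : below l (sdiffs I J) = below l J.
  rewrite /below; apply: eq_card => j; rewrite [LHS]finset.in_set [RHS]finset.in_set in_sdiffs.
  case jl: (j < l)%N; rewrite ?andbF// !andbT.
  by rewrite (_ : j \in I = false)//; apply/negP => /lI; rewrite ltnNge ltnW.
have lE : (l \in sdiffs I J) = (l \in J) by rewrite in_sdiffs (negbTE lnI).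
have tE : tog l (sdiffs I J) = sdiffs (l |: I) J.
  apply/finset.setP => j; rewrite /tog lE in_sdiffs in_setU1.
  case lJ: (l \in J); rewrite ?in_setD1 ?in_setU1 in_sdiffs; case: (eqVneq j l) => [->|]//=.
    by rewrite lJ.
  by rewrite lJ.
rewrite tE; congr (_ *: _); rewrite bE lE !inversionsE big_setU1//= exprD.
have -> : \prod_(i in (l |: I) :&: J) cr (sq i) =
    (if l \in J then cr (sq l) else 1) * \prod_(i in I :&: J) cr (sq i).
  case lJ: (l \in J).
    rewrite (_ : (l |: I) :&: J = l |: (I :&: J)) ?big_setU1//=; last first.
      by apply/finset.setP => j; rewrite !inE; case: eqP => [->|//]; rewrite lJ.
    by rewrite !inE (negbTE lnI).
  rewrite mul1r; apply: eq_bigl => j; rewrite !inE; case: eqP => [->|//].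
  by rewrite lJ !andbF.
by set d := (if _ then _ else _); rewrite -!mulrA [RHS]mulrCA; congr (_ * _); rewrite mulrCA; congr (_ * _); rewrite mulrC.
Qed.

Definition rep (a : {set 'I_n} -> R) : Q := \sum_I cr (a I) *: gp I.

End Clifford.

Lemma lin_comm (R : realType) (Q : algType R[i]) n (u : 'I_n -> Q) (o : 'I_n -> 'I_n -> R[i]) (a b : 'I_n -> R[i]) :
  (forall i j, u i * u j = - (u j * u i) + (o i j)%:A) ->
  (\sum_i a i *: u i) * (\sum_j b j *: u j) = - ((\sum_j b j *: u j) * (\sum_i a i *: u i))
    + (\sum_i \sum_j a i * b j * o i j)%:A.
Proof.
move=> uu; rewrite !mulr_suml.
under eq_bigr => i _ do rewrite mulr_sumr.
under [in RHS]eq_bigr => i _ do rewrite mulr_sumr.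
rewrite [X in - X]exchange_big -sumrN scaler_suml -big_split; apply: eq_bigr => i _ /=.
rewrite -sumrN scaler_suml -big_split; apply: eq_bigr => j _ /=.
rewrite -!scalerAl -!scalerAr !scalerA uu scalerDr scalerN scalerA.
by rewrite [b j * a i]mulrC.
Qed.

(** * The spin group acting on the Grassmann factor *)

Section Spin.
Variables (R : realType) (hbar : R) (m r s : nat).
Hypothesis hb0 : hbar != 0.
Local Notation C := R[i].
Local Notation N := (dim_E m r s).
Local Notation n := (dim_odd r s).
Local Notation H := ('rV[R]_m -> {set 'I_(r + s)} -> R[i]).
Local Notation opH := (op (Hsub R m r s)).
Local Notation ih := (Complex 0 hbar : C).
Local Notation ob := (orth_basis R r s).
Local Notation oo := (omega_odd R r s).

Lemma cr_sum I (t : seq I) (P : pred I) (F : I -> R) : cr (\sum_(i <- t | P i) F i) = \sum_(i <- t | P i) cr (F i).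
Proof. by apply: (big_morph (@cr R)) => // x y; rewrite crD. Qed.
Lemma cr_prod (I : finType) (P : pred I) (F : I -> R) : cr (\prod_(i | P i) F i) = \prod_(i | P i) cr (F i).
Proof. by apply: (big_morph (@cr R)) => // x y; rewrite crM. Qed.
Lemma cr_sign k : cr ((-1) ^+ k) = (-1) ^+ k :> C.
Proof. by rewrite -signr_odd -[in RHS]signr_odd; case: (odd k); rewrite ?expr0 ?expr1 // crN. Qed.

Definition Uodd (v : 'cV[R]_n) : opH := \sum_j cr (v j 0) *: Uop hbar (rshift (m + m) j).

Lemma UstarE (v : 'cV[R]_N) f : Hsmooth f ->
  Ustar hbar v f = (\sum_j cr (v j 0) *: Uop hbar j : opH) f.
Proof.
move=> Sf; rewrite (@opE_sum _ _ (Hsub R m r s))// /Ustar; apply: eq_bigr => j _.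
by apply/funext => x; apply/funext => J; rewrite opHZ// /Hscale UopE.
Qed.

Lemma Uodd_col v : (\sum_j cr ((col_mx 0 v : 'cV[R]_N) j 0) *: Uop hbar j : opH) = Uodd v.
Proof.
rewrite big_split_ord /= big1 ?add0r => [|i _]; last by rewrite col_mxEu mxE scale0r.
by apply: eq_bigr => i _; rewrite col_mxEd.
Qed.

Lemma UoddD v w : Uodd (v + w) = Uodd v + Uodd w.
Proof. by rewrite /Uodd -big_split /=; apply: eq_bigr => j _; rewrite mxE crD scalerDl. Qed.
Lemma UoddZ c v : Uodd (c *: v) = cr c *: Uodd v.
Proof. by rewrite /Uodd scaler_sumr; apply: eq_bigr => j _; rewrite mxE crM scalerA. Qed.
Lemma Uodd_sum I (t : seq I) (F : I -> 'cV[R]_n) : Uodd (\sum_(i <- t) F i) = \sum_(i <- t) Uodd (F i).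
Proof.
apply: (big_morph Uodd); first exact: UoddD.
by rewrite /Uodd big1// => j _; rewrite mxE scale0r.
Qed.

Lemma UU_odd i j : Uop hbar (rshift (m + m) i) * Uop hbar (rshift (m + m) j) =
  - (Uop hbar (rshift (m + m) j) * Uop hbar (rshift (m + m) i)) + (ih * cr (oo i j))%:A :> opH.
Proof. by rewrite (UU hbar (rshift (m + m) i)) !par_r expr1 scaleN1r /omega block_mxEdr. Qed.

Lemma Uodd_comm v w : Uodd v * Uodd w = - (Uodd w * Uodd v) + (ih * cr ((v^T *m oo *m w) 0 0))%:A.
Proof.
rewrite /Uodd (lin_comm _ _ UU_odd); congr (_ + _ *: _).
rewrite mxE cr_sum mulr_sumr exchange_big; apply: eq_bigr => j _ /=.
rewrite mxE crM cr_sum mulr_suml mulr_sumr; apply: eq_bigr => i _.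
by rewrite [v^T _ _]mxE !crM; ring.
Qed.

(** Dividing by $\sqrt{i\hbar}$ turns $U_*$ on odd vectors into a representation of the Clifford
    relations $XY + YX = \omega(X,Y)$. Even products contain only integral powers of $i\hbar$, so
    the choice of root is invisible on the spin group. *)
Definition lam : C := sqrtC ih.
Lemma lam2 : lam * lam = ih. Proof. by rewrite -expr2 sqrtCK. Qed.
Lemma lam_neq0 : lam != 0.
Proof. by rewrite sqrtC_eq0; exact: ih_neq0. Qed.

Definition gam (i : 'I_n) : opH := lam^-1 *: Uodd (col i ob).

Lemma ob_orth i j : i != j -> ((col i ob)^T *m oo *m col j ob) 0 0 = 0.
Proof.
move=> ij; have -> : (col i ob)^T *m oo *m col j ob = row i (ob^T *m oo) *m col j ob.
  by rewrite tr_col row_mul.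
have -> : (row i (ob^T *m oo) *m col j ob) 0 0 = (ob^T *m oo *m ob) i j.
  by rewrite !mxE; apply: eq_bigr => k _; rewrite !mxE.
have -> : ob^T *m oo *m ob = block_mx (block_mx (- 2%:M) 0 0 2%:M) 0 0 (- 1%:M).
  pose B : 'M[R]_(r + r) := block_mx 1%:M 1%:M 1%:M (- 1%:M).
  pose W : 'M[R]_(r + r) := block_mx 0 (- 1%:M) (- 1%:M) 0.
  have BT : B^T = B by rewrite /B tr_block_mx ?trmx1 linearN /= trmx1.
  have BWB : B *m W *m B = block_mx (- 2%:M) 0 0 2%:M.
    rewrite /B /W !mulmx_block !(mul0mx, mulmx0, mul1mx, mulmx1, mulmxN, mulNmx, addr0, add0r, opprK).
    by rewrite ?subrr ?addNr -?opprD -?raddfD.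
  rewrite /orth_basis /omega_odd /dim_odd -/B -/W (tr_block_mx B 0 0) BT !trmx0 trmx1.
  rewrite (mulmx_block B 0 0 _ W) (mulmx_block _ _ _ _ B) !(mul0mx, mulmx0, addr0, add0r) BWB.
  by rewrite mul1mx mulmx1.
move: ij; rewrite -(splitK i) -(splitK j).
case: (fintype.split i) => a; case: (fintype.split j) => b /=; rewrite ?eq_lshift ?eq_rshift => ab.
- rewrite block_mxEul; move: ab; rewrite -(splitK a) -(splitK b).
  case: (fintype.split a) => c; case: (fintype.split b) => d /=; rewrite ?eq_lshift ?eq_rshift => cd.
  + by rewrite block_mxEul !mxE (negbTE cd) mulr0n oppr0.
  + by rewrite block_mxEur mxE.
  + by rewrite block_mxEdl mxE.
  + by rewrite block_mxEdr !mxE (negbTE cd) mulr0n.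
- by rewrite block_mxEur mxE.
- by rewrite block_mxEdl mxE.
- by rewrite block_mxEdr !mxE (negbTE ab) mulr0n oppr0.
Qed.

Lemma gam_gg i j : i != j -> gam i * gam j = - (gam j * gam i).
Proof.
move=> ij; rewrite /gam -!scalerAl -!scalerAr -!scalerN Uodd_comm ob_orth//.
by rewrite (_ : cr 0 = 0)// mulr0 scale0r addr0.
Qed.

Lemma gam_sq i : gam i * gam i = (cr (cl_square R i))%:A.
Proof.
rewrite /gam -!scalerAl -!scalerAr scalerA.
have := Uodd_comm (col i ob) (col i ob); set W := Uodd _ * Uodd _; set c := (_ * cr _) => E.
have W2 : W = (c / 2)%:A.
  have W2 : W + W = c%:A by rewrite {1}E addrAC addNr add0r.
  have n2 : (2 : C) != 0 by rewrite pnatr_eq0.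
  apply: (scalerI n2); rewrite scalerA mulrCA mulfV// mulr1 -W2.
  by rewrite scaler_nat mulr2n.
rewrite W2 scalerA; congr (_ *: _).
rewrite /cl_square cr_div /c -lam2.
have -> : ((col i ob)^T *m oo *m col i ob) 0 0 = (ob^T *m oo *m ob) i i.
  rewrite tr_col -row_mul !mxE; apply: eq_bigr => k _; rewrite !mxE //.
by field; rewrite lam_neq0.
Qed.

Definition spi (a : cl R r s) : opH := rep gam a.

Lemma spi_mul a b : spi (cl_mul a b) = spi a * spi b.
Proof.
rewrite /spi /rep mulr_suml.
under [RHS]eq_bigr => I _ do rewrite mulr_sumr.
under [RHS]eq_bigr => I _ do rewrite (reindex_inj (inv_inj (sdiffsK I))) /=.
rewrite exchange_big; apply: eq_bigr => K _ /=.
rewrite /cl_mul cr_sum scaler_suml; apply: eq_bigr => I _.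
transitivity ((cr (a I) * cr (b (sdiffs I K))) *: (gp gam I * gp gam (sdiffs I K))); last first.
  by rewrite -scalerAl -scalerAr scalerA.
rewrite (gp_gp gam_gg gam_sq) scalerA sdiffsK; congr (_ *: _).
rewrite -/(sdiffs I K) !crM cr_sign cr_prod; ring.
Qed.

Lemma spi1 : spi (@cl_one R r s) = 1.
Proof.
rewrite /spi /rep (bigD1 finset.set0)//= big1 ?addr0 => [|I I0].
  by rewrite /cl_one eqxx scale1r gp0.
by rewrite /cl_one (negbTE I0) scale0r.
Qed.

Lemma ob_unit : ob \in unitmx.
Proof.
have : ob *m (block_mx (2^-1 *: block_mx 1%:M 1%:M 1%:M (- 1%:M)) 0 0 1%:M : 'M[R]_((r + r) + (s + s))) = 1%:M.
  rewrite /orth_basis /dim_odd (mulmx_block (block_mx 1%:M 1%:M 1%:M (- 1%:M) : 'M[R]_(r + r)) 0 0).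
  rewrite !(mul0mx, mulmx0, mulmx1, addr0, add0r) -scalemxAr mulmx_block.
  rewrite !(mul0mx, mulmx0, mul1mx, mulmx1, mulmxN, mulNmx, opprK) !subrr.
  rewrite -raddfD /= scale_block_mx !scaler0 scale_scalar_mx -[1 + 1]/(2%:R) mulVf ?pnatr_eq0//.
  by rewrite -!scalar_mx_block.
by case/mulmx1_unit.
Qed.

Lemma spi_vec v : spi (cl_vec v) = lam^-1 *: Uodd v.
Proof.
rewrite /spi /rep /cl_vec.
under eq_bigr => I _ do rewrite cr_sum scaler_suml.
rewrite (exchange_big_dep predT)//=.
transitivity (\sum_i cr ((invmx ob *m v) i 0) *: gam i).
  apply: eq_bigr => i _; rewrite big_pred1_eq; congr (_ *: _).
  rewrite -[[set i]%SET]finset.setU0 gp_min ?gp0 ?mulr1// => j; by rewrite finset.in_set0.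
have vE : v = \sum_i (invmx ob *m v) i 0 *: col i ob.
  rewrite -{1}(mulKVmx ob_unit v); move: (invmx ob *m v) => w.
  apply/matrixP => a b; rewrite ord1 !mxE summxE; apply: eq_bigr => i _; rewrite !mxE mulrC //.
rewrite [in RHS]vE Uodd_sum scaler_sumr; apply: eq_bigr => i _.
by rewrite UoddZ /gam !scalerA mulrC.
Qed.

(** Operators acting on the Grassmann index by a constant matrix. Finite dimension then turns
    one-sided inverses into two-sided ones. *)
Definition ismx (T : opH) (c : {set 'I_(r + s)} -> {set 'I_(r + s)} -> C) :=
  forall f x J, Hsmooth f -> T f x J = \sum_K c J K * f x K.

Lemma ismxD T U c d : ismx T c -> ismx U d -> ismx (T + U) (fun J K => c J K + d J K).
Proof.
move=> Tc Ud f x J Sf; rewrite opHD// Tc// Ud// -big_split; apply: eq_bigr => K _ /=.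
by rewrite mulrDl.
Qed.
Lemma ismxZ a T c : ismx T c -> ismx (a *: T) (fun J K => a * c J K).
Proof. by move=> Tc f x J Sf; rewrite opHZ// Tc// mulr_sumr; apply: eq_bigr => K _; rewrite mulrA. Qed.
Lemma ismxM T U c d : ismx T c -> ismx U d -> ismx (T * U) (fun J K => \sum_L c J L * d L K).
Proof.
move=> Tc Ud f x J Sf; rewrite opHM// Tc; last exact: S_in.
under eq_bigr do rewrite Ud// mulr_sumr; rewrite exchange_big; apply: eq_bigr => K _ /=.
by rewrite mulr_suml; apply: eq_bigr => L _; rewrite mulrA.
Qed.
Definition exmx T := exists c, ismx T c.
Lemma exmx_sum I (t : seq I) (P : pred I) (F : I -> opH) : (forall i, exmx (F i)) -> exmx (\sum_(i <- t | P i) F i).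
Proof.
move=> HF; apply: big_ind => [|T U [c Tc] [d Ud]|i _]; last exact: HF.
  exists (fun _ _ => 0) => f x J Sf; rewrite big1 => [|K _]; last by rewrite mul0r.
  by rewrite (@opE0 _ _ (Hsub R m r s)).
by exists (fun J K => c J K + d J K); exact: ismxD.
Qed.
Lemma exmxZ a T : exmx T -> exmx (a *: T).
Proof. by case=> c Tc; exists (fun J K => a * c J K); exact: ismxZ. Qed.
Lemma exmxM T U : exmx T -> exmx U -> exmx (T * U).
Proof. by case=> c Tc [d Ud]; exists (fun J K => \sum_L c J L * d L K); exact: ismxM. Qed.
Lemma exmxD T U : exmx T -> exmx U -> exmx (T + U).
Proof. by case=> c Tc [d Ud]; exists (fun J K => c J K + d J K); exact: ismxD. Qed.
Lemma exmx1 : exmx 1.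
Proof.
exists (fun J K => (J == K)%:R) => f x J Sf; rewrite opH1// (bigD1 J)//= eqxx mul1r big1 ?addr0//.
by move=> K KJ; rewrite eq_sym (negbTE KJ) mul0r.
Qed.
Lemma exmxG k : exmx (opG R m k).
Proof.
exists (fun J K : {set 'I_(r + s)} => (if k \in J then (-1) ^+ below k J else 0) * (K == J :\ k)%:R) => f x J Sf.
rewrite opGE// gmE (bigD1 (J :\ k))//= eqxx mulr1 big1 ?addr0// => K /negbTE ->.
by rewrite mulr0 mul0r.
Qed.
Lemma exmxD_ k : exmx (opD_ R m k).
Proof.
exists (fun J K : {set 'I_(r + s)} => (if k \in J then 0 else (-1) ^+ below k J) * (K == k |: J)%:R) => f x J Sf.
rewrite opDE// gdE (bigD1 (k |: J))//= eqxx mulr1 big1 ?addr0// => K /negbTE ->.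
by rewrite mulr0 mul0r.
Qed.
Lemma exmx_Uodd v : exmx (Uodd v).
Proof.
by apply: exmx_sum => j; apply: exmxZ; rewrite Uop_r; apply: exmxD; apply: exmxZ; [exact: exmxG|exact: exmxD_].
Qed.
Lemma exmx_spi a : exmx (spi a).
Proof.
apply: exmx_sum => I; apply: exmxZ; rewrite /gp; apply: big_ind => [||i _].
- exact: exmx1.
- exact: exmxM.
- by apply: exmxZ; exact: exmx_Uodd.
Qed.

(** The matrix product is read off at the origin from functions concentrated in one component, with
    value 1 there. *)
Lemma ismx_inv T U : exmx T -> exmx U -> T * U = 1 -> U * T = 1.
Proof.
move=> [c Tc] [d Ud] TU.
pose F : finType := {set 'I_(r + s)}.
pose Mc : 'M[C]_#|F| := \matrix_(i, j) c (enum_val i) (enum_val j).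
pose Md : 'M[C]_#|F| := \matrix_(i, j) d (enum_val i) (enum_val j).
have sE (G : F -> C) : \sum_K G K = \sum_(i < #|F|) G (enum_val i).
  pose ev (i : 'I_#|F|) : F := enum_val i.
  by rewrite (reindex ev)//; exists enum_rank => i _; rewrite /ev ?enum_valK ?enum_rankK.
have [f0 Sf0 f00] := schwartz_neq0 R m.
have cd : Mc *m Md = 1%:M.
  apply/matrixP => i j; rewrite !mxE.
  pose f : H := fun x K => (K == enum_val j)%:R * f0 x.
  have Sf : Hsmooth f by move=> K; exact: schwartzZ.
  have := ismxM Tc Ud 0 (enum_val i) Sf; rewrite TU opH1// /f f00.
  rewrite (bigD1 (enum_val j))//= eqxx [X in _ + X]big1 ?addr0 => [|K /negbTE ->]; last by rewrite mul0r mulr0.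
  rewrite !mulr1 (inj_eq enum_val_inj) sE => ->.
  by apply: eq_bigr => k _; rewrite !mxE.
have dc := mulmx1C cd.
apply: op_ext => f Sf; apply/funext => x; apply/funext => J.
rewrite (ismxM Ud Tc x J Sf) opH1//.
have E K : \sum_L d J L * c L K = (J == K)%:R.
  have := congr1 (fun X : 'M[C]_#|F| => X (enum_rank J) (enum_rank K)) dc.
  rewrite !mxE (inj_eq enum_rank_inj) => <-; rewrite sE.
  by apply: eq_bigr => k _; rewrite !mxE !enum_rankK.
under eq_bigr do rewrite E.
rewrite (bigD1 J)//= eqxx mul1r big1 ?addr0// => K KJ; by rewrite eq_sym (negbTE KJ) mul0r.
Qed.

(** Odd components of a spin element vanish, and for even $|I|$ the factor $\lambda^{-|I|}$ is
    $(i\hbar)^{-|I|/2}$. *)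
Lemma spinorE (aG : spin_elt R r s) f : Spin0 aG -> Hsmooth f -> spinor hbar aG.1 f = spi aG.1 f.
Proof.
case=> ev _ _ Sf; rewrite /spi /rep (@opE_sum _ _ (Hsub R m r s))// /spinor; apply: eq_bigr => I _.
have Uf : foldr (fun i => Ustar hbar (col_mx 0 (col i ob))) f (enum I) =
    (\prod_(i <- enum I) Uodd (col i ob) : opH) f.
  elim: (enum I) => [|i t IH]; first by rewrite big_nil (@opE1 _ _ (Hsub R m r s)).
  rewrite /= big_cons (@opEM _ _ (Hsub R m r s))// IH UstarE ?Uodd_col//; exact: S_in.
rewrite Uf; apply/funext => x; apply/funext => J; rewrite opHZ// /Hscale.
have [oI|eI] := boolP (odd #|I|); first by rewrite ev// (_ : Complex 0 0 = 0)// !mul0r.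
have -> : gp gam I = (lam ^- #|I|) *: (\prod_(i <- enum I) Uodd (col i ob) : opH).
  rewrite /gp cardE; elim: (enum I) => [|i t IH]; first by rewrite !big_nil /= expr0 invr1 scale1r.
  by rewrite !big_cons IH /gam -scalerAl -scalerAr scalerA /= exprS invfM.
rewrite opHZ// mulrA; congr (_ * _ * _).
by rewrite -[in RHS](even_halfK eI) -mul2n exprM expr2 lam2.
Qed.

(** [Spin0] gives $a\,\tilde a = 1$ and $a\,v\,\tilde a = Gv$, where $\tilde a$ is the reversal of
    $a$. Cancelling $\tilde a$ on the right needs $\tilde a\,a = 1$ in the representation, which is
    [ismx_inv]. *)
Lemma spin_intertwine (aG : spin_elt R r s) : Spin0 aG ->
  (exists T : opH, spi aG.1 * T = 1 /\ T * spi aG.1 = 1) /\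
  forall v, spi aG.1 * Uodd v = Uodd (aG.2 *m v) * spi aG.1.
Proof.
case=> _ r1 rv.
have e1 : spi aG.1 * spi (cl_rev aG.1) = 1 by rewrite -spi_mul r1 spi1.
have e2 := ismx_inv (exmx_spi _) (exmx_spi _) e1.
split=> [|v]; first by exists (spi (cl_rev aG.1)).
have l0 : lam^-1 != 0 by rewrite invr_eq0 lam_neq0.
apply: (scalerI l0); rewrite scalerAr scalerAl -!spi_vec -rv !spi_mul.
by rewrite -!mulrA e2 mulr1.
Qed.

End Spin.

(** * Even Heisenberg elements as operators *)

Section SuperHeisenberg.
Variables (R : realType) (A : baseAlgebra R) (hbar : R) (m r s : nat).
Hypothesis hb0 : hbar != 0.
Local Notation C := R[i].
Local Notation N := (dim_E m r s).
Local Notation opH := (op (Hsub R m r s)).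
Local Notation opA := (op (AHsub A m r s)).
Local Notation La := (@La R A m r s).
Local Notation hat := (@hat R A m r s).
Local Notation om := (omega R m r s).
Local Notation ih := (Complex 0 hbar : C).
Local Notation U := (@Uop R hbar m r s).
Local Notation muop := (@muop R hbar m r s).
Implicit Types (x y : 'I_N -> A) (a c : A).

(** [AHF] is treated as a real module, so complex scalars act as operators. They commute with every
    [La a] and every [hat p T]. *)
Definition scA (z : C) : opA := hat false (z%:A).

Lemma hat_scale p z T : hat p (z *: T) = scA z * hat p T.
Proof. by rewrite /scA hatM -scalerAl mul1r. Qed.
Lemma scA_hat z p T : scA z * hat p T = hat p T * scA z.
Proof. by rewrite /scA !hatM addbF /= -scalerAl mul1r -scalerAr mulr1. Qed.
Lemma scA_La z a : scA z * La a = La a * scA z.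
Proof. by rewrite /scA hat_La twist0. Qed.
Lemma scA_cr k : scA (cr k) = k *: 1.
Proof. by rewrite /scA hatZ hat1. Qed.
Lemma scAM z w : scA z * scA w = scA (z * w).
Proof. by rewrite /scA hatM -scalerAl mul1r scalerA. Qed.
Lemma hat_cr p k T : hat p (cr k *: T) = k *: hat p T. Proof. exact: hatZ. Qed.

Definition Uh (i : 'I_N) : opA := hat (par i) (U i).
Definition uv x : opA := \sum_i La (x i) * Uh i.
(** The form on vectors with coefficients on the left; for even [y] the coefficient [y j] has the
    parity of [j], hence the Koszul sign. *)
Definition omA x y : A := \sum_i \sum_j ((-1) ^+ (par i && par j) * om i j) *: (x i * y j).
Definition Om x y : opA := scA ih * La (omA x y).

(** Coefficients of the same parity as the basis vectors make both products even: the Koszul signs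
    turn the supercommutator of [UU] into a commutator. *)
Lemma uv_term (i j : 'I_N) a c : homog (par i) a -> homog (par j) c ->
  La a * Uh i * (La c * Uh j) =
  La c * Uh j * (La a * Uh i) + scA ih * La (((-1) ^+ (par i && par j) * om i j) *: (a * c)).
Proof.
move=> ha hc; pose sg : R := (-1) ^+ (par i && par j).
have sgsg : sg * sg = 1 by rewrite /sg -signr_addb addbb.
have L (p q : bool) b d (T V : opH) : La b * hat p T * (La d * hat q V) = La (b * twist p d) * hat (p (+) q) (T * V).
  by rewrite -mulrA (mulrA (hat p T)) hat_La !mulrA LaM -mulrA hatM.
rewrite /Uh !L (twistE _ ha) (twistE _ hc) -!scalerAr (UU hbar i j) [par j && par i]andbC -/sg.
have -> : (-1) ^+ (par i && par j) = cr sg :> C by rewrite /sg cr_sign.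
rewrite hatD hat_cr [in LHS]LaZ mulrDr -!scalerAr -!scalerAl scalerA sgsg scale1r.
rewrite (homog_comm hc ha) [par j && par i]andbC -/sg [in RHS]scalerA sgsg scale1r addbC; congr (_ + _).
have [e|e] := eqVneq (par i) (par j); last first.
  rewrite omega_par// (_ : cr 0 = 0)// mulr0 scale0r hat0 mulr0 scaler0.
  by rewrite mulr0 scale0r La0 mulr0.
rewrite e addbb -/(scA _) -scAM scA_cr -scalerAr mulr1 LaZ -scalerAr -!scalerAr.
by rewrite scalerA mulrC scA_La [om i j * _]mulrC.
Qed.

Lemma uv_comm x y : E0 x -> E0 y -> uv x * uv y = uv y * uv x + Om x y.
Proof.
move=> hx hy; rewrite /uv /Om /omA.
transitivity (\sum_i \sum_j (La (y j) * Uh j * (La (x i) * Uh i)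
  + scA ih * La (((-1) ^+ (par i && par j) * om i j) *: (x i * y j)))).
  rewrite mulr_suml; apply: eq_bigr => i _; rewrite mulr_sumr; apply: eq_bigr => j _.
  exact: uv_term (hx i) (hy j).
under eq_bigr do rewrite big_split.
rewrite big_split /=; congr (_ + _).
  by rewrite exchange_big mulr_suml; apply: eq_bigr => j _; rewrite mulr_sumr.
rewrite La_sum mulr_sumr; apply: eq_bigr => i _; rewrite La_sum mulr_sumr.
by apply: eq_bigr => j _.
Qed.

Lemma OmC x y : E0 x -> E0 y -> Om x y = - Om y x.
Proof.
move=> hx hy; have := uv_comm hx hy; rewrite (uv_comm hy hx) -addrA => /eqP.
by rewrite addrC -subr_eq subrr eq_sym addrC addr_eq0 => /eqP.
Qed.

Lemma homog_omA x y : E0 x -> E0 y -> homog false (omA x y).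
Proof.
move=> hx hy; apply: homog_sum => i _; apply: homog_sum => j _.
have [e|e] := eqVneq (par i) (par j); last by rewrite omega_par// mulr0 scale0r; exact: homog0.
by apply: homogZ; have := homogM (hx i) (hy j); rewrite e addbb.
Qed.

Lemma E0D x y : E0 x -> E0 y -> E0 (x + y).
Proof. by move=> hx hy i; apply: homogD. Qed.
Lemma E0Z (k : R) x : E0 x -> E0 (k *: x).
Proof. by move=> hx i; apply: homogZ. Qed.
Lemma E00 : E0 (0 : 'I_N -> A).
Proof. by move=> i; apply: homog0. Qed.
Lemma E0B x y : E0 x -> E0 y -> E0 (x - y).
Proof. by move=> hx hy; apply: E0D => //; rewrite -scaleN1r; exact: E0Z. Qed.

Lemma uvD x y : uv (x + y) = uv x + uv y.
Proof. by rewrite /uv -big_split; apply: eq_bigr => i _; rewrite [LHS](_ : _ = La (x i + y i) * Uh i)// LaD mulrDl. Qed.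
Lemma uvZ (k : R) x : uv (k *: x) = k *: uv x.
Proof. by rewrite /uv scaler_sumr; apply: eq_bigr => i _; rewrite scalerAl -LaZ. Qed.
Lemma uv0 : uv 0 = 0. Proof. by have := uvZ 0 0; rewrite !scale0r. Qed.
Lemma uvB x y : uv (x - y) = uv x - uv y.
Proof. by rewrite uvD -scaleN1r uvZ scaleN1r. Qed.

Lemma omADr x y z : omA x (y + z) = omA x y + omA x z.
Proof.
rewrite /omA -big_split; apply: eq_bigr => i _; rewrite -big_split; apply: eq_bigr => j _.
by rewrite (_ : (y + z) j = y j + z j)// mulrDr scalerDr.
Qed.
Lemma omAZr (k : R) x y : omA x (k *: y) = k *: omA x y.
Proof.
rewrite /omA scaler_sumr; apply: eq_bigr => i _; rewrite scaler_sumr; apply: eq_bigr => j _.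
have -> : (k *: y) j = k *: y j by [].
by rewrite -scalerAr !scalerA mulrC.
Qed.
Lemma OmDr x y z : Om x (y + z) = Om x y + Om x z.
Proof. by rewrite /Om omADr LaD mulrDr. Qed.
Lemma OmZr (k : R) x y : Om x (k *: y) = k *: Om x y.
Proof. by rewrite /Om omAZr LaZ scalerAr. Qed.
Lemma Om0r x : Om x 0 = 0. Proof. by have := OmZr 0 x 0; rewrite !scale0r. Qed.
Lemma Om_sumr I (t : seq I) (P : pred I) x (F : I -> 'I_N -> A) :
  Om x (\sum_(i <- t | P i) F i) = \sum_(i <- t | P i) Om x (F i).
Proof. by apply: (big_morph (Om x)); [exact: OmDr|exact: Om0r]. Qed.

Definition act1 p a (B : 'M[R]_N) x : 'I_N -> A :=
  fun i => \sum_j ((-1) ^+ (p && par j) * B i j) *: (a * x j).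
Definition D1 p a (B : 'M[R]_N) : opA := La a * hat p (muop B).

Lemma act1_E0 p a B x : spo p B -> homog p a -> E0 x -> E0 (act1 p a B x).
Proof.
move=> [SB _] ha hx i; apply: homog_sum => j _.
have [e|e] := eqVneq (par i (+) par j) p; last by rewrite SB// mulr0 scale0r; exact: homog0.
by apply: homogZ; have := homogM ha (hx j); rewrite -e -addbA addbb addbF.
Qed.

(** The coefficient has the parity of [B], so the product is even and the supercommutator of
    [mu_comm] becomes a commutator. *)
Lemma D1_uv p a B x : spo p B -> homog p a -> E0 x ->
  D1 p a B * uv x = uv x * D1 p a B + uv (act1 p a B x).
Proof.
move=> SB ha hx.
have L (q q' : bool) b d (T V : opH) : La b * hat q T * (La d * hat q' V) = La (b * twist q d) * hat (q (+) q') (T * V).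
  by rewrite -mulrA (mulrA (hat q T)) hat_La !mulrA LaM -mulrA hatM.
transitivity (\sum_j (La (x j) * Uh j * D1 p a B + \sum_i La (((-1) ^+ (p && par j) * B i j) *: (a * x j)) * Uh i)).
  rewrite /uv mulr_sumr; apply: eq_bigr => j _; rewrite /D1 /Uh !L (mu_comm hb0 j SB).
  pose sg : R := (-1) ^+ (p && par j).
  have sgsg : sg * sg = 1 by rewrite /sg -signr_addb addbb.
  have -> : (-1) ^+ (p && par j) = cr sg :> C by rewrite /sg cr_sign.
  rewrite (twistE _ (hx j)) (twistE _ ha) [par j && p]andbC -/sg -!scalerAr.
  rewrite (homog_comm (hx j) ha) [par j && p]andbC -/sg scalerA sgsg scale1r [par j (+) p]addbC.
  rewrite hatD hat_cr hat_sum LaZ mulrDr -!scalerAr -!scalerAl scalerA sgsg scale1r; congr (_ + _).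
  rewrite mulr_sumr scaler_sumr; apply: eq_bigr => i _; rewrite hat_cr LaZ.
  rewrite -!scalerAr -!scalerAl scalerA.
  have [e|e] := eqVneq (par i (+) par j) p; last by rewrite (proj1 SB)// mulr0 !scale0r.
  by rewrite -e -addbA addbb addbF.
rewrite big_split /= -mulr_suml; congr (_ + _).
by rewrite exchange_big; apply: eq_bigr => i _; rewrite /act1 La_sum mulr_suml.
Qed.

Lemma scLa_comm z c p a T : homog false c ->
  scA z * La c * (La a * hat p T) = La a * hat p T * (scA z * La c).
Proof.
move=> hc; rewrite -[LHS]mulrA (mulrA (La c)) LaM (homog_even_comm _ hc) -LaM.
have hT : hat p T * La c = La c * hat p T by rewrite hat_La (twistE _ hc) andbF scale1r.
by rewrite -!mulrA -hT !mulrA scA_La -(mulrA _ (scA z)) scA_hat !mulrA.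
Qed.

Definition bA (b : 'cV[R]_N) : 'I_N -> A := fun i => (b i 0)%:A.

Lemma bA_E0 b : evenv b -> E0 (bA b).
Proof.
move=> bE i; rewrite /bA; case pi: (par i); last exact: homog_scalar.
by rewrite bE// scale0r; exact: homog0.
Qed.

Definition Wh b : opA := hat false (@Wop R hbar m r s b).

(** [mu_W] with coefficients; its scalar term is $\omega(Bb,b)$, rewritten as $-\omega(b,Bb)$. *)
Lemma D1_Wh p a B b : spo p B -> homog p a -> evenv b ->
  D1 p a B * Wh b = Wh b * (D1 p a B + uv (act1 p a B (bA b)) - 2^-1 *: Om (bA b) (act1 p a B (bA b))).
Proof.
move=> SB ha bE; have hb := bA_E0 bE; have hBb := act1_E0 SB ha hb.
have actE i : act1 p a B (bA b) i = (B *m b) i 0 *: a.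
  rewrite /act1 mxE scaler_suml; apply: eq_bigr => j _; rewrite /bA -scalerAr mulr1 scalerA.
  case pj: (par j); first by rewrite bE// !mulr0.
  by rewrite andbF mul1r.
have Wa (X : opA) : La a * (Wh b * X) = Wh b * (La a * X).
  by rewrite !mulrA; congr (_ * _); rewrite /Wh hat_La twist0.
have WM (T : opH) : Wh b * hat p T = hat p (Wop hbar b * T) by rewrite /Wh hatM addFb.
set Y := act1 p a B (bA b) in hBb actE *.
have -> : - (2^-1 *: Om (bA b) Y) = 2^-1 *: Om Y (bA b) by rewrite (OmC hBb hb) scalerN.
rewrite /D1 -mulrA [X in La a * X](_ : _ = Wh b * hat p (muop B + \sum_i cr ((B *m b) i 0) *: U i
     + (ih / 2 * cr ((b^T *m om^T *m (B *m b)) 0 0))%:A)); last first.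
  by rewrite WM /Wh hatM addbF (mu_W hb0 SB bE).
rewrite Wa; congr (_ * _); rewrite hatD mulrDr; congr (_ + _).
  rewrite hatD mulrDr; congr (_ + _); rewrite hat_sum mulr_sumr; apply: eq_bigr => i _.
  rewrite hat_cr -scalerAr scalerAl -LaZ actE /Uh.
  have [e|e] := eqVneq (par i) p; first by rewrite e.
  rewrite (_ : (B *m b) i 0 = 0); last first.
    rewrite mxE big1// => j _; case pj: (par j); first by rewrite bE// mulr0.
    by rewrite (proj1 SB) ?mul0r// pj addbF.
  by rewrite !scale0r La0 !mul0r.
pose k : R := (b^T *m om^T *m (B *m b)) 0 0.
have kE : k = \sum_i (om *m b) i 0 * (B *m b) i 0.
  by rewrite /k -trmx_mul mxE; apply: eq_bigr => i _; rewrite [_^T _ _]mxE.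
(* For odd [B] the vector $Bb$ is odd while $b$ is even, and the form does not pair them. *)
have kp : p -> k = 0.
  move=> pt; rewrite kE big1// => i _; case pi: (par i); first by rewrite om_odd// mul0r.
  rewrite [X in _ * X]mxE big1 ?mulr0// => j _; case pj: (par j); first by rewrite bE// mulr0.
  by rewrite (proj1 SB) ?mul0r// pi pj pt.
have -> : Om Y (bA b) = scA ih * La (k *: a).
  congr (scA _ * La _); rewrite kE scaler_suml; apply: eq_bigr => i _.
  rewrite [(om *m b) i 0]mxE mulr_suml scaler_suml; apply: eq_bigr => j _.
  rewrite actE /bA -scalerAr mulr1 !scalerA; case pj: (par j); first by rewrite bE// !(mulr0, mul0r).
  by rewrite andbF mul1r; congr (_ *: _); rewrite -!mulrA; congr (_ * _); rewrite mulrC.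
rewrite -/k; case: p kp {SB ha hBb WM} @Y actE => [/(_ isT) ->|_] Y _.
  by rewrite (_ : cr 0 = 0)// !(mulr0, scale0r) hat0 La0 !mulr0 scaler0.
rewrite -/(scA _) -scA_La -[ih / 2]mulrC -!scAM scA_cr.
have -> : scA (2^-1) = 2^-1 *: 1.
  have n2 : (2 : C) != 0 by rewrite pnatr_eq0.
  have c2 : (2 : R) != 0 by rewrite pnatr_eq0.
  rewrite -scA_cr; congr (scA _); apply: (mulIf n2).
  by rewrite mulVf// -[2 in RHS]/(2%:R) -cr_nat -crM mulVf.
by rewrite (@LaZ R A m r s k a) -!mulrA mulr_algl (mulr_algl k).
Qed.

Section Step.
Variable l : seq A.
Hypothesis lH : forall a, a \in l -> exists p, homog p a.
Hypothesis lB : forall a, a \in l -> body A a = 0.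
Local Notation F := (@AFl R A m r s l lH lB).
Local Notation fac := (@fac R).

Definition idv (k : nat) (x : 'I_N -> A) := forall i, idl l k (x i).

Lemma Fl_uv x : idv 1 x -> F 1 (uv x).
Proof. by move=> hx; apply: Fl_sum => i _; apply: FlE (sup_hat _ _). Qed.
Lemma Fl_scLa z c : idl l 1 c -> F 1 (scA z * La c).
Proof. by move=> hc; rewrite scA_La; apply: FlE (sup_hat _ _). Qed.
Lemma idl_omA x y : idv 1 y -> idl l 1 (omA x y).
Proof. by move=> hy; apply: idl_sum => i _; apply: idl_sum => j _; apply: idlZ; apply: idlMl. Qed.

Definition Ush b n t : opA := Wh b * nexp F (uv n + scA ih * La (t - 2^-1 *: omA (bA b) n)).

Variables (p : bool) (q : nat) (a : 'I_q -> A) (B : 'I_q -> 'M[R]_N).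
Hypotheses (SB : forall k, spo p (B k)) (ha : forall k, homog p (a k)) (la : forall k, idl l 1 (a k)).
Definition Dsum : opA := \sum_k D1 p (a k) (B k).
Definition actY x : 'I_N -> A := \sum_k act1 p (a k) (B k) x.

Lemma actY_E0 x : E0 x -> E0 (actY x).
Proof.
move=> hx; rewrite /actY; elim/big_rec: _ => [|k y _ hy]; first exact: E00.
exact/E0D/hy/act1_E0.
Qed.
Lemma actY_lin (k : R) x y : actY (k *: x + y) = k *: actY x + actY y.
Proof.
rewrite /actY scaler_sumr -big_split; apply: eq_bigr => j _; apply/funext => i.
rewrite [RHS](_ : _ = k *: act1 p (a j) (B j) x i + act1 p (a j) (B j) y i)// /act1 scaler_sumr -big_split.
apply: eq_bigr => i' _; rewrite (_ : (k *: x + y) i' = k *: x i' + y i')// mulrDr scalerDr; congr (_ + _).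
by rewrite -scalerAr !scalerA mulrC.
Qed.
Lemma actY_idv k x : idv k x -> idv k.+1 (actY x).
Proof.
move=> hx i; rewrite /actY fct_sumE; apply: idl_sum => j _; rewrite /act1.
by apply: idl_sum => i' _; apply: idlZ; exact: (idlM lH (la j)).
Qed.
Lemma actY_iter_idv k x : idv k (iter k actY x).
Proof. by elim: k => [//|k IH]; exact: actY_idv. Qed.
Lemma actY_nil : exists K, forall k x, (K <= k)%N -> iter k actY x = 0.
Proof.
have [K KP] := idl_nil lH lB; exists K => k x Kk; apply/funext => i; apply: KP.
exact: (idl_mono Kk (actY_iter_idv k x i)).
Qed.

Lemma Dsum_uv x : E0 x -> Dsum * uv x = uv x * Dsum + uv (actY x).
Proof.
move=> hx; rewrite /Dsum /actY mulr_suml mulr_sumr.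
rewrite (big_morph uv uvD uv0) -big_split; apply: eq_bigr => k _; exact: D1_uv.
Qed.
Lemma Dsum_Wh b : evenv b ->
  Dsum * Wh b = Wh b * (Dsum + uv (actY (bA b)) - 2^-1 *: Om (bA b) (actY (bA b))).
Proof.
move=> bE; rewrite /Dsum /actY Om_sumr (big_morph uv uvD uv0) scaler_sumr -big_split -sumrB mulr_suml mulr_sumr.
by apply: eq_bigr => k _; exact: D1_Wh.
Qed.
Lemma Dsum_cen z c : homog false c -> scA z * La c * Dsum = Dsum * (scA z * La c).
Proof. by move=> hc; rewrite mulr_sumr mulr_suml; apply: eq_bigr => k _; exact: scLa_comm. Qed.
Lemma uv_cen z c x : homog false c -> scA z * La c * uv x = uv x * (scA z * La c).
Proof. by move=> hc; rewrite mulr_sumr mulr_suml; apply: eq_bigr => k _; exact: scLa_comm. Qed.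
Lemma Fl_Dsum : F 1 Dsum.
Proof. by apply: Fl_sum => k _; apply: FlE (sup_hat _ _). Qed.

(** Infinitesimal invariance of the form, read off from the operators: $[u(x),u(y)]$ is a scalar
    commuting with [Dsum], so the derivation $[\mathrm{Dsum}, \cdot\,]$ annihilates it. *)
Lemma Om_actY x y : E0 x -> E0 y -> Om (actY x) y = - Om x (actY y).
Proof.
move=> hx hy; have hYx := actY_E0 hx; have hYy := actY_E0 hy.
have c : Om x y * Dsum = Dsum * Om x y by apply: Dsum_cen; exact: homog_omA.
have D2 u v : E0 u -> E0 v -> Dsum * (uv u * uv v) =
    uv u * uv v * Dsum + (uv (actY u) * uv v + uv u * uv (actY v)).
  move=> hu hv; rewrite mulrA (Dsum_uv hu) mulrDl -mulrA (Dsum_uv hv) mulrDr mulrA -addrA.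
  by congr (_ + _); rewrite addrC.
have := D2 x y hx hy; rewrite (uv_comm hx hy) mulrDr mulrDl (D2 y x hy hx) c.
rewrite (uv_comm hYx hy) (uv_comm hx hYy) -!addrA => /addrI.
rewrite [Dsum * _ + _]addrC addrA => /addIr E.
apply/eqP; rewrite -addr_eq0; apply/eqP; apply: (addrI (uv (actY y) * uv x + uv y * uv (actY x))).
by rewrite addr0 [RHS]E [uv (actY y) * uv x + uv y * _]addrC -addrA; congr (_ + _); rewrite addrCA.
Qed.

Definition expY (K : nat) x : 'I_N -> A := \sum_(k < K) fac k *: iter k actY x.

(** The body [b] stays fixed: $e^Yx - b$ is again nilpotent, so only the exponent changes.
    Conjugation by $W(b)$ turns $D$ into $D + u(Yb) - \frac12[u(b),u(Yb)]$, after which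
    [exp_identity] applies with $y_0 = u(x - b)$ and $y_k = u(Y^kx)$. *)
Lemma exp_step b x tn K : evenv b -> E0 x -> idv 1 (x - bA b) -> homog false tn -> idl l 1 tn ->
  (forall k y, (K <= k)%N -> iter k actY y = 0) ->
  nexp F Dsum * Ush b (x - bA b) tn = Ush b (expY K.+1 x - bA b) tn * nexp F Dsum.
Proof.
move=> bE hx ix ht it YK; have hb := bA_E0 bE.
set n := x - bA b; have hn : E0 n by exact: E0B.
pose Yk k := iter k actY x.
have hYk k : E0 (Yk k) by elim: k => [//|k IH]; exact: actY_E0.
have iY k : idv 1 (Yk k.+1).
  by move=> i; apply: (@idl_mono _ _ _ 1 k.+1) => //; exact: actY_iter_idv.
have iYb : idv 1 (actY (bA b)) by apply: actY_idv.
have hYb := actY_E0 hb.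
pose y k := if k is k'.+1 then uv (Yk k'.+1) else uv n.
pose yv k := if k is k'.+1 then Yk k'.+1 else n.
have yE k : y k = uv (yv k) by case: k.
have hyv k : E0 (yv k) by case: k => [//|k]; exact: hYk.
have iyv k : idv 1 (yv k) by case: k => [//|k]; exact: iY.
pose z k := Om (yv k) (actY (bA b)).
pose kap : opA := - (2^-1 *: Om (bA b) (actY (bA b))).
pose c0 : opA := scA ih * La (tn - 2^-1 *: omA (bA b) n).
have YkS k : actY (Yk k) = Yk k.+1 by [].
have nE : actY n = Yk 1 - actY (bA b).
  by have := actY_lin (-1) (bA b) x; rewrite !scaleN1r [- _ + x]addrC [- _ + actY x]addrC.
pose cen (v : opA) := exists2 c, homog false c & v = scA ih * La c.
have cenOm u v : E0 u -> E0 v -> cen (Om u v) by move=> hu hv; exists (omA u v) => //; exact: homog_omA.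
have cenZ (k : R) v : cen v -> cen (k *: v).
  by move=> [c hc ->]; exists (k *: c); [exact: homogZ|rewrite LaZ scalerAr].
have hc0 : homog false (tn - 2^-1 *: omA (bA b) n).
  by apply: homogD => //; apply: homogNn; apply: homogZ; exact: homog_omA.
have ic0 : idl l 1 (tn - 2^-1 *: omA (bA b) n).
  by apply: idlD => //; rewrite -scaleNr; apply: idlZ; exact: idl_omA.
have kapE : kap = scA ih * La (- 2^-1 *: omA (bA b) (actY (bA b))).
  by rewrite /kap /Om scalerAr -LaZ -mulrN -LaN -scaleNr.
have E := @exp_identity R opA F Dsum (uv (actY (bA b))) kap c0 y z K cen.
have {}E := E Fl_Dsum (Fl_uv iYb).
rewrite /Ush mulrA -(nexp_conj F (esym (Dsum_Wh bE))) -!mulrA; congr (_ * _).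
rewrite -/n -/kap.
transitivity (nexp F (Dsum + uv (actY (bA b)) + kap) * nexp F (y 0 + c0)); first by [].
rewrite {}E; last 17 first.
- by rewrite kapE; apply: Fl_scLa; apply: idlZ; exact: idl_omA.
- exact: Fl_scLa.
- by move=> k; rewrite yE; exact: Fl_uv.
- by move=> k; apply: Fl_scLa; exact: idl_omA.
- by case=> // k Kk; rewrite /y /Yk YK ?uv0// ltnW.
- by rewrite /y (Dsum_uv hn) nE uvB.
- by move=> k; rewrite /y (Dsum_uv (hYk k.+1)).
- by move=> k; rewrite yE; exact: uv_comm.
- move=> k u v [c hc ->] [d hd ->]; exists (c - k *: d); last by rewrite LaD LaN LaZ mulrDr mulrN scalerAr.
  by apply: homogD => //; apply: homogNn; exact: homogZ.
- by move=> u v [c hc ->] [d hd ->]; rewrite -!mulrA !(mulrA (La _)) -!scA_La -!mulrA !LaM (homog_even_comm _ hc).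
- by move=> u [c hc ->]; exact: Dsum_cen.
- by move=> u k [c hc ->]; rewrite yE; exact: uv_cen.
- by move=> u [c hc ->]; exact: uv_cen.
- by move=> k; exact: cenOm.
- by exists (- 2^-1 *: omA (bA b) (actY (bA b))) => //; apply: homogZ; exact: homog_omA.
- by exists (tn - 2^-1 *: omA (bA b) n).
- by move=> j k; rewrite !yE uv_comm// addrC addKr; exact: cenOm.
congr (nexp F _ * _).
have fac1 : fac 1 = 1 by rewrite /fac invr1.
have expE : expY K.+1 x - bA b = n + \sum_(k < K) fac k.+1 *: Yk k.+1.
  rewrite /expY big_ord_recl fac0 scale1r addrAC; congr (_ + _).
have sumE : \sum_(k < K.+1) fac k *: y k = uv (expY K.+1 x - bA b).
  rewrite expE uvD (big_morph uv uvD uv0) big_ord_recl fac0 scale1r; congr (_ + _).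
  by apply: eq_bigr => k _; rewrite uvZ.
rewrite sumE -!addrA; congr (_ + _).
have OmE u : scA ih * La (tn - 2^-1 *: omA (bA b) u) = scA ih * La tn - 2^-1 *: Om (bA b) u.
  by rewrite LaD mulrDr -scaleNr LaZ -scalerAr scaleNr.
rewrite /c0 OmE OmE -addrA; congr (_ + _); rewrite /kap -!opprD -!scalerDr; congr (- (_ *: _)).
rewrite expE OmDr; congr (_ + _).
(* Invariance moves $Y$ away from [b]. With $Y(x - b) = Yx - Yb$, the term of [kap] and the sum of
   the [z k] add up to $-\frac12 i\hbar\,\omega(b, e^Yx - x)$, the change of the phase in [Ush]. *)
have zE k : z k = Om (bA b) (actY (yv k)).
  by rewrite /z (OmC _ hYb)// (Om_actY hb) ?opprK.
transitivity (Om (bA b) (\sum_(k < K.+1) fac k.+1 *: Yk k.+1)).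
  rewrite [X in _ + X](_ : _ = Om (bA b) (\sum_(k < K.+1) fac k.+1 *: actY (yv k))); last first.
    by rewrite Om_sumr; apply: eq_bigr => k _; rewrite OmZr zE.
  rewrite -OmDr; congr Om; rewrite 2!big_ord_recl fac1 !scale1r [actY (yv _)]nE addrA; congr (_ + _).
  by rewrite addrC subrK.
congr Om; rewrite big_ord_recr /=.
have -> : actY (Yk K) = 0 by exact: (YK K.+1).
by rewrite scaler0 addr0.
Qed.

End Step.

End SuperHeisenberg.

(** * Complexified Grassmann algebra *)

Section Complexified.
Variables (R : realType) (A : baseAlgebra R).
Local Notation cscale := (@Pilot.Defs.cscale R A).
Implicit Types (z w v : A * A).

Lemma cmulA z w v : cmul z (cmul w v) = cmul (cmul z w) v.
Proof.
case: z w v => [z1 z2] [w1 w2] [v1 v2]; rewrite /cmul /=; congr pair;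
  rewrite !(mulrDr, mulrBr, mulrDl, mulrBl, mulrN, mulNr) !mulrA ?opprD;
  by rewrite [LHS](AC (2*2) ((1*4)*(2*3))).
Qed.
Lemma cmulDl z w v : cmul (z + w) v = cmul z v + cmul w v.
Proof. by rewrite /cmul !mulrDl pairD opprD addrACA [X in (_, X)]addrACA. Qed.
Lemma cmulDr z w v : cmul v (z + w) = cmul v z + cmul v w.
Proof. by rewrite /cmul !mulrDr pairD opprD addrACA [X in (_, X)]addrACA. Qed.
Lemma cmul0 z : cmul z 0 = 0. Proof. by rewrite /cmul /= !mulr0 subr0 addr0. Qed.
Lemma cmul0l z : cmul 0 z = 0. Proof. by rewrite /cmul /= !mul0r subr0 addr0. Qed.
Lemma cmulZl (k : R) z w : cmul (k *: z) w = k *: cmul z w.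
Proof. by rewrite /cmul /= pairZ -!scalerAl -scalerBr -scalerDr. Qed.
Lemma cmulZr (k : R) z w : cmul z (k *: w) = k *: cmul z w.
Proof. by rewrite /cmul /= pairZ -!scalerAr -scalerBr -scalerDr. Qed.
Lemma cmul_sumr I (t : seq I) (P : pred I) (G : I -> A * A) z :
  cmul z (\sum_(i <- t | P i) G i) = \sum_(i <- t | P i) cmul z (G i).
Proof. by apply: (big_morph (cmul z)) => [u v|]; [exact: cmulDr|exact: cmul0]. Qed.

Lemma cmul_cscale c z w : cmul (cscale c z) w = cscale c (cmul z w).
Proof.
case: z w => [z1 z2] [w1 w2]; rewrite /cmul /cscale /=; congr pair;
  rewrite !(mulrBl, mulrDl) -!scalerAl !(scalerBr, scalerDr) ?opprD;
  by rewrite [LHS](AC (2*2) ((1*3)*(4*2))).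
Qed.
Lemma cscale_cmul c z w : cmul z (cscale c w) = cscale c (cmul z w).
Proof.
case: z w => [z1 z2] [w1 w2]; rewrite /cmul /cscale /=; congr pair;
  rewrite !(mulrBr, mulrDr) -!scalerAr !(scalerBr, scalerDr) ?opprD;
  by rewrite [LHS](AC (2*2) ((1*3)*(2*4))).
Qed.
Lemma cscaleD c z w : cscale c (z + w) = cscale c z + cscale c w.
Proof. by rewrite /cscale !scalerDr pairD opprD addrACA [X in (_, X)]addrACA. Qed.
Lemma cscale0 c : cscale c 0 = 0 :> A * A.
Proof. by rewrite /cscale /= !scaler0 subr0 addr0. Qed.
Lemma cscaleM c d z : cscale c (cscale d z) = cscale (c * d) z.
Proof.
case: z => [a b]; rewrite /Pilot.Defs.cscale ReM ImM /=; congr pair;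
  rewrite !(scalerBr, scalerDr, scalerA, scalerBl, scalerDl) ?opprD;
  by rewrite [LHS](AC (2*2) ((1*4)*(2*3)))/= ?scaleNr.
Qed.
Lemma twistN p (a : A) : twist p (- a) = - twist p a.
Proof. exact: (linearN (@twist R A p)). Qed.
Lemma ctwistM p z w : ctwist p (cmul z w) = cmul (ctwist p z) (ctwist p w).
Proof. by rewrite /ctwist /cmul /= !twistD twistN !twistM. Qed.
Lemma ctwistD p z w : ctwist p (z + w) = ctwist p z + ctwist p w.
Proof. by rewrite /ctwist !twistD. Qed.
Lemma ctwistZ p (k : R) z : ctwist p (k *: z) = k *: ctwist p z.
Proof. by rewrite /ctwist !twistZ. Qed.
Lemma ctwist0 p : ctwist p (0 : A * A) = 0.
Proof. by rewrite /ctwist !(linear0 (@twist R A p)). Qed.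
Lemma ctwist_cscale p c z : ctwist p (cscale c z) = cscale c (ctwist p z).
Proof. by rewrite /ctwist /cscale /= !twistD twistN !twistZ. Qed.
Lemma ctwist_sum I (t : seq I) (P : pred I) (G : I -> A * A) p :
  ctwist p (\sum_(i <- t | P i) G i) = \sum_(i <- t | P i) ctwist p (G i).
Proof. by apply: (big_morph (ctwist p)) => [u v|]; [exact: ctwistD|exact: ctwist0]. Qed.
Lemma ctwist_ctwist p q z : ctwist p (ctwist q z) = ctwist (p (+) q) z.
Proof. by rewrite /ctwist /= !twist_twist. Qed.
Lemma ctwist_false z : ctwist false z = z.
Proof. by rewrite /ctwist !twist0; case: z. Qed.
Lemma cmul1 z : cmul (1, 0) z = z.
Proof. by rewrite /cmul /= !mul1r !mul0r subr0 addr0; case: z. Qed.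
Lemma ctwist1 p : ctwist p (1 : A, 0 : A) = (1, 0).
Proof. by rewrite /ctwist /= twist1 (linear0 (@twist R A p)). Qed.
Definition codd z := homog true z.1 /\ homog true z.2.
Lemma ctwist_odd z : codd z -> ctwist true z = - z.
Proof. by case: z => [a b] [/= ha hb]; rewrite /ctwist /= (twistE _ ha) (twistE _ hb) !scaleN1r. Qed.
Lemma codd_anti z w : codd z -> codd w -> cmul z w = - cmul w z.
Proof.
case: z w => [a b] [c d] [/= ha hb] [/= hc hd]; rewrite /cmul /=.
rewrite (homog_comm ha hc) (homog_comm hb hd) (homog_comm ha hd) (homog_comm hb hc) !scaleN1r.
by congr pair; rewrite opprD ?opprK// addrC.
Qed.
End Complexified.

(** * Multiplication in the Grassmann algebra *)

Section GrassmannTheory.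
Variables (R : realType) (A : baseAlgebra R) (n : nat).
Local Notation gr := ({set 'I_n} -> A * A).
Local Notation cscale := (@Pilot.Defs.cscale R A).
Implicit Types (z w u : gr).

Lemma below_setUD k (J K : {set 'I_n}) : J \subset K -> below k K = (below k J + below k (K :\: J))%N.
Proof.
move=> JK; rewrite /below -(cardsID J); congr (_ + _)%N; congr #|pred_of_set _|; apply/finset.setP => j; rewrite !inE.
  by case jJ: (j \in J); rewrite ?andbF// (fintype.subsetP JK _ jJ) andbT.
by rewrite andbA.
Qed.
Lemma below_self k (J : {set 'I_n}) : below k (k |: J) = below k J.
Proof.
have [kJ|kJ] := boolP (k \in J); first by rewrite (finset.setUidPr _)// finset.sub1set.
by rewrite below_setU1// ltnn.
Qed.

Lemma gmul_gconst c w K : gmul (gconst c) w K = cmul c (w K).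
Proof.
rewrite /gmul (bigD1 finset.set0) ?finset.sub0set//= big1 ?addr0.
  rewrite /gconst eqxx inversionsE big_pred0 ?expr0 ?scale1r; last by move=> i; rewrite finset.in_set0.
  by rewrite cards0 finset.setD0 ctwist_false.
by move=> I /andP[_ /negbTE I0]; rewrite /gconst I0 cmul0l scaler0.
Qed.
Lemma gmul_ggen k w K : gmul (ggen A k) w K =
  if k \in K then (-1) ^+ below k K *: ctwist true (w (K :\ k)) else 0.
Proof.
have [kK|kK] := boolP (k \in K); last first.
  rewrite /gmul big1// => I IK; rewrite /ggen; case: eqP => [E|_]; last by rewrite cmul0l scaler0.
  by move: IK; rewrite E finset.sub1set (negbTE kK).
rewrite /gmul (bigD1 [set k]%SET) ?finset.sub1set//= big1 ?addr0.
  rewrite /ggen eqxx cmul1 cards1 inversionsE finset.big_set1.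
  have -> : below k K = below k (K :\ k) by rewrite -{1}(finset.setD1K kK) below_self.
  by [].
by move=> I /andP[_ /negbTE I0]; rewrite /ggen I0 cmul0l scaler0.
Qed.
Lemma gmulDl z w u : gmul (z + w) u = gmul z u + gmul w u.
Proof.
apply/funext => K; rewrite /gmul [RHS](_ : _ = gmul z u K + gmul w u K)// -big_split.
by apply: eq_bigr => I _; rewrite (_ : (z + w) I = z I + w I)// cmulDl scalerDr.
Qed.
Lemma gmulDr z w u : gmul u (z + w) = gmul u z + gmul u w.
Proof.
apply/funext => K; rewrite /gmul [RHS](_ : _ = gmul u z K + gmul u w K)// -big_split.
by apply: eq_bigr => I _; rewrite (_ : (z + w) _ = z (K :\: I) + w (K :\: I))// ctwistD cmulDr scalerDr.
Qed.
Lemma gmulZl (k : R) z u : gmul (k *: z) u = k *: gmul z u.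
Proof.
apply/funext => K; rewrite /gmul [RHS](_ : _ = k *: gmul z u K)// scaler_sumr.
by apply: eq_bigr => I _; rewrite (_ : (k *: z) I = k *: z I)// cmulZl !scalerA mulrC.
Qed.
Lemma gmulZr (k : R) z u : gmul u (k *: z) = k *: gmul u z.
Proof.
apply/funext => K; rewrite /gmul [RHS](_ : _ = k *: gmul u z K)// scaler_sumr.
by apply: eq_bigr => I _; rewrite (_ : (k *: z) _ = k *: z (K :\: I))// ctwistZ cmulZr !scalerA mulrC.
Qed.
Lemma gmul0l w : gmul 0 w = 0.
Proof. by have := gmulZl 0 0 w; rewrite !scale0r. Qed.
Lemma gmul0r w : gmul w 0 = 0.
Proof. by have := gmulZr 0 0 w; rewrite !scale0r. Qed.
Lemma cscaleZ c (k : R) (z : A * A) : cscale c (k *: z) = k *: cscale c z.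
Proof. by rewrite /cscale /= pairZ scalerBr scalerDr !scalerA ![k * _]mulrC. Qed.
Lemma gscale_gmul c z w : gmul (gscale c z) w = gscale c (gmul z w).
Proof.
apply/funext => K; rewrite /gmul /gscale (big_morph (cscale c) (cscaleD c) (cscale0 A c)).
by apply: eq_bigr => I _; rewrite cmul_cscale cscaleZ.
Qed.
Lemma gmul_gscale c z w : gmul z (gscale c w) = gscale c (gmul z w).
Proof.
apply/funext => K; rewrite /gmul /gscale (big_morph (cscale c) (cscaleD c) (cscale0 A c)).
by apply: eq_bigr => I _; rewrite ctwist_cscale cscale_cmul cscaleZ.
Qed.
Lemma gscaleD c z w : gscale c (z + w) = gscale c z + gscale c w.
Proof. by apply/funext => K; rewrite /gscale; exact: cscaleD. Qed.

Lemma gmul1r z : gmul z (gconst (1, 0)) = z.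
Proof.
apply/funext => K; rewrite /gmul (bigD1 K)//= big1 ?addr0 => [|I /andP[IK neK]].
  rewrite finset.setDv /gconst eqxx ctwist1 inversionsE big1 ?expr0 ?scale1r.
    by rewrite /cmul /= !mulr1 !mulr0 subr0 add0r; case: (z K).
  move=> i _; rewrite /below; apply/eqP; rewrite cards_eq0; apply/eqP/finset.setP => j.
  by rewrite !inE.
rewrite /gconst; case: eqP => [/eqP|_]; last by rewrite ctwist0 cmul0 scaler0.
by rewrite finset.setD_eq0 => KI; move: neK; rewrite finset.eqEsubset IK KI.
Qed.

(* Elements acting associatively; with the generators they include every
   polynomial, which is all that is needed of the associativity of gmul. *)
Definition lassoc z := forall u w, gmul (gmul z u) w = gmul z (gmul u w).

Lemma lassoc_const c : lassoc (gconst c).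
Proof.
move=> u w; apply/funext => K; rewrite gmul_gconst /gmul cmul_sumr; apply: eq_bigr => I _.
by rewrite -/(gmul _ _ _) gmul_gconst cmulZr cmulA.
Qed.
Lemma lassoc_gen k : lassoc (ggen A k).
Proof.
move=> u w; apply/funext => K; rewrite gmul_ggen.
rewrite {1}/gmul (bigID (fun I : {set 'I_n} => k \in I)) /= [X in _ + X]big1 ?addr0; last first.
  by move=> I /andP[_ /negbTE kI]; rewrite gmul_ggen kI cmul0l scaler0.
have [kK|kK] := boolP (k \in K); last first.
  by rewrite big1// => I /andP[IK kI]; move: kK; rewrite (fintype.subsetP IK).
rewrite (reindex_onto (fun J : {set 'I_n} => k |: J) (fun I : {set 'I_n} => I :\ k)) /=; last first.
  by move=> I /andP[_ kI]; rewrite finset.setD1K.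
rewrite {2}/gmul ctwist_sum scaler_sumr; apply: eq_big => [J|J].
  apply/andP/idP => [[/andP[KJ _] /eqP <-]|JK]; first exact: finset.setSD.
  have kJ : k \notin J by apply/negP => /(fintype.subsetP JK); rewrite !inE eqxx.
  rewrite setU11 setU1K// eqxx finset.subUset finset.sub1set kK andbT; split=> //.
  rewrite /=; apply: (fintype.subset_trans JK); exact: finset.subsetDl.
move=> /andP[/andP[KJ _] /eqP JE].
have kJ : k \notin J by rewrite -JE !inE eqxx.
have JK : J \subset K :\ k by rewrite -JE; exact: finset.setSD.
rewrite gmul_ggen setU11 setU1K// -finset.setDDl below_self inversionsE big_setU1//= -inversionsE.
rewrite cardsU1 kJ /= ctwistZ ctwistM ctwist_ctwist cmulZl !scalerA; congr (_ *: _).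
have -> : below k K = below k (K :\ k) by rewrite -{1}(finset.setD1K kK) below_self.
rewrite (below_setUD k JK) !exprD.
by rewrite [in LHS]mulrC !mulrA.
Qed.
Lemma lassocD z w : lassoc z -> lassoc w -> lassoc (z + w).
Proof. by move=> hz hw u v; rewrite !gmulDl hz hw. Qed.
Lemma lassocZ (k : R) z : lassoc z -> lassoc (k *: z).
Proof. by move=> hz u v; rewrite !gmulZl hz. Qed.
Lemma lassoc_scale c z : lassoc z -> lassoc (gscale c z).
Proof. by move=> hz u v; rewrite !gscale_gmul hz. Qed.
Lemma lassocM z w : lassoc z -> lassoc w -> lassoc (gmul z w).
Proof. by move=> hz hw u v; rewrite hz hz hw hz. Qed.

(** Any bound beyond which the iterates vanish may replace the one picked by [xget]. *)
Lemma nilexpE (V : lmodType R) (T : V -> V) v q : (forall k, (q <= k)%N -> iter k T v = 0) ->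
  nilexp T v = \sum_(k < q) fac R k *: iter k T v.
Proof.
move=> Tq; rewrite /nilexp; set P := [set K | _].
have PK : P (xget 0%N P) by apply: (@xgetPex _ _ P); exists q.
move: (xget 0%N P) PK => K PK.
have E a b : (forall k, (a <= k)%N -> iter k T v = 0) -> (a <= b)%N ->
    \sum_(k < b) fac R k *: iter k T v = \sum_(k < a) fac R k *: iter k T v.
  move=> Ta ab; rewrite -(subnKC ab) big_split_ord /= [X in _ + X]big1 ?addr0// => k _.
  by rewrite Ta ?leq_addr// scaler0.
rewrite -/(fac R) -[LHS](E K (maxn K q)) ?leq_maxl//; first by rewrite (E q) ?leq_maxr.
Qed.
End GrassmannTheory.

(** * Fibrewise action of operators *)

Section Fibres.
Variables (R : realType) (A : baseAlgebra R) (hbar : R) (m r s : nat).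
Local Notation C := R[i].
Local Notation cscale := (@Pilot.Defs.cscale R A).
Local Notation opH := (op (Hsub R m r s)).
Local Notation opA := (op (AHsub A m r s)).
Local Notation AHF := ('rV[R]_m -> {set 'I_(r + s)} -> A * A).
Local Notation gr := ({set 'I_(r + s)} -> A * A).
Local Notation La := (@La R A m r s).
Local Notation hat := (@hat R A m r s).
Local Notation scA := (@scA R A m r s).
Local Notation H := ('rV[R]_m -> {set 'I_(r + s)} -> R[i]).
Implicit Types (T : opA) (phi : AHF) (y : 'rV[R]_m) (z : A * A) (k : 'I_(r + s)).

Definition Lc z : opA := La z.1 + La z.2 * scA 'i%C.
Definition Gh k : opA := hat true (opG R m k).
Definition Dh k : opA := hat true (opD_ R m k).
Definition Xh (i : 'I_m) : opA := hat false (opX R r s i).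
Definition Ph (i : 'I_m) : opA := hat false (opP R r s i).

Lemma tensC a (f : H) y K c : ((tens a (c *: f : H) : AHF) y K) = cscale c ((tens a f : AHF) y K).
Proof.
rewrite !tensE (_ : (c *: f : H) y K = c * f y K)// ReM ImM /Pilot.Defs.cscale /=.
by congr pair; rewrite ?scalerBl ?scalerDl !scalerA.
Qed.

Lemma A_in T phi : AH phi -> AH (T phi).
Proof. exact: (@op_in _ _ (AHsub A m r s)). Qed.

Lemma fib_ind2 y y' T (t : gr -> gr) : (forall u v, t (u + v) = t u + t v) -> t 0 = 0 ->
  (forall a (f : H), Hsmooth f -> T (tens a f) y = t ((tens a f : AHF) y')) ->
  forall phi, AH phi -> T phi y = t (phi y').
Proof.
move=> tD t0 tT phi /AH_P[l Sl ->]; rewrite /tsum; elim: l Sl => [|[a f] l IH].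
  by move=> _; rewrite !big_nil op0 [RHS](_ : _ = t 0).
move=> /andP[/asboolP Sf Sl]; rewrite !big_cons.
have Sl' : AHsub A m r s (\sum_(af <- l) tens af.1 af.2).
  by apply/AH_P; exists l.
have Sf' : AHsub A m r s (tens a f) by exact: AH_tens.
rewrite (opD T Sf' Sl') [LHS](_ : _ = T (tens a f) y + T (\sum_(af <- l) tens af.1 af.2) y)//.
rewrite (IH Sl) tT// [in RHS](_ : (_ + _) y' = (tens a f : AHF) y' + (\sum_(af <- l) tens af.1 af.2 : AHF) y')//.
Qed.

Lemma fib_ind y T (t : gr -> gr) : (forall u v, t (u + v) = t u + t v) -> t 0 = 0 ->
  (forall a (f : H), Hsmooth f -> T (tens a f) y = t ((tens a f : AHF) y)) ->
  forall phi, AH phi -> T phi y = t (phi y).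
Proof. exact: fib_ind2. Qed.

Lemma gcD (f g : gr) : f + g = fun K => f K + g K. Proof. by []. Qed.
Lemma AHFD (f g : AHF) y : (f + g) y = f y + g y. Proof. by []. Qed.

Lemma scA_fib c y phi : AH phi -> scA c phi y = gscale c (phi y).
Proof.
move: phi; apply: fib_ind => [u v||a f Sf].
- exact: gscaleD.
- by apply/funext => K; rewrite /gscale (cscale0 A).
- apply/funext => K; rewrite hat_tens// twist0 /gscale -tensC; congr (tens _ _ _ _).
  by have Sf' : Hsub R m r s f by []; rewrite (opEZ _ _ Sf') (opE1 Sf').
Qed.
Lemma La_fib a y phi : AH phi -> La a phi y = gmul (gconst (a, 0)) (phi y).
Proof.
move: phi; apply: fib_ind => [u v||b f Sf]; [exact: gmulDr|exact: gmul0r|].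
apply/funext => K; rewrite La_tens// gmul_gconst !tensE /cmul /= !mul0r subr0 addr0.
by rewrite -!scalerAr.
Qed.
Lemma Lc_fib z y phi : AH phi -> Lc z phi y = gmul (gconst z) (phi y).
Proof.
move=> hp; rewrite /Lc (@opED _ _ (AHsub A m r s) _ _ _ hp) (@opEM _ _ (AHsub A m r s) _ _ _ hp) AHFD La_fib// La_fib; last exact: A_in.
rewrite scA_fib// gmul_gscale -gscale_gmul -gmulDl; congr gmul; apply/funext => K.
rewrite gcD /gscale /gconst; case: ifP => _; last by rewrite (cscale0 A) addr0.
by case: z => a b; rewrite /Pilot.Defs.cscale /= !scale0r !scaler0 scale1r subr0 add0r pairD addr0 add0r.
Qed.
Lemma Gh_fib k y phi : AH phi -> Gh k phi y = gmul (ggen A k) (phi y).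
Proof.
move: phi; apply: fib_ind => [u v||b f Sf]; [exact: gmulDr|exact: gmul0r|].
apply/funext => K; rewrite hat_tens// gmul_ggen tensE opGE// gmE.
case: ifP => _; last by rewrite mul0r /= !scale0r.
rewrite /ctwist !tensE /= !twistZ.
have -> : (-1) ^+ below k K = cr ((-1) ^+ below k K) :> C by rewrite cr_sign.
by rewrite ReM ImM /= !mul0r subr0 addr0 pairZ !scalerA.
Qed.
Lemma Xh_fib i y phi : AH phi -> Xh i phi y = y 0 i *: phi y.
Proof.
move: phi; apply: fib_ind => [u v||b f Sf]; [exact: scalerDr|exact: scaler0|].
apply/funext => K; rewrite hat_tens// twist0 tensE opXE// ReM ImM /= !mul0r subr0 addr0.
by rewrite (_ : (y 0 i *: (tens b f : AHF) y) K = y 0 i *: (tens b f : AHF) y K)// tensE pairZ !scalerA.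
Qed.

(** The bridge between the formula for U, written with [gmul] at each point, and the operator
    algebra. [lassoc g] is included so that powers of [T] correspond to iterates of [gmul g]. *)
Definition fib y T (g : gr) := lassoc g /\ forall phi, AH phi -> T phi y = gmul g (phi y).

Lemma fibD y T U (g h : gr) : fib y T g -> fib y U h -> fib y (T + U) (g + h).
Proof.
move=> [ag hg] [ah hh]; split=> [|phi hp]; first exact: lassocD.
by rewrite (@opED _ _ (AHsub A m r s) _ _ _ hp) AHFD hg// hh// gmulDl.
Qed.
Lemma fibZ y T (g : gr) (k : R) : fib y T g -> fib y (k *: T) (k *: g).
Proof.
move=> [ag hg]; split=> [|phi hp]; first exact: lassocZ.
by rewrite (@opEZ _ _ (AHsub A m r s) _ _ _ hp) (_ : (k *: T phi) y = k *: T phi y)// hg// gmulZl.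
Qed.
Lemma fibN y T (g : gr) : fib y T g -> fib y (- T) (- g).
Proof. by move=> /(fibZ (-1)); rewrite [X in fib _ X _]scaleN1r [X in fib _ _ X]scaleN1r. Qed.
Lemma fib_scA y T (g : gr) c : fib y T g -> fib y (scA c * T) (gscale c g).
Proof.
move=> [ag hg]; split=> [|phi hp]; first exact: lassoc_scale.
by rewrite (@opEM _ _ (AHsub A m r s) _ _ _ hp) scA_fib; [rewrite hg// gscale_gmul|exact: A_in].
Qed.
Lemma fibM y T U (g h : gr) : fib y T g -> fib y U h -> fib y (T * U) (gmul g h).
Proof.
move=> [ag hg] [ah hh]; split=> [|phi hp]; first exact: lassocM.
by rewrite (@opEM _ _ (AHsub A m r s) _ _ _ hp) hg; [rewrite hh// ag|exact: A_in].
Qed.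
Lemma fib_La y a : fib y (La a) (gconst (a, 0)).
Proof. by split=> [|phi]; [exact: lassoc_const|exact: La_fib]. Qed.
Lemma fib_Lc y z : fib y (Lc z) (gconst z).
Proof. by split=> [|phi]; [exact: lassoc_const|exact: Lc_fib]. Qed.
Lemma fib_Gh y k : fib y (Gh k) (ggen A k).
Proof. by split=> [|phi]; [exact: lassoc_gen|exact: Gh_fib]. Qed.
Lemma fib0 y : fib y 0 0.
Proof. by have := fibZ 0 (fib_La y 0); rewrite !scale0r. Qed.
Lemma fib_sum y I (t : seq I) (F : I -> opA) (G : I -> gr) : (forall i, fib y (F i) (G i)) ->
  fib y (\sum_(i <- t) F i) (\sum_(i <- t) G i).
Proof.
move=> FG; elim: t => [|i t IH]; first by rewrite !big_nil; exact: fib0.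
by rewrite !big_cons; exact: fibD.
Qed.
Lemma fib_Xh y i : fib y (Xh i) (gconst ((y 0 i)%:A, 0)).
Proof.
split=> [|phi hp]; first exact: lassoc_const.
rewrite Xh_fib//; apply/funext => K; rewrite gmul_gconst /cmul /= !mul0r subr0 addr0.
by rewrite !mulr_algl (_ : (y 0 i *: phi y) K = y 0 i *: phi y K)//; case: (phi y K).
Qed.

Lemma unit_at y : exists2 phi : AHF, AH phi & phi y = gconst (1, 0).
Proof.
have [f Sf f1] := schwartz_neq0 R m.
pose g : H := fun x K => if K == finset.set0 then u0 0 y 0 f x else 0.
have Sg : Hsmooth g.
  by move=> K; rewrite /g; case: eqP => _; [exact: schwartz_u0|exact: schwartz0].
exists (tens 1 g); first exact: AH_tens.
apply/funext => K; rewrite tensE /g /gconst; case: eqP => _; last by rewrite /= !scale0r.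
by rewrite /u0 mul0r ei0 mul1r subrr f1 /= scale1r scale0r.
Qed.

(** The nilpotency of [T] passes to [gmul z] by testing on a superfunction with value 1 at [y]
    ([unit_at]); the two series then agree term by term. *)
Lemma gexp_fib (F : filtration opA) y T (z : gr) phi : F 1 T -> fib y T z -> AH phi ->
  gmul (nilexp (gmul z) (gconst (1, 0))) (phi y) = nexp F T phi y.
Proof.
move=> FT [az hz] hp; set q := (fl_order F).+2.
have itE (u : AHF) (k : nat) : AH u -> iter k (gmul z) (u y) = (T ^+ k) u y.
  move=> hu; elim: k => [|k IH]; first by rewrite expr0 (@opE1 _ _ (AHsub A m r s) _ hu).
  by rewrite iterS IH exprS (@opEM _ _ (AHsub A m r s) _ _ _ hu) hz//; exact: A_in.
have Tq : T ^+ fl_order F = 0 by apply/(fl_nil (f := F))/flX.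
have [phi1 h1 e1] := unit_at y.
rewrite (@nilexpE R gr _ _ q); last first.
  move=> k qk; rewrite -e1 itE//.
  by rewrite -(subnKC (leq_trans (leqW (leqnSn _)) qk)) exprD Tq mul0r (@opE0 _ _ (AHsub A m r s) _ h1).
have nE : nexp F T phi y = \sum_(k < q) fac R k *: (T ^+ k) phi y.
  rewrite /nexp /texp (@opE_sum _ _ (AHsub A m r s) _ _ _ _ _ hp) -/q.
  elim/big_ind2 : _ => // [u1 u2 v1 v2 <- <-//|k _]; by rewrite (@opEZ _ _ (AHsub A m r s) _ _ _ hp).
rewrite nE (big_morph (fun w => gmul w (phi y)) (fun u v => gmulDl u v _) (gmul0l _)).
apply: eq_bigr => k _; rewrite gmulZl -itE//; congr (_ *: _).
elim: (k : nat) => [|j IH]; last by rewrite !iterS az IH.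
by apply/funext => K; rewrite gmul_gconst cmul1.
Qed.

(** As [e] commutes with [X], $[X^{k+1}, G] = (k+1)\,e\,X^k$. *)
Lemma nexp_shift (F : filtration opA) (X G e : opA) : F 1 X -> X * G = G * X + e -> e * X = X * e ->
  nexp F X * G = (G + e) * nexp F X.
Proof.
move=> FX XG eX; have Xq : X ^+ fl_order F = 0 by apply/(fl_nil (f := F))/flX.
have XkG (k : nat) : X ^+ k.+1 * G = G * X ^+ k.+1 + k.+1%:R *: (e * X ^+ k).
  elim: k => [|k IH]; first by rewrite !expr1 expr0 mulr1 scale1r.
  rewrite exprS -mulrA IH mulrDr mulrA XG mulrDl -mulrA -exprS -addrA; congr (_ + _).
  by rewrite -scalerAr mulrA -eX -mulrA -exprS -[k.+2]addn1 natrD scalerDl scale1r addrC.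
have stab j : (fl_order F <= j)%N -> texp j X = nexp F X.
  by move=> le; rewrite (texp_nexp FX (n := j))// -(subnKC le) exprD Xq mul0r.
set q := fl_order F; rewrite mulrDl -{1}(stab q.+1)// -{1}(stab q.+1)// -(stab q)//.
rewrite /texp !big_ord_recl !expr0 fac0 !scale1r mulrDl mulrDr mul1r mulr1 -addrA; congr (_ + _).
rewrite mulr_suml !mulr_sumr -big_split; apply: eq_bigr => k _ /=.
rewrite -scalerAl XkG scalerDr -!scalerAr; congr (_ + _).
by rewrite scalerA -(facS R k) mulr_natr.
Qed.

End Fibres.

(** * Odd translations as exponentials *)

Section Shift.
Variables (R : realType) (A : baseAlgebra R) (m r s : nat).
Local Notation C := R[i].
Local Notation cscale := (@Pilot.Defs.cscale R A).
Local Notation opH := (op (Hsub R m r s)).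
Local Notation opA := (op (AHsub A m r s)).
Local Notation AHF := ('rV[R]_m -> {set 'I_(r + s)} -> A * A).
Local Notation gr := ({set 'I_(r + s)} -> A * A).
Local Notation La := (@La R A m r s).
Local Notation Lc := (@Lc R A m r s).
Local Notation Gh := (@Gh R A m r s).
Local Notation Dh := (@Dh R A m r s).
Local Notation Xh := (@Xh R A m r s).
Local Notation Ph := (@Ph R A m r s).
Local Notation hat := (@hat R A m r s).
Local Notation scA := (@scA R A m r s).
Local Notation H := ('rV[R]_m -> {set 'I_(r + s)} -> R[i]).

Lemma scAN1 : scA (-1) = -1.
Proof. by rewrite /scA scaleN1r hatN hat1. Qed.
Lemma Lc_hat p (T : opH) z : hat p T * Lc z = Lc (ctwist p z) * hat p T.
Proof. by rewrite /Lc mulrDr mulrDl mulrA !hat_La -!mulrA scA_hat. Qed.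
Lemma Lc_scA c z : scA c * Lc z = Lc z * scA c.
Proof. by rewrite /scA Lc_hat ctwist_false. Qed.
Lemma LcM z w : Lc z * Lc w = Lc (cmul z w).
Proof.
case: z w => [a b] [c d]; rewrite /Lc /cmul /= mulrDl !mulrDr.
have ii : scA 'i%C * scA 'i%C = -1.
  rewrite scAM -scAN1; congr (scA _).
  by apply: complex_ext; rewrite ?ReM ?ImM /= ?mulr0 ?mul0r ?mulr1 ?sub0r ?addr0 ?oppr0.
have e1 (u v : A) : La u * scA 'i%C * La v = La (u * v) * scA 'i%C by rewrite -mulrA scA_La mulrA LaM.
have e2 : La a * (La d * scA 'i%C) = La (a * d) * scA 'i%C by rewrite mulrA LaM.
have e4 : La b * scA 'i%C * (La d * scA 'i%C) = - La (b * d) by rewrite mulrA e1 -mulrA ii mulrN1.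
rewrite e2 e1 e4 LaM !LaD LaN mulrDl [LHS](AC (2*2) ((1*4)*(2*3)))/=.
by [].
Qed.
Lemma LcD z w : Lc (z + w) = Lc z + Lc w.
Proof. by rewrite /Lc !LaD mulrDl addrACA. Qed.
Lemma LcZ (k : R) z : Lc (k *: z) = k *: Lc z.
Proof. by rewrite /Lc !LaZ scalerDr scalerAl. Qed.
Lemma LcN z : Lc (- z) = - Lc z.
Proof. by rewrite -scaleN1r LcZ scaleN1r. Qed.
Lemma Lc0 : Lc 0 = 0. Proof. by have := LcZ 0 0; rewrite !scale0r. Qed.
Lemma Lc_La a : Lc (a, 0) = La a.
Proof. by rewrite /Lc /= La0 mul0r addr0. Qed.
Lemma Lc_sum I (t : seq I) (P : pred I) F : Lc (\sum_(i <- t | P i) F i) = \sum_(i <- t | P i) Lc (F i).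
Proof. by apply: (big_morph Lc); [exact: LcD|exact: Lc0]. Qed.

Lemma DhGh k k' : Dh k * Gh k' = - (Gh k' * Dh k) + (k == k')%:R.
Proof.
rewrite /Gh /Dh !hatM opDG hatD hatN; congr (_ + _).
by case: eqP => _; rewrite ?scale1r ?scale0r ?hat1 ?hat0.
Qed.
Lemma PhXh i j : Ph i * Xh j = Xh j * Ph i + (i == j)%:R.
Proof.
rewrite /Ph /Xh !hatM opPX hatD; congr (_ + _).
by case: eqP => _; rewrite ?scale1r ?scale0r ?hat1 ?hat0.
Qed.
Lemma XhDh i k : Xh i * Dh k = Dh k * Xh i.
Proof. by rewrite /Xh /Dh !hatM opXD. Qed.
Lemma PhGh i k : Ph i * Gh k = Gh k * Ph i.
Proof. by rewrite /Ph /Gh !hatM opPG. Qed.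
Lemma PhDh i k : Ph i * Dh k = Dh k * Ph i.
Proof. by rewrite /Ph /Dh !hatM opPD. Qed.

Lemma odd_pair z w p (T U : opH) : codd z -> codd w ->
  Lc z * hat true T * (Lc w * hat p U) = - (Lc (cmul z w) * (hat true T * hat p U)).
Proof.
move=> hz hw; rewrite -mulrA (mulrA (hat true T)) Lc_hat (ctwist_odd hw) LcN !mulNr mulrN !mulrA LcM.
by [].
Qed.

Section Filt.
Variable l : seq A.
Hypothesis lH : forall a, a \in l -> exists p, homog p a.
Hypothesis lB : forall a, a \in l -> body A a = 0.
Local Notation F := (@AFl R A m r s l lH lB).

Definition cidl (z : A * A) := idl l 1 z.1 /\ idl l 1 z.2.
Lemma Fl_Lc p T z : cidl z -> F 1 (Lc z * hat p T).
Proof.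
move=> [h1 h2]; rewrite /Lc mulrDl; apply: flD; first by apply: FlE (sup_hat _ _).
by rewrite -mulrA -hat_scale; apply: FlE (sup_hat _ _).
Qed.

Variable h : 'I_(r + s) -> A * A.
Hypotheses (ho : forall k, codd (h k)) (hi : forall k, cidl (h k)).

(** The generator $-\sum h_k\,\partial/\partial e_k$ of the odd translation; its exponential is
    [gshift h] on each fibre. *)
Definition SB : opA := \sum_k - (Lc (h k) * Dh k).
Lemma Fl_SB : F 1 SB.
Proof. by apply: Fl_sum => k _; rewrite -scaleN1r; apply: (flZ (f := F)); exact: Fl_Lc. Qed.

Lemma SB_Gh k : SB * Gh k = Gh k * SB - Lc (h k).
Proof.
rewrite /SB mulr_suml mulr_sumr.
have LG j : Gh k * Lc (h j) = - (Lc (h j) * Gh k) by rewrite /Gh Lc_hat (ctwist_odd (ho j)) LcN mulNr.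
have E j : - (Lc (h j) * Dh j) * Gh k = Gh k * - (Lc (h j) * Dh j) - (j == k)%:R * Lc (h k).
  rewrite mulNr -mulrA DhGh mulrDr mulrN opprD opprK mulrN (mulrA (Gh k)) LG mulNr opprK -mulrA.
  congr (_ - _).
  by case: eqP => [->|_]; rewrite ?mulr1 ?mul1r// mulr0 mul0r.
rewrite (eq_bigr _ (fun j _ => E j)) sumrB; congr (_ - _).
by rewrite (bigD1 k)//= eqxx mul1r big1 ?addr0// => j /negbTE ->; rewrite mul0r.
Qed.

Definition Sop : opA := nexp F SB.
Lemma Lc_SB j : Lc (h j) * SB = SB * Lc (h j).
Proof.
rewrite /SB mulr_suml mulr_sumr; apply: eq_bigr => k _.
rewrite mulrN mulNr -mulrA /Dh Lc_hat (ctwist_odd (ho j)) LcN mulNr mulrN opprK.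
by rewrite !mulrA !LcM codd_anti// LcN mulNr opprK.
Qed.
Lemma Sop_Gh k : Sop * Gh k = (Gh k - Lc (h k)) * Sop.
Proof. by apply: nexp_shift Fl_SB (SB_Gh k) _; rewrite mulNr mulrN Lc_SB. Qed.
Lemma Sop_La a : Sop * La a = La a * Sop.
Proof.
symmetry; apply: nexp_conj; rewrite /SB mulr_suml mulr_sumr; apply: eq_bigr => k _.
have e : La a * Lc (h k) = Lc (h k) * La (twist true a).
  rewrite -!Lc_La !LcM; congr Lc; rewrite /cmul /= !mul0r !mulr0 !subr0 addr0 add0r.
  by have [h1 h2] := ho k; rewrite (homog_mul_twist _ h1) (homog_mul_twist _ h2).
have e' : Dh k * La a = La (twist true a) * Dh k by exact: hat_La.
by rewrite mulrN mulNr mulrA e -(mulrA (Lc (h k)) (Dh k)) e' mulrA.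
Qed.

Lemma nexp_kill (X : opA) (phi : AHF) : AH phi -> X phi = 0 -> nexp F X phi = phi.
Proof.
move=> hp Xp; rewrite /nexp /texp (@opE_sum _ _ (AHsub A m r s) _ _ _ _ _ hp) big_ord_recl big1.
  by rewrite addr0 fac0 scale1r expr0 (@opE1 _ _ (AHsub A m r s) _ hp).
move=> k _; rewrite (@opEZ _ _ (AHsub A m r s) _ _ _ hp) /= exprSr (@opEM _ _ (AHsub A m r s) _ _ _ hp) Xp op0.
by rewrite scaler0.
Qed.

(** A superfunction is a sum of products of generators applied to functions of Grassmann degree 0.
    The exponential fixes the latter and moves through the former, replacing each generator $e_k$ by
    $e_k - h_k$, which is how [gshift] is defined. *)
Lemma Sop_fib y (phi : AHF) : AH phi -> Sop phi y = gshift h (phi y).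
Proof.
have gshD u v : gshift h (u + v) = gshift h u + gshift h v.
  rewrite /gshift -big_split; apply: eq_bigr => I _; rewrite (_ : gconst _ = gconst (u I) + gconst (v I)) ?gmulDl//.
  apply/funext => K; rewrite (_ : (gconst (u I) + gconst (v I)) K = gconst (u I) K + gconst (v I) K)//.
  by rewrite /gconst; case: (K == _) => //; rewrite addr0.
move: phi; apply: fib_ind => [//||a f Sf].
  by rewrite /gshift big1// => I _; rewrite (_ : gconst _ = 0) ?gmul0l//; apply/funext => K; rewrite /gconst; case: ifP.
(* The component [I] of [f], placed in Grassmann degree 0. *)
pose fI I : H := fun x J => if J == finset.set0 then f x I else 0.
have SfI I : Hsmooth (fI I) by move=> J; rewrite /fI; case: eqP => _; [exact: Sf|exact: schwartz0].
have gpE I : forall x J, gp (opG R m (r := r) (s := s)) I (fI I) x J = if J == I then f x I else 0.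
  have gpE' (u : H) I' : Hsmooth u -> (forall x J, J != finset.set0 -> u x J = 0) ->
      forall x J, gp (opG R m (r := r) (s := s)) I' u x J = if J == I' then u x finset.set0 else 0.
    move=> Su u0; elim/set_min_ind: I' => [|k J kJ IH] x K.
      by rewrite gp0 opH1//; case: eqP => [->//|/eqP]; exact: u0.
    have knJ : k \notin J by apply/negP => /kJ; rewrite ltnn.
    rewrite gp_min// opHM// opGE ?gmE ?IH; last exact: S_in.
    case: ifP => [kK|/negbT kK]; last first.
      by rewrite mul0r; case: eqP => // E; move: kK; rewrite E setU11.
    have -> : (K :\ k == J) = (K == k |: J).
      by apply/eqP/eqP => [<-|->]; [rewrite finset.setD1K|rewrite setU1K].
    case: eqP => [->|_]; last by rewrite mulr0.
    by rewrite below_self below_min// expr0 mul1r.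
  by move=> x J; rewrite gpE'// /fI ?eqxx// => x' K /negbTE ->.
have fE : f = \sum_I gp (opG R m (r := r) (s := s)) I (fI I).
  apply/funext => x; apply/funext => J; rewrite !fct_sumE (bigD1 J)//= gpE eqxx big1 ?addr0//.
  by move=> I /negbTE IJ; rewrite gpE eq_sym IJ.
have hatgp (t : seq 'I_(r + s)) (u : H) : Hsmooth u ->
    tens 1 ((\prod_(i <- t) opG R m (r := r) (s := s) i : opH) u) = (\prod_(i <- t) Gh i : opA) (tens 1 u).
  move=> Su; elim: t => [|i t IH]; first by rewrite !big_nil (@opE1 _ _ (Hsub R m r s)) ?(@opE1 _ _ (AHsub A m r s))//; exact: AH_tens.
  rewrite !big_cons (@opEM _ _ (Hsub R m r s))// (@opEM _ _ (AHsub A m r s)); last exact: AH_tens.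
  by rewrite -IH /Gh hat_tens ?twist1//; exact: S_in.
have tE : tens a f = \sum_(I : {set 'I_(r + s)}) (La a * \prod_(i <- enum I) Gh i : opA) (tens 1 (fI I)).
  rewrite {1}fE (big_morph (fun u : H => tens a u : AHF) (tensDr a) (tens0 _ _ _ a)).
  apply: eq_bigr => I _; rewrite (@opEM _ _ (AHsub A m r s)); last exact: AH_tens.
  by rewrite -hatgp// La_tens ?mulr1//; exact: S_in.
have kill I : Sop (tens 1 (fI I)) = tens 1 (fI I).
  apply: nexp_kill; first exact: AH_tens.
  have ht : AHsub A m r s (tens 1 (fI I)) by exact: AH_tens.
  rewrite /SB (@opE_sum _ _ (AHsub A m r s))// big1// => k _.
  rewrite (@opEN _ _ (AHsub A m r s))// (@opEM _ _ (AHsub A m r s))// /Dh hat_tens//.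
  rewrite (_ : opD_ R m k (fI I) = 0) ?tens0 ?op0 ?oppr0//.
  apply/funext => x; apply/funext => J; rewrite opDE// gdE /fI.
  rewrite (_ : (k |: J == finset.set0) = false) ?mulr0//.
  by apply/negbTE/finset.set0Pn; exists k; rewrite setU11.
have SG (t : seq 'I_(r + s)) : Sop * \prod_(i <- t) Gh i = (\prod_(i <- t) (Gh i - Lc (h i))) * Sop.
  elim: t => [|i t IH]; first by rewrite !big_nil mulr1 mul1r.
  by rewrite !big_cons mulrA Sop_Gh -!mulrA IH.
rewrite [in LHS]tE (@op_sumv _ _ (AHsub A m r s)); last by move=> I _; apply: A_in; exact: AH_tens.
rewrite fct_sumE /gshift; apply: eq_bigr => I _.
have ht : AHsub A m r s (tens 1 (fI I)) by exact: AH_tens.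
rewrite -(@opEM _ _ (AHsub A m r s))// mulrA Sop_La -mulrA SG mulrA (@opEM _ _ (AHsub A m r s))// kill.
have fibP : fib y (La a * \prod_(i <- enum I) (Gh i - Lc (h i)))
    (gmul (gconst (a, 0)) (foldr (@gmul R A (r + s)) (gconst (1, 0)) [seq ggen A i - gconst (h i) | i <- enum I])).
  apply: fibM; first exact: fib_La.
  elim: (enum I) => [|i t IH]; first by rewrite big_nil -La1; exact: fib_La.
  rewrite big_cons /=; apply: fibM IH; apply: fibD; [exact: fib_Gh|apply: fibN; exact: fib_Lc].
have [_ ->//] := fibP.
have -> : (tens 1 (fI I) : AHF) y = gscale (f y I) (gconst (1, 0)).
  apply/funext => K; rewrite tensE /fI /gscale /gconst; case: ifP => _.
    by rewrite /Pilot.Defs.cscale /= !scaler0 subr0 add0r.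
  by rewrite (cscale0 A) /= !scale0r.
rewrite gmul_gscale gmul1r -gscale_gmul; congr gmul; apply/funext => K.
rewrite /gscale /gconst; case: ifP => _; last by rewrite (cscale0 A).
by rewrite tensE /Pilot.Defs.cscale /= !scaler0 subr0 add0r.
Qed.
End Filt.
End Shift.

(** * Factorisation of the Schroedinger operators *)

Section Factorisation.
Variables (R : realType) (A : baseAlgebra R) (hbar : R) (m r s : nat).
Local Notation C := R[i].
Local Notation N := (dim_E m r s).
Local Notation cscale := (@Pilot.Defs.cscale R A).
Local Notation opH := (op (Hsub R m r s)).
Local Notation opA := (op (AHsub A m r s)).
Local Notation AHF := ('rV[R]_m -> {set 'I_(r + s)} -> A * A).
Local Notation gr := ({set 'I_(r + s)} -> A * A).
Local Notation La := (@La R A m r s).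
Local Notation Lc := (@Lc R A m r s).
Local Notation Gh := (@Gh R A m r s).
Local Notation Dh := (@Dh R A m r s).
Local Notation Xh := (@Xh R A m r s).
Local Notation Ph := (@Ph R A m r s).
Local Notation hat := (@hat R A m r s).
Local Notation scA := (@scA R A m r s).
Local Notation H := ('rV[R]_m -> {set 'I_(r + s)} -> R[i]).
Local Notation ih := (Complex 0 hbar : C).
Local Notation Wh := (@Wh R A hbar m r s).
Local Notation uv := (@uv R A hbar m r s).
Local Notation omA := (@omA R A m r s).
Local Notation Uh := (@Uh R A hbar m r s).
Local Notation bA := (@bA R A m r s).
Local Notation body := (Defs.body A).

Lemma bodyM (a c : A) : body (a * c) = body a * body c.
Proof. exact: (rmorphM body). Qed.

Lemma sum_comm (n : nat) (a b d : 'I_n -> opA) :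
  (forall i j, a i * b j = b j * a i + (if i == j then d i else 0)) ->
  (\sum_i a i) * (\sum_j b j) = (\sum_j b j) * (\sum_i a i) + \sum_i d i.
Proof.
move=> ab; transitivity (\sum_i ((\sum_j b j) * a i + d i)).
  rewrite mulr_suml; apply: eq_bigr => i _; rewrite mulr_sumr mulr_suml.
  rewrite (eq_bigr _ (fun j _ => ab i j)) big_split /=; congr (_ + _).
  by rewrite (bigD1 i)//= eqxx big1 ?addr0// => j ji; rewrite eq_sym (negbTE ji).
by rewrite big_split -mulr_sumr.
Qed.
Lemma sum_comm0 (n n' : nat) (a : 'I_n -> opA) (b : 'I_n' -> opA) :
  (forall i j, a i * b j = b j * a i) -> (\sum_i a i) * (\sum_j b j) = (\sum_j b j) * (\sum_i a i).
Proof.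
move=> ab; rewrite mulr_suml mulr_sumr; apply: eq_bigr => i _; rewrite mulr_sumr mulr_suml.
by apply: eq_bigr => j _; exact: ab.
Qed.
Lemma gmul_const2 (a b : A * A) : gmul (gconst a) (gconst b) = gconst (cmul a b) :> gr.
Proof. by apply/funext => K; rewrite gmul_gconst /gconst; case: (K == _); rewrite ?cmul0. Qed.
Lemma gconstD (a b : A * A) : gconst (a + b) = gconst a + gconst b :> gr.
Proof.
apply/funext => K; rewrite (_ : (gconst a + gconst b) K = gconst a K + gconst b K)//.
by rewrite /gconst; case: (K == _) => //; rewrite addr0.
Qed.
Lemma gconst0 : gconst (0 : A * A) = 0 :> gr.
Proof. by apply/funext => K; rewrite /gconst; case: (K == _). Qed.
Lemma gconstZ (k : R) (a : A * A) : gconst (k *: a) = k *: gconst a :> gr.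
Proof.
apply/funext => K; rewrite (_ : (k *: gconst a) K = k *: gconst a K)//.
by rewrite /gconst; case: (K == _) => //; rewrite scaler0.
Qed.
Lemma gconst_sum I (t : seq I) (G : I -> A * A) :
  gconst (\sum_(i <- t) G i) = \sum_(i <- t) gconst (G i) :> gr.
Proof. by apply: (big_morph (@gconst R A (r + s))); [exact: gconstD|exact: gconst0]. Qed.

Lemma even_scomm p (T : opH) a : homog false a -> hat p T * La a = La a * hat p T.
Proof. by move=> ha; rewrite hat_La (twistE _ ha) andbF scale1r. Qed.
Lemma nilexp_op (F : filtration opA) (T : AHF -> AHF) (T' : opA) phi :
  (forall psi, AH psi -> T psi = T' psi) -> F 1 T' -> AH phi -> nilexp T phi = nexp F T' phi.
Proof.
move=> TT FT hp.
have itE (k : nat) : iter k T phi = (T' ^+ k) phi.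
  elim: k => [|k IH]; first by rewrite expr0 (@opE1 _ _ (AHsub A m r s) _ hp).
  by rewrite iterS IH exprS (@opEM _ _ (AHsub A m r s) _ _ _ hp) TT//; exact: A_in.
have Tq : T' ^+ fl_order F = 0 by apply/(fl_nil (f := F))/flX.
rewrite (@nilexpE R _ _ _ (fl_order F).+2) => [|k qk].
  rewrite /nexp /texp (@opE_sum _ _ (AHsub A m r s) _ _ _ _ _ hp); apply: eq_bigr => k _.
  by rewrite itE (@opEZ _ _ (AHsub A m r s) _ _ _ hp).
rewrite itE -(subnKC (leq_trans (leqW (leqnSn _)) qk)) exprD Tq mul0r.
exact: (@opE0 _ _ (AHsub A m r s) _ hp).
Qed.

Variable l : seq A.
Hypothesis lH : forall a, a \in l -> exists p, homog p a.
Hypothesis lB : forall a, a \in l -> body a = 0.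
Local Notation F := (@AFl R A m r s l lH lB).

Variables (x : 'I_N -> A) (t : A) (b : 'cV[R]_N).
Hypotheses (xE : E0 x) (tE : homog false t).
Hypothesis bx : forall i, b i 0 = body (x i).
Let n := x - bA b.
Let tn := t - (body t)%:A.
Hypotheses (il : idv l 1 n) (it : idl l 1 tn).

Let q i : A := x (ia r s i).
Let p i : A := x (ib r s i).
Let qb i : R := b (ia r s i) 0.
Let pb i : R := b (ib r s i) 0.
Let qn i : A := n (ia r s i).
Let pn i : A := n (ib r s i).
Let h := odd_shift x.
(** The factor paired with the [k]-th odd generator in the phase: $p_a$ for $\theta_a$ and
    $\bar\zeta^c/2$ for $\zeta_c$. Together with [h] it treats both kinds of odd variables alike. *)
Let pk (k : 'I_(r + s)) : A * A :=
  match fintype.split k with inl a => (podd x a, 0) | inr c => 2^-1 *: zetabar x c end.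

Lemma evenb : evenv b.
Proof. by move=> i pi; rewrite bx; apply: body_odd; have := xE i; rewrite pi. Qed.
Let nE : E0 n. Proof. exact: E0B (bA_E0 A evenb). Qed.
Let oddn (j : 'I_(dim_odd r s)) : n (rshift (m + m) j) = x (rshift (m + m) j).
Proof.
rewrite (_ : n _ = x (rshift (m + m) j) - bA b (rshift (m + m) j))//.
by rewrite /bA evenb ?par_r// scale0r subr0.
Qed.
Let xodd (j : 'I_(dim_odd r s)) : homog true (x (rshift (m + m) j)).
Proof. by have := xE (rshift (m + m) j); rewrite par_r. Qed.
Let xidl (j : 'I_(dim_odd r s)) : idl l 1 (x (rshift (m + m) j)).
Proof. by rewrite -oddn; exact: il. Qed.
Let qE i : q i = (qb i)%:A + qn i.
Proof. by rewrite /qn /n (_ : (x - bA b) _ = x (ia r s i) - bA b (ia r s i))// addrC subrK. Qed.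
Let pE i : p i = (pb i)%:A + pn i.
Proof. by rewrite /pn /n (_ : (x - bA b) _ = x (ib r s i) - bA b (ib r s i))// addrC subrK. Qed.
Let qnh i : homog false (qn i).
Proof. by have := nE (ia r s i); rewrite par_l. Qed.
Let pnh i : homog false (pn i).
Proof. by have := nE (ib r s i); rewrite par_l. Qed.
Let ho k : codd (h k).
Proof.
by rewrite /h /odd_shift; case: (fintype.split k) => a; split => //=; [exact: xodd|exact: homog0|exact: xodd|exact: xodd].
Qed.
Let po k : codd (pk k).
Proof.
rewrite /pk; case: (fintype.split k) => a; split => /=; try exact: homog0; try exact: xodd.
- by apply: homogZ; exact: xodd.
- by apply: homogZ; apply: homogNn; exact: xodd.
Qed.
Let i0 : idl l 1 0. Proof. exact: (idl_0 l 1). Qed.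
Let hi k : cidl l (h k).
Proof. by rewrite /h /odd_shift; case: (fintype.split k) => a; split; by [exact: xidl|exact: i0]. Qed.
Let pki k : cidl l (pk k).
Proof.
rewrite /pk; case: (fintype.split k) => a; split; try exact: i0; try exact: xidl.
- apply: (@idlZ R A l 1); exact: xidl.
- change (idl l 1 (2^-1 *: - x (iw' m r a))); apply: (@idlZ R A l 1).
  by rewrite -scaleN1r; apply: (@idlZ R A l 1); exact: xidl.
Qed.

Let ct (i : 'I_m) : A := 2^-1 *: (q i * p i - (qb i * pb i)%:A).

(* The nilpotent part of the phase, with the coordinates of q_0 as operators. *)
Let Nn : opA := scA ih * (La tn + \sum_i (La (ct i) - La (pn i) * Xh i)
  + \sum_k (2^-1 *: Lc (h k) - Gh k) * Lc (pk k)).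
Let gn (y : 'rV[R]_m) : gr := gscale ih (gconst (tn, 0) +
  \sum_i (gconst (ct i, 0) - gmul (gconst (pn i, 0)) (gconst ((y 0 i)%:A, 0)))
  + \sum_k gmul (2^-1 *: gconst (h k) - ggen A k) (gconst (pk k))).
(** The body of the phase at [y], divided by $i\hbar$; what remains is [gn y], with coefficients in
    the nilpotent ideal. *)
Let ey (y : 'rV[R]_m) : R := body t + \sum_i (2^-1 * qb i - y 0 i) * pb i.

Lemma Nn_fib y : fib y Nn (gn y).
Proof.
apply: fib_scA; apply: fibD; first apply: fibD; first exact: fib_La.
  apply: fib_sum => i; apply: fibD; first exact: fib_La.
  by apply: fibN; apply: fibM; [exact: fib_La|exact: fib_Xh].
apply: fib_sum => k; apply: fibM; last exact: fib_Lc.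
by apply: fibD; [apply: fibZ; exact: fib_Lc|apply: fibN; exact: fib_Gh].
Qed.

Lemma phaseE y : sch_phase hbar x t y = gn y + gconst (cscale (ih * cr (ey y)) (1, 0)).
Proof.
rewrite /sch_phase /gn.
have sg1 (z : A * A) : gscale ih (gconst z) = gconst (cscale ih z) :> gr.
  by apply/funext => K; rewrite /gscale /gconst; case: (K == _) => //; rewrite (cscale0 A).
have -> : gconst (cscale (ih * cr (ey y)) (1, 0)) = gscale ih (gconst ((ey y)%:A, 0)) :> gr.
  rewrite sg1 -cscaleM; congr gconst; congr (cscale _ _).
  by rewrite /Pilot.Defs.cscale /= !scale0r !scaler0 subr0 addr0.
rewrite -gscaleD; congr gscale.
transitivity (gconst (t, 0) + \sum_i gconst ((2^-1 *: qev x i - (y 0 i)%:A) * pev x i, 0) +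
   \sum_k gmul (2^-1 *: gconst (h k) - ggen A k) (gconst (pk k)) : gr).
  have split2 (G : 'I_(r + s) -> gr) : \sum_k G k = \sum_a G (theta s a) + \sum_c G (zeta r c) by rewrite big_split_ord.
  rewrite -[LHS]addrA; congr (_ + _); rewrite split2; congr (_ + _).
    apply: eq_bigr => a _; rewrite /h /odd_shift /pk !split_l /theta; congr (gmul (_ - _) _).
    by rewrite -gconstZ pairZ scaler0.
  rewrite scaler_sumr; apply: eq_bigr => c _; rewrite /h /odd_shift /pk !split_r /zeta.
  by rewrite -gconstZ (gconstZ _ (zetabar x c)) gmulZr.
rewrite [RHS]addrAC; congr (_ + _).
under [in RHS]eq_bigr do rewrite gmul_const2 -[- gconst _]scaleN1r -gconstZ -gconstD.
rewrite -!gconst_sum -!gconstD; congr gconst.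
have fstE (I : Type) (u : seq I) (G : I -> A) : \sum_(i <- u) (G i, 0 : A) = (\sum_(i <- u) G i, 0) :> A * A.
  by elim/big_rec2 : _ => // i u1 u2 _ ->; rewrite pairD addr0.
have cm (a c : A) : cmul (a, 0) (c, 0) = (a * c, 0) by rewrite /cmul /= !mulr0 !mul0r subr0 addr0.
under [in RHS]eq_bigr do rewrite cm pairZ scaler0 pairD addr0.
rewrite !fstE !pairD !addr0; congr pair.
rewrite /ey scalerDl scaler_suml /tn [RHS](AC (3*2) ((1*3*5)*(2*4)))/= addNr addr0 -addrA; congr (_ + _).
rewrite -big_split; apply: eq_bigr => i _ /=.
rewrite /ct scaleN1r (_ : qev x i = q i)// (_ : pev x i = p i)// !mulr_algr.
rewrite mulrBl mulr_algl -scalerAl {2}pE scalerDr.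
have -> : ((2^-1 * qb i - y 0 i) * pb i)%:A = (2^-1 * (qb i * pb i))%:A - y 0 i *: (pb i)%:A :> A.
  by rewrite (scalerA (y 0 i)) -scalerBl mulrBl mulrA.
have -> : 2^-1 *: (q i * p i - (qb i * pb i)%:A) = 2^-1 *: (q i * p i) - (2^-1 * (qb i * pb i))%:A by rewrite scalerBr scalerA.
by rewrite opprD [RHS](AC (3*2) (1*(5*3)*(4*2)))/= subrr addr0.
Qed.

Lemma idlct i : idl l 1 (ct i).
Proof.
apply: (@idlZ R A l 1).
have -> : q i * p i - (qb i * pb i)%:A = qb i *: pn i + qn i * p i.
  rewrite {1}qE mulrDl mulr_algl {1}pE scalerDr scalerA.
  by rewrite [LHS](AC (3*1) ((1*4)*(2*3)))/= subrr add0r.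
apply: idlD; first by apply: (@idlZ R A l 1); exact: il.
by apply: (idlMr (l := l) (k := 1)); exact: il.
Qed.

Lemma Fl_scA c (X : opA) : F 1 X -> F 1 (scA c * X).
Proof.
elim=> [|a p' S Z ia sS _ IH]; first by rewrite mulr0; exact: Fl_nil.
have -> : scA c * (La a * S + Z) = La a * (scA c * S) + scA c * Z by rewrite mulrDr !mulrA scA_La.
have sS' : sup p' (scA c * S) := supM (@sup_hat R A m r s false (c%:A)) sS.
exact: (FlD (FlE ia sS') IH).
Qed.

Lemma Fl_Nn : F 1 Nn.
Proof.
apply: Fl_scA; apply: FlD; first apply: FlD.
- exact: Fl_La.
- apply: Fl_sum => i _; apply: FlD; first by apply: Fl_La; exact: idlct.
  by rewrite -scaleN1r; apply: FlZ; apply: FlE (sup_hat _ _); exact: il.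
apply: Fl_sum => k _.
have -> : (2^-1 *: Lc (h k) - Gh k) * Lc (pk k) =
    Lc (2^-1 *: cmul (h k) (pk k)) * hat false 1 + Lc (pk k) * Gh k.
  rewrite mulrBl -scalerAl LcM -LcZ hat1 mulr1; congr (_ + _).
  by rewrite /Gh Lc_hat (ctwist_odd (po k)) LcN mulNr opprK.
apply: FlD; [apply: (Fl_Lc lH lB)|by apply: (Fl_Lc lH lB); exact: pki].
have [h1 h2] := hi k; split; apply: (@idlZ R A l 1).
  apply: idlD; first exact: (idlMr (l := l) (k := 1)).
  by rewrite -scaleN1r; apply: (@idlZ R A l 1); exact: (idlMr (l := l) (k := 1)).
by apply: idlD; exact: (idlMr (l := l) (k := 1)).
Qed.

Let STop : opA := \sum_i La (- qn i) * Ph i.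
Lemma Fl_ST : F 1 STop.
Proof.
apply: Fl_sum => i _; apply: FlE (sup_hat _ _).
by rewrite -scaleN1r; apply: (@idlZ R A l 1); exact: il.
Qed.
Lemma sch_taylorE phi : AH phi -> sch_taylor x phi = STop phi.
Proof.
move=> hp; rewrite /sch_taylor /STop (@opE_sum _ _ (AHsub A m r s) _ _ _ _ _ hp); apply: eq_bigr => i _.
rewrite (@tens_opE R A m r s _ _ _ (opP R r s i) phi _ hp) => [|f Sf].
  congr ((La _ * _) phi); rewrite /qn /n; congr (- _).
  by rewrite (_ : (x - bA b) (ia r s i) = x (ia r s i) - bA b (ia r s i))// /bA bx.
by apply/funext => y; apply/funext => J; rewrite opPE.
Qed.

Lemma gbodyE y : gbody (sch_phase hbar x t y) = ih * cr (ey y).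
Proof.
rewrite phaseE /gbody.
rewrite (_ : (gn y + _) finset.set0 = gn y finset.set0 + cscale (ih * cr (ey y)) (1, 0)); last first.
  by rewrite /gconst -[LHS]/(_ + _) eqxx.
have bD (u v : A * A) : cbody (u + v) = cbody u + cbody v by apply: complex_ext; rewrite ?ReD ?ImD /= raddfD.
have b0 : cbody (0 : A * A) = 0 by apply: complex_ext; rewrite /= raddf0.
have bsc c (u : A * A) : cbody (cscale c u) = c * cbody u.
  by apply: complex_ext; rewrite ?ReM ?ImM /= ?raddfB ?raddfD /= !linearZ.
rewrite bD bsc.
have -> : cbody (1 : A, 0 : A) = 1 by apply: complex_ext; rewrite /= ?rmorph1 ?raddf0.
rewrite mulr1 /gn /gscale bsc.
set G := (_ + _ : gr); rewrite (_ : cbody (G finset.set0) = 0) ?mulr0 ?add0r// {}/G.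
have ib a : idl l 1 a -> body a = 0.
  by move=> [c _ ->]; rewrite raddf_sum big1// => i _; rewrite /= bodyM lB ?mul0r// mem_nth.
have gD (u v : gr) : (u + v) finset.set0 = u finset.set0 + v finset.set0 by [].
have gs (I : finType) (G : I -> gr) : (forall i, cbody (G i finset.set0) = 0) -> cbody ((\sum_i G i) finset.set0) = 0.
  by move=> G0; elim/big_rec : _ => // i u _ hu; rewrite gD bD G0 hu addr0.
have gc (z : A * A) : cidl l z -> cbody ((gconst z : gr) finset.set0) = 0.
  by move=> [h1 h2]; rewrite /gconst eqxx /cbody !ib.
have gcc z w : cidl l z -> cbody ((gmul (gconst z) (gconst w) : gr) finset.set0) = 0.
  move=> [h1 h2]; rewrite gmul_gconst /gconst eqxx /cbody /cmul /=.
  by apply: complex_ext; rewrite /= ?raddfB ?raddfD /= !bodyM (ib _ h1) (ib _ h2) !mul0r ?subr0 ?addr0.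
have Z1 : cbody ((gconst (tn, 0) : gr) finset.set0) = 0 by apply: gc; split; [exact: it|exact: i0].
have Z2 : cbody ((\sum_i (gconst (ct i, 0) - gmul (gconst (pn i, 0)) (gconst ((y 0 i)%:A, 0))) : gr) finset.set0) = 0.
  apply: gs => i; rewrite gD bD gc ?add0r; last by split; [exact: idlct|exact: i0].
  rewrite -[- gmul _ _]scaleN1r -gmulZl -gconstZ gcc//; split; last by rewrite /= scaler0; exact: i0.
  by apply: (@idlZ R A l 1); exact: il.
rewrite gD bD gD bD Z1 Z2 !add0r; apply: gs.
move=> k; rewrite gmulDl gD bD -gconstZ gcc ?add0r; last first.
  by have [h1 h2] := hi k; split; apply: (@idlZ R A l 1).
by rewrite -[- ggen A k]scaleN1r gmulZl (_ : (_ *: gmul _ _) finset.set0 = -1 *: gmul (ggen A k) (gconst (pk k)) finset.set0)//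
  gmul_ggen finset.in_set0 scaler0.
Qed.

Lemma cexp_ih (u : R) : cexp (ih * cr u) = ei (hbar * u).
Proof.
rewrite /cexp /ei ReM ImM /= !mul0r mulr0 subrr add0r.
by rewrite expR0 !mul1r.
Qed.
Lemma gexpE y : gexp (sch_phase hbar x t y) =
  gscale (ei (hbar * ey y)) (nilexp (gmul (gn y)) (gconst (1, 0))).
Proof. by rewrite /gexp gbodyE phaseE addrK cexp_ih. Qed.

Lemma Wh_fib y phi : AH phi ->
  Wh b phi y = gscale (ei (hbar * \sum_i (2^-1 * qb i - y 0 i) * pb i)) (phi (y - qbody x)).
Proof.
have qE' : \row_i b (ia r s i) 0 = qbody x by apply/rowP => i; rewrite !mxE bx.
move: phi; apply: fib_ind2 => [u v||a f Sf].
- exact: gscaleD.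
- by apply/funext => K; rewrite /gscale (cscale0 A).
apply/funext => K; rewrite /Wh hat_tens// twist0 /gscale tensE /Wop opWE// /u0 qE'.
have -> : 2^-1 * dot (qbody x) (\row_i b (ib r s i) 0) - dot y (\row_i b (ib r s i) 0)
   = \sum_i (2^-1 * qb i - y 0 i) * pb i.
  rewrite /dot mulr_sumr -sumrB; apply: eq_bigr => i _; rewrite !mxE mulrA -mulrBl.
  by rewrite /qb (bx (ia r s i)).
by rewrite -(tensC a f) tensE.
Qed.

Let Sop_ : opA := @Sop R A m r s l lH lB h.
(** The body of the phase and the translation by the body of $q$ form
    $e^{i\hbar\,\mathrm{body}(t)}W(b)$; the nilpotent part of the phase, the odd translation and the
    even Taylor shift are the three nilpotent exponentials. *)
Lemma schrodingerE phi : AH phi ->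
  schrodinger hbar x t phi =
  (scA (ei (hbar * body t)) * (nexp F Nn * (Wh b * (Sop_ * nexp F STop)))) phi.
Proof.
move=> hp; apply/funext => y; rewrite /schrodinger.
rewrite (nilexp_op sch_taylorE Fl_ST hp) -/h.
have h1 : AH (nexp F STop phi) by exact: A_in.
rewrite -(@Sop_fib R A m r s l lH lB h ho hi _ _ h1) -/Sop_.
have h2 : AH (Sop_ (nexp F STop phi)) by exact: A_in.
move: (Sop_ _) h2 (@opEM _ _ (AHsub A m r s) (Sop_) (nexp F STop) phi hp) => psi h2 eS.
rewrite gexpE gscale_gmul /ey mulrDr eiD.
rewrite (@opEM _ _ (AHsub A m r s) _ _ _ hp) scA_fib; last exact: A_in.
rewrite (@opEM _ _ (AHsub A m r s) _ _ _ hp) (@opEM _ _ (AHsub A m r s) _ _ _ hp) eS.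
have h3 : AH (Wh b psi) by exact: A_in.
rewrite -(gexp_fib Fl_Nn (Nn_fib y) h3) Wh_fib// gmul_gscale.
by apply/funext => K; rewrite /gscale cscaleM.
Qed.

Let EX : opA := \sum_i - (scA ih * (La (pn i) * Xh i)).
Let OG : opA := \sum_k scA ih * (Lc (pk k) * Gh k).
Let SBp : opA := @SB R A m r s h.
(** The scalar part of the nilpotent phase once it has passed $W(b)$: the term $-p_ix_i$ then
    contributes $-q^b_ip_i$, for the nilpotent part of $p_i$ and the body $q^b_i$ of $q_i$. Ordering
    coefficients before generators contributes nothing further. *)
Let c1 : A * A := (tn + \sum_i (ct i - qb i *: pn i), 0) + \sum_k 2^-1 *: cmul (h k) (pk k).
Let N1 : opA := scA ih * Lc c1 + EX + OG.

Lemma Wh_hat p' (T : opH) : Wop hbar b * T = T * Wop hbar b -> Wh b * hat p' T = hat p' T * Wh b.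
Proof. by move=> WT; rewrite /Wh !hatM WT addbF. Qed.
Lemma Wh_La a : Wh b * La a = La a * Wh b.
Proof. by rewrite /Wh hat_La twist0. Qed.
Lemma Wh_scA c : Wh b * scA c = scA c * Wh b.
Proof. by apply: Wh_hat; rewrite -scalerAl -scalerAr mul1r mulr1. Qed.
Lemma Wh_Lc z : Wh b * Lc z = Lc z * Wh b.
Proof. by rewrite /Lc mulrDr mulrDl mulrA !Wh_La -!mulrA Wh_scA. Qed.
Lemma Wh_Gh k : Wh b * Gh k = Gh k * Wh b.
Proof. by apply: Wh_hat; rewrite /Wop opWG. Qed.
Lemma Xh_Wh i : Xh i * Wh b = Wh b * Xh i + qb i *: Wh b.
Proof.
rewrite /Xh /Wh !hatM -hat_cr -hatD; congr (hat _ _).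
by rewrite /Wop opXW mulrDr -scalerAr mulr1 mxE.
Qed.

(** $W(b)$ conjugates $x_i$ to $x_i$ plus the body of $q_i$ and leaves the odd generators alone, so
    only the scalar part of the exponent changes. *)
Lemma N1E : Wh b * N1 = Nn * Wh b.
Proof.
have kE k : (2^-1 *: Lc (h k) - Gh k) * Lc (pk k) = Lc (2^-1 *: cmul (h k) (pk k)) + Lc (pk k) * Gh k.
  rewrite mulrBl -scalerAl LcM -LcZ; congr (_ + _).
  by rewrite /Gh Lc_hat (ctwist_odd (po k)) LcN mulNr opprK.
have -> : Nn = scA ih * (Lc ((tn + \sum_i ct i, 0) + \sum_k 2^-1 *: cmul (h k) (pk k)))
     + EX + OG.
  rewrite /Nn sumrB (eq_bigr _ (fun k _ => kE k)) big_split /= LcD Lc_La LaD La_sum Lc_sum.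
  have -> : EX = - (scA ih * \sum_i La (pn i) * Xh i) by rewrite /EX sumrN mulr_sumr.
  have -> : OG = scA ih * \sum_k Lc (pk k) * Gh k by rewrite mulr_sumr.
  by rewrite -mulrN -!mulrDr; congr (_ * _); rewrite [LHS](AC ((1*2)*2) (1*2*4*3*5)).
have EO : Wh b * OG = OG * Wh b.
  rewrite /OG mulr_sumr mulr_suml; apply: eq_bigr => k _.
  by rewrite !mulrA Wh_scA -(mulrA _ (Wh b)) Wh_Lc !mulrA -(mulrA _ (Wh b)) Wh_Gh !mulrA.
have EE : EX * Wh b = Wh b * EX - scA ih * La (\sum_i qb i *: pn i) * Wh b.
  rewrite /EX mulr_suml mulr_sumr La_sum mulr_sumr mulr_suml -sumrB; apply: eq_bigr => i _.
  have e1 : Wh b * (scA ih * (La (pn i) * Xh i)) = scA ih * (La (pn i) * (Wh b * Xh i)).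
    by rewrite mulrA Wh_scA -mulrA (mulrA (Wh b)) Wh_La -mulrA.
  rewrite mulrN mulNr e1 -opprD -!mulrA Xh_Wh !mulrDr LaZ.
  by rewrite -!scalerAr -!scalerAl -!scalerAr.
have EC : Wh b * (scA ih * Lc c1) =
    scA ih * Lc ((tn + \sum_i ct i, 0) + \sum_k 2^-1 *: cmul (h k) (pk k)) * Wh b
    - scA ih * La (\sum_i qb i *: pn i) * Wh b.
  rewrite mulrA Wh_scA -mulrA Wh_Lc mulrA -mulrBl; congr (_ * _); rewrite -mulrBr; congr (_ * _).
  rewrite -Lc_La -LcN -LcD; congr Lc; rewrite /c1 sumrB [RHS]addrAC; congr (_ + _).
  by rewrite (_ : - (_, 0) = (- (\sum_i qb i *: pn i), - 0) :> A * A)// pairD oppr0 addr0 addrA.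
rewrite /N1 2!mulrDr EO EC 2!mulrDl EE.
by rewrite [LHS](AC ((2*1)*1) (1*(3*2)*4)).
Qed.

Lemma scA_LaH c a p' (T : opH) : scA c * (La a * hat p' T) = La a * hat p' T * scA c.
Proof. by rewrite mulrA scA_La -mulrA scA_hat mulrA. Qed.
Lemma scA_LcH c z p' (T : opH) : scA c * (Lc z * hat p' T) = Lc z * hat p' T * scA c.
Proof. by rewrite mulrA Lc_scA -mulrA scA_hat mulrA. Qed.
Lemma neg_sc_comm c (X Y d : opA) : scA c * Y = Y * scA c -> X * Y = Y * X + d ->
  scA c * X * Y = Y * (scA c * X) + scA c * d.
Proof. by move=> cY XY; rewrite -mulrA XY mulrDr !mulrA cY. Qed.

Lemma EX_ST : EX * STop = STop * EX + \sum_i - (scA ih * La (pn i * qn i)).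
Proof.
apply: sum_comm => i j.
have E : La (pn i) * Xh i * (La (- qn j) * Ph j) = La (- qn j) * Ph j * (La (pn i) * Xh i)
    + (if i == j then La (pn i * qn i) else 0).
  have XL a k : homog false a -> Xh k * La a = La a * Xh k by exact: even_scomm.
  have PL a k : homog false a -> Ph k * La a = La a * Ph k by exact: even_scomm.
  rewrite -!mulrA (mulrA (Xh i)) XL ?(mulrA (Ph j)) ?PL//; last exact: homogNn.
  rewrite !mulrA !LaM -!mulrA PhXh mulrDr (homog_even_comm (- qn j) (pnh i)) -addrA -[LHS]addr0; congr (_ + _).
  rewrite eq_sym; case: (eqVneq i j) => [->|_]; last by rewrite mulr0 addr0.
  by rewrite mulr1 mulNr -LaD (homog_even_comm _ (pnh j)) addNr La0.
rewrite mulNr (neg_sc_comm (scA_LaH _ _ _ _) E) mulrN opprD; congr (_ + _).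
by case: eqP; rewrite // mulr0 oppr0.
Qed.
Lemma EX_SB : EX * SBp = SBp * EX.
Proof.
apply: sum_comm0 => i k; rewrite mulNr mulrN opprK mulNr mulrN opprK.
have XL z : Xh i * Lc z = Lc z * Xh i by rewrite /Xh Lc_hat ctwist_false.
have LL z : La (pn i) * Lc z = Lc z * La (pn i).
  by rewrite -!Lc_La !LcM; congr Lc; rewrite /cmul /= !mul0r !mulr0 !subr0 !addr0 !(homog_even_comm _ (pnh i)) add0r.
have DL : Dh k * La (pn i) = La (pn i) * Dh k by exact: even_scomm.
rewrite -mulrA [X in _ * X = _](_ : _ = Lc (h k) * Dh k * (La (pn i) * Xh i)).
  by rewrite mulrA scA_LcH !mulrA.
by rewrite -!mulrA (mulrA (Xh i)) XL (mulrA (Dh k)) DL -!mulrA XhDh !mulrA LL.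
Qed.
Lemma OG_SB : OG * SBp = SBp * OG + \sum_k - (scA ih * Lc (cmul (h k) (pk k))).
Proof.
apply: sum_comm => k j.
have E : Lc (pk k) * Gh k * - (Lc (h j) * Dh j) = - (Lc (h j) * Dh j) * (Lc (pk k) * Gh k)
    + (if k == j then - Lc (cmul (h k) (pk k)) else 0).
  rewrite mulrN mulNr /Gh /Dh !odd_pair// -/(Gh k) -/(Dh j) !opprK DhGh mulrDr mulrN.
  rewrite (codd_anti (po k) (ho j)) LcN mulNr -addrA -[LHS]addr0; congr (_ + _).
  by rewrite eq_sym; case: (eqVneq k j) => [->|_]; rewrite ?mulr1 ?subrr// mulr0 addr0.
rewrite (neg_sc_comm _ E); last by rewrite mulrN mulNr scA_LcH.
by congr (_ + _); case: eqP; rewrite ?mulrN// mulr0.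
Qed.
Lemma OG_ST : OG * STop = STop * OG.
Proof.
apply: sum_comm0 => k i; have hq : homog false (- qn i) by exact: homogNn.
have PL z : Ph i * Lc z = Lc z * Ph i by rewrite /Ph Lc_hat ctwist_false.
have LL z : La (- qn i) * Lc z = Lc z * La (- qn i).
  by rewrite -!Lc_La !LcM; congr Lc; rewrite /cmul /= !mul0r !mulr0 !subr0 !addr0 !(homog_even_comm _ hq) add0r.
have GL : Gh k * La (- qn i) = La (- qn i) * Gh k by exact: even_scomm.
rewrite -mulrA [X in _ * X = _](_ : _ = La (- qn i) * Ph i * (Lc (pk k) * Gh k)).
  by rewrite mulrA scA_LaH !mulrA.
by rewrite -!mulrA (mulrA (Ph i)) PL (mulrA (Gh k)) GL -!mulrA PhGh !mulrA LL.
Qed.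
Lemma SB_ST : SBp * STop = STop * SBp.
Proof.
apply: sum_comm0 => k i; have hq : homog false (- qn i) by exact: homogNn.
have PL z : Ph i * Lc z = Lc z * Ph i by rewrite /Ph Lc_hat ctwist_false.
have LL z : La (- qn i) * Lc z = Lc z * La (- qn i).
  by rewrite -!Lc_La !LcM; congr Lc; rewrite /cmul /= !mul0r !mulr0 !subr0 !addr0 !(homog_even_comm _ hq) add0r.
have DL : Dh k * La (- qn i) = La (- qn i) * Dh k by exact: even_scomm.
rewrite mulNr mulrN; congr (- _).
by rewrite -!mulrA (mulrA (Ph i)) PL (mulrA (Dh k)) DL -!mulrA PhDh !mulrA LL.
Qed.

Definition ceven (z : A * A) := homog false z.1 /\ homog false z.2.
Lemma cen_LcH w z z' p' (T : opH) : ceven z -> scA w * Lc z * (Lc z' * hat p' T) = Lc z' * hat p' T * (scA w * Lc z).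
Proof.
move=> [h1 h2]; have E : scA w * Lc z = scA w * La z.1 + scA (w * 'i%C) * La z.2.
  by rewrite /Lc mulrDr -scA_La mulrA scAM.
have E' : Lc z' * hat p' T = La z'.1 * hat p' T + La z'.2 * hat p' ('i%C *: T).
  by rewrite /Lc mulrDl -mulrA -hat_scale.
by rewrite E E' !mulrDl !mulrDr !scLa_comm// addrACA.
Qed.
Lemma cen_LaH w z a p' (T : opH) : ceven z -> scA w * Lc z * (La a * hat p' T) = La a * hat p' T * (scA w * Lc z).
Proof. by move=> hz; rewrite -Lc_La; exact: cen_LcH. Qed.
Lemma cen_scA w z c : scA c * (scA w * Lc z) = scA w * Lc z * scA c.
Proof. by rewrite mulrA scAM mulrC -scAM -!mulrA Lc_scA. Qed.

Let c2 : A * A := (\sum_i pn i * qn i, 0) + \sum_k cmul (h k) (pk k).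
Let zz : opA := - (scA ih * Lc c2).
Lemma zzE : \sum_i - (scA ih * La (pn i * qn i)) + \sum_k - (scA ih * Lc (cmul (h k) (pk k))) = zz.
Proof.
by rewrite !sumrN -opprD -!mulr_sumr -mulrDr -La_sum -Lc_sum -Lc_La -LcD.
Qed.
Let ceven0 (a : A) : homog false a -> ceven (a, 0).
Proof. by split => //; exact: homog0. Qed.
Let cevenD z w : ceven z -> ceven w -> ceven (z + w).
Proof. by move=> [h1 h2] [h3 h4]; split; exact: homogD. Qed.
Let cevenZ (k : R) z : ceven z -> ceven (k *: z).
Proof. by move=> [h1 h2]; split; exact: homogZ. Qed.
Let ceven_sum (I : finType) (G : I -> A * A) : (forall i, ceven (G i)) -> ceven (\sum_i G i).
Proof.
by move=> HG; elim/big_rec : _ => [|i z _]; [split; exact: homog0|exact: cevenD].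
Qed.
Let ceven_hp k : ceven (cmul (h k) (pk k)).
Proof.
have [h1 h2] := ho k; have [h3 h4] := po k.
by split; apply: homogD; try apply: homogNn; [exact: (homogM h1 h3)|exact: (homogM h2 h4)|exact: (homogM h1 h4)|exact: (homogM h2 h3)].
Qed.
Let bh i : homog false (ct i).
Proof.
apply: homogZ; apply: homogD; last exact/homogNn/homog_scalar.
by have := homogM (xE (ia r s i)) (xE (ib r s i)); rewrite !par_l.
Qed.
Lemma ceven_c2 : ceven c2.
Proof.
apply: cevenD; last exact: ceven_sum.
by apply: ceven0; apply: homog_sum => i _; exact: (homogM (pnh i) (qnh i)).
Qed.
Lemma ceven_c1 : ceven c1.
Proof.
apply: cevenD; last by apply: ceven_sum => k; exact: cevenZ.
apply: ceven0; apply: homogD; first by apply: homogD => //; exact/homogNn/homog_scalar.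
by apply: homog_sum => i _; apply: homogD => //; apply: homogNn; exact: homogZ.
Qed.
Lemma cidl_hp k : cidl l (cmul (h k) (pk k)).
Proof.
have [h1 h2] := hi k; split.
  by apply: idlD; [|rewrite -scaleN1r; apply: (@idlZ R A l 1)]; exact: (idlMr (l := l) (k := 1)).
by apply: idlD; exact: (idlMr (l := l) (k := 1)).
Qed.
Let cidlD z w : cidl l z -> cidl l w -> cidl l (z + w).
Proof. by move=> [h1 h2] [h3 h4]; split; exact: idlD. Qed.
Let cidl_sum (I : finType) (G : I -> A * A) : (forall i, cidl l (G i)) -> cidl l (\sum_i G i).
Proof. by move=> HG; elim/big_rec : _ => [|i z _]; [split; exact: i0|exact: cidlD]. Qed.
Lemma cidl_c2 : cidl l c2.
Proof.
apply: cidlD; last by apply: cidl_sum; exact: cidl_hp.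
split; last exact: i0; apply: idl_sum => i _; apply: (idlMr (l := l) (k := 1)); exact: il.
Qed.
Lemma cidl_c1 : cidl l c1.
Proof.
apply: cidlD; last first.
  by apply: cidl_sum => k; have [h1 h2] := cidl_hp k; split; exact: (@idlZ R A l 1).
split; last exact: i0; apply: idlD; first exact: it.
apply: idl_sum => i _; apply: idlD; first exact: idlct.
by rewrite -scaleNr; apply: (@idlZ R A l 1); exact: il.
Qed.
Lemma Fl_scLc c z : cidl l z -> F 1 (scA c * Lc z).
Proof. by move=> hz; apply: Fl_scA; rewrite -[Lc z]mulr1 -hat1; exact: (Fl_Lc lH lB). Qed.
Lemma Fl_N1 : F 1 N1.
Proof.
apply: FlD; first apply: FlD; first exact: Fl_scLc cidl_c1.
  apply: Fl_sum => i _; rewrite -scaleN1r; apply: FlZ; apply: Fl_scA; apply: FlE (sup_hat _ _); exact: il.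
apply: Fl_sum => k _; apply: Fl_scA; exact: (Fl_Lc lH lB _ _ (pki k)).
Qed.
Lemma zsc w z c (X : opA) : scA w * Lc z * X = X * (scA w * Lc z) ->
  scA w * Lc z * (scA c * X) = scA c * X * (scA w * Lc z).
Proof. by move=> E; rewrite mulrA -cen_scA -mulrA E mulrA. Qed.
Lemma zz_EX : zz * EX = EX * zz.
Proof.
rewrite mulNr mulrN; congr (- _); rewrite mulr_sumr mulr_suml; apply: eq_bigr => i _.
by rewrite mulrN mulNr zsc// cen_LaH//; exact: ceven_c2.
Qed.
Lemma zz_OG : zz * OG = OG * zz.
Proof.
rewrite mulNr mulrN; congr (- _); rewrite mulr_sumr mulr_suml; apply: eq_bigr => k _.
by rewrite zsc// cen_LcH//; exact: ceven_c2.
Qed.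
Lemma cz_SB z w : ceven z -> scA w * Lc z * SBp = SBp * (scA w * Lc z).
Proof.
move=> hz; rewrite mulr_sumr mulr_suml; apply: eq_bigr => k _.
by rewrite mulrN mulNr cen_LcH.
Qed.
Lemma cz_ST z w : ceven z -> scA w * Lc z * STop = STop * (scA w * Lc z).
Proof. by move=> hz; rewrite mulr_sumr mulr_suml; apply: eq_bigr => i _; rewrite cen_LaH. Qed.
Lemma zz_c1 : zz * (scA ih * Lc c1) = scA ih * Lc c1 * zz.
Proof.
rewrite mulNr mulrN; congr (- _).
have E (z w : A * A) : scA ih * Lc z * (scA ih * Lc w) = scA (ih * ih) * Lc (cmul z w).
  by rewrite mulrA -(mulrA (scA ih)) -Lc_scA mulrA scAM -mulrA LcM.
rewrite !E; congr (_ * Lc _); have [h1 h2] := ceven_c1; have [h3 h4] := ceven_c2.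
rewrite /cmul; congr pair.
  by rewrite (homog_even_comm c1.1 h3) (homog_even_comm c1.2 h4).
by rewrite (homog_even_comm c1.2 h3) (homog_even_comm c1.1 h4) addrC.
Qed.

(** The only non-commuting pairs are each $x_i$ with $\partial/\partial x_i$ and each $e_k$ with
    $\partial/\partial e_k$. Their contractions sum to the central [zz], so [nexp_bch] merges the
    exponentials. *)
Lemma exp_product : nexp F Nn * (Wh b * (Sop_ * nexp F STop)) =
  Wh b * nexp F (N1 + (SBp + STop) + 2^-1 *: zz).
Proof.
have gen (a e o sb st z1 z2 : opA) : a * sb = sb * a -> a * st = st * a -> e * sb = sb * e ->
    e * st = st * e + z1 -> o * sb = sb * o + z2 -> o * st = st * o ->
    (a + e + o) * (sb + st) = (sb + st) * (a + e + o) + (z1 + z2).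
  move=> E1 E2 E3 E4 E5 E6; rewrite !mulrDl !mulrDr E1 E2 E3 E4 E5 E6.
  by rewrite [LHS](AC ((2*(1*2))*(2*1)) ((1*3*6)*(2*4*8)*(5*7))).
have zz_SB : zz * SBp = SBp * zz by rewrite mulNr mulrN cz_SB//; exact: ceven_c2.
have zz_ST : zz * STop = STop * zz by rewrite mulNr mulrN cz_ST//; exact: ceven_c2.
have FSB : F 1 SBp by apply: Fl_SB.
have -> : Sop_ * nexp F STop = nexp F (SBp + STop).
  by apply: nexpC SB_ST; [exact: FSB|exact: Fl_ST].
rewrite mulrA -(nexp_conj F N1E) -mulrA; congr (_ * _).
have Fz : F 1 zz by rewrite /zz -scaleN1r; apply: FlZ; exact: Fl_scLc cidl_c2.
apply: nexp_bch => //; first exact: Fl_N1.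
- by apply: FlD => //; exact: Fl_ST.
- by rewrite -zzE; apply: gen; [exact: cz_SB ceven_c1|exact: cz_ST ceven_c1|exact: EX_SB|exact: EX_ST|exact: OG_SB|exact: OG_ST].
- by rewrite /N1 mulrDl mulrDr mulrDl mulrDr zz_EX zz_OG zz_c1.
- by rewrite mulrDl mulrDr zz_SB zz_ST.
Qed.

Lemma La_hatZ a p' c (T : opH) : La a * hat p' (c *: T) = scA c * (La a * hat p' T).
Proof. by rewrite hat_scale !mulrA scA_La. Qed.
Lemma uvE : uv n = EX + OG + SBp + STop.
Proof.
have split4 (G : 'I_N -> opA) : \sum_i G i = (\sum_i G (ia r s i) + \sum_i G (ib r s i))
   + ((\sum_a G (iu m s a) + \sum_a G (iv m s a)) + (\sum_c G (iw m r c) + \sum_c G (iw' m r c))).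
  by rewrite !big_split_ord.
have split2 (G : 'I_(r + s) -> opA) : \sum_k G k = \sum_a G (theta s a) + \sum_c G (zeta r c) by rewrite big_split_ord.
rewrite /uv split4 /OG /SBp /SB !split2.
have -> : \sum_i La (n (ia r s i)) * Uh (ia r s i) = STop.
  apply: eq_bigr => i _; rewrite /Uh par_l Uop_l /ev_x /ev_p /ev_idx split_l scale0r add0r scaleN1r hatN mulrN.
  by rewrite LaN mulNr.
have -> : \sum_i La (n (ib r s i)) * Uh (ib r s i) = EX.
  apply: eq_bigr => i _; rewrite /Uh par_l Uop_l /ev_x /ev_p /ev_idx split_r scale0r addr0 scaleNr hatN mulrN.
  by rewrite La_hatZ.
have -> : \sum_a La (n (iu m s a)) * Uh (iu m s a) = \sum_a - (Lc (h (theta s a)) * Dh (theta s a)).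
  apply: eq_bigr => a _; rewrite /Uh par_r Uop_r /od_g /od_d /od_idx !split_l scale0r add0r scaleN1r hatN mulrN.
  by rewrite /iu oddn /h /odd_shift split_l Lc_La.
have -> : \sum_a La (n (iv m s a)) * Uh (iv m s a) = \sum_a scA ih * (Lc (pk (theta s a)) * Gh (theta s a)).
  apply: eq_bigr => a _; rewrite /Uh par_r Uop_r /od_g /od_d /od_idx split_l split_r scale0r addr0.
  by rewrite La_hatZ /iv oddn /pk split_l Lc_La.
have -> : \sum_c La (n (iw m r c)) * Uh (iw m r c) + \sum_c La (n (iw' m r c)) * Uh (iw' m r c) =
   \sum_c scA ih * (Lc (pk (zeta r c)) * Gh (zeta r c)) + \sum_c - (Lc (h (zeta r c)) * Dh (zeta r c)).
  rewrite -!big_split; apply: eq_bigr => c _ /=.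
  rewrite /Uh !par_r !Uop_r /od_g /od_d /od_idx !split_r !split_l.
  rewrite /iw /iw' !oddn /h /odd_shift /pk split_r !hatD LcZ !mulrDr !La_hatZ.
  have e1 : Complex 0 (hbar / 2) = ih * cr 2^-1 :> C by apply: complex_ext; rewrite ?ReM ?ImM /=; ring.
  have e2 : Complex (hbar / 2) 0 = - (ih * cr 2^-1 * 'i%C) :> C by apply: complex_ext; rewrite ?ReN ?ImN ?ReM ?ImM /= ?ReM ?ImM /=; ring.
  have e3 : Complex 0 (-1) = - 'i%C :> C by apply: complex_ext; rewrite ?ReN ?ImN /= ?oppr0.
  have sN c' : scA (- c') = - scA c' by rewrite /scA scaleNr hatN.
  have LcH z p' (T : opH) : Lc z * hat p' T = La z.1 * hat p' T + scA 'i%C * (La z.2 * hat p' T).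
    by rewrite /Lc mulrDl -scA_La mulrA.
  have half (X : opA) : scA ih * (2^-1 *: X) = scA (ih * cr 2^-1) * X.
    by rewrite -scAM scA_cr -!scalerAr mulr1 -scalerAl.
  have s1 : scA 1 = 1 by rewrite /scA scale1r hat1.
  rewrite e1 e2 e3 !sN s1 -!scalerAl half !LcH /= LaN !mulNr !mulrDr mul1r !mulrN !(mulrA (scA _) (scA _)) !scAM.
  by rewrite opprD [LHS](AC (2*2) ((1*3)*(2*4))).
by rewrite [LHS](AC (2*(2*2)) (2*(4*5)*(3*6)*1)).
Qed.

Lemma omAE : omA (bA b) n = \sum_i (qb i *: pn i - pb i *: qn i).
Proof.
have split4 (G : 'I_N -> A) : \sum_i G i = (\sum_i G (ia r s i) + \sum_i G (ib r s i))
   + \sum_j G (rshift (m + m) j) by rewrite !big_split_ord.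
have bo (j : 'I_(dim_odd r s)) : bA b (rshift (m + m) j) = 0.
  by rewrite /bA evenb ?par_r// scale0r.
have omo (i : 'I_(m + m)) (j : 'I_(dim_odd r s)) : omega R m r s (lshift _ i) (rshift (m + m) j) = 0.
  by rewrite omega_par// par_l par_r.
have oml (i j : 'I_(m + m)) : omega R m r s (lshift _ i) (lshift _ j) = omega_even R m i j.
  by rewrite /omega block_mxEul.
rewrite /omA split4 [X in _ + X]big1 ?addr0 => [|j _]; last first.
  by rewrite big1// => i _; rewrite bo mul0r scaler0.
rewrite -big_split; apply: eq_bigr => i _ /=; congr (_ + _).
  rewrite split4 [X in _ + X]big1 ?addr0 => [|j _]; last by rewrite omo mulr0 scale0r.
  rewrite [X in X + _]big1 ?add0r => [|j _]; last by rewrite oml /omega_even block_mxEul mxE mulr0 scale0r.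
  rewrite (bigD1 i)//= [X in _ + X]big1 ?addr0 => [|j ji]; last first.
    by rewrite oml /omega_even block_mxEur mxE eq_sym (negbTE ji) mulr0 scale0r.
  by rewrite oml /omega_even block_mxEur mxE eqxx !par_l /= mul1r scale1r /bA mulr_algl.
rewrite split4 [X in _ + X]big1 ?addr0 => [|j _]; last by rewrite omo mulr0 scale0r.
rewrite [X in _ + X]big1 ?addr0 => [|j _]; last by rewrite oml /omega_even block_mxEdr mxE mulr0 scale0r.
rewrite (bigD1 i)//= [X in _ + X]big1 ?addr0 => [|j ji]; last first.
  by rewrite oml /omega_even block_mxEdl !mxE eq_sym (negbTE ji) oppr0 mulr0 scale0r.
by rewrite oml /omega_even block_mxEdl !mxE eqxx !par_l /= mul1r scaleN1r /bA mulr_algl.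
Qed.

(** The factors $1/2$ in the phase produce exactly the symmetric ordering: in [c1 - c2 / 2] the odd
    terms cancel, the products of two nilpotent even coordinates cancel, and $-\frac12\omega(b,n)$
    remains beside [tn]. *)
Lemma schrodinger_Ush phi : AH phi ->
  schrodinger hbar x t phi = (scA (ei (hbar * body t)) * @Ush R A hbar m r s l lH lB b n tn) phi.
Proof.
move=> hp; rewrite schrodingerE// exp_product; congr ((_ * (_ * nexp F _)) phi).
rewrite uvE /N1.
have -> : scA ih * La (tn - 2^-1 *: omA (bA b) n) = scA ih * Lc c1 + 2^-1 *: zz.
  rewrite /zz scalerN scalerAr -LcZ -mulrBr -LcN -LcD; congr (_ * _); rewrite -Lc_La; congr Lc.
  rewrite /c1 /c2 scalerDr opprD addrACA -scaler_sumr subrr addr0 pairZ scaler0.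
  rewrite (_ : - (_, 0) = (- (2^-1 *: \sum_i pn i * qn i), - 0) :> A * A)// pairD oppr0 addr0; congr pair.
  rewrite -[RHS]addrA; congr (_ + _); have -> := omAE; rewrite !scaler_sumr -sumrN -sumrB; apply: eq_bigr => i _.
  have -> : ct i = 2^-1 *: (qb i *: pn i + qn i * p i).
    rewrite /ct; congr (_ *: _); rewrite {1}qE mulrDl mulr_algl {1}pE scalerDr scalerA.
    by rewrite [LHS](AC (3*1) ((1*4)*(2*3)))/= subrr add0r.
  rewrite pE mulrDr mulr_algr (homog_even_comm (pn i) (qnh i)).
  move: (pn i) (qn i) (qb i) (pb i) => P Q u v; rewrite !scalerDr.
  have half (X : A) : X = 2^-1 *: X + 2^-1 *: X.
    by rewrite -scalerDl -[LHS]scale1r; congr (_ *: _); rewrite -div1r -splitr.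
  rewrite [X in _ - X - _](half (u *: P)) scalerN opprD opprK opprD.
  by rewrite [RHS](AC (((1*2)*2)*1) ((4*2)*((1*5)*(3*6))))/= !subrr !addr0.
by rewrite [LHS](AC ((3*2)*1) (2*3*4*5*(1*6))).
Qed.
End Factorisation.

(** * The body of the metaplectic representation *)

Section FockIntertwining.
Variables (R : realType) (hbar : R) (m r s : nat).
Variable mu : mp_elt R m -> ('rV[R]_m -> R[i]) -> 'rV[R]_m -> R[i].
Hypothesis Hmu : metaplectic_rep r s hbar mu.
Hypothesis hb0 : hbar != 0.
Local Notation V := 'rV[R]_m.
Local Notation C := R[i].
Local Notation N := (dim_E m r s).
Local Notation H := ('rV[R]_m -> {set 'I_(r + s)} -> R[i]).
Local Notation opH := (op (Hsub R m r s)).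
Local Notation ustar := (ustar hbar).
Local Notation uX := (@uX R hbar m).
Local Notation U := (@Uop R hbar m r s).
Local Notation bigX := (@bigX R m r s).

(** The derivative at 0 of $\langle \mu U(tX)f, \mu k\rangle = \langle U(tgX)\mu f, \mu k\rangle$.
    Unitarity removes $\mu$ on the left, so nothing is assumed on its continuity, and functions $\mu
    k$ suffice as tests because [good] includes surjectivity. *)
Lemma mu_ustar g X f : Mp2m g -> schwartz f ->
  mu g (ustar (cq X) (cp X) f) = ustar (cq (g.1 *m X)) (cp (g.1 *m X)) (mu g f).
Proof.
move=> Mg Sf; have [good1 good2] := real_intertwine Hmu hb0 Mg.
have Sg k : schwartz k -> schwartz (mu g k) by exact: (mp_smooth Hmu Mg).
have Su (Y : 'cV[R]_(m + m)) k : schwartz k -> schwartz (ustar (cq Y) (cp Y) k) by exact: schwartz_ustar.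
have SX (Y : 'cV[R]_(m + m)) k : schwartz k -> schwartz (uX Y k) by exact: schwartz_u0.
apply: Bf_eq; [exact/Sg/Su|exact/Su/Sg|] => _ /good2[k Sk <-].
rewrite (Bf_mu Hmu Mg)//; last exact: Su.
have d (Y : 'cV[R]_(m + m)) k1 k2 : schwartz k1 -> schwartz k2 ->
    is_derive (0 : R) (1 : R) (fun t => Bf (uX (t *: Y) k1) k2) (Bf (ustar (cq Y) (cp Y) k1) k2).
  move=> S1 S2.
  have e0 : Bf k1 (fun=> 0) = 0.
    have E0 : (fun x : V => cr 0 * 0) = (fun=> 0 : C) by apply/funext => x; rewrite mulr0.
    by have := BfZ 0 (@schwartz0 R m) S1; rewrite E0 mul0r BfC.
  have S0 : schwartz (fun _ : V => 0 : C) by exact: schwartz0.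
  have sd : sdiff (fun t => uX (t *: Y) k1) k1 (ustar (cq Y) (cp Y) k1).
    have -> : (fun t => uX (t *: Y) k1) = (fun t => u0 hbar (t *: cq Y) (t *: cp Y) k1).
      by apply/funext => t; rewrite uX_scale.
    exact: sdiff_u0.
  have z0 : uX (0 *: Y) k1 = k1 by rewrite uX_scale !scale0r u0_0.
  have := sdiff_Bf (fun t => SX (t *: Y) _ S1) (fun=> S2) (Su Y _ S1) S0 z0 erefl sd (sdiff_cst k2).
  by rewrite e0 addr0.
have d1 := d X f k Sf Sk.
have d2 := d (g.1 *m X) (mu g f) (mu g k) (Sg _ Sf) (Sg _ Sk).
have E : (fun t => Bf (uX (t *: (g.1 *m X)) (mu g f)) (mu g k)) = (fun t => Bf (uX (t *: X) f) k).
  by apply/funext => t; rewrite scalemxAr -good1// (Bf_mu Hmu Mg)//; exact: SX.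
rewrite E in d2.
by rewrite -(@derive_val _ _ _ _ _ _ _ d1) -(@derive_val _ _ _ _ _ _ _ d2).
Qed.

Section Element.
Variable g : mp_elt R m.
Hypothesis Mg : Mp2m g.

Fact mu_pres : preserving (Hsub R m r s) (fun (f : H) x J => mu g (fun y => f y J) x).
Proof. by apply: Hlift => [f|c f h]; [exact: (mp_smooth Hmu Mg)|exact: (mp_linear Hmu)]. Qed.
Definition opMu : opH := mkop mu_pres.
Lemma opMuE f x J : Hsmooth f -> opMu f x J = mu g (fun y => f y J) x.
Proof. by move=> Sf; rewrite /opMu mkopE. Qed.

Lemma muZ (c : C) f : schwartz f -> mu g (fun x => c * f x) = fun x => c * mu g f x.
Proof.
move=> Sf; have z0 : mu g (fun=> 0) = fun=> 0.
  have := mp_linear Hmu (- 1) Mg (@schwartz0 R m) (@schwartz0 R m).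
  rewrite (_ : (fun x => -1 * 0 + 0) = (fun=> 0)); last by apply/funext => x; rewrite mulr0 addr0.
  move=> E; apply/funext => x; have := congr1 (fun k => k x) E => /= ->.
  by rewrite mulN1r addNr.
have := mp_linear Hmu c Mg Sf (@schwartz0 R m); rewrite z0.
rewrite (_ : (fun x => c * f x + 0) = (fun x => c * f x)); last by apply/funext => x; rewrite addr0.
by move=> ->; apply/funext => x; rewrite addr0.
Qed.

Lemma opMu_odd j : opMu * U (rshift (m + m) j) = U (rshift (m + m) j) * opMu.
Proof.
rewrite Uop_r mulrDr mulrDl -!scalerAr -!scalerAl; congr (_ *: _ + _ *: _).
  exact: (comm_G mu_pres _ (fun a f => @muZ a f)).
exact: (comm_D mu_pres _ (fun a f => @muZ a f)).
Qed.

Definition Ueven (X : 'cV[R]_(m + m)) : opH := \sum_k cr (X k 0) *: U (lshift (dim_odd r s) k).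
Lemma UevenE X f x J : Hsmooth f -> Ueven X f x J = ustar (cq X) (cp X) (fun y => f y J) x.
Proof.
move=> Sf.
have split1 (F : 'I_(m + m) -> C) : \sum_i F i = \sum_i F (lshift _ i) + \sum_i F (rshift _ i) by rewrite big_split_ord.
rewrite /Ueven (@opE_sum _ _ (Hsub R m r s))// !fct_sumE split1 /ustar -big_split; apply: eq_bigr => i _.
rewrite !opHZ// !Uop_l /ev_x /ev_p /ev_idx !split_l !split_r !opHD// !opHZ// opXE// opPE//.
rewrite /Ae !mxE.
by apply: complex_ext; rewrite !reimE /=; ring.
Qed.
Lemma WopE X f x J : Hsmooth f -> Wop hbar (bigX X) f x J = uX X (fun y => f y J) x.
Proof.
move=> Sf; rewrite /Wop opWE// /uX; congr (u0 _ _ _ _ _).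
  by apply/rowP => i; rewrite mxE /bigX /ia col_mxEu !mxE.
by apply/rowP => i; rewrite mxE /bigX /ib col_mxEu !mxE.
Qed.

Lemma opMu_Ueven X : opMu * Ueven X = Ueven (g.1 *m X) * opMu.
Proof.
apply: op_ext => f Sf; apply/funext => x; apply/funext => J.
rewrite !opHM// opMuE; last exact: S_in.
rewrite UevenE; last exact: S_in.
rewrite (_ : (fun y => opMu f y J) = mu g (fun y => f y J)); last by apply/funext => y; rewrite opMuE.
rewrite -mu_ustar//; congr (mu _ _ _); apply/funext => y; exact: UevenE.
Qed.
Lemma opMu_W X : opMu * Wop hbar (bigX X) = Wop hbar (bigX (g.1 *m X)) * opMu.
Proof.
apply: op_ext => f Sf; apply/funext => x; apply/funext => J.
rewrite !opHM// opMuE; last exact: S_in.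
rewrite WopE; last exact: S_in.
rewrite (_ : (fun y => opMu f y J) = mu g (fun y => f y J)); last by apply/funext => y; rewrite opMuE.
have [good1 _] := real_intertwine Hmu hb0 Mg.
rewrite -good1//; congr (mu _ _ _); apply/funext => y; exact: WopE.
Qed.

Lemma mu_inj f h : schwartz f -> schwartz h -> mu g f = mu g h -> f = h.
Proof.
move=> Sf Sh E.
have Sd : schwartz (fun x => -1 * f x + h x) by exact: schwartz_lin.
have : Nf (fun x => -1 * f x + h x) = 0.
  rewrite -(Nf_mu Hmu Mg)// (mp_linear Hmu)// E.
  rewrite (_ : (fun x => _) = (fun=> 0)) ?Nf0//.
  by apply/funext => x; rewrite mulN1r addNr.
move=> /(Nf_eq0 Sd) z; apply/funext => x; have := z x.
by move/eqP; rewrite mulN1r addrC subr_eq0 => /eqP.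
Qed.
(** Preimages are chosen function by function; injectivity, a consequence of unitarity, makes the
    choice linear. *)
Lemma opMu_inv : exists T : opH, opMu * T = 1 /\ T * opMu = 1.
Proof.
have [_ good2] := real_intertwine Hmu hb0 Mg.
have ex (h : V -> C) : exists f, schwartz h -> schwartz f /\ mu g f = h.
  have [Sh|nS] := pselect (schwartz h); last by exists (fun=> 0).
  by have [f Sf fh] := good2 h Sh; exists f.
have [mi miP] := choice ex.
have pres : preserving (Hsub R m r s) (fun (f : H) x J => mi (fun y => f y J) x).
  apply: Hlift => [f /miP[]//|c f h Sf Sh].
  have [Sf' Ef] := miP f Sf; have [Sh' Eh] := miP h Sh.
  have [Sl El] := miP _ (schwartz_lin c Sf Sh).
  by apply: mu_inj => //; [exact: schwartz_lin|rewrite El (mp_linear Hmu)// Ef Eh].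
exists (mkop pres); split; apply: op_ext => f Sf; apply/funext => x; apply/funext => J.
  rewrite opHM// opMuE ?opH1//; last exact: S_in.
  rewrite (_ : (fun y => _) = mi (fun y => f y J)); last by apply/funext => y; rewrite mkopE.
  by rewrite (miP _ (Sf J)).2.
rewrite opHM// opH1// mkopE; last exact: S_in.
rewrite (_ : (fun y => opMu f y J) = mu g (fun y => f y J)); last by apply/funext => y; rewrite opMuE.
have [S1 E1] := miP _ (mp_smooth Hmu Mg (Sf J)).
by rewrite (mu_inj S1 (Sf J) E1).
Qed.

Lemma spi_comm (T : opH) a : (forall j, T * U (rshift (m + m) j) = U (rshift (m + m) j) * T) ->
  T * spi hbar m a = spi hbar m a * T.
Proof.
move=> TU; rewrite /spi /rep mulr_suml mulr_sumr; apply: eq_bigr => I _.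
rewrite -scalerAl -scalerAr; congr (_ *: _); rewrite /gp.
elim: (enum I) => [|i t IH]; first by rewrite !big_nil mulr1 mul1r.
rewrite !big_cons mulrA -[in RHS]mulrA -IH !mulrA; congr (_ * _).
rewrite /gam -scalerAl -scalerAr; congr (_ *: _); rewrite /Uodd mulr_suml mulr_sumr.
by apply: eq_bigr => j _; rewrite -scalerAl -scalerAr TU.
Qed.

Variable aG : spin_elt R r s.
Hypothesis HaG : Spin0 aG.
Definition Mop : opH := opMu * spi hbar m aG.1.
Definition Gt : 'M[R]_N := block_mx g.1 0 0 aG.2.

Lemma mu0E f : Hsmooth f -> mu0 hbar mu g aG f = Mop f.
Proof.
move=> Sf; apply/funext => x; apply/funext => J; rewrite /Mop opHM// opMuE; last exact: S_in.
by rewrite /mu0 (spinorE hbar HaG Sf).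
Qed.

Lemma U_evenodd k j : U (lshift (dim_odd r s) k) * U (rshift (m + m) j) = U (rshift (m + m) j) * U (lshift _ k).
Proof.
rewrite UU par_l expr0 scale1r omega_par; last by rewrite par_l par_r.
by rewrite (_ : cr 0 = 0)// mulr0 scale0r addr0.
Qed.

(** On even vectors the spinor factor commutes with everything and [mu g] intertwines; on odd
    vectors the roles are exchanged. *)
Lemma Mop_U j : Mop * U j = (\sum_i cr (Gt i j) *: U i) * Mop.
Proof.
have split2 (F : 'I_N -> opH) : \sum_i F i = \sum_k F (lshift _ k) + \sum_k F (rshift _ k) by rewrite big_split_ord.
have [[k -> _]|[k -> _]] := par_cases j.
  have -> : \sum_i cr (Gt i (lshift _ k)) *: U i = Ueven (g.1 *m delta_mx k 0).
    rewrite split2 [X in _ + X]big1 ?addr0 => [|i _]; last by rewrite /Gt block_mxEdl mxE scale0r.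
    apply: eq_bigr => i _; rewrite /Gt block_mxEul; congr (cr _ *: _).
    by rewrite -colE mxE.
  have -> : U (lshift _ k) = Ueven (delta_mx k 0).
    rewrite /Ueven (bigD1 k)//= big1 ?addr0 => [|i /negbTE ik]; first by rewrite !mxE !eqxx cr1 scale1r.
    by rewrite !mxE ik (_ : cr _ = 0)// scale0r.
  rewrite /Mop mulrA -opMu_Ueven -!mulrA; congr (_ * _); rewrite spi_comm// => i.
  rewrite /Ueven mulr_suml mulr_sumr; apply: eq_bigr => k' _.
  by rewrite -scalerAl -scalerAr U_evenodd.
have -> : \sum_i cr (Gt i (rshift _ k)) *: U i = Uodd hbar m (aG.2 *m delta_mx k 0).
  rewrite split2 [X in X + _]big1 ?add0r => [|i _]; last by rewrite /Gt block_mxEur mxE scale0r.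
  apply: eq_bigr => i _; rewrite /Gt block_mxEdr; congr (cr _ *: _).
  by rewrite -colE mxE.
have -> : U (rshift _ k) = Uodd hbar m (delta_mx k 0).
  rewrite /Uodd (bigD1 k)//= big1 ?addr0 => [|i /negbTE ik]; first by rewrite !mxE !eqxx cr1 scale1r.
  by rewrite !mxE ik (_ : cr _ = 0)// scale0r.
have [_ sv] := spin_intertwine m hb0 HaG.
rewrite /Mop -mulrA sv !mulrA; congr (_ * _).
by rewrite /Uodd mulr_suml mulr_sumr; apply: eq_bigr => j' _; rewrite -scalerAl -scalerAr opMu_odd.
Qed.

Lemma Gt_bigX X : Gt *m bigX X = bigX (g.1 *m X).
Proof. by rewrite /Gt /bigX mul_block_col !mul0mx !mulmx0 !addr0. Qed.
Lemma evenv_bigXE b : evenv b -> b = bigX (usubmx b).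
Proof.
move=> bE; rewrite -[LHS](vsubmxK (m1 := m + m)); congr col_mx.
by apply/colP => i; rewrite !mxE bE// par_r.
Qed.
Lemma Mop_W b : evenv b -> Mop * Wop hbar b = Wop hbar (Gt *m b) * Mop.
Proof.
move=> /evenv_bigXE ->; set X := usubmx b; rewrite Gt_bigX /Mop mulrA -opMu_W -!mulrA; congr (_ * _).
rewrite spi_comm// => j; rewrite UW; last exact: evenv_bigX.
by rewrite om_odd ?par_r//; [rewrite (_ : cr 0 = 0)// mulr0 scale0r addr0|exact: evenv_bigX].
Qed.
Lemma Mop_inv : exists T : opH, Mop * T = 1 /\ T * Mop = 1.
Proof.
have [T [T1 T2]] := opMu_inv; have [[S [S1 S2]] _] := spin_intertwine m hb0 HaG.
exists (S * T); rewrite /Mop; split.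
  by rewrite -mulrA (mulrA _ S) S1 mul1r.
by rewrite -mulrA (mulrA T) T2 mul1r.
Qed.
Lemma Gt_par i j : par i != par j -> Gt i j = 0.
Proof.
have [[k -> ->]|[k -> ->]] := par_cases i; have [[k' -> ->]|[k' -> ->]] := par_cases j => // _.
  by rewrite /Gt block_mxEur mxE.
by rewrite /Gt block_mxEdl mxE.
Qed.
Lemma Gt_even b : evenv b -> evenv (Gt *m b).
Proof.
move=> bE i pi; rewrite mxE big1// => j _; case pj: (par j); first by rewrite bE// mulr0.
by rewrite Gt_par ?mul0r// pi pj.
Qed.
(** [b] has no odd coordinates, so the identity comes down to the symplectic condition on the even
    block. *)
Lemma Gt_om b : evenv b -> (Gt *m b)^T *m omega R m r s *m Gt = b^T *m omega R m r s.
Proof.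
move=> /evenv_bigXE ->; set X := usubmx b; rewrite Gt_bigX /bigX /omega /Gt.
rewrite !tr_col_mx !trmx0 !mul_row_block !mul0mx !mulmx0 !addr0.
case: Mg => oE _ _ _; congr row_mx; rewrite ?mulmx0 ?mul0mx ?addr0//.
by rewrite trmx_mul -!mulmxA (mulmxA g.1^T) oE.
Qed.
End Element.
End FockIntertwining.

(** * Intertwining over the base algebra *)

Section Assembly.
Variables (R : realType) (A : baseAlgebra R) (hbar : R) (m r s : nat).
Variable mu : mp_elt R m -> ('rV[R]_m -> R[i]) -> 'rV[R]_m -> R[i].
Hypothesis Hmu : metaplectic_rep r s hbar mu.
Hypothesis hb0 : hbar != 0.
Local Notation C := R[i].
Local Notation N := (dim_E m r s).
Local Notation opH := (op (Hsub R m r s)).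
Local Notation opA := (op (AHsub A m r s)).
Local Notation AHF := ('rV[R]_m -> {set 'I_(r + s)} -> A * A).
Local Notation La := (@La R A m r s).
Local Notation hat := (@hat R A m r s).
Local Notation scA := (@scA R A m r s).
Local Notation ih := (Complex 0 hbar : C).
Local Notation Wh := (@Wh R A hbar m r s).
Local Notation uv := (@uv R A hbar m r s).
Local Notation omA := (@omA R A m r s).
Local Notation Uh := (@Uh R A hbar m r s).
Local Notation bA := (@bA R A m r s).
Local Notation om := (omega R m r s).
Local Notation body := (Defs.body A).

Section Tensor.
Variables (p : bool) (q : nat) (a : 'I_q -> A) (B : 'I_q -> 'M[R]_N).
Hypothesis SB : forall k, spo p (B k).
Let X : 'M[A]_N := \sum_k (\matrix_(i, j) (B k i j *: a k)).

Lemma tensor_entry i j : X i j = \sum_k B k i j *: a k.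
Proof. by rewrite /X summxE; apply: eq_bigr => k _; rewrite mxE. Qed.

Lemma super_actE : super_act X = actY p a B.
Proof.
apply/funext => x; apply/funext => i; rewrite /super_act /actY fct_sumE /act1 exchange_big /=.
apply: eq_bigr => j _; rewrite tensor_entry mulr_suml mulr_sumr; apply: eq_bigr => k _.
rewrite -scalerAl -scalerAr signAM scalerA.
have [e|e] := eqVneq (par i (+) par j) p; last by rewrite (proj1 (SB k))// !(mulr0, mul0r) !scale0r.
by rewrite e mulrC.
Qed.

Lemma mu_starAE phi : AH phi -> mu_starA hbar X phi = Dsum hbar p a B phi.
Proof.
move=> hp; rewrite /mu_starA /Dsum.
transitivity ((\sum_i \sum_j La (4^-1 *: (X *m map_mx (fun c : R => c%:A) om^T) i j) *
    hat (par i (+) par j) (quadop hbar i j) : opA) phi).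
  rewrite (@opE_sum _ _ (AHsub A m r s))//; apply: eq_bigr => i _.
  rewrite (@opE_sum _ _ (AHsub A m r s))//; apply: eq_bigr => j _.
  by apply: tens_opE => // f Sf; exact: mu_quadE.
congr ((_ : opA) phi).
have E i j : (X *m map_mx (fun c : R => c%:A) om^T) i j = \sum_k (B k *m om^T) i j *: a k.
  rewrite mxE; under eq_bigr do rewrite tensor_entry mxE mulr_suml.
  rewrite exchange_big; apply: eq_bigr => k _ /=; rewrite [(B k *m _) i j]mxE scaler_suml.
  by apply: eq_bigr => i' _; rewrite mulr_algr scalerA mulrC.
pose T i j k : opA := ((B k *m om^T) i j / 4) *: (La (a k) * hat p (quadop hbar i j)).
transitivity (\sum_i \sum_j \sum_k T i j k).
  apply: eq_bigr => i _; apply: eq_bigr => j _.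
  rewrite E scaler_sumr La_sum mulr_suml; apply: eq_bigr => k _; rewrite /T scalerA LaZ -scalerAl mulrC.
  have [e|e] := eqVneq (par i (+) par j) p; first by rewrite e.
  have := spc_par (SB k) e; rewrite /spc => /(congr1 (@complex.Re R)) /= ->.
  by rewrite mul0r !scale0r.
transitivity (\sum_i \sum_k \sum_j T i j k).
  by apply: eq_bigr => i _; rewrite exchange_big.
rewrite exchange_big /=; apply: eq_bigr => k _.
rewrite /D1 /muop /amu hat_sum mulr_sumr; apply: eq_bigr => i _.
rewrite hat_sum mulr_sumr; apply: eq_bigr => j _.
by rewrite -/(quadop hbar i j) hat_cr -scalerAr.
Qed.
End Tensor.

Section ExpProps.
Variable l : seq A.
Hypothesis lH : forall a, a \in l -> exists p, homog p a.
Variables (p : bool) (q : nat) (a : 'I_q -> A) (B : 'I_q -> 'M[R]_N).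
Hypotheses (SB : forall k, spo p (B k)) (ha : forall k, homog p (a k)) (la : forall k, idl l 1 (a k)).
Local Notation actY := (@actY R A m r s p q a B).
Local Notation expY := (@expY R A m r s p q a B).

Lemma nilexp_actY K x : (forall k y, (K <= k)%N -> iter k actY y = 0) -> nilexp actY x = expY K.+1 x.
Proof. by move=> YK; rewrite (@nilexpE R _ _ _ K.+1)// => k Kk; apply: YK; exact: ltnW. Qed.

Lemma expY_E0 K x : E0 x -> E0 (expY K x).
Proof.
move=> hx; rewrite /expY; elim/big_rec : _ => [|k y _ hy]; first exact: E00.
apply: E0D => //; apply: E0Z; elim: (k : nat) => [//|j IH]; exact: (actY_E0 SB ha).
Qed.
Lemma expY_idv K x b : idv l 1 (x - bA b) -> idv l 1 (expY K.+1 x - bA b).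
Proof.
move=> hx i; rewrite /expY big_ord_recl fac0 scale1r addrAC.
rewrite (_ : (_ + _) i = (x - bA b) i + (\sum_(k < K) fac R k.+1 *: iter k.+1 actY x) i)//.
apply: idlD; first exact: hx.
rewrite fct_sumE; apply: idl_sum => k _; apply: (@idlZ R A l 1).
by apply: (@idl_mono R A l 1 k.+1) => //; exact: actY_iter_idv.
Qed.
End ExpProps.

Section Group.
Variables (g : mp_elt R m) (aG : spin_elt R r s).
Hypotheses (Mg : Mp2m g) (HaG : Spin0 aG).
Local Notation Gt := (@Gt R m r s g aG).
Let Mo : opH := Mop Hmu Mg aG.
Definition mh : opA := hat false Mo.
Definition gact (x : 'I_N -> A) : 'I_N -> A := fun i => \sum_j Gt i j *: x j.

Lemma gactB x y : gact (x - y) = gact x - gact y.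
Proof.
apply/funext => i; rewrite (_ : (gact x - gact y) i = gact x i - gact y i)// /gact -sumrB.
by apply: eq_bigr => j _; rewrite -scalerBr.
Qed.
Lemma gact_bA b : gact (bA b) = bA (Gt *m b).
Proof.
apply/funext => i; rewrite /gact /bA mxE scaler_suml; apply: eq_bigr => j _.
by rewrite scalerA.
Qed.
Lemma gact_E0 x : E0 x -> E0 (gact x).
Proof.
move=> hx i; apply: homog_sum => j _.
have [e|e] := eqVneq (par i) (par j); last by rewrite Gt_par// scale0r; exact: homog0.
by apply: homogZ; rewrite e.
Qed.
Lemma gact_idv l k x : idv l k x -> idv l k (gact x).
Proof. by move=> hx i; apply: idl_sum => j _; apply: idlZ. Qed.

Lemma mh_Uh j : mh * Uh j = \sum_i Gt i j *: (Uh i * mh).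
Proof.
rewrite /mh /Uh hatM addFb Mop_U// mulr_suml hat_sum; apply: eq_bigr => i _.
rewrite -scalerAl hat_cr hatM addbF.
have [->//|e] := eqVneq (par i) (par j).
by rewrite Gt_par// !scale0r.
Qed.
Lemma mh_uv x : mh * uv x = uv (gact x) * mh.
Proof.
transitivity (\sum_j \sum_i Gt i j *: (La (x j) * (Uh i * mh))).
  rewrite /uv mulr_sumr; apply: eq_bigr => j _.
  rewrite mulrA {1}/mh hat_La twist0 -mulrA -/mh mh_Uh mulr_sumr; apply: eq_bigr => i _.
  by rewrite -scalerAr.
rewrite exchange_big /= /uv mulr_suml; apply: eq_bigr => i _.
rewrite /gact La_sum !mulr_suml; apply: eq_bigr => j _.
by rewrite LaZ -!scalerAl mulrA.
Qed.
Lemma mh_Wh b : evenv b -> mh * Wh b = Wh (Gt *m b) * mh.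
Proof. by move=> bE; rewrite /mh /Wh !hatM Mop_W. Qed.
Lemma mh_scA z : mh * scA z = scA z * mh.
Proof. by rewrite /mh scA_hat. Qed.
Lemma mh_scLa z c : mh * (scA z * La c) = scA z * La c * mh.
Proof. by rewrite mulrA mh_scA -mulrA /mh hat_La twist0 mulrA. Qed.
Lemma omA_row b x : evenv b -> omA (bA b) x = \sum_j (b^T *m om) 0 j *: x j.
Proof.
move=> bE; rewrite /omA exchange_big /=; apply: eq_bigr => j _.
rewrite [(b^T *m om) 0 j]mxE scaler_suml; apply: eq_bigr => i _; rewrite /bA mulr_algl scalerA [b^T 0 i]mxE.
case pi: (par i); first by rewrite bE// !(mulr0, mul0r).
by rewrite mul1r mulrC.
Qed.
(** The phase in [Ush] pairs the nilpotent part with a real even vector; this pairing is the one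
    [Gt_om] preserves. *)
Lemma omA_gact b x : evenv b -> omA (bA (Gt *m b)) (gact x) = omA (bA b) x.
Proof.
move=> bE; rewrite !omA_row//; last exact: Gt_even.
rewrite -(Gt_om Mg aG bE).
transitivity (\sum_j \sum_k ((((Gt *m b)^T *m om) 0 j * Gt j k) *: x k)).
  by apply: eq_bigr => j _; rewrite /gact scaler_sumr; apply: eq_bigr => k _; rewrite scalerA.
rewrite exchange_big /=; apply: eq_bigr => k _.
by rewrite [in RHS]mxE scaler_suml.
Qed.
Lemma mh_inv : exists T : opA, mh * T = 1 /\ T * mh = 1.
Proof.
have [T [T1 T2]] := Mop_inv Hmu hb0 Mg HaG.
by exists (hat false T); rewrite /mh !hatM T1 T2 hat1.
Qed.

Section Filt.
Variable l : seq A.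
Hypothesis lH : forall a, a \in l -> exists p, homog p a.
Hypothesis lB : forall a, a \in l -> body a = 0.
Local Notation Ush := (@Ush R A hbar m r s l lH lB).
Lemma mh_Ush b n tn : evenv b -> mh * Ush b n tn = Ush (Gt *m b) (gact n) tn * mh.
Proof.
move=> bE; rewrite /Ush mulrA mh_Wh// -!mulrA; congr (_ * _).
apply: nexp_conj; rewrite mulrDr mulrDl mh_uv; congr (_ + _).
by rewrite mh_scLa omA_gact.
Qed.
End Filt.
End Group.

Lemma scA_Dsum p q (a : 'I_q -> A) B c : scA c * Dsum hbar p a B = Dsum hbar p a B * scA c.
Proof. by rewrite mulr_sumr mulr_suml; apply: eq_bigr => k _; exact: scA_LaH. Qed.

Lemma intertwine_steps (T : pzRingType) (S3 S2 S1 S0 E1 E2 h c : T) :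
  E1 * S0 = S1 * E1 -> E2 * S1 = S2 * E2 -> h * S2 = S3 * h ->
  h * (E2 * E1) * c = c * (h * (E2 * E1)) ->
  c * S3 * (h * (E2 * E1)) = h * (E2 * E1) * (c * S0).
Proof.
by move=> e1 e2 e3 e4; rewrite [RHS]mulrA e4 -!mulrA e1 (mulrA E2) e2 !mulrA -(mulrA c) -e3 !mulrA.
Qed.

Lemma metaplectic_intertwines (M : Mp A m r s) (x : 'I_N -> A) (t : A) : E0 x -> homog false t ->
  set_bij (@AH R A m r s) (@AH R A m r s) (metaplectic hbar mu M) /\
  forall phi : AHfun A m r s, AH phi ->
    schrodinger hbar (rho M x) t phi =
    metaplectic hbar mu M (schrodinger hbar x t (metaplectic_inv hbar mu M phi)).
Proof.
move=> hx ht; case: M => g aG Y X Mg HaG [qY [aY [BY [YP YE]]]] [qX [aX [BX [XP XE]]]].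
pose b : 'cV[R]_N := \col_i body (x i).
have bx i : b i 0 = body (x i) by rewrite mxE.
pose n := x - bA b; pose tn := t - (body t)%:A.
(* All nilpotent coefficients that occur: those of both exponents of [M], of [x - b] and of [t].
   They fix the ideal, hence the filtration and the length of every exponential below. *)
pose l : seq A := codom aX ++ codom aY ++ codom n ++ [:: tn].
have bE : evenv b by apply: (evenb hx bx).
have hb := bA_E0 A bE.
have hn : E0 n by exact: E0B.
have htn : homog false tn by apply: homogD => //; exact/homogNn/homog_scalar.
have body_scal (c : R) : body (c%:A) = c by rewrite linearZ /= rmorph1 /GRing.scale /= mulr1.
have lP (P : A -> Prop) : (forall k, P (aX k)) -> (forall k, P (aY k)) -> (forall i, P (n i)) -> P tn ->
    forall a, a \in l -> P a.
  move=> P1 P2 P3 P4 a; rewrite !mem_cat inE => /orP[/codomP[k ->]//|/orP[/codomP[k ->]//|/orP[/codomP[k ->]//|/eqP ->//]]].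
have lH : forall a, a \in l -> exists p, homog p a.
  apply: lP => [k|k|i|]; [by exists true; case: (XP k)|by exists false; case: (YP k) => -[]|by exists (par i)|by exists false].
have lB : forall a, a \in l -> body a = 0.
  apply: lP => [k|k|i|]; first by case: (XP k) => h1 _; exact: body_odd.
  - by case: (YP k) => -[].
  - by rewrite /n (_ : (x - bA b) i = x i - bA b i)// raddfB /= /bA body_scal bx subrr.
  - by rewrite raddfB /= body_scal subrr.
have lin a : a \in l -> idl l 1 a by move=> al; rewrite -[a]mulr1; exact: (@idlS R A l 0).
have il : idv l 1 n by move=> i; apply: lin; rewrite !mem_cat codom_f !orbT.
have it : idl l 1 tn by apply: lin; rewrite !mem_cat inE eqxx !orbT.
have iX k : idl l 1 (aX k) by apply: lin; rewrite !mem_cat codom_f.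
have iY k : idl l 1 (aY k) by apply: lin; rewrite !mem_cat codom_f !orbT.
have SX k : spo true (BX k) by case: (XP k). have hX k : homog true (aX k) by case: (XP k).
have SY k : spo false (BY k) by case: (YP k). have hY k : homog false (aY k) by case: (YP k) => -[].
pose F := @AFl R A m r s l lH lB.
pose DX : opA := Dsum hbar true aX BX; pose DY : opA := Dsum hbar false aY BY.
have FX : F 1 DX by apply: Fl_Dsum.
have FY : F 1 DY by apply: Fl_Dsum.
have [KX nX] := actY_nil lH lB true BX iX.
have [KY nY] := actY_nil lH lB false BY iY.
pose x1 := expY true aX BX KX.+1 x; pose x2 := expY false aY BY KY.+1 x1.
have hx1 : E0 x1 by exact: expY_E0.
have hx2 : E0 x2 by exact: expY_E0.
have i1 : idv l 1 (x1 - bA b) by apply: expY_idv.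
have i2 : idv l 1 (x2 - bA b) by apply: expY_idv.
pose M := Build_Mp Mg HaG (ex_intro _ qY (ex_intro _ aY (ex_intro _ BY (conj YP YE))))
   (ex_intro _ qX (ex_intro _ aX (ex_intro _ BX (conj XP XE)))).
rewrite -/M.
(* $\mu(M)$ as one element of the operator algebra, invertible factor by factor. *)
pose Mo : opA := mh aG Mg * (nexp F DY * nexp F DX).
have metE phi : AH phi -> metaplectic hbar mu M phi = Mo phi.
  move=> hp.
  have -> : Mo phi = mh aG Mg (nexp F DY (nexp F DX phi)).
    by rewrite /Mo (@opEM _ _ (AHsub A m r s) _ _ _ hp) (@opEM _ _ (AHsub A m r s) _ _ _ hp).
  rewrite /metaplectic /=.
  have eX : nilexp (mu_starA hbar X) phi = nexp F DX phi.
    by apply: nilexp_op => // psi hpsi; rewrite XE (mu_starAE aX SX).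
  rewrite eX; have h1 : AH (nexp F DX phi) by exact: A_in.
  have eY : nilexp (mu_starA hbar Y) (nexp F DX phi) = nexp F DY (nexp F DX phi).
    by apply: nilexp_op => // psi hpsi; rewrite YE (mu_starAE aY SY).
  rewrite eY; have h2 : AH (nexp F DY (nexp F DX phi)) by exact: A_in.
  rewrite (@tens_opE R A m r s 1 false _ (Mop Hmu Mg aG) _ _ h2) => [|f Sf]; last exact: mu0E.
  by rewrite La1 mul1r.
have [Ti [Ti1 Ti2]] : exists T : opA, Mo * T = 1 /\ T * Mo = 1.
  have [T [T1 T2]] := mh_inv Mg HaG.
  have NX : nexp F (- DX) * nexp F DX = 1 := nexpN FX.
  have NY : nexp F (- DY) * nexp F DY = 1 := nexpN FY.
  have F_N D : F 1 D -> F 1 (- D) by move=> FD; rewrite -scaleN1r; exact: (flZ (f := F)).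
  have NX' : nexp F DX * nexp F (- DX) = 1 by have := nexpN (F_N _ FX); rewrite opprK.
  have NY' : nexp F DY * nexp F (- DY) = 1 by have := nexpN (F_N _ FY); rewrite opprK.
  exists (nexp F (- DX) * nexp F (- DY) * T); rewrite /Mo; split.
    by rewrite !mulrA -(mulrA _ (nexp F DX)) NX' mulr1 -(mulrA _ (nexp F DY)) NY' mulr1.
  by rewrite !mulrA -(mulrA _ T) T2 mulr1 -(mulrA _ (nexp F (- DY))) NY mulr1.
have bij : set_bij (@AH R A m r s) (@AH R A m r s) (metaplectic hbar mu M).
  split=> [phi hp|phi psi|psi hp].
  - by rewrite metE//; exact: A_in.
  - rewrite !inE => hp hq; rewrite !metE// => E.
    have := congr1 (fun f => Ti f) E.
    by rewrite -!(@opEM _ _ (AHsub A m r s))// Ti2 !(@opE1 _ _ (AHsub A m r s)).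
  - exists (Ti psi); first exact: A_in.
    rewrite metE; last exact: A_in.
    by rewrite -(@opEM _ _ (AHsub A m r s))// Ti1 (@opE1 _ _ (AHsub A m r s)).
split=> // phi hp.
(* Writing $\phi = \mu(M)\psi$ removes the inverse: the claim becomes an identity of operators,
   applied to [psi]. *)
have [psi hpsi psiE] : exists2 psi, AH psi & metaplectic hbar mu M psi = phi.
  by have [_ _ sj] := bij; have [psi hpsi E] := sj phi hp; exists psi.
have -> : metaplectic_inv hbar mu M phi = psi.
  rewrite /metaplectic_inv -psiE; apply: pinvKV; last by rewrite inE.
  by case: bij.
have rhoE : rho M x = gact g aG x2.
  rewrite /rho /body_act /= /gact.
  have -> : nilexp (super_act X) x = x1 by rewrite XE (super_actE aX SX); apply: nilexp_actY.
  have -> : nilexp (super_act Y) x1 = x2 by rewrite YE (super_actE aY SY); apply: nilexp_actY.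
  by [].
(* The body of $\rho(M)x$: both nilpotent exponentials keep the difference from [b] in the ideal, so
   only the body matrix moves [b]. *)
set b3 := @Gt R m r s g aG *m b.
have gB : gact g aG x2 - bA b3 = gact g aG (x2 - bA b) by rewrite gactB gact_bA.
have i3 : idv l 1 (gact g aG x2 - bA b3) by rewrite gB; exact: gact_idv.
have ib a : idl l 1 a -> body a = 0.
  by move=> [c _ ->]; rewrite raddf_sum big1// => i _; rewrite /= bodyM lB ?mul0r// mem_nth.
have b3x i : b3 i 0 = body (gact g aG x2 i).
  have := ib _ (i3 i); rewrite (_ : (gact g aG x2 - bA b3) i = gact g aG x2 i - bA b3 i)// raddfB /= /bA body_scal.
  by move/eqP; rewrite subr_eq0 => /eqP ->.
have hx3 : E0 (gact g aG x2) by exact: gact_E0.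
rewrite rhoE (@schrodinger_Ush R A hbar m r s l lH lB _ t b3 hx3 ht b3x i3 it phi hp).
rewrite (@schrodinger_Ush R A hbar m r s l lH lB x t b hx ht bx il it psi hpsi).
rewrite metE; last exact: A_in.
have fin (S3 S1 : opA) : S3 * Mo = Mo * S1 -> S3 phi = Mo (S1 psi).
  move=> SE; have -> : phi = Mo psi by rewrite -psiE metE.
  transitivity ((S3 * Mo) psi); first by rewrite (@opEM _ _ (AHsub A m r s) S3 Mo psi hpsi).
  rewrite SE; exact: (@opEM _ _ (AHsub A m r s) Mo S1 psi hpsi).
apply: fin.
set c := scA _.
have cD D : c * D = D * c -> c * nexp F D = nexp F D * c by exact: nexp_conj.
have cMo : Mo * c = c * Mo.
  by rewrite /Mo -!mulrA -cD ?scA_Dsum// (mulrA _ c) -cD ?scA_Dsum// !mulrA mh_scA.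
have eX : nexp F DX * @Ush R A hbar m r s l lH lB b n tn = @Ush R A hbar m r s l lH lB b (x1 - bA b) tn * nexp F DX.
  by apply: exp_step.
have eY : nexp F DY * @Ush R A hbar m r s l lH lB b (x1 - bA b) tn = @Ush R A hbar m r s l lH lB b (x2 - bA b) tn * nexp F DY.
  by apply: exp_step.
have eh : mh aG Mg * @Ush R A hbar m r s l lH lB b (x2 - bA b) tn =
    @Ush R A hbar m r s l lH lB b3 (gact g aG x2 - bA b3) tn * mh aG Mg.
  by rewrite gB; exact: mh_Ush.
exact: (intertwine_steps eX eY eh cMo).
Qed.
End Assembly.

(* The signature is (k, l) = (r + 2 s, r). *)
Theorem proposition7p14 (R : realType) (A : baseAlgebra R) (hbar : R)
    (hbar_neq0 : hbar != 0) (m r s : nat)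
    (mu : mp_elt R m -> ('rV[R]_m -> R[i]) -> 'rV[R]_m -> R[i])
    (mu_metaplectic : metaplectic_rep r s hbar mu)
    (M : Mp A m r s) (x : 'I_(dim_E m r s) -> A) (t : A)
    (xE0 : E0 x) (tA0 : homog false t) :
  set_bij (@AH R A m r s) (@AH R A m r s) (metaplectic hbar mu M) /\
  forall phi : AHfun A m r s, AH phi ->
    schrodinger hbar (rho M x) t phi =
    metaplectic hbar mu M (schrodinger hbar x t (metaplectic_inv hbar mu M phi)).
Proof. exact: (metaplectic_intertwines mu_metaplectic hbar_neq0 M xE0 tA0). Qed.
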